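(* There exist a real $\epsilon>0$, a positive integer $c$ and a $c$-size binary test $P$ whose time requirement on every machine $N_n$ is at most $c$, such that the following holds for every $c'>0$ and every $c'$-size unary test $Q$. Suppose that for all sufficiently large positive integers $n$ and all $a\in[0,2^n-1]$ the following two statements are equivalent: (i) there exists $x\in[0,2^n-1]$ with $P_n(x,a)=0$; (ii) $Q_n(a)=0$. Then for infinitely many positive integers $n$ the time requirement of $Q$ on $N_n$ is at least $\epsilon(\log\log n)^{1/2}(\log\log\log n)^{-1}$.
   Context: For each positive integer $n$, $N_n$ is a random access machine (von Neumann type) with word length $n$ (words are integers in $[0,2^n-1]$) and $2^n$ memory cells. All machines $N_n$ share a common finite instruction set; each instruction has a name which is a fixed natural number (independent of $n$), and only $n>10$ is considered, so that names fit in a cell. The instructions are: arithmetic instructions (addition and multiplication modulo $2^n$; the constants $0,1,n$ and $2^n-1$; the unary function $x\mapsto\min\{2^x,2^n-1\}$; the binary functions $\lfloor x/y\rfloor$ with $\lfloor x/0\rfloor=0$, $\max(x,y)$, $\min(x,y)$; and the componentwise boolean operations $\wedge,\vee,\neg$ on the $n$-bit binary representations), read/write instructions, control transfer instructions, input/output instructions and a halt instruction. A program is a finite sequence of instruction names; $N_n$ executes a program of length $k$ by starting from the state where the first $k$ memory cells contain the program in order and all other cells contain $0$. For positive integers $c,k$, a program $P$ is a $c$-size $k$-ary test if $\mathrm{length}(P)\le c$, $k\le c$, and for every $n>10$ and all $x_1,\dots,x_k\in[0,2^n-1]$, $P$ running on $N_n$ with input $x_1,\dots,x_k$ uses only the first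 $c$ memory cells and produces an output $P_n(x_1,\dots,x_k)\in\{0,1\}$. The time requirement of $P$ on $N_n$ is the smallest integer $t$ such that for all inputs $x_1,\dots,x_k\in[0,2^n-1]$, $P$ produces its output within time $t$. ''Binary'' means $k=2$, ''unary'' means $k=1$. Logarithms are base 2. *)

(* Defs.v *)
From Stdlib Require Import Reals Arith List.
Import ListNotations.

(* The processor has a program counter [pc] and three word registers: an
   accumulator [acc], a second operand [opd] and an address register [adr].
   Instructions carry no operands, so that a program is nothing but a sequence
   of instruction names; other constants and addresses are computed. *)
Inductive instr : Set :=
| Halt
| Add | Mul | Const0 | Const1 | ConstN | ConstMax | Exp2 | Div | Max | Min
| And | Or | Not
| Load | Store | SwapOpd | SwapAdr
| Jump | JumpZero
| Input | Output.

(* The name of an instruction is its position in this list. *)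
Definition instruction_set : list instr :=
  [Halt; Add; Mul; Const0; Const1; ConstN; ConstMax; Exp2; Div; Max; Min;
   And; Or; Not; Load; Store; SwapOpd; SwapAdr; Jump; JumpZero; Input; Output].

Definition decode (w : nat) : option instr := nth_error instruction_set w.

Definition is_program (P : list nat) : Prop :=
  Forall (fun w => w < length instruction_set) P.

(* Addresses are words of [N_n], so only the cells [0, 2^n-1] of [mem] matter. *)
Record state : Type := State {
  mem : nat -> nat;
  pc : nat;
  acc : nat;
  opd : nat;
  adr : nat;
  inp : list nat;  (* inputs not yet consumed *)
  out : list nat   (* words output so far, latest first *)
}.

(* A program longer than [2^n] is thereby cut to its first [2^n] names; this
   concerns finitely many [n] for each program. *)
Definition init (P xs : list nat) : state :=
  State (fun i => nth i P 0) 0 0 0 0 xs [].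

Definition fetch (s : state) : option instr := decode (mem s (pc s)).

Definition update (m : nat -> nat) (a v : nat) : nat -> nat :=
  fun i => if i =? a then v else m i.

(* [Nat.div x 0] is [0], as required. *)
Definition arith (n : nat) (i : instr) (x y : nat) : option nat :=
  match i with
  | Add => Some ((x + y) mod 2 ^ n)
  | Mul => Some ((x * y) mod 2 ^ n)
  | Const0 => Some 0
  | Const1 => Some 1
  | ConstN => Some n
  | ConstMax => Some (2 ^ n - 1)
  | Exp2 => Some (Nat.min (2 ^ x) (2 ^ n - 1))
  | Div => Some (x / y)
  | Max => Some (Nat.max x y)
  | Min => Some (Nat.min x y)
  | And => Some (Nat.land x y)
  | Or => Some (Nat.lor x y)
  | Not => Some (Nat.lnot x n)
  | _ => None
  end.

(* [None]: the machine has halted, or it is stuck because the current word is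
   not an instruction name or because the input is exhausted. *)
Definition step (n : nat) (s : state) : option state :=
  let '(State m p a b d xs ys) := s in
  let p' := (p + 1) mod 2 ^ n in
  match fetch s with
  | None | Some Halt => None
  | Some Load => Some (State m p' (m d) b d xs ys)
  | Some Store => Some (State (update m d a) p' a b d xs ys)
  | Some SwapOpd => Some (State m p' b a d xs ys)
  | Some SwapAdr => Some (State m p' d b a xs ys)
  | Some Jump => Some (State m d a b d xs ys)
  | Some JumpZero => Some (State m (if a =? 0 then d else p') a b d xs ys)
  | Some Input =>
      match xs with
      | x :: xs' => Some (State m p' x b d xs' ys)
      | [] => None
      end
  | Some Output => Some (State m p' a b d xs (a :: ys))
  | Some i =>
      match arith n i a b with
      | Some v => Some (State m p' v b d xs ys)
      | None => None
      end
  end.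

Fixpoint run (n t : nat) (s : state) : option state :=
  match t with
  | 0 => Some s
  | S t' => match step n s with
            | Some s' => run n t' s'
            | None => None
            end
  end.

(* Cells touched by the instruction about to be executed, its fetch included. *)
Definition accessed (s : state) : list nat :=
  pc s :: match fetch s with
          | Some Load | Some Store => [adr s]
          | _ => []
          end.

Definition uses_only (n c : nat) (P xs : list nat) : Prop :=
  forall t s, run n t (init P xs) = Some s -> Forall (fun i => i < c) (accessed s).

(* The halt instruction is counted: reaching it after [t'] steps takes time
   [t' + 1].  The output is the single word written before halting. *)
Definition outputs_within (n : nat) (P xs : list nat) (t y : nat) : Prop :=
  exists t' s, t' < t /\ run n t' (init P xs) = Some s /\
               fetch s = Some Halt /\ out s = [y].

(* [P_n(xs) = y] *)
Definition outputs (n : nat) (P xs : list nat) (y : nat) : Prop :=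
  exists t, outputs_within n P xs t y.

Definition is_input (n k : nat) (xs : list nat) : Prop :=
  length xs = k /\ Forall (fun x => x < 2 ^ n) xs.

Definition is_test (c k : nat) (P : list nat) : Prop :=
  0 < c /\ 0 < k /\ is_program P /\ length P <= c /\ k <= c /\
  forall n xs, 10 < n -> is_input n k xs ->
    uses_only n c P xs /\ exists y, (y = 0 \/ y = 1) /\ outputs n P xs y.

Definition runs_within (n k : nat) (P : list nat) (t : nat) : Prop :=
  forall xs, is_input n k xs -> exists y, outputs_within n P xs t y.

Definition time_requirement (n k : nat) (P : list nat) (t : nat) : Prop :=
  runs_within n k P t /\ forall t', runs_within n k P t' -> t <= t'.

Definition log2 (x : R) : R := (ln x / ln 2)%R.

(* Main.v *)
(** The binary test [P] reads its second argument as a list of packed constraints (sums,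
    products, bitwise conjunctions) on the blocks of its first argument and checks all of
    them with a constant number of word operations.  So [exists x, P(x, a) = 0] expresses the
    truth of an arbitrary bounded existential formula, the parameter [a] being a constant plus
    the packed values of the free variables.

    Suppose that [Q] decides this in time [T] on all machines up to word length
    [n = 2 ^ 2 ^ (T * T)].  The statement "[Q] rejects" is again existential over slightly
    longer words, so [Q] eliminates negations, each at the cost of a bounded growth of the
    formula.  A formula with few alternations over words much shorter than [n] can therefore
    describe a run of [T] steps of [Q] on words of length [n]: the words are given by their
    digits in a large base, and the digits of sums, products and quotients are obtained from
    a discrete Fourier transform modulo a number [2 ^ M + 1] and from a power series for the
    inverse.  All numbers involved have few runs of ones in binary, hence the parameter that
    asks [P] whether [Q] rejects the parameter coded by a short word [z] can be coded by a
    short word itself.  Choosing [z] to be this code makes [Q] reject exactly the questions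
    to which the answer is that it rejects, a contradiction. *)
Require Import Defs.
From Stdlib Require Import Reals Lra Arith List Lia Bool Classical.
Import ListNotations.
Import Defs.

(** Eliminating a negation moves to words longer by a factor [2 ^ W0], so a formula about [Q] on
    words of length [n] may quantify only over words far shorter than [n]. Hence a long word is
    never the value of a variable; it is a function of a short parameter, known through the graph of
    its digits. Its arithmetic needs iterations longer than a packed witness can record. Ten nested
    levels of packed chains make them definable at constant rank; the nesting uses universal
    quantifiers, hence negation. The transform is taken modulo [2 ^ M + 1] because the roots of
    unity are then powers of two, given directly by exponentiation; it turns the powers of
    polynomials in the inverse into iterated products of single residues. The runs of [Q] that serve
    to eliminate negations are different: their words fit into variables, but their description has
    to be positive, exponentiation included. All ranks and growth rates are polynomials or powers of
    two of polynomials in [T], and [2 ^ 2 ^ (T * T)] leaves room for them. *)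

(** * Powers of two and bitwise operations *)

Lemma pow2_pos n : 0 < 2 ^ n.
Proof. induction n; simpl; lia. Qed.

Lemma pow2_nz n : 2 ^ n <> 0.
Proof. pose proof (pow2_pos n); lia. Qed.
#[local] Hint Resolve pow2_pos pow2_nz : core.

Lemma pow2_le a b : a <= b -> 2 ^ a <= 2 ^ b.
Proof. intros; apply Nat.pow_le_mono_r; lia. Qed.

Lemma pow2_lt a b : a < b -> 2 ^ a < 2 ^ b.
Proof. intros; apply Nat.pow_lt_mono_r; lia. Qed.

Lemma lt_pow2_mono x a b : x < 2 ^ a -> a <= b -> x < 2 ^ b.
Proof. intros H L; apply pow2_le in L; lia. Qed.

Lemma lt_pow2 n : n < 2 ^ n.
Proof. apply Nat.pow_gt_lin_r; lia. Qed.

Lemma mul_lt_pow2 x y a b : x < 2 ^ a -> y < 2 ^ b -> x * y < 2 ^ (a + b).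
Proof.
  intros; rewrite Nat.pow_add_r.
  pose proof (pow2_pos a); pose proof (pow2_pos b); nia.
Qed.

Lemma testbit_join W a A j : a < 2 ^ W ->
  Nat.testbit (a + 2 ^ W * A) j = if j <? W then Nat.testbit a j else Nat.testbit A (j - W).
Proof.
  intros Ha; destruct (Nat.ltb_spec j W) as [L|L].
  - rewrite <- (Nat.mod_pow2_bits_low _ W j L).
    rewrite Nat.mul_comm, Nat.Div0.mod_add, Nat.mod_small by auto; reflexivity.
  - replace j with (j - W + W) at 1 by lia.
    rewrite <- Nat.div_pow2_bits, Nat.mul_comm, Nat.div_add, Nat.div_small by auto.
    reflexivity.
Qed.

Lemma join_lt W a A q : a < 2 ^ W -> A < 2 ^ q -> a + 2 ^ W * A < 2 ^ (W + q).
Proof. intros; rewrite Nat.pow_add_r; nia. Qed.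

Lemma land_join W a A b B : a < 2 ^ W -> b < 2 ^ W ->
  Nat.land (a + 2 ^ W * A) (b + 2 ^ W * B) = Nat.land a b + 2 ^ W * Nat.land A B.
Proof.
  intros Ha Hb.
  assert (Hl : Nat.land a b < 2 ^ W).
  { apply Nat.le_lt_trans with a; [apply Nat.land_le_l|auto]. }
  apply Nat.bits_inj; intro j.
  rewrite Nat.land_spec, !testbit_join by auto.
  destruct (j <? W); rewrite Nat.land_spec; reflexivity.
Qed.

Lemma land_ones_mul y h q : Nat.land y ((2 ^ h - 1) * 2 ^ q) = ((y / 2 ^ q) mod 2 ^ h) * 2 ^ q.
Proof.
  rewrite (Nat.div_mod_eq y (2 ^ q)) at 1.
  rewrite (Nat.add_comm (2 ^ q * _)).
  replace ((2 ^ h - 1) * 2 ^ q) with (0 + 2 ^ q * (2 ^ h - 1)) by lia.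
  rewrite land_join by (auto; apply Nat.mod_upper_bound; auto).
  rewrite Nat.land_0_r.
  replace (2 ^ h - 1) with (Nat.ones h) by (rewrite Nat.ones_equiv; lia).
  rewrite Nat.land_ones; lia.
Qed.

Lemma mod_div_mod y c a h : a + h <= c -> (y mod 2 ^ c / 2 ^ a) mod 2 ^ h = (y / 2 ^ a) mod 2 ^ h.
Proof.
  intros L. apply Nat.bits_inj; intro j.
  destruct (Nat.lt_ge_cases j h).
  - rewrite !Nat.mod_pow2_bits_low, !Nat.div_pow2_bits, Nat.mod_pow2_bits_low by lia; auto.
  - rewrite !Nat.mod_pow2_bits_high by lia; auto.
Qed.

(** * Concatenation of words *)

(** Base [2 ^ W], least significant entry first. Entries may exceed [2 ^ W], so sums and multiples
    are taken entrywise without side conditions and carries are dealt with elsewhere. *)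
Fixpoint catf (W n : nat) (f : nat -> nat) : nat :=
  match n with
  | 0 => 0
  | S n => f 0 + 2 ^ W * catf W n (fun r => f (S r))
  end.

Lemma catf_ext W n : forall f g, (forall r, r < n -> f r = g r) -> catf W n f = catf W n g.
Proof.
  induction n; intros f g H; simpl; auto.
  rewrite (H 0), (IHn _ (fun r => g (S r))) by (intros; try apply H; lia); auto.
Qed.

Lemma catf_lt W n : forall f, (forall r, r < n -> f r < 2 ^ W) -> catf W n f < 2 ^ (W * n).
Proof.
  induction n; intros f H; simpl.
  - rewrite Nat.mul_0_r; simpl; lia.
  - rewrite Nat.mul_succ_r, Nat.add_comm. rewrite (Nat.add_comm (W * n)).
    rewrite Nat.add_comm. apply join_lt; [apply H; lia|]. apply IHn; intros; apply H; lia.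
Qed.

Lemma catf_add W n : forall f g, catf W n f + catf W n g = catf W n (fun r => f r + g r).
Proof. induction n; intros; simpl; auto. rewrite <- IHn; lia. Qed.

Lemma catf_mul W n c : forall f, c * catf W n f = catf W n (fun r => c * f r).
Proof. induction n; intros; simpl; auto. rewrite <- IHn; lia. Qed.

Lemma catf_zero W n : catf W n (fun _ => 0) = 0.
Proof. induction n; simpl; auto. rewrite IHn; lia. Qed.

Lemma catf_land W n : forall f g,
  (forall r, r < n -> f r < 2 ^ W) -> (forall r, r < n -> g r < 2 ^ W) ->
  Nat.land (catf W n f) (catf W n g) = catf W n (fun r => Nat.land (f r) (g r)).
Proof.
  induction n; intros f g Hf Hg; simpl; auto.
  rewrite land_join by (try apply Hf; try apply Hg; lia).
  rewrite IHn by (intros; try apply Hf; try apply Hg; lia); auto.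
Qed.

Lemma catf_nth W n : forall f r, (forall r, r < n -> f r < 2 ^ W) -> r < n ->
  (catf W n f / 2 ^ (W * r)) mod 2 ^ W = f r.
Proof.
  induction n; intros f r Hf Hr; simpl; [lia|].
  destruct r.
  - rewrite Nat.mul_0_r, Nat.pow_0_r, Nat.div_1_r, Nat.mul_comm, Nat.Div0.mod_add.
    apply Nat.mod_small, Hf; lia.
  - rewrite Nat.mul_succ_r, Nat.add_comm, Nat.pow_add_r, Nat.mul_comm.
    rewrite (Nat.mul_comm (2 ^ (W * r))), <- Nat.Div0.div_div.
    rewrite (Nat.add_comm _ (f 0)), Nat.div_add, (Nat.div_small (f 0)) by (auto; apply Hf; lia).
    apply (IHn (fun r => f (S r)) r); [intros; apply Hf|]; lia.
Qed.

Lemma catf_inj W n f g :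
  (forall r, r < n -> f r < 2 ^ W) -> (forall r, r < n -> g r < 2 ^ W) ->
  catf W n f = catf W n g -> forall r, r < n -> f r = g r.
Proof.
  intros Hf Hg E r Hr. rewrite <- (catf_nth W n f r), E, catf_nth; auto.
Qed.

Lemma catf_split W n x : x < 2 ^ (W * n) ->
  x = catf W n (fun i => (x / 2 ^ (W * i)) mod 2 ^ W).
Proof.
  revert x; induction n; intros x H; simpl.
  - rewrite Nat.mul_0_r in H; simpl in H; lia.
  - rewrite Nat.mul_0_r, Nat.pow_0_r, Nat.div_1_r.
    rewrite (Nat.div_mod_eq x (2 ^ W)) at 1. rewrite Nat.add_comm. do 2 f_equal.
    rewrite (IHn (x / 2 ^ W)) at 1.
    + apply catf_ext; intros r _. rewrite Nat.Div0.div_div, <- Nat.pow_add_r.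
      replace (W * S r) with (W + W * r) by lia; reflexivity.
    + apply Nat.Div0.div_lt_upper_bound. rewrite <- Nat.pow_add_r.
      replace (W + W * n) with (W * S n) by lia; auto.
Qed.

(** * Numbers whose binary expansion has few runs *)

Definition in_ivs (l : list (nat * nat)) (j : nat) : bool :=
  existsb (fun p => (fst p <=? j) && (j <? snd p)) l.

(** The intervals are half-open and may overlap or be empty; only their number counts, not the
    length of [x]. *)
Definition IO (m x : nat) : Prop :=
  exists l : list (nat * nat), length l <= m /\ forall j, Nat.testbit x j = in_ivs l j.

Lemma IO_mono m m' x : IO m x -> m <= m' -> IO m' x.
Proof. intros (l & L & E) H. exists l; split; auto; lia. Qed.

Lemma IO_0 m : IO m 0.
Proof. exists []; split; simpl; [lia|]. intros; apply Nat.bits_0. Qed.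

Lemma IO_join W x y m1 m2 : x < 2 ^ W -> IO m1 x -> IO m2 y -> IO (m1 + m2) (x + 2 ^ W * y).
Proof.
  intros Hx (l1 & L1 & E1) (l2 & L2 & E2).
  exists (l1 ++ map (fun p => (fst p + W, snd p + W)) l2). split.
  - rewrite length_app, length_map; lia.
  - intros j. rewrite testbit_join by auto. unfold in_ivs. rewrite existsb_app.
    fold (in_ivs l1 j). rewrite <- E1.
    assert (Ex2 : existsb (fun p => (fst p <=? j) && (j <? snd p))
                    (map (fun p => (fst p + W, snd p + W)) l2)
                  = if j <? W then false else in_ivs l2 (j - W)).
    { clear E2 L2. induction l2 as [|[a b] l2 IH]; simpl; [destruct (j <? W); auto|].
      rewrite IH. destruct (Nat.ltb_spec j W).
      - destruct (Nat.leb_spec (a + W) j); simpl; auto; lia.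
      - f_equal. f_equal.
        + destruct (Nat.leb_spec (a + W) j), (Nat.leb_spec a (j - W)); auto; lia.
        + destruct (Nat.ltb_spec j (b + W)), (Nat.ltb_spec (j - W) b); auto; lia. }
    rewrite Ex2. destruct (Nat.ltb_spec j W); [rewrite orb_false_r; auto|].
    rewrite <- E2. rewrite <- (Nat.mod_small x (2 ^ W)) at 1 by auto.
    rewrite Nat.mod_pow2_bits_high by auto. auto.
Qed.

Lemma IO_ones a : IO 1 (2 ^ a - 1).
Proof.
  exists [(0, a)]; split; auto. intros j.
  replace (2 ^ a - 1) with (Nat.ones a) by (rewrite Nat.ones_equiv; lia).
  unfold in_ivs; simpl. rewrite orb_false_r.
  destruct (Nat.ltb_spec j a).
  - apply Nat.ones_spec_low; auto.
  - apply Nat.ones_spec_high; auto.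
Qed.

Lemma IO_shift x m q : IO m x -> IO m (x * 2 ^ q).
Proof.
  intros. replace (x * 2 ^ q) with (0 + 2 ^ q * x) by lia.
  apply (IO_join q 0 x 0 m); auto. apply IO_0.
Qed.

Lemma IO_pow2 q : IO 1 (2 ^ q).
Proof. replace (2 ^ q) with ((2 ^ 1 - 1) * 2 ^ q) by (simpl; lia). apply IO_shift, IO_ones. Qed.

Lemma IO_catf W n m : forall f, (forall r, r < n -> f r < 2 ^ W) -> (forall r, r < n -> IO m (f r)) ->
  IO (n * m) (catf W n f).
Proof.
  induction n; intros f Hf Hm; simpl; [apply IO_0|].
  apply IO_join; [apply Hf; lia|apply Hm; lia|].
  apply IHn; intros; [apply Hf|apply Hm]; lia.
Qed.

(** A crude bound by the number of ones. It serves for small constants only, such as instruction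
    names and addresses. *)
Lemma IO_small x : IO x x.
Proof.
  assert (G : forall W x, x < 2 ^ W -> IO x x); [|apply (G x), lt_pow2].
  induction W; intros y Hy.
  - simpl in Hy. replace y with 0 by lia. apply IO_0.
  - pose proof (Nat.div_mod_eq y 2).
    assert (Hm : y mod 2 < 2) by (apply Nat.mod_upper_bound; auto).
    replace y with (y mod 2 + 2 ^ 1 * (y / 2)) at 2 by (rewrite Nat.pow_1_r; lia).
    apply IO_mono with (y mod 2 + y / 2); [|lia].
    apply IO_join; [exact Hm| |apply IHW].
    + destruct (y mod 2) as [|[|?]]; [apply IO_0|apply (IO_pow2 0)|lia].
    + apply Nat.Div0.div_lt_upper_bound. rewrite Nat.pow_succ_r' in Hy; auto.
Qed.

(** * The relation checked by the binary test *)

(* Field [i] of the parameter [a]; the fields are [n / 16] bits wide. *)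
Definition fld (n a i : nat) : nat := (a / 2 ^ (n / 16 * i)) mod 2 ^ (n / 16).

(** The blocks of [x] are compared with [f 0] under the mask [f 1]. Multiplying by [f 2], [f 3],
    [f 4] makes one shifted copy of [x] per constraint, so that the first, second or third operand
    of each constraint comes to the same place of its cell; [f 7] selects that place. The masks
    [f 9] and [f 10] pick the cells of the sums and of the conjunctions. For products, [Y2] holds
    the second operands in cells wide enough for a whole copy of [X1], so [X1 * Y2] is the matrix of
    all pairwise products; [f 11] picks diagonal cells, and [f 6] brings the third operands there.
    Fields of [n / 16] bits keep all products below [2 ^ n]. *)
Definition chk (n x a : nat) : Prop :=
  let f := fld n a in
  let X1 := Nat.land (x * f 2) (f 7) in
  let X2 := Nat.land (x * f 3) (f 7) in
  let X3 := Nat.land (x * f 4) (f 7) in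
  let Y2 := Nat.land (x * f 5) (f 8) in
  let Y3 := Nat.land (x * f 6) (f 11) in
  x < 2 ^ (n / 16) /\
  Nat.land x (f 1) = f 0 /\
  Nat.land (X1 + X2) (f 9) = Nat.land X3 (f 9) /\
  Nat.land (Nat.land X1 X2) (f 10) = Nat.land X3 (f 10) /\
  Nat.land (X1 * Y2) (f 11) = Y3.

Inductive op3 := OAdd | OMul | OLand.

Definition op3_rel (o : op3) (x y z : nat) : Prop :=
  match o with
  | OAdd => x + y = z
  | OMul => x * y = z
  | OLand => Nat.land x y = z
  end.

Definition is_add o := match o with OAdd => true | _ => false end.
Definition is_mul o := match o with OMul => true | _ => false end.
Definition is_land o := match o with OLand => true | _ => false end.

(** * Packing variables and constraints into the two arguments *)

Section Packing.
  (* [V] variables in slots of [H] bits and [R] constraints [o r (i r) (j r) (k r)]. *)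
  Variables (n H B V R : nat) (mask kv : nat -> nat).
  Variables (o : nat -> op3) (i j k : nat -> nat).
  Let w := n / 16.
  Let D := 4 * V.
  Let A := H * D.
  Let ones := 2 ^ H - 1.

  Hypothesis HB : 2 * B + 1 <= H.
  Hypothesis HV : 0 < V.
  Hypothesis HR : 0 < R.
  Hypothesis Hw : A * R * R <= w.
  Hypothesis Hi : forall r, r < R -> i r < V /\ j r < V /\ k r < V.
  Hypothesis Hm : forall q, q < V -> mask q < 2 ^ H /\ kv q < 2 ^ H.
  Hypothesis Hslot : forall q v, q < V -> v < 2 ^ H -> Nat.land v (mask q) = kv q -> v < 2 ^ B.

  (** A cell has [4 * V] slots. A shift by [V - i] slots moves slot [i] of [x] to position [V], so a
      copy of [x] ends below slot [2 * V]; products of selected operands appear at position [2 * V],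
      and the copies aligned with them end below [3 * V]. Rows 5, 6, 8 and 11 use cells of [A * R]
      bits, the rows of the [R] by [R] matrix of products. The ones in the upper part of row 1
      forbid bits of [x] beyond its slots. *)
  Definition par (q : nat) : nat :=
    match q with
    | 0 => catf H V kv
    | 1 => catf H V mask + 2 ^ (H * V) * (2 ^ (w - H * V) - 1)
    | 2 => catf A R (fun r => 2 ^ (H * (V - i r)))
    | 3 => catf A R (fun r => 2 ^ (H * (V - j r)))
    | 4 => catf A R (fun r => 2 ^ (H * (V - k r)))
    | 5 => catf (A * R) R (fun r => 2 ^ (H * (V - j r)))
    | 6 => catf (A * R) R (fun r => 2 ^ (A * r + H * (2 * V - k r)))
    | 7 => catf A R (fun _ => ones * 2 ^ (H * V))
    | 8 => catf (A * R) R (fun _ => ones * 2 ^ (H * V))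
    | 9 => catf A R (fun r => if is_add (o r) then ones * 2 ^ (H * V) else 0)
    | 10 => catf A R (fun r => if is_land (o r) then ones * 2 ^ (H * V) else 0)
    | 11 => catf (A * R) R (fun r => if is_mul (o r) then ones * 2 ^ (A * r + 2 * H * V) else 0)
    | _ => 0
    end.

  Definition param : nat := catf w 12 par.

  Let HVA : H * V <= A.
  Proof. unfold A, D; nia. Qed.
  Let HVw : H * V <= w.
  Proof.
    apply Nat.le_trans with (A * R * R); auto. apply Nat.le_trans with A; auto.
    rewrite <- Nat.mul_assoc. apply Nat.le_mul_r. nia.
  Qed.
  Let A1 : A * R <= w.
  Proof. apply Nat.le_trans with (A * R * R); auto. apply Nat.le_mul_r; lia. Qed.

  Lemma ones_mul_lt q c : H + q <= c -> ones * 2 ^ q < 2 ^ c.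
  Proof.
    intros L. apply lt_pow2_mono with (H + q); auto.
    rewrite Nat.pow_add_r. unfold ones. pose proof (pow2_pos H); pose proof (pow2_pos q). nia.
  Qed.

  Let slotA : H + H * V <= A.
  Proof. unfold A, D; nia. Qed.
  Let slotAR r : r < R -> H + (A * r + 2 * H * V) <= A * R.
  Proof. intros. assert (H + 2 * H * V <= A) by (unfold A, D; nia). nia. Qed.

  Lemma catf_lt_w W f : W * R <= w -> (forall r, r < R -> f r < 2 ^ W) -> catf W R f < 2 ^ w.
  Proof. intros L Hf. apply lt_pow2_mono with (W * R); auto. apply catf_lt; auto. Qed.

  Let pj q : q < V -> 2 ^ (H * (V - q)) < 2 ^ A.
  Proof. intros. apply pow2_lt. unfold A, D. nia. Qed.
  Let pj' q : q < V -> 2 ^ (H * (V - q)) < 2 ^ (A * R).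
  Proof. intros. eapply lt_pow2_mono; [apply pj; auto|nia]. Qed.

  Lemma par_lt q : q < 12 -> par q < 2 ^ w.
  Proof.
    intros Hq.
    assert (forall W f, W * R <= w -> (forall r, r < R -> f r < 2 ^ W) -> catf W R f < 2 ^ w)
      as Q by apply catf_lt_w.
    destruct q as [|[|[|[|[|[|[|[|[|[|[|[|?]]]]]]]]]]]]; [..|lia]; simpl par.
    - apply lt_pow2_mono with (H * V); auto. apply catf_lt; intros; apply Hm; auto.
    - replace w with (H * V + (w - H * V)) at 2 by lia.
      apply join_lt; [apply catf_lt; intros; apply Hm; auto|].
      pose proof (pow2_pos (w - H * V)); lia.
    - apply Q; auto. intros r Hr. apply pj, Hi; auto.
    - apply Q; auto. intros r Hr. apply pj, Hi; auto.
    - apply Q; auto. intros r Hr. apply pj, Hi; auto.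
    - apply Q; auto. intros r Hr. apply pj', Hi; auto.
    - apply Q; auto. intros r Hr. apply pow2_lt.
      specialize (slotAR r Hr). assert (H * (2 * V - k r) <= 2 * H * V) by nia. lia.
    - apply Q; auto. intros. apply ones_mul_lt; auto.
    - apply Q; auto. intros. apply ones_mul_lt. nia.
    - apply Q; auto. intros. destruct (is_add _); auto. apply ones_mul_lt; auto.
    - apply Q; auto. intros. destruct (is_land _); auto. apply ones_mul_lt; auto.
    - apply Q; auto. intros. destruct (is_mul _); auto. apply ones_mul_lt; auto.
  Qed.

  Lemma fld_param q : q < 12 -> fld n param q = par q.
  Proof. intros. unfold fld. fold w. apply catf_nth; auto. apply par_lt. Qed.

  Section Values.
    Variable s : nat -> nat.
    Hypothesis Hs : forall q, q < V -> s q < 2 ^ B.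
    Let x := catf H V s.

    Let sH q : q < V -> s q < 2 ^ H.
    Proof. intros L; apply Hs in L. eapply lt_pow2_mono; eauto; lia. Qed.
    Let xlt : x < 2 ^ (H * V).
    Proof. apply catf_lt; auto. Qed.

    Lemma select_slot q p : q < V ->
      Nat.land (x * 2 ^ (p + H * (V - q))) (ones * 2 ^ (p + H * V)) = s q * 2 ^ (p + H * V).
    Proof.
      intros Hq. unfold ones. rewrite land_ones_mul. f_equal.
      replace (p + H * V) with (p + H * (V - q) + H * q) by nia.
      rewrite (Nat.pow_add_r 2 (p + H * (V - q))), <- Nat.Div0.div_div, Nat.div_mul by auto.
      apply catf_nth; auto.
    Qed.

    Lemma select_slot0 q : q < V ->
      Nat.land (x * 2 ^ (H * (V - q))) (ones * 2 ^ (H * V)) = s q * 2 ^ (H * V).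
    Proof. apply (select_slot q 0). Qed.

    Lemma x_shift_lt q p c : q < V -> p + 2 * H * V <= c -> x * 2 ^ (p + H * (V - q)) < 2 ^ c.
    Proof.
      intros.
      assert (H * (V - q) <= H * V) by (apply Nat.mul_le_mono_l; lia).
      apply lt_pow2_mono with (H * V + (p + H * (V - q))); [|lia].
      rewrite (Nat.pow_add_r 2 (H * V)). apply Nat.mul_lt_mono_pos_r; auto.
    Qed.

    Lemma select_arr W (q : nat -> nat) : 2 * H * V <= W -> H + H * V <= W ->
      (forall r, r < R -> q r < V) ->
      Nat.land (x * catf W R (fun r => 2 ^ (H * (V - q r)))) (catf W R (fun _ => ones * 2 ^ (H * V)))
      = catf W R (fun r => s (q r) * 2 ^ (H * V)).
    Proof.
      intros L1 L2 Hq. rewrite catf_mul, catf_land.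
      - apply catf_ext; intros; apply select_slot0; auto.
      - intros r Hr; apply (x_shift_lt (q r) 0); auto.
      - intros; apply ones_mul_lt; auto.
    Qed.

    Lemma land_sel v p : v < 2 ^ H -> Nat.land (v * 2 ^ p) (ones * 2 ^ p) = v * 2 ^ p.
    Proof.
      intros. unfold ones. rewrite land_ones_mul, Nat.div_mul, Nat.mod_small; auto.
    Qed.

    Lemma sel_lt v p c : v < 2 ^ H -> H + p <= c -> v * 2 ^ p < 2 ^ c.
    Proof.
      intros. apply lt_pow2_mono with (H + p); auto.
      rewrite (Nat.pow_add_r 2 H p). apply Nat.mul_lt_mono_pos_r; auto.
    Qed.

    Let X1 := catf A R (fun r => s (i r) * 2 ^ (H * V)).
    Let X2 := catf A R (fun r => s (j r) * 2 ^ (H * V)).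
    Let X3 := catf A R (fun r => s (k r) * 2 ^ (H * V)).
    Let Y2 := catf (A * R) R (fun r => s (j r) * 2 ^ (H * V)).

    Let sB2 a b : a < 2 ^ B -> b < 2 ^ B -> a + b < 2 ^ H /\ a * b < 2 ^ H.
    Proof.
      intros. split.
      - apply lt_pow2_mono with (B + 1); [|lia]. rewrite Nat.pow_add_r; simpl; lia.
      - apply lt_pow2_mono with (B + B); [|lia]. apply mul_lt_pow2; auto.
    Qed.

    Lemma masked_eq (m : op3 -> bool) (f g : nat -> nat) :
      (forall r, r < R -> f r < 2 ^ H) -> (forall r, r < R -> g r < 2 ^ H) ->
      let M := catf A R (fun r => if m (o r) then ones * 2 ^ (H * V) else 0) in
      Nat.land (catf A R (fun r => f r * 2 ^ (H * V))) M =
      Nat.land (catf A R (fun r => g r * 2 ^ (H * V))) M <->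
      forall r, r < R -> m (o r) = true -> f r = g r.
    Proof.
      intros Hf Hg M. unfold M.
      assert (Hb : forall r, r < R -> (if m (o r) then ones * 2 ^ (H * V) else 0) < 2 ^ A).
      { intros; destruct (m _); auto. apply ones_mul_lt; auto. }
      rewrite !catf_land by (intros; auto; apply sel_lt; auto).
      split.
      - intros E r Hr Hmr.
        apply catf_inj with (r := r) in E; auto.
        + rewrite Hmr, !land_sel in E by auto. apply Nat.mul_cancel_r in E; auto.
        + intros q Hq. eapply Nat.le_lt_trans; [apply Nat.land_le_r|]; auto.
        + intros q Hq. eapply Nat.le_lt_trans; [apply Nat.land_le_r|]; auto.
      - intros E. apply catf_ext; intros r Hr. specialize (E r Hr).
        destruct (m (o r)); [rewrite E; auto|rewrite !Nat.land_0_r; auto].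
    Qed.

    Lemma add_part :
      Nat.land (X1 + X2) (par 9) = Nat.land X3 (par 9) <->
      forall r, r < R -> is_add (o r) = true -> s (i r) + s (j r) = s (k r).
    Proof.
      unfold X1, X2. rewrite catf_add.
      rewrite (catf_ext _ _ _ (fun r => (s (i r) + s (j r)) * 2 ^ (H * V))) by (intros; lia).
      apply (masked_eq is_add); intros r Hr; destruct (Hi r Hr) as (?&?&?); auto.
      apply sB2; auto.
    Qed.

    Lemma land_part :
      Nat.land (Nat.land X1 X2) (par 10) = Nat.land X3 (par 10) <->
      forall r, r < R -> is_land (o r) = true -> Nat.land (s (i r)) (s (j r)) = s (k r).
    Proof.
      unfold X1, X2.
      rewrite catf_land by (intros r Hr; destruct (Hi r Hr) as (?&?&?); apply sel_lt; auto).
      rewrite (catf_ext _ _ _ (fun r => Nat.land (s (i r)) (s (j r)) * 2 ^ (H * V))).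
      - apply (masked_eq is_land); intros r Hr; destruct (Hi r Hr) as (?&?&?); auto.
        eapply Nat.le_lt_trans; [apply Nat.land_le_l|]; auto.
      - intros. rewrite <- !Nat.shiftl_mul_pow2, Nat.shiftl_land; auto.
    Qed.

    Let cell r := s (i r) * s (j r).

    (** Row [r] of the matrix contains [s (i q) * s (j r)] in every cell [q]; the product belonging
        to constraint [r] is the diagonal one, at offset [A * r]. *)
    Lemma mul_entry r : r < R ->
      Nat.land (X1 * (s (j r) * 2 ^ (H * V))) (ones * 2 ^ (A * r + 2 * H * V))
      = cell r * 2 ^ (A * r + 2 * H * V).
    Proof.
      intros Hr. unfold ones. rewrite land_ones_mul. f_equal.
      destruct (Hi r Hr) as (I1&I2&I3).
      rewrite Nat.mul_comm. unfold X1. rewrite catf_mul.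
      rewrite (catf_ext _ _ _ (fun q => (s (i q) * s (j r)) * 2 ^ (2 * H * V))).
      2:{ intros. replace (2 * H * V) with (H * V + H * V) by lia. rewrite Nat.pow_add_r. lia. }
      assert (Hb : forall q, q < R -> (s (i q) * s (j r)) * 2 ^ (2 * H * V) < 2 ^ A).
      { intros q Hq. apply sel_lt; [apply sB2; auto; apply Hs, Hi; auto|].
        unfold A, D; nia. }
      rewrite (Nat.pow_add_r 2 (A * r)), <- Nat.Div0.div_div.
      assert (2 * H * V + H <= A) by (unfold A, D; nia).
      rewrite <- (mod_div_mod _ A) by auto.
      rewrite catf_nth by auto. rewrite Nat.div_mul by auto. apply Nat.mod_small.
      apply sB2; auto.
    Qed.

    Lemma mul_part :
      Nat.land (X1 * Y2) (par 11) = Nat.land (x * par 6) (par 11) <->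
      forall r, r < R -> is_mul (o r) = true -> s (i r) * s (j r) = s (k r).
    Proof.
      simpl par. unfold Y2. rewrite !catf_mul.
      assert (HX1 : X1 < 2 ^ (A * R)).
      { apply catf_lt; intros r Hr; destruct (Hi r Hr) as (?&?&?); apply sel_lt; auto. }
      assert (Hp : forall r q, r < R -> q < R -> s (i q) * s (j r) < 2 ^ H).
      { intros r q Hr Hq. apply sB2; apply Hs, Hi; auto. }
      assert (Hl : forall r, r < R -> X1 * (s (j r) * 2 ^ (H * V)) < 2 ^ (A * R)).
      { intros r Hr. unfold X1. rewrite Nat.mul_comm, catf_mul. apply catf_lt.
        intros q Hq.
        replace (s (j r) * 2 ^ (H * V) * (s (i q) * 2 ^ (H * V)))
          with ((s (i q) * s (j r)) * 2 ^ (2 * H * V)).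
        2:{ replace (2 * H * V) with (H * V + H * V) by lia. rewrite Nat.pow_add_r. lia. }
        apply sel_lt; auto. unfold A, D; nia. }
      assert (Hx : forall r, r < R -> x * 2 ^ (A * r + H * (2 * V - k r)) < 2 ^ (A * R)).
      { intros r Hr. destruct (Hi r Hr) as (?&?&?).
        replace (A * r + H * (2 * V - k r)) with ((A * r + H * V) + H * (V - k r)) by nia.
        apply x_shift_lt; auto. assert (3 * H * V <= A) by (unfold A, D; nia). nia. }
      assert (Hk : forall r, r < R -> (if is_mul (o r) then ones * 2 ^ (A * r + 2 * H * V) else 0)
                    < 2 ^ (A * R)).
      { intros; destruct (is_mul _); auto. apply ones_mul_lt; auto. }
      assert (Hsel : forall r, r < R ->
         Nat.land (x * 2 ^ (A * r + H * (2 * V - k r))) (ones * 2 ^ (A * r + 2 * H * V)) =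
         s (k r) * 2 ^ (A * r + 2 * H * V)).
      { intros r Hr. destruct (Hi r Hr) as (?&?&?).
        replace (A * r + H * (2 * V - k r)) with ((A * r + H * V) + H * (V - k r)) by nia.
        replace (A * r + 2 * H * V) with ((A * r + H * V) + H * V) by nia.
        apply select_slot; auto. }
      rewrite !catf_land by auto. split.
      - intros E r Hr Hmr.
        apply catf_inj with (r := r) in E; auto.
        + rewrite Hmr, mul_entry, Hsel in E by auto. apply Nat.mul_cancel_r in E; auto.
        + intros q Hq. eapply Nat.le_lt_trans; [apply Nat.land_le_r|]; auto.
        + intros q Hq. eapply Nat.le_lt_trans; [apply Nat.land_le_r|]; auto.
      - intros E. apply catf_ext; intros r Hr. specialize (E r Hr).
        destruct (is_mul (o r)); [|rewrite !Nat.land_0_r; auto].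
        rewrite mul_entry, Hsel by auto. unfold cell. rewrite E; auto.
    Qed.

    Lemma slots_part :
      Nat.land x (par 1) = par 0 <-> forall q, q < V -> Nat.land (s q) (mask q) = kv q.
    Proof.
      simpl par. replace x with (x + 2 ^ (H * V) * 0) by lia.
      rewrite land_join by (auto; apply catf_lt; intros; apply Hm; auto).
      rewrite Nat.land_0_l, Nat.mul_0_r, Nat.add_0_r. unfold x.
      rewrite catf_land by (intros; auto; apply Hm; auto).
      split; intros E.
      - apply catf_inj with (2 := fun r Hr => proj2 (Hm r Hr)) (3 := E).
        intros r Hr. eapply Nat.le_lt_trans; [apply Nat.land_le_l|]; auto.
      - apply catf_ext; auto.
    Qed.

    Lemma chk_values : chk n x param <->
      (forall q, q < V -> Nat.land (s q) (mask q) = kv q) /\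
      (forall r, r < R -> op3_rel (o r) (s (i r)) (s (j r)) (s (k r))).
    Proof.
      unfold chk. rewrite !fld_param by lia. fold w.
      replace (Nat.land (x * par 2) (par 7)) with X1
        by (symmetry; apply select_arr; [unfold A, D; nia|auto|intros; apply Hi; auto]).
      replace (Nat.land (x * par 3) (par 7)) with X2
        by (symmetry; apply select_arr; [unfold A, D; nia|auto|intros; apply Hi; auto]).
      replace (Nat.land (x * par 4) (par 7)) with X3
        by (symmetry; apply select_arr; [unfold A, D; nia|auto|intros; apply Hi; auto]).
      replace (Nat.land (x * par 5) (par 8)) with Y2.
      2:{ symmetry; apply select_arr; [|nia|intros; apply Hi; auto].
          assert (2 * H * V <= A) by (unfold A, D; nia). nia. }
      rewrite slots_part, add_part, land_part, mul_part.
      split.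
      - intros (_&S&Ha&Hl&Hmu); split; auto. intros r Hr.
        specialize (Ha r Hr); specialize (Hl r Hr); specialize (Hmu r Hr).
        destruct (o r); simpl in *; auto.
      - intros (S&C). split; [apply lt_pow2_mono with (H * V); auto|].
        split; auto. repeat split; intros r Hr E; specialize (C r Hr);
          destruct (o r); simpl in *; congruence.
    Qed.
  End Values.

  (** Each entry of a row is a power of two or a block of ones, hence a single run, except for the
      constants in [kv]. *)
  Lemma par_io m : (forall q, q < V -> IO (m + 1) (kv q)) -> (forall q, q < V -> IO 1 (mask q)) ->
    forall q, q < 12 -> IO ((m + 1) * V + R + 1) (par q).
  Proof.
    intros Ik Im q Hq.
    assert (VM : forall W (h : nat -> nat), (forall r, r < R -> h r < 2 ^ W) ->
                  (forall r, r < R -> IO 1 (h r)) -> IO ((m + 1) * V + R + 1) (catf W R h)).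
    { intros W h H1 H2. apply IO_mono with (R * 1); [apply IO_catf; auto|lia]. }
    assert (O1 : forall q, IO 1 (ones * 2 ^ q)) by (intros; apply IO_shift, IO_ones).
    assert (O0 : IO 1 0) by apply IO_0.
    destruct q as [|[|[|[|[|[|[|[|[|[|[|[|?]]]]]]]]]]]]; [..|lia]; cbn [par].
    - apply IO_mono with (V * (m + 1)); [|lia]. apply IO_catf; auto. intros; apply Hm; auto.
    - apply IO_mono with (V * 1 + 1); [|nia]. apply IO_join; [| |apply IO_ones].
      + apply catf_lt. intros; apply Hm; auto.
      + apply IO_catf; auto. intros; apply Hm; auto.
    - apply VM; intros r Hr; [|apply IO_pow2]. apply pj, Hi; auto.
    - apply VM; intros r Hr; [|apply IO_pow2]. apply pj, Hi; auto.
    - apply VM; intros r Hr; [|apply IO_pow2]. apply pj, Hi; auto.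
    - apply VM; intros r Hr; [|apply IO_pow2]. apply pj', Hi; auto.
    - apply VM; intros r Hr; [|apply IO_pow2]. apply pow2_lt.
      specialize (slotAR r Hr). assert (H * (2 * V - k r) <= 2 * H * V) by nia. lia.
    - apply VM; intros r Hr; auto. apply ones_mul_lt; auto.
    - apply VM; intros r Hr; auto. apply ones_mul_lt. nia.
    - apply VM; intros r Hr; destruct (is_add (o r)); auto. apply ones_mul_lt; auto.
    - apply VM; intros r Hr; destruct (is_land (o r)); auto. apply ones_mul_lt; auto.
    - apply VM; intros r Hr; destruct (is_mul (o r)); auto. apply ones_mul_lt; auto.
  Qed.

  Theorem chk_param :
    (exists x, x < 2 ^ n /\ chk n x param) <->
    exists s : nat -> nat,
      (forall q, q < V -> s q < 2 ^ H /\ Nat.land (s q) (mask q) = kv q) /\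
      (forall r, r < R -> op3_rel (o r) (s (i r)) (s (j r)) (s (k r))).
  Proof.
    assert (w <= n) by apply Nat.Div0.div_le_upper_bound, Nat.le_mul_l, Nat.neq_succ_0.
    split.
    - intros (x & _ & C).
      assert (C' := C). destruct C' as (Hx & S & _).
      rewrite !fld_param in S by lia. fold w in Hx.
      (* The masked comparison covers all bits above the slots, where field 0 is zero. *)
      assert (HxV : x < 2 ^ (H * V)).
      { assert (Ex : x = x mod 2 ^ (H * V) + 2 ^ (H * V) * (x / 2 ^ (H * V)))
          by (rewrite Nat.add_comm; apply Nat.div_mod_eq).
        assert (Hq : x / 2 ^ (H * V) < 2 ^ (w - H * V)).
        { apply Nat.Div0.div_lt_upper_bound. rewrite <- Nat.pow_add_r.
          replace (H * V + (w - H * V)) with w by lia; auto. }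
        rewrite Ex in S. simpl par in S.
        assert (Hmm : catf H V mask < 2 ^ (H * V)) by (apply catf_lt; intros; apply Hm; auto).
        rewrite land_join in S by (auto; apply Nat.mod_upper_bound; auto).
        assert (Hk0 : catf H V kv < 2 ^ (H * V)) by (apply catf_lt; intros; apply Hm; auto).
        replace (2 ^ (w - H * V) - 1) with (Nat.ones (w - H * V)) in S
          by (rewrite Nat.ones_equiv; lia).
        rewrite Nat.land_ones, (Nat.mod_small _ (2 ^ (w - H * V))) in S by auto.
        assert (x / 2 ^ (H * V) = 0) by nia.
        apply Nat.div_small_iff; auto. }
      pose (s := fun q => (x / 2 ^ (H * q)) mod 2 ^ H).
      assert (Es : x = catf H V s) by (apply catf_split; auto).
      assert (HsH : forall q, s q < 2 ^ H) by (intros; apply Nat.mod_upper_bound; auto).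
      assert (Sl : forall q, q < V -> Nat.land (s q) (mask q) = kv q).
      { rewrite Es in S. simpl par in S.
        replace (catf H V s) with (catf H V s + 2 ^ (H * V) * 0) in S by lia.
        rewrite land_join in S by (apply catf_lt; auto; intros; apply Hm; auto).
        rewrite Nat.land_0_l, Nat.mul_0_r, Nat.add_0_r in S.
        rewrite catf_land in S by (intros; auto; apply Hm; auto).
        apply catf_inj with (2 := fun r Hr => proj2 (Hm r Hr)) (3 := S).
        intros r Hr. eapply Nat.le_lt_trans; [apply Nat.land_le_l|]; auto. }
      exists s. split; [split; auto|].
      rewrite Es in C. apply chk_values in C; [apply C|]. intros; eapply Hslot; eauto.
    - intros (s & S & C). exists (catf H V s). split.
      + apply lt_pow2_mono with (H * V); [|lia]. apply catf_lt; intros; apply S; auto.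
      + apply chk_values; [|split; auto; intros; apply S; auto].
        intros q Hq. destruct (S q Hq). eapply Hslot; eauto.
  Qed.
End Packing.

(** * Positive existential formulas *)

Definition scons (v : nat) (e : nat -> nat) (i : nat) : nat :=
  match i with 0 => v | S i => e i end.

(** De Bruijn indices; [PEx b] ranges over the numbers below [2 ^ b]. Negation is absent because a
    formula has to become a single existential question. *)
Inductive pf : Set :=
| PAtom (o : op3) (i j k : nat)
| PCst (i c : nat)
| PAnd (f g : pf)
| POr (f g : pf)
| PEx (b : nat) (f : pf).

Fixpoint sat (f : pf) (e : nat -> nat) : Prop :=
  match f with
  | PAtom o i j k => op3_rel o (e i) (e j) (e k)
  | PCst i c => e i = c
  | PAnd f g => sat f e /\ sat g e
  | POr f g => sat f e \/ sat g e
  | PEx b f => exists v, v < 2 ^ b /\ sat f (scons v e)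
  end.

Fixpoint psize (f : pf) : nat :=
  match f with
  | PAtom _ _ _ _ | PCst _ _ => 1
  | PAnd f g | POr f g => 1 + psize f + psize g
  | PEx _ f => 1 + psize f
  end.

Fixpoint wd (b : nat) (f : pf) : Prop :=
  match f with
  | PAtom _ _ _ _ => True
  | PCst _ c => c < 2 ^ b
  | PAnd f g | POr f g => wd b f /\ wd b g
  | PEx b' f => b' <= b /\ wd b f
  end.

Fixpoint cio (m : nat) (f : pf) : Prop :=
  match f with
  | PAtom _ _ _ _ => True
  | PCst _ c => IO m c
  | PAnd f g | POr f g => cio m f /\ cio m g
  | PEx _ f => cio m f
  end.

Fixpoint fv (f : pf) : list nat :=
  match f with
  | PAtom _ i j k => [i; j; k]
  | PCst i _ => [i]
  | PAnd f g | POr f g => fv f ++ fv g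
  | PEx _ f => flat_map (fun i => match i with 0 => [] | S i => [i] end) (fv f)
  end.

Lemma fv_length f : length (fv f) <= 3 * psize f.
Proof.
  induction f; simpl; rewrite ?length_app; try lia.
  assert (forall l, length (flat_map (fun i => match i with 0 => [] | S i => [i] end) l) <= length l).
  { induction l as [|[|a] l IH]; simpl; auto; lia. }
  specialize (H (fv f)); lia.
Qed.

Lemma psize_pos f : 1 <= psize f.
Proof. destruct f; simpl; lia. Qed.

Lemma in_fv_ex b f i : In i (fv (PEx b f)) <-> In (S i) (fv f).
Proof.
  simpl. rewrite in_flat_map. split.
  - intros ([|x] & H1 & H2); simpl in H2; [tauto|]. destruct H2 as [->|[]]; auto.
  - intros H. exists (S i); simpl; auto.
Qed.

Lemma sat_fv f : forall e e', (forall i, In i (fv f) -> e i = e' i) -> sat f e <-> sat f e'.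
Proof.
  induction f; intros e e' H.
  - simpl in *. rewrite !H by auto. tauto.
  - simpl in *. rewrite !H by auto. tauto.
  - simpl in *. rewrite (IHf1 e e'), (IHf2 e e') by (intros; apply H, in_or_app; auto). tauto.
  - simpl in *. rewrite (IHf1 e e'), (IHf2 e e') by (intros; apply H, in_or_app; auto). tauto.
  - simpl sat. split; intros (v & Hv & S); exists v; split; auto; revert S; apply IHf;
    intros [|i] Hi; simpl; auto; [symmetry|]; apply H, in_fv_ex; auto.
Qed.

(** * Compilation to a list of constraints *)

Inductive slot : Set := SFix (c : nat) | SWid (b : nat).

Definition slot_ok (s : slot) (v : nat) : Prop :=
  match s with SFix c => v = c | SWid b => v < 2 ^ b end.

Definition cstr : Set := op3 * nat * nat * nat.

Definition cstr_ok (s : nat -> nat) (c : cstr) : Prop :=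
  let '(o, i, j, k) := c in op3_rel o (s i) (s j) (s k).

(* Every atom is guarded by the 0/1-valued variable [g]: with [g = 0] it holds for the
   copies of its arguments, which are then unrelated to the arguments.  A disjunction
   splits [g] into a sum of two guards. *)
Fixpoint pcomp (B : nat) (f : pf) (rho : nat -> nat) (g V : nat) : list slot * list cstr :=
  match f with
  | PAtom o i j k =>
      (repeat (SWid B) 6,
       [(OMul, g, rho i, V + 3); (OMul, g, V, V + 3);
        (OMul, g, rho j, V + 4); (OMul, g, V + 1, V + 4);
        (OMul, g, rho k, V + 5); (OMul, g, V + 2, V + 5);
        (o, V, V + 1, V + 2)])
  | PCst i c =>
      ([SFix c; SWid B], [(OMul, g, rho i, V + 1); (OMul, g, V, V + 1)])
  | PAnd f h =>
      let p := pcomp B f rho g V in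
      let q := pcomp B h rho g (V + length (fst p)) in
      (fst p ++ fst q, snd p ++ snd q)
  | POr f h =>
      let p := pcomp B f rho V (V + 2) in
      let q := pcomp B h rho (V + 1) (V + 2 + length (fst p)) in
      ([SWid 1; SWid 1] ++ fst p ++ fst q, (OAdd, V, V + 1, g) :: snd p ++ snd q)
  | PEx b f =>
      let p := pcomp B f (scons V rho) g (S V) in
      (SWid b :: fst p, snd p)
  end.

Definition slots_ok (s : nat -> nat) (V : nat) (l : list slot) : Prop :=
  forall q d, q < length l -> slot_ok (nth q l d) (s (V + q)).

Lemma slots_ok_app s V l l' :
  slots_ok s V (l ++ l') <-> slots_ok s V l /\ slots_ok s (V + length l) l'.
Proof.
  unfold slots_ok. rewrite length_app. split.
  - intros H; split; intros q d Hq.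
    + specialize (H q d). rewrite app_nth1 in H by auto. apply H; lia.
    + specialize (H (length l + q) d). rewrite app_nth2_plus in H.
      rewrite <- Nat.add_assoc. apply H; lia.
  - intros (H1 & H2) q d Hq. destruct (Nat.lt_ge_cases q (length l)).
    + rewrite app_nth1 by auto. apply H1; auto.
    + rewrite app_nth2 by auto. replace (V + q) with (V + length l + (q - length l)) by lia.
      apply H2; lia.
Qed.

Lemma slots_ok_cons s V a l : slots_ok s V (a :: l) <-> slot_ok a (s V) /\ slots_ok s (S V) l.
Proof.
  change (a :: l) with ([a] ++ l). rewrite slots_ok_app. simpl.
  replace (V + 1) with (S V) by lia.
  assert (slots_ok s V [a] <-> slot_ok a (s V)); [|tauto].
  unfold slots_ok; simpl. split.
  - intros H. specialize (H 0 a). rewrite Nat.add_0_r in H. apply H; auto.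
  - intros H [|q] d Hq; [rewrite Nat.add_0_r; auto|lia].
Qed.

Lemma comp_size B f : forall rho g V,
  length (fst (pcomp B f rho g V)) <= 6 * psize f /\ length (snd (pcomp B f rho g V)) <= 7 * psize f.
Proof.
  induction f; intros rho g V; simpl; try lia.
  - rewrite !length_app.
    pose proof (IHf1 rho g V). pose proof (IHf2 rho g (V + length (fst (pcomp B f1 rho g V)))). lia.
  - rewrite !length_app. pose proof (IHf1 rho V (V + 2)).
    pose proof (IHf2 rho (V + 1) (V + 2 + length (fst (pcomp B f1 rho V (V + 2))))). lia.
  - pose proof (IHf (scons V rho) g (S V)). lia.
Qed.

Definition cstr_lt (V : nat) (c : cstr) : Prop :=
  let '(_, i, j, k) := c in i < V /\ j < V /\ k < V.

Lemma cstr_lt_mono V V' c : cstr_lt V c -> V <= V' -> cstr_lt V' c.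
Proof. destruct c as [[[o i] j] k]; simpl; lia. Qed.

Lemma comp_idx B f : forall rho g V,
  (forall i, In i (fv f) -> rho i < V) -> g < V ->
  Forall (cstr_lt (V + length (fst (pcomp B f rho g V)))) (snd (pcomp B f rho g V)).
Proof.
  induction f; intros rho g V Hr Hg.
  - simpl. pose proof (Hr i); pose proof (Hr j); pose proof (Hr k). simpl in *.
    repeat constructor; simpl; try lia; (eapply Nat.lt_le_trans; [apply Hr; auto 6|lia]).
  - simpl. repeat constructor; simpl; try lia. specialize (Hr i); simpl in Hr; lia.
  - simpl. rewrite length_app. apply Forall_app; split.
    + eapply Forall_impl; [intros c Hc; eapply cstr_lt_mono; [apply Hc|]|apply IHf1; auto].
      * lia.
      * intros; apply Hr, in_or_app; auto.
    + eapply Forall_impl; [intros c Hc; eapply cstr_lt_mono; [apply Hc|]|apply IHf2; try lia].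
      * lia.
      * intros i Hi. specialize (Hr i (in_or_app _ _ _ (or_intror Hi))). lia.
  - simpl. rewrite length_app. constructor; [simpl; lia|]. apply Forall_app; split.
    + eapply Forall_impl; [intros c Hc; eapply cstr_lt_mono; [apply Hc|]|apply IHf1; try lia].
      * lia.
      * intros i Hi. specialize (Hr i (in_or_app _ _ _ (or_introl Hi))). lia.
    + eapply Forall_impl; [intros c Hc; eapply cstr_lt_mono; [apply Hc|]|apply IHf2; try lia].
      * lia.
      * intros i Hi. specialize (Hr i (in_or_app _ _ _ (or_intror Hi))). lia.
  - simpl. eapply Forall_impl; [intros c Hc; eapply cstr_lt_mono; [apply Hc|]|apply IHf; try lia].
    + lia.
    + intros [|i] Hi; simpl; [lia|]. apply in_fv_ex with (b := b) in Hi. apply Hr in Hi; lia.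
Qed.

(** With guard 1, equal products identify each argument with its copy. At a disjunction two guards
    with values in [{0, 1}] add up to 1, so one of them is 1. *)
Lemma comp_sound B f : forall rho g V s,
  slots_ok s V (fst (pcomp B f rho g V)) -> Forall (cstr_ok s) (snd (pcomp B f rho g V)) ->
  s g = 1 -> sat f (fun i => s (rho i)).
Proof.
  induction f; intros rho g V s S C G.
  - simpl in *. repeat match goal with H : Forall _ (_ :: _) |- _ => inversion_clear H end.
    simpl in *. rewrite G in *.
    assert (s (rho i) = s V) by lia.
    assert (s (rho j) = s (V + 1)) by lia.
    assert (s (rho k) = s (V + 2)) by lia. congruence.
  - simpl in *. repeat match goal with H : Forall _ (_ :: _) |- _ => inversion_clear H end.
    simpl in *. rewrite G in *. rewrite slots_ok_cons in S. destruct S as [S _]. simpl in S. lia.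
  - simpl in *. rewrite slots_ok_app in S. rewrite Forall_app in C. destruct S, C. split; eauto.
  - simpl in S, C. apply slots_ok_cons in S. destruct S as [S1 S].
    apply slots_ok_cons in S. destruct S as [S2 S]. simpl in S1, S2.
    inversion_clear C. simpl in H. rewrite Forall_app in H0. destruct H0 as [C1 C2].
    replace (Datatypes.S (Datatypes.S V)) with (V + 2) in S by lia.
    rewrite slots_ok_app in S. destruct S as [T1 T2].
    replace (s (Datatypes.S V)) with (s (V + 1)) in S2 by (f_equal; lia).
    simpl. destruct (s V) as [|[|?]] eqn:E1; [|left|lia].
    + right. eapply IHf2; eauto. lia.
    + eapply IHf1; eauto.
  - simpl in S, C. apply slots_ok_cons in S. destruct S as [S1 S]. simpl in S1.
    simpl. exists (s V); split; auto.
    apply (sat_fv f (fun i => s (scons V rho i))); [|eapply IHf; eauto].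
    intros [|i] _; reflexivity.
Qed.

Lemma cstr_ok_ext s s' V c : cstr_lt V c -> (forall q, q < V -> s q = s' q) -> cstr_ok s c -> cstr_ok s' c.
Proof. destruct c as [[[o i] j] k]; simpl. intros (?&?&?) E. rewrite !E by auto. auto. Qed.

Lemma slots_ok_ext s s' V l : (forall q, q < length l -> s (V + q) = s' (V + q)) ->
  slots_ok s V l -> slots_ok s' V l.
Proof. intros E H q d Hq. rewrite <- E by auto. apply H; auto. Qed.

Definition upd (s : nat -> nat) (V v : nat) (q : nat) : nat := if q =? V then v else s q.

Lemma upd_eq s V v : upd s V v V = v.
Proof. unfold upd. rewrite Nat.eqb_refl; auto. Qed.

Lemma upd_neq s V v q : q <> V -> upd s V v q = s q.
Proof. unfold upd. intros H. apply Nat.eqb_neq in H. rewrite H; auto. Qed.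

(** Where the guard is 0 the copies are set to 0, and [0 + 0], [0 * 0] and the conjunction of 0 with
    0 are all 0. Variables below [V] keep their values, so the parts of a formula can be satisfied
    one after the other. *)
Lemma gate_cases B f : 0 < B -> wd B f -> forall rho g V s,
  (forall i, In i (fv f) -> rho i < V /\ s (rho i) < 2 ^ B) -> g < V ->
  s g = 0 \/ (s g = 1 /\ sat f (fun i => s (rho i))) ->
  exists s', (forall q, q < V -> s' q = s q) /\
    slots_ok s' V (fst (pcomp B f rho g V)) /\ Forall (cstr_ok s') (snd (pcomp B f rho g V)).
Proof.
  intros HB. induction f; intros Hwd rho g V s Hr Hg G.
  - assert (Ri := Hr i); assert (Rj := Hr j); assert (Rk := Hr k). simpl in Ri, Rj, Rk.
    destruct Ri as [Ri Li]; auto. destruct Rj as [Rj Lj]; auto. destruct Rk as [Rk Lk]; auto.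
    pose (x := s g * s (rho i)). pose (y := s g * s (rho j)). pose (z := s g * s (rho k)).
    assert (Lx : x < 2 ^ B) by (unfold x; destruct G as [->|[-> _]]; simpl; try lia; auto).
    assert (Ly : y < 2 ^ B) by (unfold y; destruct G as [->|[-> _]]; simpl; try lia; auto).
    assert (Lz : z < 2 ^ B) by (unfold z; destruct G as [->|[-> _]]; simpl; try lia; auto).
    assert (Ro : op3_rel o x y z).
    { unfold x, y, z. destruct G as [->|[-> G]]; [destruct o; reflexivity|].
      rewrite !Nat.mul_1_l. exact G. }
    exists (fun q => if q <? V then s q else nth (q - V) [x; y; z; x; y; z] 0).
    assert (El : forall q, q < V -> (if q <? V then s q else nth (q - V) [x; y; z; x; y; z] 0) = s q).
    { intros q Hq. apply Nat.ltb_lt in Hq. rewrite Hq; auto. }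
    assert (Eh : forall q, (if V + q <? V then s (V + q) else nth (V + q - V) [x; y; z; x; y; z] 0)
                 = nth q [x; y; z; x; y; z] 0).
    { intros q. destruct (Nat.ltb_spec (V + q) V); [lia|]. f_equal; lia. }
    assert (E0 := Eh 0). rewrite Nat.add_0_r in E0.
    split; [exact El|]. split.
    + intros q d Hq. rewrite Eh. cbn [pcomp fst repeat length] in Hq |- *.
      do 6 (destruct q as [|q]; [simpl; auto|]). lia.
    + cbn [pcomp snd].
      repeat apply Forall_cons; [..|apply Forall_nil]; cbn [cstr_ok];
      rewrite ?El, ?Eh, ?E0 by auto; cbn [nth op3_rel]; auto;
      unfold x, y, z; destruct G as [->|[-> _]]; simpl; lia.
  - assert (Ri := Hr i). simpl in Ri. destruct Ri as [Ri Li]; auto. simpl in Hwd.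
    exists (upd (upd s V c) (V + 1) (s g * s (rho i))).
    assert (El : forall q, q < V -> upd (upd s V c) (V + 1) (s g * s (rho i)) q = s q)
      by (intros; rewrite !upd_neq by lia; auto).
    assert (E0 : upd (upd s V c) (V + 1) (s g * s (rho i)) V = c)
      by (rewrite upd_neq, upd_eq by lia; auto).
    split; auto. split.
    + cbn [pcomp fst]. rewrite !slots_ok_cons. rewrite E0. split; [reflexivity|].
      replace (S V) with (V + 1) by lia. rewrite upd_eq. split.
      * simpl. destruct G as [->|[-> _]]; simpl; try lia; auto.
      * intros q d Hq; simpl in Hq; lia.
    + cbn [pcomp snd]. repeat apply Forall_cons; [..|apply Forall_nil]; cbn [cstr_ok];
      rewrite upd_eq, ?El, ?E0 by auto; cbn [op3_rel]; auto.
      destruct G as [->|[-> G]]; simpl in *; lia.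
  - destruct Hwd as [W1 W2].
    destruct (IHf1 W1 rho g V s) as (s1 & E1 & S1 & C1); auto.
    { intros; apply Hr, in_or_app; auto. }
    { simpl in G; tauto. }
    simpl. set (p := pcomp B f1 rho g V) in *.
    destruct (IHf2 W2 rho g (V + length (fst p)) s1) as (s2 & E2 & S2 & C2).
    { intros i Hi. destruct (Hr i) as [A1 A2]; [apply in_or_app; auto|].
      rewrite E1 by auto. split; auto; lia. }
    { lia. }
    { rewrite E1 by auto. destruct G as [|[G1 [_ G2]]]; auto. right; split; auto.
      eapply sat_fv; [|exact G2]. intros i Hi. apply E1, Hr, in_or_app; auto. }
    exists s2. split; [intros; rewrite E2, E1 by lia; auto|]. split.
    + apply slots_ok_app; split; auto. eapply slots_ok_ext; [|exact S1].
      intros; rewrite E2 by lia; auto.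
    + apply Forall_app; split; auto.
      eapply Forall_impl; [|exact (Forall_and C1 (comp_idx B f1 rho g V
         (fun i Hi => proj1 (Hr i (in_or_app _ _ _ (or_introl Hi)))) Hg))].
      intros c (Hc1 & Hc2). apply (cstr_ok_ext s1 s2 _ c Hc2); auto. intros; symmetry; apply E2; auto.
  - destruct Hwd as [W1 W2].
    assert (Gs : exists b1 b2, b1 + b2 = s g /\ b1 < 2 /\ b2 < 2 /\
       (b1 = 0 \/ (b1 = 1 /\ sat f1 (fun i => s (rho i)))) /\
       (b2 = 0 \/ (b2 = 1 /\ sat f2 (fun i => s (rho i))))).
    { destruct G as [->|[-> [G|G]]]; [exists 0, 0|exists 1, 0|exists 0, 1]; repeat split; auto. }
    destruct Gs as (b1 & b2 & Eb & L1 & L2 & G1 & G2).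
    pose (s0 := upd (upd s V b1) (V + 1) b2).
    assert (A0 : forall q, q < V -> s0 q = s q) by (intros; unfold s0; rewrite !upd_neq by lia; auto).
    assert (AV : s0 V = b1) by (unfold s0; rewrite upd_neq, upd_eq by lia; auto).
    assert (AV1 : s0 (V + 1) = b2) by (unfold s0; rewrite upd_eq; auto).
    assert (Hr1 : forall i, In i (fv f1) -> rho i < V + 2 /\ s0 (rho i) < 2 ^ B).
    { intros i Hi. destruct (Hr i) as [R1 R2]; [apply in_or_app; auto|].
      rewrite A0 by auto. split; auto; lia. }
    destruct (IHf1 W1 rho V (V + 2) s0) as (s1 & E1 & S1 & C1); auto; [lia| |].
    { rewrite AV. destruct G1 as [|[? G1]]; auto. right; split; auto.
      eapply sat_fv; [|exact G1]. intros i Hi. apply A0, Hr, in_or_app; auto. }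
    simpl. set (p := pcomp B f1 rho V (V + 2)) in *.
    destruct (IHf2 W2 rho (V + 1) (V + 2 + length (fst p)) s1) as (s2 & E2 & S2 & C2).
    { intros i Hi. destruct (Hr i) as [R1 R2]; [apply in_or_app; auto|].
      rewrite E1, A0 by lia. split; auto; lia. }
    { lia. }
    { rewrite E1, AV1 by lia. destruct G2 as [|[? G2]]; auto. right; split; auto.
      eapply sat_fv; [|exact G2]. intros i Hi. destruct (Hr i) as [R1 R2]; [apply in_or_app; auto|].
      rewrite E1, A0 by lia; auto. }
    exists s2. split; [intros; rewrite E2, E1, A0 by lia; auto|]. split.
    + rewrite !slots_ok_cons. split; [rewrite E2, E1, AV by lia; simpl; auto|].
      replace (S V) with (V + 1) by lia.
      split; [rewrite E2, E1, AV1 by lia; simpl; auto|].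
      replace (S (V + 1)) with (V + 2) by lia.
      apply slots_ok_app; split; auto. eapply slots_ok_ext; [|exact S1].
      intros; rewrite E2 by lia; auto.
    + constructor.
      * simpl. rewrite !E2, !E1, AV, AV1, A0 by lia; auto.
      * apply Forall_app; split; auto.
        eapply Forall_impl; [|exact (Forall_and C1 (comp_idx B f1 rho V (V + 2)
         (fun i Hi => proj1 (Hr1 i Hi)) ltac:(lia)))].
        intros c (Hc1 & Hc2). apply (cstr_ok_ext s1 s2 _ c Hc2); auto. intros; symmetry; apply E2; auto.
  - destruct Hwd as [Wb W].
    assert (Gs : exists v, v < 2 ^ b /\ (s g = 0 \/ (s g = 1 /\ sat f (scons v (fun i => s (rho i)))))).
    { destruct G as [G|[G (v & Hv & Sv)]]; [exists 0; auto|exists v; auto]. }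
    destruct Gs as (v & Hv & G').
    destruct (IHf W (scons V rho) g (S V) (upd s V v)) as (s1 & E1 & S1 & C1).
    { intros [|i] Hi; simpl.
      - rewrite upd_eq. split; auto. eapply lt_pow2_mono; eauto.
      - apply in_fv_ex with (b := b) in Hi. apply Hr in Hi. rewrite upd_neq by lia. split; [lia|tauto]. }
    { lia. }
    { rewrite upd_neq by lia. destruct G' as [|[? G']]; auto. right; split; auto.
      eapply sat_fv; [|exact G']. intros [|i] Hi; simpl; [apply upd_eq|].
      apply in_fv_ex with (b := b) in Hi. apply Hr in Hi. apply upd_neq; lia. }
    exists s1. split; [intros; rewrite E1, upd_neq by lia; auto|]. simpl. split; auto.
    apply slots_ok_cons; split; auto. rewrite E1, upd_eq by lia. simpl; auto.
Qed.

Fixpoint idx (i : nat) (l : list nat) : nat :=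
  match l with [] => 0 | a :: l => if a =? i then 0 else S (idx i l) end.

Lemma idx_spec i l d : In i l -> idx i l < length l /\ nth (idx i l) l d = i.
Proof.
  induction l as [|a l IH]; simpl; [tauto|].
  destruct (Nat.eqb_spec a i); intros H; [split; auto; lia|].
  destruct H; [tauto|]. destruct (IH H); split; auto; lia.
Qed.

Lemma catf_trunc W m h : forall n, m <= n ->
  catf W n (fun q => if q <? m then h q else 0) = catf W m h.
Proof.
  revert h; induction m; intros h n L.
  - apply (eq_trans (catf_ext W n _ (fun _ => 0) (fun r _ => eq_refl))), catf_zero.
  - destruct n; [lia|]. simpl. f_equal. f_equal.
    rewrite <- (IHm (fun r => h (S r)) n) by lia. apply catf_ext; reflexivity.
Qed.

(** The mask of a fixed slot does not depend on its constant. Hence the values of the free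
    variables, which are fixed slots, enter only field 0 of the parameter. *)
Definition mask_of (H : nat) (s : slot) : nat :=
  match s with SFix _ => 2 ^ H - 1 | SWid b => 2 ^ H - 2 ^ b end.
Definition kv_of (s : slot) : nat := match s with SFix c => c | SWid _ => 0 end.
Definition slot_wd (B : nat) (s : slot) : Prop :=
  match s with SFix c => c < 2 ^ B | SWid b => b <= B end.

Lemma slot_ok_mask H B s v : B <= H -> slot_wd B s ->
  slot_ok s v <-> v < 2 ^ H /\ Nat.land v (mask_of H s) = kv_of s.
Proof.
  intros L W. destruct s as [c|b]; simpl in *.
  - replace (2 ^ H - 1) with (Nat.ones H) by (rewrite Nat.ones_equiv; lia).
    rewrite Nat.land_ones. assert (c < 2 ^ H) by (eapply lt_pow2_mono; eauto). split.
    + intros ->. split; auto. apply Nat.mod_small; auto.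
    + intros (A & E). rewrite Nat.mod_small in E by auto; auto.
  - assert (E : 2 ^ H - 2 ^ b = (2 ^ (H - b) - 1) * 2 ^ b).
    { replace H with (H - b + b) at 1 by lia. rewrite Nat.pow_add_r. nia. }
    rewrite E, land_ones_mul.
    assert (Q : v < 2 ^ H -> v / 2 ^ b mod 2 ^ (H - b) = v / 2 ^ b).
    { intros. apply Nat.mod_small, Nat.Div0.div_lt_upper_bound. rewrite <- Nat.pow_add_r.
      replace (b + (H - b)) with H by lia; auto. }
    split.
    + intros Hv. assert (v < 2 ^ H) by (eapply lt_pow2_mono; eauto; lia).
      split; auto. rewrite Q, Nat.div_small by auto; auto.
    + intros (A & Z). rewrite Q in Z by auto. apply Nat.div_small_iff; auto.
      pose proof (pow2_pos b). nia.
Qed.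

Lemma mask_of_lt H B s : B <= H -> slot_wd B s -> mask_of H s < 2 ^ H /\ kv_of s < 2 ^ H.
Proof.
  intros L W. pose proof (pow2_pos H). destruct s as [c|b]; simpl in *.
  - split; [lia|]. eapply lt_pow2_mono; eauto.
  - pose proof (pow2_pos b). lia.
Qed.

Lemma mask_of_io H B s : B <= H -> slot_wd B s -> IO 1 (mask_of H s).
Proof.
  intros L W. destruct s as [c|b]; simpl in *; [apply IO_ones|].
  replace (2 ^ H - 2 ^ b) with ((2 ^ (H - b) - 1) * 2 ^ b); [apply IO_shift, IO_ones|].
  replace H with (H - b + b) at 2 by lia. rewrite Nat.pow_add_r. nia.
Qed.

Lemma slot_ok_lt B s v : slot_wd B s -> slot_ok s v -> v < 2 ^ B.
Proof. destruct s; simpl; intros; [subst; auto|eapply lt_pow2_mono; eauto]. Qed.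

Lemma comp_slot_wd B f : 0 < B -> wd B f -> forall rho g V, Forall (slot_wd B) (fst (pcomp B f rho g V)).
Proof.
  intros HB; induction f; intros W rho g V; simpl in *.
  - repeat constructor; simpl; auto.
  - repeat constructor; simpl; auto.
  - apply Forall_app; split; [apply IHf1|apply IHf2]; tauto.
  - do 2 (constructor; [simpl; lia|]). apply Forall_app; split; [apply IHf1|apply IHf2]; tauto.
  - constructor; [simpl; tauto|]. apply IHf; tauto.
Qed.

Lemma comp_slot_io B f m : cio m f -> forall rho g V, Forall (fun s => IO m (kv_of s)) (fst (pcomp B f rho g V)).
Proof.
  induction f; intros W rho g V; simpl in *.
  - repeat constructor; simpl; apply IO_0.
  - repeat constructor; simpl; auto; apply IO_0.
  - apply Forall_app; split; [apply IHf1|apply IHf2]; tauto.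
  - do 2 (constructor; [simpl; apply IO_0|]). apply Forall_app; split; [apply IHf1|apply IHf2]; tauto.
  - constructor; [simpl; apply IO_0|]. apply IHf; tauto.
Qed.

(** * Universality of the relation [chk] *)

Section Universal.
  Variables (f : pf) (n B s m : nat).
  Hypothesis Hsz : psize f <= s.
  Hypothesis HB : 0 < B.
  Hypothesis Hwd : wd B f.
  Hypothesis Hio : cio m f.
  (** There are at most [11 * s] variables and [8 * s] constraints, and 3000 exceeds
      [4 * 11 * 8 * 8]. *)
  Hypothesis Hn : 3000 * (2 * B + 1) * (s * s * s) <= n / 16.

  Let H := 2 * B + 1.
  (* Variable [0] gets the first slot, and only that one. *)
  Let vs := 0 :: filter (fun i => negb (i =? 0)) (fv f).
  Let g := length vs.
  Let p := pcomp B f (fun i => idx i vs) g (S g).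
  Let sl (e : nat -> nat) := map (fun i => SFix (e i)) vs ++ SFix 1 :: fst p.
  (** Variable [g] is the outermost guard, fixed to 1. The constraint [1 * 1 = 1] on it makes the
      list nonempty. *)
  Let cl : list cstr := (OMul, g, g, g) :: snd p.
  Let V := length vs + S (length (fst p)).
  Let R := length cl.
  Let d0 := SFix 0.
  Let c0 : cstr := (OMul, 0, 0, 0).
  Let o r := match nth r cl c0 with (o, _, _, _) => o end.
  Let i r := match nth r cl c0 with (_, i, _, _) => i end.
  Let j r := match nth r cl c0 with (_, _, j, _) => j end.
  Let k r := match nth r cl c0 with (_, _, _, k) => k end.
  Let mk q := mask_of H (nth q (sl (fun _ => 0)) d0).
  Let kv e q := kv_of (nth q (sl e) d0).
  Let prm e := param n H V R mk (kv e) o i j k.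

  Lemma sl_length e : length (sl e) = V.
  Proof. unfold sl, V. rewrite length_app, length_map; simpl; lia. Qed.

  Lemma V_bound : 0 < V /\ V <= 11 * s /\ 0 < R /\ R <= 8 * s /\ g <= 3 * s + 1.
  Proof.
    pose proof (comp_size B f (fun i => idx i vs) g (S g)) as [A1 A2]. fold p in A1, A2.
    pose proof (fv_length f). pose proof (psize_pos f).
    pose proof (filter_length_le (fun i => negb (i =? 0)) (fv f)).
    unfold V, R, g, cl, vs in *. simpl. lia.
  Qed.

  Lemma w_bound : H * (4 * V) * R * R <= n / 16.
  Proof.
    destruct V_bound as (_ & L1 & _ & L2 & _). fold H in Hn.
    assert (H * (4 * V) <= H * (44 * s)) by (apply Nat.mul_le_mono_l; lia).
    assert (R * R <= (8 * s) * (8 * s)) by (apply Nat.mul_le_mono; auto).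
    assert (H * (4 * V) * (R * R) <= H * (44 * s) * ((8 * s) * (8 * s))) by (apply Nat.mul_le_mono; auto).
    assert (H * (44 * s) * ((8 * s) * (8 * s)) = 2816 * (H * (s * s * s))) by lia.
    assert (3000 * H * (s * s * s) = 3000 * (H * (s * s * s))) by lia.
    lia.
  Qed.

  Lemma idx_vs q : In q (fv f) -> idx q vs < g /\ nth (idx q vs) vs 0 = q.
  Proof.
    intros. apply idx_spec. destruct (Nat.eq_dec q 0) as [->|N]; [left; auto|right].
    apply filter_In. split; auto. apply Nat.eqb_neq in N. rewrite N. auto.
  Qed.

  Lemma cl_lt r : r < R -> i r < V /\ j r < V /\ k r < V.
  Proof.
    intros Hr. assert (F : Forall (cstr_lt V) cl).
    { constructor; [change V with (g + S (length (fst p))); cbn [cstr_lt]; lia|].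
      eapply Forall_impl; [|apply comp_idx].
      - intros c Hc. eapply cstr_lt_mono; [exact Hc|]. fold p. change V with (g + S (length (fst p))). lia.
      - intros q Hq. apply idx_vs in Hq. lia.
      - lia. }
    rewrite Forall_forall in F. specialize (F (nth r cl c0) (nth_In _ _ Hr)).
    unfold i, j, k. destruct (nth r cl c0) as [[[? ?] ?] ?]; auto.
  Qed.

  Lemma sl_wd e : (forall i, e i < 2 ^ B) -> Forall (slot_wd B) (sl e).
  Proof.
    intros He. apply Forall_app; split.
    - apply Forall_map, Forall_forall. intros; simpl; auto.
    - constructor; [simpl|apply comp_slot_wd; auto].
      apply Nat.pow_gt_1; lia.
  Qed.

  Lemma sl_wd_nth e q : (forall i, e i < 2 ^ B) -> q < V -> slot_wd B (nth q (sl e) d0).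
  Proof.
    intros He Hq. pose proof (sl_wd e He) as F. rewrite Forall_forall in F.
    apply F, nth_In. rewrite sl_length; auto.
  Qed.

  Lemma sl_nth_vs e q : q < g -> nth q (sl e) d0 = SFix (e (nth q vs 0)).
  Proof.
    intros. unfold sl. rewrite app_nth1 by (rewrite length_map; auto).
    rewrite (nth_indep _ d0 (SFix (e 0))) by (rewrite length_map; auto).
    apply (map_nth (fun i => SFix (e i)) vs 0).
  Qed.

  Lemma sl_nth_rest e e' q : g <= q -> nth q (sl e) d0 = nth q (sl e') d0.
  Proof.
    intros. unfold sl. rewrite !app_nth2; rewrite !length_map; auto.
  Qed.

  Lemma mk_eq e q : q < V -> mk q = mask_of H (nth q (sl e) d0).
  Proof.
    intros. unfold mk. destruct (Nat.lt_ge_cases q g).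
    - rewrite !sl_nth_vs by auto; reflexivity.
    - rewrite (sl_nth_rest e (fun _ => 0)) by auto; auto.
  Qed.

  Lemma prm_sat e : (forall i, e i < 2 ^ B) ->
    (exists x, x < 2 ^ n /\ chk n x (prm e)) <-> sat f e.
  Proof.
    intros He. destruct V_bound as (V1 & _ & R1 & _ & _). unfold prm.
    rewrite (chk_param n H B V R mk (kv e) o i j k); auto; unfold H; try lia.
    2:{ apply w_bound. }
    2:{ apply cl_lt. }
    2:{ intros q Hq. rewrite (mk_eq e) by auto. apply mask_of_lt with B; [unfold H; lia|]. apply sl_wd_nth; auto. }
    2:{ intros q v Hq Hv E. rewrite (mk_eq e) in E by auto.
        apply slot_ok_lt with (nth q (sl e) d0); [apply sl_wd_nth; auto|].
        apply (slot_ok_mask H B); [unfold H; lia|apply sl_wd_nth; auto|]. split; auto. }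
    fold H.
    assert (Sl : forall t, (forall q, q < V -> t q < 2 ^ H /\ Nat.land (t q) (mk q) = kv e q) <->
                  slots_ok t 0 (sl e)).
    { intros t. unfold slots_ok. rewrite sl_length. split.
      - intros A q d Hq. rewrite (nth_indep _ d d0) by (rewrite sl_length; auto).
        apply (slot_ok_mask H B); [unfold H; lia|apply sl_wd_nth; auto|].
        rewrite <- mk_eq by auto. apply A; auto.
      - intros A q Hq. rewrite (mk_eq e) by auto.
        apply (slot_ok_mask H B); [unfold H; lia|apply sl_wd_nth; auto|]. apply (A q d0 Hq). }
    assert (Cl : forall t, (forall r, r < R -> op3_rel (o r) (t (i r)) (t (j r)) (t (k r))) <->
                  Forall (cstr_ok t) cl).
    { intros t. rewrite Forall_forall. split.
      - intros A c Hc. apply (In_nth _ _ c0) in Hc. destruct Hc as (r & Hr & <-).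
        specialize (A r Hr). unfold o, i, j, k in A. destruct (nth r cl c0) as [[[? ?] ?] ?]; auto.
      - intros A r Hr. specialize (A _ (nth_In cl c0 Hr)).
        unfold o, i, j, k. destruct (nth r cl c0) as [[[? ?] ?] ?]; auto. }
    assert (Sp : forall t, slots_ok t 0 (sl e) <->
       (forall q, q < g -> t q = e (nth q vs 0)) /\ t g = 1 /\ slots_ok t (S g) (fst p)).
    { intros t. unfold sl. rewrite slots_ok_app, length_map. fold g.
      rewrite slots_ok_cons. simpl (0 + g). cbn [slot_ok].
      assert (slots_ok t 0 (map (fun i => SFix (e i)) vs) <-> (forall q, q < g -> t q = e (nth q vs 0)));
        [|tauto].
      unfold slots_ok. rewrite length_map. fold g. split.
      - intros A q Hq. specialize (A q (SFix (e 0)) Hq).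
        rewrite (map_nth (fun i => SFix (e i)) vs 0) in A. exact A.
      - intros A q d Hq. rewrite (nth_indep _ d (SFix (e 0))) by (rewrite length_map; auto).
        rewrite (map_nth (fun i => SFix (e i)) vs 0). apply A; auto. }
    split.
    - intros (t & A & C). apply Sl, Sp in A. destruct A as (A1 & A2 & A3).
      apply Cl in C. inversion_clear C.
      eapply sat_fv; [|eapply comp_sound; [exact A3|eassumption|exact A2]].
      intros q Hq. apply idx_vs in Hq. destruct Hq as [Q1 Q2]. rewrite A1, Q2 by auto; auto.
    - intros S.
      pose (t0 := fun q => if q <? g then e (nth q vs 0) else 1).
      assert (T0 : forall q, q < g -> t0 q = e (nth q vs 0)).
      { intros q Hq. unfold t0. apply Nat.ltb_lt in Hq. rewrite Hq; auto. }
      assert (Tg : t0 g = 1) by (unfold t0; rewrite Nat.ltb_irrefl; auto).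
      destruct (gate_cases B f HB Hwd (fun i => idx i vs) g (Datatypes.S g) t0) as (t & E & A & C).
      + intros q Hq. apply idx_vs in Hq. rewrite T0 by tauto. split; auto; lia.
      + lia.
      + right; split; auto. eapply sat_fv; [|exact S].
        intros q Hq. apply idx_vs in Hq. destruct Hq as [Q1 Q2]. rewrite T0, Q2 by auto; auto.
      + exists t. split.
        * apply Sl, Sp. split; [|split; auto].
          -- intros q Hq. rewrite E, T0 by lia; auto.
          -- rewrite E by lia; auto.
        * apply Cl. constructor; auto. simpl. rewrite E, Tg by lia. auto.
  Qed.

  (** The free variables have the first slots of field 0, which is the lowest field. A formula can
      therefore compute the parameter of an instance of another formula by concatenating values and
      adding a constant. *)
  Lemma prm_affine e : prm e = prm (fun _ => 0) + catf H g (fun q => e (nth q vs 0)).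
  Proof.
    unfold prm, param.
    change (catf (n / 16) 12 (par n H V R mk (kv e) o i j k)) with
      (catf H V (kv e) + 2 ^ (n / 16) *
        catf (n / 16) 11 (fun q => par n H V R mk (kv e) o i j k (S q))).
    change (catf (n / 16) 12 (par n H V R mk (kv (fun _ => 0)) o i j k)) with
      (catf H V (kv (fun _ => 0)) + 2 ^ (n / 16) *
        catf (n / 16) 11 (fun q => par n H V R mk (kv e) o i j k (S q))).
    rewrite <- (catf_trunc H g (fun q => e (nth q vs 0)) V) by (unfold V, g; lia).
    set (rest := catf (n / 16) 11 _).
    assert (catf H V (kv e) = catf H V (kv (fun _ => 0)) +
            catf H V (fun q => if q <? g then e (nth q vs 0) else 0)); [|lia].
    rewrite catf_add. apply catf_ext. intros q Hq. unfold kv.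
    destruct (Nat.ltb_spec q g).
    - rewrite !sl_nth_vs by auto. reflexivity.
    - rewrite (sl_nth_rest e (fun _ => 0)) by auto. lia.
  Qed.

  Let parlt e : (forall i, e i < 2 ^ B) -> forall q, q < 12 -> par n H V R mk (kv e) o i j k q < 2 ^ (n / 16).
  Proof.
    intros He. destruct V_bound as (V1 & _ & R1 & _ & _).
    apply (par_lt n H B V R); auto.
    - apply w_bound.
    - apply cl_lt.
    - intros q Hq. rewrite (mk_eq e) by auto. apply mask_of_lt with B; [unfold H; lia|]. apply sl_wd_nth; auto.
  Qed.

  Lemma prm_lt e : (forall i, e i < 2 ^ B) -> prm e < 2 ^ n.
  Proof.
    intros He. apply lt_pow2_mono with (n / 16 * 12).
    - apply catf_lt. apply parlt; auto.
    - pose proof (Nat.div_mod_eq n 16). lia.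
  Qed.

  Lemma prm_io : IO (300 * (s * (m + 1))) (prm (fun _ => 0)).
  Proof.
    destruct V_bound as (V1 & LV & R1 & LR & Lg).
    assert (L1 : (m + 1) * V <= (m + 1) * (11 * s)) by (apply Nat.mul_le_mono_l; auto).
    assert (L2 : 1 <= s) by (pose proof (psize_pos f); lia).
    apply IO_mono with (12 * ((m + 1) * V + R + 1)); [|lia].
    apply IO_catf.
    { apply parlt. auto. }
    apply (par_io n H B V R); auto.
    - apply w_bound.
    - apply cl_lt.
    - intros q Hq. apply mask_of_lt with B; [unfold H; lia|]. apply sl_wd_nth; auto.
    - intros q Hq. unfold kv. destruct (Nat.lt_ge_cases q g).
      + rewrite sl_nth_vs by auto. apply IO_0.
      + unfold sl. rewrite app_nth2 by (rewrite length_map; auto). rewrite length_map. fold g.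
        destruct (q - g) as [|t] eqn:E; cbn [nth].
        * apply IO_mono with 1; [apply (IO_pow2 0)|lia].
        * pose proof (comp_slot_io B f m Hio (fun i => idx i vs) g (S g)) as F.
          rewrite Forall_forall in F. apply IO_mono with m; [|lia]. apply F, nth_In.
          change V with (g + S (length (fst p))) in Hq. fold p. lia.
    - intros q Hq. apply mask_of_io with B; [unfold H; lia|]. apply sl_wd_nth; auto.
  Qed.

  (** The lowest slot belongs to variable 0 and is empty in the constant part. A value of variable 0
      thus forms the low bits of the parameter, which is what the self-reference needs. *)
  Lemma prm_low : (prm (fun _ => 0)) mod 2 ^ H = 0.
  Proof.
    destruct V_bound as (V1 & LV & R1 & LR & Lg).
    assert (Hw : H <= n / 16).
    { apply Nat.le_trans with (H * (4 * V) * R * R); [|apply w_bound].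
      rewrite <- !Nat.mul_assoc. apply Nat.le_mul_r.
      apply Nat.neq_mul_0; split; [lia|]. apply Nat.neq_mul_0; split; [lia|]. apply Nat.neq_mul_0; lia. }
    unfold prm, param. cbn [catf par].
    assert (E : exists V', V = S V') by (exists (V - 1); lia). destruct E as (V' & E). rewrite E at 1.
    cbn [catf].
    replace (kv (fun _ => 0) 0) with 0.
    2:{ unfold kv. rewrite sl_nth_vs; auto. unfold g, vs; simpl; lia. }
    simpl (0 + _). replace (n / 16) with (H + (n / 16 - H)) by lia. rewrite Nat.pow_add_r.
    match goal with |- (_ * ?a + _ * _ * ?b) mod _ = 0 =>
      replace (2 ^ H * a + 2 ^ H * 2 ^ (n / 16 - H) * b) with ((a + 2 ^ (n / 16 - H) * b) * 2 ^ H) by lia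
    end.
    apply Nat.Div0.mod_mul.
  Qed.

  Theorem chk_universal : exists (K : nat) (vs : list nat),
    length vs <= 3 * s + 1 /\ (exists ws, vs = 0 :: ws /\ ~ In 0 ws) /\
    IO (300 * (s * (m + 1))) K /\ K mod 2 ^ (2 * B + 1) = 0 /\
    forall e, (forall i, e i < 2 ^ B) ->
      K + catf (2 * B + 1) (length vs) (fun q => e (nth q vs 0)) < 2 ^ n /\
      ((exists x, x < 2 ^ n /\ chk n x (K + catf (2 * B + 1) (length vs) (fun q => e (nth q vs 0))))
       <-> sat f e).
  Proof.
    exists (prm (fun _ => 0)), vs. destruct V_bound as (V1 & LV & R1 & LR & Lg).
    split; [exact Lg|]. split.
    { eexists. split; [reflexivity|]. rewrite filter_In. intros (_ & N). discriminate N. }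
    split; [apply prm_io|]. split; [apply prm_low|].
    intros e He. fold H g. rewrite <- prm_affine. split; [apply prm_lt|apply prm_sat]; auto.
  Qed.
End Universal.

(** * The binary test *)

Definition icode (i : instr) : nat :=
  match i with
  | Halt => 0 | Add => 1 | Mul => 2 | Const0 => 3 | Const1 => 4 | ConstN => 5 | ConstMax => 6
  | Exp2 => 7 | Div => 8 | Max => 9 | Min => 10 | And => 11 | Or => 12 | Not => 13
  | Load => 14 | Store => 15 | SwapOpd => 16 | SwapAdr => 17 | Jump => 18 | JumpZero => 19
  | Input => 20 | Output => 21
  end.

Lemma decode_icode i : decode (icode i) = Some i.
Proof. destruct i; reflexivity. Qed.

Lemma decode_some w i : decode w = Some i -> w = icode i.
Proof.
  unfold decode. do 22 (destruct w as [|w]; [simpl; intros [= <-]; reflexivity|]).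
  destruct w; discriminate.
Qed.

(** The accesses of the last state are left to the following segment of the run. *)
Definition reach (n c k : nat) (s s' : state) : Prop :=
  run n k s = Some s' /\
  forall t s'', t < k -> run n t s = Some s'' -> Forall (fun i => i < c) (accessed s'').

Lemma run_app n k1 k2 s : run n (k1 + k2) s =
  match run n k1 s with Some s' => run n k2 s' | None => None end.
Proof. revert s; induction k1; intros s; simpl; auto. destruct (step n s); auto. Qed.

Lemma reach_0 n c s : reach n c 0 s s.
Proof. split; [reflexivity|intros; lia]. Qed.

Lemma reach_trans n c k1 k2 s1 s2 s3 :
  reach n c k1 s1 s2 -> reach n c k2 s2 s3 -> reach n c (k1 + k2) s1 s3.
Proof.
  intros (R1 & A1) (R2 & A2). split; [rewrite run_app, R1; auto|].
  intros t s Ht Hs. destruct (Nat.lt_ge_cases t k1); [eauto|].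
  replace t with (k1 + (t - k1)) in Hs by lia. rewrite run_app, R1 in Hs.
  apply (A2 (t - k1)); auto; lia.
Qed.

Lemma reach_step n c k s s1 s2 : step n s = Some s1 -> Forall (fun i => i < c) (accessed s) ->
  reach n c k s1 s2 -> reach n c (S k) s s2.
Proof.
  intros E A R. apply (reach_trans n c 1 k s s1 s2); auto. split.
  - simpl. rewrite E; auto.
  - intros t s'' Ht Hs. replace t with 0 in Hs by lia. simpl in Hs. congruence.
Qed.

Definition sst : Type := (nat -> nat) * nat * nat * nat * list nat * list nat.

(* One instruction of straight-line code whose data lie in the first 64 cells. *)
Definition sl1 (n : nat) (i : instr) (s : sst) : option sst :=
  let '(m, a, b, d, xs, ys) := s in
  match i with
  | Halt | Jump | JumpZero => None
  | Load => if d <? 64 then Some (m, m d, b, d, xs, ys) else None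
  | Store => if d <? 64 then Some (update m d a, a, b, d, xs, ys) else None
  | SwapOpd => Some (m, b, a, d, xs, ys)
  | SwapAdr => Some (m, d, b, a, xs, ys)
  | Input => match xs with x :: xs' => Some (m, x, b, d, xs', ys) | [] => None end
  | Output => Some (m, a, b, d, xs, a :: ys)
  | i => match arith n i a b with Some v => Some (m, v, b, d, xs, ys) | None => None end
  end.

Fixpoint slx (n : nat) (l : list instr) (s : sst) : option sst :=
  match l with
  | [] => Some s
  | i :: l => match sl1 n i s with Some s' => slx n l s' | None => None end
  end.

Lemma slx_app n l l' s : slx n (l ++ l') s = match slx n l s with Some s' => slx n l' s' | None => None end.
Proof. revert s; induction l; intros s; simpl; auto. destruct (sl1 n a s); auto. Qed.

Definition st_of (p : nat) (s : sst) : state :=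
  let '(m, a, b, d, xs, ys) := s in State m p a b d xs ys.

Definition mem_of (s : sst) : nat -> nat := let '(m, a, b, d, xs, ys) := s in m.

Lemma update_neq m a v q : q <> a -> update m a v q = m q.
Proof. unfold update. intros H. apply Nat.eqb_neq in H. rewrite H; auto. Qed.

Lemma update_eq m a v : update m a v a = v.
Proof. unfold update. rewrite Nat.eqb_refl; auto. Qed.

Lemma sl1_step n c i s s' p : sl1 n i s = Some s' -> mem_of s p = icode i -> p + 1 < 2 ^ n ->
  step n (st_of p s) = Some (st_of (p + 1) s') /\
  (p < c -> 64 <= c -> Forall (fun i => i < c) (accessed (st_of p s))).
Proof.
  destruct s as [[[[[m a] b] d] xs] ys]. intros E Hm Hp. simpl in Hm.
  assert (F : fetch (st_of p (m, a, b, d, xs, ys)) = Some i).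
  { unfold fetch. simpl. rewrite Hm. apply decode_icode. }
  unfold accessed. rewrite F. split.
  - unfold step. simpl in F |- *. rewrite F. rewrite (Nat.mod_small (p + 1)) by auto.
    destruct i; simpl in E; try discriminate; try (injection E as <-; reflexivity).
    + destruct (d <? 64); try discriminate. injection E as <-; reflexivity.
    + destruct (d <? 64); try discriminate. injection E as <-; reflexivity.
    + destruct xs; try discriminate. injection E as <-; reflexivity.
  - intros Hc H64. constructor; auto. destruct i; try constructor; simpl in E |- *; try constructor;
    destruct (Nat.ltb_spec d 64); try discriminate; lia.
Qed.

Lemma sl1_mem n i s s' q : sl1 n i s = Some s' -> 64 <= q \/ i <> Store -> mem_of s' q = mem_of s q.
Proof.
  destruct s as [[[[[m a] b] d] xs] ys]. intros E Hq.
  destruct i; simpl in E; try discriminate; try (injection E as <-; reflexivity).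
  - destruct (d <? 64); try discriminate. injection E as <-; reflexivity.
  - destruct Hq as [Hq|Hq]; [|congruence].
    destruct (Nat.ltb_spec d 64); try discriminate. injection E as <-. simpl.
    apply update_neq; lia.
  - destruct xs; try discriminate. injection E as <-; reflexivity.
Qed.

Lemma slx_mem n l : forall s s' q, slx n l s = Some s' -> 64 <= q \/ ~ In Store l -> mem_of s' q = mem_of s q.
Proof.
  induction l as [|i l IH]; intros s s' q E H; simpl in *; [congruence|].
  destruct (sl1 n i s) as [s1|] eqn:E1; [|discriminate].
  rewrite (IH s1 s' q E) by tauto. eapply sl1_mem; eauto.
  destruct H as [H|H]; [left; exact H|right; intros ->; tauto].
Qed.

Definition code_at (m : nat -> nat) (p : nat) (l : list instr) : Prop :=
  forall q, q < length l -> m (p + q) = icode (nth q l Halt).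

(** Stores go to cells below 64, so code is not overwritten if it lies above them or contains no
    [Store]. *)
Lemma slx_reach n c l : forall s s' p, slx n l s = Some s' -> code_at (mem_of s) p l ->
  64 <= p \/ ~ In Store l -> p + length l <= c -> 64 <= c -> p + length l < 2 ^ n ->
  reach n c (length l) (st_of p s) (st_of (p + length l) s').
Proof.
  induction l as [|i l IH]; intros s s' p E C HS Hc H64 Hn; simpl length in Hn.
  - simpl in *. injection E as <-. rewrite Nat.add_0_r. apply reach_0.
  - simpl in E, Hc, HS. destruct (sl1 n i s) as [s1|] eqn:E1; [|discriminate].
    assert (C0 := C 0 ltac:(simpl; lia)). rewrite Nat.add_0_r in C0. simpl in C0.
    destruct (sl1_step n c i s s1 p E1 C0) as [S1 S2]; [lia|].
    simpl length in *. eapply reach_step; [exact S1|apply S2; lia|].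
    replace (p + S (length l)) with (p + 1 + length l) by lia.
    apply IH; auto; try lia.
    + intros q Hq. rewrite (sl1_mem n i s s1) ; [|exact E1|].
      * replace (p + 1 + q) with (p + S q) by lia. apply (C (S q)). simpl; lia.
      * destruct HS as [HS|HS]; [left; lia|right]. intros ->. tauto.
    + destruct HS as [HS|HS]; [left; lia|right; tauto].
Qed.

Lemma exp2_small n x : 10 < n -> x <= 4 -> Nat.min (2 ^ x) (2 ^ n - 1) = 2 ^ x.
Proof.
  intros. apply Nat.min_l. assert (2 ^ x <= 2 ^ 4) by (apply pow2_le; lia).
  assert (2 ^ 11 <= 2 ^ n) by (apply pow2_le; lia). simpl (2 ^ 4) in *. simpl (2 ^ 11) in *. lia.
Qed.

(** Instructions carry no operands, so a constant is counted up from 0, with the increment 1 in the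
    second operand. *)
Definition num (k : nat) : list instr := [Const1; SwapOpd; Const0] ++ repeat Add k.
Definition setadr (k : nat) : list instr := num k ++ [SwapAdr].

Lemma slx_adds n k : forall m a d xs ys, a + k < 2 ^ n ->
  slx n (repeat Add k) (m, a, 1, d, xs, ys) = Some (m, a + k, 1, d, xs, ys).
Proof.
  induction k; intros m a d xs ys H; simpl.
  - rewrite Nat.add_0_r; auto.
  - rewrite Nat.mod_small by lia. rewrite IHk by lia.
    replace (a + S k) with (a + 1 + k) by lia; auto.
Qed.

Lemma slx_num n k m a b d xs ys : k < 2 ^ n ->
  slx n (num k) (m, a, b, d, xs, ys) = Some (m, k, 1, d, xs, ys).
Proof. intros. unfold num. rewrite slx_app. simpl. rewrite slx_adds; auto. Qed.

Lemma slx_setadr n k m a b d xs ys : k < 2 ^ n ->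
  slx n (setadr k) (m, a, b, d, xs, ys) = Some (m, d, 1, k, xs, ys).
Proof. intros. unfold setadr. rewrite slx_app, slx_num by auto. reflexivity. Qed.

(* [(op, i, j, l)] stores [op] of the cells [i] and [j] in the cell [l]; cell 2 is scratch,
   its address being obtainable without touching the second operand. *)
Definition tac : Type := instr * nat * nat * nat.

Definition val (n : nat) (op : instr) (x y : nat) : nat :=
  match arith n op x y with Some v => v | None => 0 end.

Definition tac_code (t : tac) : list instr :=
  let '(op, i, j, l) := t in
  setadr j ++ [Load; SwapOpd; Const1; Exp2; SwapAdr; SwapOpd; Store] ++
  setadr i ++ [Load; SwapOpd; Const1; Exp2; SwapAdr; Load; SwapOpd] ++ [op; Store] ++
  num l ++ [SwapOpd; Load; SwapOpd; SwapAdr; SwapOpd; Store].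

Definition tac_mem (n : nat) (t : tac) (m : nat -> nat) : nat -> nat :=
  let '(op, i, j, l) := t in
  let m1 := update m 2 (m j) in
  let v := val n op (m1 i) (m j) in
  update (update m1 2 v) l v.

Definition tac_ok (t : tac) : bool :=
  let '(op, i, j, l) := t in
  (2 <? i) && (2 <? j) && (2 <? l) && (i <? 64) && (j <? 64) && (l <? 64) &&
  match arith 11 op 0 0 with Some _ => true | None => false end.

Lemma slx_tac n t m a b d xs ys : 10 < n -> tac_ok t = true -> exists a' b' d',
  slx n (tac_code t) (m, a, b, d, xs, ys) = Some (tac_mem n t m, a', b', d', xs, ys).
Proof.
  destruct t as [[[op i] j] l]. intros Hn Ht. unfold tac_ok in Ht.
  rewrite !andb_true_iff in Ht. destruct Ht as [[[[[[Ht1 Ht2] Ht3] Ht4] Ht5] Ht6] Ht7].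
  assert (Hj := Ht5); assert (Hi := Ht4); assert (Hl := Ht6).
  apply Nat.ltb_lt in Hj, Hi, Hl.
  assert (H64 : 64 < 2 ^ n).
  { assert (2 ^ 11 <= 2 ^ n) by (apply pow2_le; lia). simpl (2 ^ 11) in *. lia. }
  do 3 eexists. unfold tac_code, tac_mem.
  rewrite slx_app, slx_setadr by lia. rewrite slx_app.
  cbn [slx sl1 arith]. rewrite Ht5. cbn [slx sl1 arith].
  rewrite (exp2_small n 1) by lia. change (2 ^ 1) with 2.
  change (2 <? 64) with true. cbn [slx sl1 arith].
  rewrite slx_app, slx_setadr by lia. rewrite slx_app.
  cbn [slx sl1 arith]. rewrite Ht4. cbn [slx sl1 arith].
  rewrite (exp2_small n 1) by lia. change (2 ^ 1) with 2.
  change (2 <? 64) with true. cbn [slx sl1 arith]. rewrite (update_eq m 2). rewrite slx_app.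
  set (m1 := update m 2 (m j)).
  assert (Eop : sl1 n op (m1, m1 i, m j, 2, xs, ys) = Some (m1, val n op (m1 i) (m j), m j, 2, xs, ys)).
  { unfold val. destruct op; try discriminate Ht7; reflexivity. }
  cbn [slx]. rewrite Eop. cbn [sl1]. change (2 <? 64) with true. cbn match.
  rewrite slx_app, slx_num by lia. cbn [slx sl1]. change (2 <? 64) with true. cbn [slx sl1].
  rewrite Ht6. rewrite update_eq. reflexivity.
Qed.

Definition tacs_code (l : list tac) : list instr := flat_map tac_code l.
Definition tacs_mem (n : nat) (l : list tac) (m : nat -> nat) : nat -> nat :=
  fold_left (fun m t => tac_mem n t m) l m.

Lemma slx_tacs n l : 10 < n -> forallb tac_ok l = true -> forall m a b d xs ys, exists a' b' d',
  slx n (tacs_code l) (m, a, b, d, xs, ys) = Some (tacs_mem n l m, a', b', d', xs, ys).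
Proof.
  intros Hn. induction l as [|t l IH]; intros Hl m a b d xs ys; simpl in *.
  - eauto.
  - apply andb_true_iff in Hl. destruct Hl as [H1 H2].
    destruct (slx_tac n t m a b d xs ys Hn H1) as (a1 & b1 & d1 & E1).
    destruct (IH H2 (tac_mem n t m) a1 b1 d1 xs ys) as (a2 & b2 & d2 & E2).
    exists a2, b2, d2. rewrite slx_app, E1. exact E2.
Qed.

(** The effect on the cells above the scratch cell 2, with all other cells read as registers. *)
Definition tac_st (n : nat) (g : nat -> nat) (t : tac) : nat -> nat :=
  let '(op, i, j, l) := t in fun q => if q =? l then val n op (g i) (g j) else g q.

Lemma tac_mem_st n t m g : tac_ok t = true -> (forall q, 2 < q -> m q = g q) ->
  forall q, 2 < q -> tac_mem n t m q = tac_st n g t q.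
Proof.
  destruct t as [[[op i] j] l]. intros Ht E q Hq. unfold tac_ok in Ht.
  rewrite !andb_true_iff in Ht. destruct Ht as [[[[[[Ht1 Ht2] Ht3] _] _] _] _].
  apply Nat.ltb_lt in Ht1, Ht2, Ht3. simpl.
  rewrite (update_neq m 2 _ i), !E by lia.
  unfold update. destruct (Nat.eqb_spec q l); auto.
  destruct (Nat.eqb_spec q 2); [lia|]. auto.
Qed.

Lemma tacs_mem_st n l : forallb tac_ok l = true -> forall m g, (forall q, 2 < q -> m q = g q) ->
  forall q, 2 < q -> tacs_mem n l m q = fold_left (tac_st n) l g q.
Proof.
  induction l as [|t l IH]; intros Hl m g E q Hq; simpl in *; auto.
  apply andb_true_iff in Hl. destruct Hl. apply IH; auto.
  intros; apply tac_mem_st; auto.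
Qed.

(** Cell 3 holds [x] and cell 4 holds [a]. Cell 5 becomes [2 ^ n - 1], cell 6 becomes 1, cell 7
    becomes 16 through 2 and 4, cell 8 becomes [2 ^ (n / 16)], and adding [2 ^ n - 1] modulo [2 ^ n]
    yields its predecessor, the mask of a field, in cell 9. The fields of [a] will occupy cells 10
    to 21. *)
Definition ph_const : list tac :=
  [(ConstMax, 5, 5, 5); (Const1, 6, 6, 6); (Exp2, 6, 6, 7); (Exp2, 7, 7, 7); (Exp2, 7, 7, 7);
   (ConstN, 8, 8, 8); (Div, 8, 7, 8); (Exp2, 8, 8, 8); (Add, 8, 5, 9)].

Definition ph_field (q : nat) : list tac := [(And, 4, 9, 10 + q); (Div, 4, 8, 4)].

Definition ph_fields : list tac := flat_map ph_field (seq 0 12).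

(* Accumulates in cell 22 whether the cells [i] and [j] differ. *)
Definition ph_eq (i j : nat) : list tac :=
  [(Not, j, j, 23); (Add, i, 23, 23); (Add, 23, 6, 23); (Or, 22, 23, 22)].

(** Cell 22 starts as the quotient of [x] by [2 ^ (n / 16)], zero iff [x] fits into a field, and
    collects the differences of all compared pairs. The final minimum with 1 turns it into the
    output. *)
Definition ph_check : list tac :=
  [(Div, 3, 8, 22); (And, 3, 11, 24)] ++ ph_eq 24 10 ++
  [(Mul, 3, 12, 24); (And, 24, 17, 24); (Mul, 3, 13, 25); (And, 25, 17, 25);
   (Mul, 3, 14, 26); (And, 26, 17, 26);
   (Add, 24, 25, 27); (And, 27, 19, 27); (And, 26, 19, 28)] ++ ph_eq 27 28 ++
  [(And, 24, 25, 27); (And, 27, 20, 27); (And, 26, 20, 28)] ++ ph_eq 27 28 ++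
  [(Mul, 3, 15, 27); (And, 27, 18, 27); (Mul, 24, 27, 27); (And, 27, 21, 27);
   (Mul, 3, 16, 28); (And, 28, 21, 28)] ++ ph_eq 27 28 ++
  [(Min, 22, 6, 22)].

Definition test_tacs : list tac := ph_const ++ ph_fields ++ ph_check.

(* Cells 0-15.  The quotient [16 / n] is zero iff [16 < n]; then control passes to cell 16,
   and otherwise the output is 1. *)
Definition prologue : list instr :=
  [Const1; Exp2; Exp2; Exp2; SwapAdr; ConstN; SwapOpd; Const1; Exp2; Exp2; Exp2; Div;
   JumpZero; Output; Halt; Halt].

(** The inputs go to cells 3 and 4, over the prologue, which has been executed by then. *)
Definition body : list instr :=
  (setadr 3 ++ [Input; Store]) ++ (setadr 4 ++ [Input; Store]) ++
  tacs_code test_tacs ++ (setadr 22 ++ [Load; Output]).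

(* The constants in cells 16-63 only make room for the data. *)
Definition test_instrs : list instr := prologue ++ repeat Const0 48 ++ body ++ [Halt].
Definition test_prog : list nat := map icode test_instrs.
Definition test_size : nat := length test_prog.

(** The program fits into the memory when [n > 16]. For smaller [n] only cells of the prologue are
    executed. *)
Lemma test_size_bounds : 64 <= test_size /\ test_size <= 2 ^ 16.
Proof.
  assert (E : (Nat.leb 64 test_size && Nat.leb test_size (Nat.pow 2 16))%bool = true)
    by (vm_compute; reflexivity).
  apply andb_true_iff in E. rewrite !Nat.leb_le in E. exact E.
Qed.

Lemma test_code_at pre l post xs : test_instrs = pre ++ l ++ post ->
  code_at (mem (init test_prog xs)) (length pre) l.
Proof.
  intros E q Hq.
  change (nth (length pre + q) (map icode test_instrs) (icode Halt) = icode (nth q l Halt)).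
  rewrite map_nth, E, app_nth2_plus, app_nth1 by auto. reflexivity.
Qed.

Lemma prologue_run n x a : 10 < n ->
  reach n test_size 12 (init test_prog [x; a])
    (State (mem (init test_prog [x; a])) 12 (16 / n) n 16 [x; a] []).
Proof.
  intros Hn. destruct test_size_bounds as [B1 B2].
  assert (2 ^ 11 <= 2 ^ n) by (apply pow2_le; lia). simpl (2 ^ 11) in *.
  apply (slx_reach n test_size (firstn 12 prologue)
     (mem (init test_prog [x; a]), 0, 0, 0, [x; a], []) 
     (mem (init test_prog [x; a]), 16 / n, n, 16, [x; a], []) 0); simpl length; try lia.
  - cbn [firstn prologue slx sl1 arith]. rewrite !(exp2_small n 1) by lia. change (2 ^ 1) with 2.
    rewrite !(exp2_small n 2) by lia. change (2 ^ 2) with 4.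
    rewrite !(exp2_small n 4) by lia. change (2 ^ 4) with 16. reflexivity.
  - apply (test_code_at [] (firstn 12 prologue) (skipn 12 prologue ++ repeat Const0 48 ++ body ++ [Halt])).
    rewrite app_nil_l, app_assoc, firstn_skipn. reflexivity.
  - right. simpl. intuition discriminate.
Qed.

Lemma fetch_init q xs i : q < test_size -> nth q test_instrs Halt = i ->
  forall p a b d ys, p = q -> fetch (State (mem (init test_prog xs)) p a b d xs ys) = Some i.
Proof.
  intros Hq E p a b d ys ->. unfold fetch.
  change (decode (nth q (map icode test_instrs) (icode Halt)) = Some i). rewrite map_nth, E. apply decode_icode.
Qed.

Definition loaded (x a : nat) : nat -> nat :=
  update (update (mem (init test_prog [x; a])) 3 x) 4 a.

Lemma body_run n x a : 10 < n -> exists s,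
  slx n body (mem (init test_prog [x; a]), 0, 0, 16, [x; a], []) = Some s /\
  out (st_of 0 s) = [fold_left (tac_st n) test_tacs (loaded x a) 22].
Proof.
  intros Hn.
  assert (H64 : 64 < 2 ^ n).
  { assert (2 ^ 11 <= 2 ^ n) by (apply pow2_le; lia). simpl (2 ^ 11) in *. lia. }
  unfold body. rewrite slx_app, slx_app, slx_setadr by lia.
  cbn [slx sl1]. change (3 <? 64) with true. cbn match.
  rewrite slx_app, slx_app, slx_setadr by lia.
  cbn [slx sl1]. change (4 <? 64) with true. cbn match.
  fold (loaded x a). rewrite slx_app.
  assert (Ok : forallb tac_ok test_tacs = true) by (vm_compute; reflexivity).
  destruct (slx_tacs n test_tacs Hn Ok (loaded x a) a 1 4 [] []) as (a' & b' & d' & E).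
  rewrite E. rewrite slx_app, slx_setadr by lia.
  cbn [slx sl1]. change (22 <? 64) with true. cbn match.
  eexists; split; [reflexivity|]. cbn [st_of out].
  rewrite (tacs_mem_st n test_tacs Ok (loaded x a) (loaded x a)) by (intros; try lia; reflexivity). reflexivity.
Qed.

Lemma test_run n x a : 16 < n -> exists k s,
  k < test_size /\ reach n test_size k (init test_prog [x; a]) s /\ fetch s = Some Halt /\
  pc s < test_size /\ out s = [fold_left (tac_st n) test_tacs (loaded x a) 22].
Proof.
  intros Hn. destruct test_size_bounds as [B1 B2].
  assert (HN : test_size < 2 ^ n).
  { assert (2 ^ 17 <= 2 ^ n) by (apply pow2_le; lia).
    assert (2 ^ 16 < 2 ^ 17) by (apply pow2_lt; lia). lia. }
  assert (Hlen : test_size = 64 + length body + 1).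
  { unfold test_size, test_prog. rewrite length_map. unfold test_instrs.
    rewrite !length_app, repeat_length. cbn [length prologue]. lia. }
  set (m0 := mem (init test_prog [x; a])).
  assert (J : reach n test_size 1 (State m0 12 (16 / n) n 16 [x; a] []) (State m0 16 0 n 16 [x; a] [])).
  { assert (E0 : 16 / n = 0) by (apply Nat.div_small; lia). rewrite E0.
    assert (F : fetch (State m0 12 0 n 16 [x; a] []) = Some JumpZero)
      by (apply (fetch_init 12); [lia|reflexivity|reflexivity]).
    eapply reach_step; [| |apply reach_0].
    - unfold step. rewrite F. reflexivity.
    - unfold accessed. rewrite F. constructor; [simpl; lia|constructor]. }
  assert (Sl : slx n (repeat Const0 48) (m0, 0, n, 16, [x; a], []) = Some (m0, 0, n, 16, [x; a], []))
    by reflexivity.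
  assert (S1 : reach n test_size 48 (State m0 16 0 n 16 [x; a] []) (State m0 64 0 n 16 [x; a] [])).
  { apply (slx_reach n test_size (repeat Const0 48) _ _ 16 Sl); rewrite ?repeat_length; try lia.
    - apply (test_code_at prologue (repeat Const0 48) (body ++ [Halt])). reflexivity.
    - right. intros I. apply repeat_spec in I. discriminate. }
  assert (Bd : exists s, slx n body (m0, 0, n, 16, [x; a], []) = Some s /\
     out (st_of 0 s) = [fold_left (tac_st n) test_tacs (loaded x a) 22]).
  { destruct (body_run n x a ltac:(lia)) as (s & E & O). exists s; split; auto. }
  destruct Bd as (s & E & O).
  assert (S2 : reach n test_size (length body) (State m0 64 0 n 16 [x; a] []) (st_of (64 + length body) s)).
  { apply (slx_reach n test_size body _ _ 64 E); try lia.
    change 64 with (length (prologue ++ repeat Const0 48)).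
    apply (test_code_at _ body [Halt]). unfold test_instrs. rewrite <- app_assoc. reflexivity. }
  exists (12 + (1 + (48 + length body))), (st_of (64 + length body) s).
  split; [lia|]. split.
  - eapply reach_trans; [apply prologue_run; lia|]. eapply reach_trans; [exact J|].
    eapply reach_trans; [exact S1|exact S2].
  - assert (Hp : pc (st_of (64 + length body) s) = 64 + length body)
      by (destruct s as [[[[[? ?] ?] ?] ?] ?]; reflexivity).
    split; [|split; [rewrite Hp; lia|]].
    + unfold fetch. rewrite Hp.
      replace (mem (st_of (64 + length body) s)) with (mem_of s)
        by (destruct s as [[[[[? ?] ?] ?] ?] ?]; reflexivity).
      rewrite (slx_mem n body _ s (64 + length body) E) by (left; lia).
      pose proof (test_code_at (prologue ++ repeat Const0 48 ++ body) [Halt] [] [x; a]) as C.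
      assert (L : length (prologue ++ repeat Const0 48 ++ body) = 64 + length body)
        by (rewrite !length_app, repeat_length; reflexivity).
      rewrite L in C.
      specialize (C ltac:(unfold test_instrs; rewrite <- !app_assoc; reflexivity) 0 ltac:(simpl; lia)).
      rewrite Nat.add_0_r in C. unfold mem_of. fold m0 in C. rewrite C. reflexivity.
    + destruct s as [[[[[? ?] ?] ?] ?] ?]; exact O.
Qed.

Lemma test_run_small n x a : 10 < n -> n <= 16 -> exists k s,
  k < test_size /\ reach n test_size k (init test_prog [x; a]) s /\ fetch s = Some Halt /\
  pc s < test_size /\ out s = [1].
Proof.
  intros Hn Hn'. destruct test_size_bounds as [B1 B2].
  assert (2 ^ 11 <= 2 ^ n) by (apply pow2_le; lia). simpl (2 ^ 11) in *.
  set (m0 := mem (init test_prog [x; a])).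
  assert (E1 : 16 / n = 1).
  { do 17 (destruct n as [|n]; [try lia; try reflexivity|]). lia. }
  pose proof (prologue_run n x a Hn) as P0. fold m0 in P0. rewrite E1 in P0.
  assert (F1 : fetch (State m0 12 1 n 16 [x; a] []) = Some JumpZero)
    by (apply (fetch_init 12); [lia|reflexivity|reflexivity]).
  assert (F2 : fetch (State m0 13 1 n 16 [x; a] []) = Some Output)
    by (apply (fetch_init 13); [lia|reflexivity|reflexivity]).
  assert (F3 : fetch (State m0 14 1 n 16 [x; a] [1]) = Some Halt)
    by (apply (fetch_init 14); [lia|reflexivity|reflexivity]).
  exists (12 + 2), (State m0 14 1 n 16 [x; a] [1]). split; [lia|]. split.
  - eapply reach_trans; [exact P0|].
    apply reach_step with (State m0 13 1 n 16 [x; a] []).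
    + unfold step. rewrite F1. rewrite Nat.mod_small by lia. reflexivity.
    + unfold accessed. rewrite F1. constructor; [cbn [pc]; lia|constructor].
    + apply reach_step with (State m0 14 1 n 16 [x; a] [1]); [| |apply reach_0].
      * unfold step. rewrite F2. rewrite Nat.mod_small by lia. reflexivity.
      * unfold accessed. rewrite F2. constructor; [cbn [pc]; lia|constructor].
  - split; [exact F3|]. split; [cbn [pc]; lia|reflexivity].
Qed.

(** * What the binary test computes *)

(** In two's complement the left side is [u - v]. *)
Lemma eq_code n u v : u < 2 ^ n -> v < 2 ^ n ->
  ((u + Nat.lnot v n) mod 2 ^ n + 1) mod 2 ^ n = 0 <-> u = v.
Proof.
  intros Hu Hv.
  assert (E : Nat.lnot v n = 2 ^ n - 1 - v).
  { destruct (Nat.eq_dec v 0) as [->|Z].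
    - rewrite Nat.lnot_0_l, Nat.ones_equiv. lia.
    - rewrite Nat.lnot_sub_low, Nat.ones_equiv by (apply Nat.log2_lt_pow2; lia). lia. }
  rewrite E, Nat.Div0.add_mod_idemp_l.
  replace (u + (2 ^ n - 1 - v) + 1) with (u + (2 ^ n - v)) by lia.
  split; [|intros ->].
  - intros M. destruct (Nat.lt_ge_cases u v).
    + rewrite Nat.mod_small in M by lia. lia.
    + replace (u + (2 ^ n - v)) with ((u - v) + 1 * 2 ^ n) in M by lia.
      rewrite Nat.Div0.mod_add, Nat.mod_small in M by lia. lia.
  - replace (v + (2 ^ n - v)) with (1 * 2 ^ n) by lia. apply Nat.Div0.mod_mul.
Qed.

Lemma ph_const_spec n g : 16 < n ->
  let g' := fold_left (tac_st n) ph_const g in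
  g' 3 = g 3 /\ g' 4 = g 4 /\ g' 6 = 1 /\ g' 8 = 2 ^ (n / 16) /\ g' 9 = 2 ^ (n / 16) - 1.
Proof.
  intros Hn. unfold ph_const. cbv [fold_left tac_st Nat.eqb val arith]. 
  assert (W : Nat.min (2 ^ (n / 16)) (2 ^ n - 1) = 2 ^ (n / 16)).
  { apply Nat.min_l. assert (2 ^ (n / 16) < 2 ^ n); [|lia].
    apply pow2_lt, Nat.div_lt; lia. }
  rewrite !(exp2_small n 1) by lia. change (2 ^ 1) with 2.
  rewrite !(exp2_small n 2) by lia. change (2 ^ 2) with 4.
  rewrite !(exp2_small n 4) by lia. change (2 ^ 4) with 16. rewrite W.
  repeat split. pose proof (pow2_pos n). pose proof (pow2_pos (n / 16)).
  replace (2 ^ (n / 16) + (2 ^ n - 1)) with (2 ^ (n / 16) - 1 + 1 * 2 ^ n) by lia.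
  rewrite Nat.Div0.mod_add, Nat.mod_small; [reflexivity|].
  apply Nat.lt_le_trans with (2 ^ (n / 16)); [lia|]. apply pow2_le, Nat.Div0.div_le_upper_bound. lia.
Qed.

Lemma ph_fields_spec n k : forall s g,
  let g' := fold_left (tac_st n) (flat_map ph_field (seq s k)) g in
  (forall q, q < 10 -> q <> 4 -> g' q = g q) /\
  (forall q, q < s -> g' (10 + q) = g (10 + q)) /\
  (forall q, q < k -> g' (10 + (s + q)) = Nat.land (g 4 / g 8 ^ q) (g 9)).
Proof.
  induction k; intros s g; cbn [seq flat_map].
  - cbn [fold_left]. repeat split; auto; intros; lia.
  - rewrite fold_left_app. set (g1 := fold_left (tac_st n) (ph_field s) g).
    assert (A4 : g1 4 = g 4 / g 8) by reflexivity.
    assert (A8 : g1 8 = g 8) by reflexivity.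
    assert (A9 : g1 9 = g 9) by reflexivity.
    assert (As : g1 (10 + s) = Nat.land (g 4) (g 9)).
    { unfold g1, ph_field. cbn [fold_left tac_st]. unfold val; cbn [arith].
      destruct (Nat.eqb_spec (10 + s) 4); [lia|]. rewrite Nat.eqb_refl; auto. }
    assert (Ao : forall q, q <> 4 -> q <> 10 + s -> g1 q = g q).
    { intros q Q1 Q2. unfold g1, ph_field. cbn [fold_left tac_st].
      apply Nat.eqb_neq in Q1, Q2. rewrite Q1, Q2; auto. }
    destruct (IHk (S s) g1) as (I1 & I2 & I3). repeat split.
    + intros q Hq H4. rewrite I1 by auto. apply Ao; lia.
    + intros q Hq. rewrite I2 by lia. apply Ao; lia.
    + intros [|q] Hq.
      * rewrite Nat.add_0_r, I2, As, Nat.pow_0_r, Nat.div_1_r by lia; auto.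
      * replace (s + S q) with (S s + q) by lia. rewrite I3 by lia.
        rewrite A4, A8, A9, Nat.Div0.div_div, Nat.pow_succ_r'. auto.
Qed.

Lemma land_lt_r n a b : b < 2 ^ n -> Nat.land a b < 2 ^ n.
Proof. intros. eapply Nat.le_lt_trans; [apply Nat.land_le_r|auto]. Qed.

(** Once [x] fits into a field, every factor and summand is below [2 ^ (n / 16)], so no operation
    wraps around and the machine evaluates [chk] exactly. *)
Lemma ph_check_spec n x a (g : nat -> nat) : 16 < n -> x < 2 ^ n ->
  g 3 = x -> g 6 = 1 -> g 8 = 2 ^ (n / 16) ->
  (forall q, q < 12 -> g (10 + q) = fld n a q) ->
  let r := fold_left (tac_st n) ph_check g 22 in
  (r = 0 \/ r = 1) /\ (r = 0 <-> chk n x a).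
Proof.
  intros Hn Hx E3 E6 E8 EF r.
  assert (F := EF 0); assert (F1 := EF 1); assert (F2 := EF 2); assert (F3 := EF 3);
  assert (F4 := EF 4); assert (F5 := EF 5); assert (F6 := EF 6); assert (F7 := EF 7);
  assert (F8 := EF 8); assert (F9 := EF 9); assert (F10 := EF 10); assert (F11 := EF 11).
  clear EF. simpl Nat.add in *. 
  assert (Fl : forall q, fld n a q < 2 ^ (n / 16)) by (intros; apply Nat.mod_upper_bound; auto).
  set (w := n / 16) in *.
  assert (Hw : w * 16 <= n) by (unfold w; pose proof (Nat.div_mod_eq n 16); lia).
  assert (Fl' : forall q, fld n a q < 2 ^ n) by (intros; eapply lt_pow2_mono; [apply Fl|lia]).
  unfold r, ph_check, ph_eq. cbn [app]. cbv [fold_left tac_st Nat.eqb val arith]. clear r.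
  rewrite F, F1, F2, F3, F4, F5, F6, F7, F8, F9, F10, F11, E3, E6, E8 by lia.
  match goal with |- context [Nat.min ?z 1] => set (t := z) end.
  split; [lia|].
  transitivity (t = 0); [lia|]. unfold t; clear t.
  rewrite !Nat.lor_eq_0_iff.
  rewrite !eq_code by auto using land_lt_r.
  rewrite (Nat.div_small_iff x) by auto.
  unfold chk. fold w.
  destruct (Nat.lt_ge_cases x (2 ^ w)) as [Lx|Lx]; [|split; intros; lia].
  assert (M : forall u v, u < 2 ^ w -> v < 2 ^ w -> (u * v) mod 2 ^ n = u * v).
  { intros u v Hu Hv. apply Nat.mod_small. eapply lt_pow2_mono; [apply mul_lt_pow2; eauto|lia]. }
  rewrite !(M x) by auto.
  rewrite (M (Nat.land _ _) (Nat.land _ _)) by (apply land_lt_r; auto).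
  assert (A2 : forall u v, u < 2 ^ w -> v < 2 ^ w -> (u + v) mod 2 ^ n = u + v).
  { intros u v Hu Hv. apply Nat.mod_small.
    assert (2 ^ w + 2 ^ w <= 2 ^ n); [|lia].
    replace (2 ^ w + 2 ^ w) with (2 ^ S w) by (simpl; lia). apply pow2_le. unfold w in *.
    pose proof (Nat.div_le_lower_bound n 16 1). lia. }
  rewrite (A2 (Nat.land _ _) (Nat.land _ _)) by (apply land_lt_r; auto).
  tauto.
Qed.

Lemma test_value n x a : 16 < n -> x < 2 ^ n ->
  let r := fold_left (tac_st n) test_tacs (loaded x a) 22 in
  (r = 0 \/ r = 1) /\ (r = 0 <-> chk n x a).
Proof.
  intros Hn Hx. unfold test_tacs. rewrite !fold_left_app.
  destruct (ph_const_spec n (loaded x a) Hn) as (A3 & A4 & A6 & A8 & A9).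
  set (g1 := fold_left (tac_st n) ph_const (loaded x a)) in *.
  destruct (ph_fields_spec n 12 0 g1) as (B1 & _ & B2). fold ph_fields in B1, B2.
  set (g2 := fold_left (tac_st n) ph_fields g1) in *.
  assert (C3 : g2 3 = x) by (rewrite B1, A3 by lia; reflexivity).
  assert (C6 : g2 6 = 1) by (rewrite B1, A6 by lia; reflexivity).
  assert (C8 : g2 8 = 2 ^ (n / 16)) by (rewrite B1, A8 by lia; reflexivity).
  assert (CF : forall q, q < 12 -> g2 (10 + q) = fld n a q).
  { intros q Hq. specialize (B2 q Hq). cbn [Nat.add] in B2 |- *.
    rewrite B2, A4, A8, A9. unfold fld. change (loaded x a 4) with a.
    rewrite <- Nat.pow_mul_r.
    replace (2 ^ (n / 16) - 1) with (Nat.ones (n / 16)) by (rewrite Nat.ones_equiv; lia).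
    apply Nat.land_ones. }
  exact (ph_check_spec n x a g2 Hn Hx C3 C6 C8 CF).
Qed.

Lemma reach_halt n c k s s' : reach n c k s s' -> fetch s' = Some Halt -> pc s' < c ->
  forall t s'', run n t s = Some s'' -> Forall (fun i => i < c) (accessed s'').
Proof.
  intros (R & A) F Hp t s'' Hs.
  destruct (Nat.lt_ge_cases t k) as [L|L]; [eauto|].
  replace t with (k + (t - k)) in Hs by lia. rewrite run_app, R in Hs.
  assert (St : step n s' = None) by (destruct s'; unfold step; rewrite F; auto).
  destruct (t - k); simpl in Hs.
  - injection Hs as <-. unfold accessed. rewrite F. auto.
  - rewrite St in Hs. discriminate.
Qed.

Lemma run_halt_unique n s t t' s1 s2 :
  run n t s = Some s1 -> fetch s1 = Some Halt -> run n t' s = Some s2 -> fetch s2 = Some Halt -> s1 = s2.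
Proof.
  assert (G : forall t t' s1 s2, t <= t' -> run n t s = Some s1 -> fetch s1 = Some Halt ->
     run n t' s = Some s2 -> s1 = s2).
  { intros a b u v L R F R'. replace b with (a + (b - a)) in R' by lia. rewrite run_app, R in R'.
    assert (St : step n u = None) by (destruct u; unfold step; rewrite F; auto).
    destruct (b - a); simpl in R'; [congruence|]. rewrite St in R'. discriminate. }
  intros R1 F1 R2 F2. destruct (Nat.le_ge_cases t t'); [eauto|symmetry; eauto].
Qed.

Lemma outputs_unique n P xs y y' : outputs n P xs y -> outputs n P xs y' -> y = y'.
Proof.
  intros (t & t1 & s1 & _ & R1 & F1 & O1) (t' & t2 & s2 & _ & R2 & F2 & O2).
  assert (s1 = s2) by (eapply run_halt_unique; eauto). congruence.
Qed.

Lemma test_prog_outputs n x a : 10 < n -> x < 2 ^ n -> exists y, (y = 0 \/ y = 1) /\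
  uses_only n test_size test_prog [x; a] /\ outputs_within n test_prog [x; a] test_size y /\
  (16 < n -> (y = 0 <-> chk n x a)).
Proof.
  intros Hn Hx. destruct (Nat.lt_ge_cases 16 n) as [L|L].
  - destruct (test_run n x a L) as (k & s & Hk & R & F & Hp & O).
    destruct (test_value n x a L Hx) as [V1 V2].
    eexists; split; [exact V1|]. split; [|split].
    + intros t s'. apply (reach_halt _ _ _ _ _ R F Hp).
    + exists k, s. destruct R. auto.
    + intros _. exact V2.
  - destruct (test_run_small n x a Hn L) as (k & s & Hk & R & F & Hp & O).
    exists 1. split; auto. split; [|split].
    + intros t s'. apply (reach_halt _ _ _ _ _ R F Hp).
    + exists k, s. destruct R. auto.
    + lia.
Qed.

Lemma is_input_2 n xs : is_input n 2 xs -> exists x a, xs = [x; a] /\ x < 2 ^ n /\ a < 2 ^ n.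
Proof.
  intros (L & F). destruct xs as [|x [|a [|? ?]]]; try discriminate.
  inversion_clear F. inversion_clear H0. eauto.
Qed.

Lemma test_prog_is_test : is_test test_size 2 test_prog.
Proof.
  destruct test_size_bounds as [B1 B2]. unfold is_test. repeat split; try lia.
  - unfold is_program, test_prog. apply Forall_map, Forall_forall. intros i _.
    destruct i; simpl; lia.
  - unfold test_size. lia.
  - apply is_input_2 in H0. destruct H0 as (x & a & -> & Hx & _).
    destruct (test_prog_outputs n x a H Hx) as (y & _ & U & _). exact U.
  - apply is_input_2 in H0. destruct H0 as (x & a & -> & Hx & _).
    destruct (test_prog_outputs n x a H Hx) as (y & Y & _ & O & _). exists y; split; auto.
    exists test_size; auto.
Qed.

Lemma least_time n k P t : runs_within n k P t -> exists t', time_requirement n k P t' /\ t' <= t.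
Proof.
  induction t as [t IH] using lt_wf_ind. intros H.
  destruct (classic (exists u, u < t /\ runs_within n k P u)) as [(u & Hu & Ru)|N].
  - destruct (IH u Hu Ru) as (t' & T & L). exists t'; split; auto; lia.
  - exists t; split; auto. split; auto. intros u Ru.
    destruct (Nat.le_gt_cases t u); auto. exfalso; eauto.
Qed.

Lemma test_prog_time n : 10 < n -> exists t, time_requirement n 2 test_prog t /\ t <= test_size.
Proof.
  intros Hn. apply least_time. intros xs Hxs. apply is_input_2 in Hxs.
  destruct Hxs as (x & a & -> & Hx & _).
  destruct (test_prog_outputs n x a Hn Hx) as (y & _ & _ & O & _). eauto.
Qed.

Theorem test_prog_spec n x a : 16 < n -> x < 2 ^ n -> outputs n test_prog [x; a] 0 <-> chk n x a.
Proof.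
  intros Hn Hx. destruct (test_prog_outputs n x a) as (y & _ & _ & O & C); auto; try lia.
  rewrite <- C by auto. assert (Oy : outputs n test_prog [x; a] y) by (eexists; eauto).
  split; [intros O0; eapply outputs_unique; eauto|intros ->; auto].
Qed.

(** * Definable relations *)

Definition ebd (b : nat) (e : nat -> nat) : Prop := forall i, e i < 2 ^ b.

Definition PD (be b s m : nat) (R : (nat -> nat) -> Prop) : Prop :=
  exists f, psize f <= s /\ wd b f /\ cio m f /\ forall e, ebd be e -> (sat f e <-> R e).

Lemma wd_mono b b' f : b <= b' -> wd b f -> wd b' f.
Proof.
  intros L; induction f; simpl; intros; try tauto; intuition (try lia).
  eapply lt_pow2_mono; eauto.
Qed.

Lemma cio_mono m m' f : m <= m' -> cio m f -> cio m' f.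
Proof.
  intros L; induction f; simpl; intros; try tauto; intuition (try lia).
  eapply IO_mono; eauto.
Qed.

Lemma PD_mono be b s m be' b' s' m' R : PD be b s m R ->
  be' <= be -> b <= b' -> s <= s' -> m <= m' -> PD be' b' s' m' R.
Proof.
  intros (f & A & B & C & E) L1 L2 L3 L4. exists f.
  split; [lia|]. split; [eapply wd_mono; eauto|]. split; [eapply cio_mono; eauto|].
  intros e He. apply E. intros i. eapply lt_pow2_mono; eauto.
Qed.

Lemma PD_ext be b s m R R' : (forall e, ebd be e -> (R e <-> R' e)) -> PD be b s m R -> PD be b s m R'.
Proof.
  intros H (f & A & B & C & E). exists f. repeat split; auto; intros; [apply H|]; auto.
  - apply E; auto.
  - apply E; auto. apply H; auto.
Qed.

Lemma PD_and be b s s' m R R' : PD be b s m R -> PD be b s' m R' ->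
  PD be b (1 + s + s') m (fun e => R e /\ R' e).
Proof.
  intros (f & A & B & C & E) (f' & A' & B' & C' & E'). exists (PAnd f f'). simpl.
  repeat split; auto; try lia; rewrite <- ?E, <- ?E' in *; tauto.
Qed.

Lemma PD_or be b s s' m R R' : PD be b s m R -> PD be b s' m R' ->
  PD be b (1 + s + s') m (fun e => R e \/ R' e).
Proof.
  intros (f & A & B & C & E) (f' & A' & B' & C' & E'). exists (POr f f'). simpl.
  split; [lia|]. do 2 (split; auto). intros e He. rewrite E, E'; tauto.
Qed.

Lemma ebd_scons b e v : ebd b e -> v < 2 ^ b -> ebd b (scons v e).
Proof. intros He Hv [|i]; simpl; auto. Qed.

Lemma PD_ex be b s m c (R : (nat -> nat) -> nat -> Prop) : c <= be -> c <= b ->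
  PD be b s m (fun e => R (fun i => e (S i)) (e 0)) ->
  PD be b (1 + s) m (fun e => exists v, v < 2 ^ c /\ R e v).
Proof.
  intros L1 L2 (f & A & B & C & E). exists (PEx c f). simpl.
  split; [lia|]. do 2 (split; auto). intros e He.
  split; intros (v & Hv & S); exists v; split; auto.
  - apply E in S; auto. apply ebd_scons; auto. eapply lt_pow2_mono; eauto.
  - apply E; auto. apply ebd_scons; auto. eapply lt_pow2_mono; eauto.
Qed.

(* Relations definable with a given rank: the rank bounds the size of the formula, the
   width of its quantifiers and the number of runs of its constants; the free variables
   range over the numbers below [2 ^ cbe].  Ranks above [ckmax] carry no information. *)
Record cls : Type := Cls {
  cbe : nat;
  ckmax : nat;
  cbf : nat -> nat;
  csf : nat -> nat;
  cmf : nat -> nat;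
  cbf_mono : forall i j, i <= j -> cbf i <= cbf j;
  csf_mono : forall i j, i <= j -> csf i <= csf j;
  cmf_mono : forall i j, i <= j -> cmf i <= cmf j;
  cbe_le : cbe <= cbf 0;
  cbe_pos : 1 <= cbe;
  cmf_pos : 1 <= cmf 0;
  csf_pos : 3 <= csf 0;
  csf_step : forall i, 2 * csf i + 1 <= csf (S i)
}.

Definition D (C : cls) (k : nat) (R : (nat -> nat) -> Prop) : Prop :=
  k <= ckmax C -> PD (cbe C) (cbf C k) (csf C k) (cmf C k) R.

(** * Closure properties of definability *)

Section Closure.
  Variable C : cls.

  Lemma D_mono i j R : D C i R -> i <= j -> D C j R.
  Proof.
    intros H L K. eapply PD_mono; [apply H; lia|auto| | |].
    - apply cbf_mono; auto.
    - apply csf_mono; auto.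
    - apply cmf_mono; auto.
  Qed.

  Lemma D_ext k R R' : (forall e, ebd (cbe C) e -> (R e <-> R' e)) -> D C k R -> D C k R'.
  Proof. intros H HD K. eapply PD_ext; [exact H|apply HD; auto]. Qed.

  Lemma D_and i j R R' : D C i R -> D C j R' -> D C (S (Nat.max i j)) (fun e => R e /\ R' e).
  Proof.
    intros H H' K. assert (K1 : Nat.max i j <= ckmax C) by lia.
    apply (D_mono i (Nat.max i j)) in H; [|lia]. apply (D_mono j (Nat.max i j)) in H'; [|lia].
    eapply PD_mono; [apply PD_and; [apply H; auto|apply H'; auto]|auto| | |].
    - apply cbf_mono; lia.
    - pose proof (csf_step C (Nat.max i j)). lia.
    - apply cmf_mono; lia.
  Qed.

  Lemma D_or i j R R' : D C i R -> D C j R' -> D C (S (Nat.max i j)) (fun e => R e \/ R' e).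
  Proof.
    intros H H' K. assert (K1 : Nat.max i j <= ckmax C) by lia.
    apply (D_mono i (Nat.max i j)) in H; [|lia]. apply (D_mono j (Nat.max i j)) in H'; [|lia].
    eapply PD_mono; [apply PD_or; [apply H; auto|apply H'; auto]|auto| | |].
    - apply cbf_mono; lia.
    - pose proof (csf_step C (Nat.max i j)). lia.
    - apply cmf_mono; lia.
  Qed.

  Lemma D_exb k c (R : (nat -> nat) -> nat -> Prop) : c <= cbe C ->
    D C k (fun e => R (fun i => e (S i)) (e 0)) ->
    D C (S k) (fun e => exists v, v < 2 ^ c /\ R e v).
  Proof.
    intros L H K. eapply PD_mono; [apply PD_ex; [exact L| |apply H; lia]|auto| | |].
    - pose proof (cbe_le C). pose proof (cbf_mono C 0 k). lia.
    - apply cbf_mono; lia.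
    - pose proof (csf_step C k). lia.
    - apply cmf_mono; lia.
  Qed.

  Lemma D_ex k (R : (nat -> nat) -> nat -> Prop) :
    D C k (fun e => R (fun i => e (S i)) (e 0)) ->
    D C (S k) (fun e => exists v, v < 2 ^ cbe C /\ R e v).
  Proof. apply D_exb; auto. Qed.

  Lemma D_atom o i j k : D C 0 (fun e => op3_rel o (e i) (e j) (e k)).
  Proof.
    intros _. exists (PAtom o i j k). simpl. pose proof (csf_pos C).
    repeat split; auto; lia.
  Qed.

  Lemma D_add i j k : D C 0 (fun e => e i + e j = e k).
  Proof. apply (D_atom OAdd). Qed.
  Lemma D_mul i j k : D C 0 (fun e => e i * e j = e k).
  Proof. apply (D_atom OMul). Qed.
  Lemma D_land i j k : D C 0 (fun e => Nat.land (e i) (e j) = e k).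
  Proof. apply (D_atom OLand). Qed.

  Lemma D_eq i j : D C 0 (fun e => e i = e j).
  Proof.
    eapply D_ext; [|apply (D_land i i j)]. intros e _. cbv beta. rewrite Nat.land_diag. tauto.
  Qed.

  Lemma D_cst i c : c < 2 ^ cbe C -> IO (cmf C 0) c -> D C 0 (fun e => e i = c).
  Proof.
    intros L I _. exists (PCst i c). simpl. pose proof (csf_pos C).
    split; [lia|]. split; [eapply lt_pow2_mono; [exact L|apply cbe_le]|]. split; [auto|tauto].
  Qed.

  Lemma D_true : D C 0 (fun _ => True).
  Proof. eapply D_ext; [|apply (D_eq 0 0)]. tauto. Qed.

  Lemma D_pow2c i q : q < cbe C -> D C 0 (fun e => e i = 2 ^ q).
  Proof.
    intros. apply D_cst; [apply pow2_lt; auto|].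
    eapply IO_mono; [apply IO_pow2|apply cmf_pos].
  Qed.

  Lemma D_one i : D C 0 (fun e => e i = 1).
  Proof. apply (D_pow2c i 0). pose proof (cbe_pos C); lia. Qed.

  Lemma D_zero i : D C 0 (fun e => e i = 0).
  Proof. apply D_cst; auto. apply IO_0. Qed.

  Lemma D_false : D C 1 (fun _ => False).
  Proof.
    apply D_mono with (S (Nat.max 0 0)); auto.
    eapply D_ext; [|apply D_and; [apply (D_zero 0)|apply (D_one 0)]].
    intros e _; cbv beta. lia.
  Qed.

  Lemma D_le i j : D C 1 (fun e => e i <= e j).
  Proof.
    eapply (D_ext _ (fun e => exists v, v < 2 ^ cbe C /\ e i + v = e j)).
    2:{ apply D_ex, D_add. }
    intros e He; cbv beta. split.
    - intros (v & _ & E). lia.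
    - intros L. exists (e j - e i). split; [|lia]. specialize (He j). lia.
  Qed.

End Closure.

Lemma D_intro C k R : (k <= ckmax C -> PD (cbe C) (cbf C k) (csf C k) (cmf C k) R) -> D C k R.
Proof. auto. Qed.

Lemma D_elim C k R : D C k R -> k <= ckmax C -> PD (cbe C) (cbf C k) (csf C k) (cmf C k) R.
Proof. auto. Qed.

#[global] Opaque D.
#[global] Hint Resolve D_add D_mul D_land D_eq D_one D_zero D_le D_true D_false : dd.

(* Builds a rank for a relation given by conjunctions, disjunctions, existential
   quantifiers and relations known to be definable. *)
Ltac dstep := cbv beta; first
  [ solve [eauto 3 with dd]
  | eapply D_ex | eapply D_exb; [solve [eauto with dd | lia]|]
  | eapply D_and | eapply D_or ].
Ltac dbuild := eapply D_mono; [repeat dstep|lia].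
Ltac dby P := eapply (D_ext _ _ P); [|dbuild].

(** * Order, division and remainder as definable relations *)

Section Arith.
  Variable C : cls.
  Notation X := (2 ^ cbe C).

  Lemma D_succ i j : D C 2 (fun e => e i + 1 = e j).
  Proof.
    dby (fun e => exists o, o < X /\ (o = 1 /\ e i + o = e j)).
    intros e He. split.
    - intros (o & _ & -> & E); auto.
    - intros E. exists 1. repeat split; auto. specialize (He j). lia.
  Qed.
  Hint Resolve D_succ : dd.

  Lemma D_lt i j : D C 4 (fun e => e i < e j).
  Proof.
    dby (fun e => exists o, o < X /\ (e i + 1 = o /\ o <= e j)).
    intros e He. split.
    - intros (o & _ & E & L); lia.
    - intros E. exists (e i + 1). specialize (He j). repeat split; lia.
  Qed.
  Hint Resolve D_lt : dd.

  Lemma D_ne i j : D C 5 (fun e => e i <> e j).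
  Proof. dby (fun e => e i < e j \/ e j < e i). intros; lia. Qed.
  Hint Resolve D_ne : dd.

  Lemma D_nz i : D C 7 (fun e => e i <> 0).
  Proof.
    dby (fun e => exists o, o < X /\ (o = 0 /\ e i <> o)).
    intros e He. split.
    - intros (o & _ & -> & E); auto.
    - intros E. exists 0. repeat split; auto.
  Qed.
  Hint Resolve D_nz : dd.

  Lemma D_divmod i j q r : D C 7 (fun e => e j * e q + e r = e i /\ e r < e j).
  Proof.
    dby (fun e => exists t, t < X /\ (e j * e q = t /\ (t + e r = e i /\ e r < e j))).
    intros e He. split.
    - intros (t & _ & E & F & L). lia.
    - intros (E & L). exists (e j * e q). repeat split; auto. specialize (He i). lia.
  Qed.
  Hint Resolve D_divmod : dd.

  Lemma divmod_spec x y q r : y * q + r = x /\ r < y <-> y <> 0 /\ q = x / y /\ r = x mod y.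
  Proof.
    split.
    - intros (E & L). split; [lia|]. split.
      + apply Nat.div_unique with r; lia.
      + apply Nat.mod_unique with q; lia.
    - intros (N & -> & ->). split; [symmetry; apply Nat.div_mod_eq|apply Nat.mod_upper_bound; auto].
  Qed.

  Lemma D_div i j q : D C 9 (fun e => e i / e j = e q).
  Proof.
    dby (fun e => (e j = 0 /\ e q = 0) \/
                  exists r, r < X /\ (e j * e q + r = e i /\ r < e j)).
    intros e He. destruct (Nat.eq_dec (e j) 0) as [Z|Z].
    - rewrite Z. split; [|auto]. intros [[_ ->]|(r & _ & _ & L)]; [reflexivity|lia].
    - split.
      + intros [|(r & _ & E)]; [lia|]. apply divmod_spec in E. lia.
      + intros E. right. exists (e i mod e j). split.
        * eapply Nat.le_lt_trans; [apply Nat.Div0.mod_le|apply He].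
        * apply divmod_spec. auto.
  Qed.

  Lemma D_mod i j r : D C 9 (fun e => e i mod e j = e r).
  Proof.
    dby (fun e => (e j = 0 /\ e r = e i) \/
                  exists q, q < X /\ (e j * q + e r = e i /\ e r < e j)).
    intros e He. destruct (Nat.eq_dec (e j) 0) as [Z|Z].
    - rewrite Z. simpl. split; [|auto]. intros [[_ ->]|(q & _ & _ & L)]; [reflexivity|lia].
    - split.
      + intros [|(q & _ & E)]; [lia|]. apply divmod_spec in E. lia.
      + intros E. right. exists (e i / e j). split.
        * eapply Nat.le_lt_trans; [apply Nat.Div0.div_le_upper_bound|apply (He i)]. nia.
        * apply divmod_spec. auto.
  Qed.
End Arith.
#[global] Hint Resolve D_succ D_lt D_ne D_nz D_divmod D_div D_mod : dd.

(** * The graph of exponentiation *)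

Lemma land_pred_pow2 x : Nat.land (2 ^ x) (2 ^ x - 1) = 0.
Proof.
  replace (2 ^ x - 1) with (Nat.ones x) by (rewrite Nat.ones_equiv; lia).
  rewrite Nat.land_ones. apply Nat.Div0.mod_same.
Qed.

(** Unless [v] is a power of two, [v] and [v - 1] share their leading bit. *)
Lemma land_pred_inv v w : w + 1 = v -> Nat.land v w = 0 -> exists y, v = 2 ^ y.
Proof.
  intros E L. exists (Nat.log2 v).
  destruct (Nat.log2_spec v ltac:(lia)) as [A B].
  set (y := Nat.log2 v) in *.
  destruct (Nat.eq_dec v (2 ^ y)) as [|N]; auto. exfalso.
  assert (T : forall u, 2 ^ y <= u < 2 ^ S y -> Nat.testbit u y = true).
  { intros u (U1 & U2). rewrite Nat.testbit_true.
    replace (u / 2 ^ y) with 1; [reflexivity|].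
    apply Nat.div_unique with (u - 2 ^ y); simpl in U2; lia. }
  assert (Z : Nat.testbit (Nat.land v w) y = true) by (rewrite Nat.land_spec, !T by lia; auto).
  rewrite L, Nat.bits_0 in Z. discriminate.
Qed.

(* [(Z + 1) ^ x = 1 + Z s] with [s = x] modulo [Z]: this recovers the exponent. *)
Lemma geo_exists Z x : exists s q, Z * s + 1 = (Z + 1) ^ x /\ Z * q + x = s.
Proof.
  induction x as [|x (s & q & E1 & E2)].
  - exists 0, 0. simpl; lia.
  - exists (s * (Z + 1) + 1), (s + q). rewrite Nat.pow_succ_r', <- E1. nia.
Qed.

Section Pow2.
  Variables (C : cls) (b lam : nat).
  Notation X := (2 ^ cbe C).
  Let L := 2 ^ lam.
  Hypothesis HL : L < cbe C.
  Hypothesis Hb : b * L < cbe C.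
  Hypothesis HbL : b + 2 <= 2 ^ L.

  Lemma D_sqs m : forall i j, D C (2 * m) (fun e => e j = e i ^ (2 ^ m)).
  Proof.
    induction m; intros i j.
    - dby (fun e : nat -> nat => e j = e i). intros e _; cbv beta.
      rewrite Nat.pow_0_r, Nat.pow_1_r; tauto.
    - dby (fun e => exists t, t < X /\ (t = e i ^ (2 ^ m) /\ t * t = e j)).
      intros e He. rewrite Nat.pow_succ_r', (Nat.mul_comm 2), Nat.pow_mul_r.
      replace ((e i ^ 2 ^ m) ^ 2) with (e i ^ 2 ^ m * e i ^ 2 ^ m) by (simpl; lia).
      set (t := e i ^ 2 ^ m). split.
      + intros (? & _ & -> & E). auto.
      + intros E. exists t. repeat split; auto. specialize (He j). nia.
  Qed.

  (** A power of two [v = 2 ^ y] is recognized by its conjunction with [v - 1]. With [L = 2 ^ lam],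
      [lam] squarings give [v ^ L], which is [(Z + 1) ^ y] for [Z = 2 ^ L - 1]; subtracting 1 and
      dividing by [Z] leaves a number congruent to [y] modulo [Z], and [y < b < Z] determines [y].
      The formula is positive, and [lam] need only be about the iterated logarithm of the bound [b]
      on the exponents. *)
  Lemma D_pow2 i j : D C (2 * lam + 20) (fun e => e j < 2 ^ b /\ 2 ^ (e i) = e j).
  Proof.
    assert (HS := D_sqs lam).
    assert (HZ : forall i, D C 0 (fun e => e i = 2 ^ L)) by (intros; apply D_pow2c; auto).
    assert (HB : forall i, D C 0 (fun e => e i = 2 ^ b)).
    { intros; apply D_pow2c. assert (1 <= L) by apply pow2_pos. nia. }
    dby (fun e => (exists B, B < X /\ (B = 2 ^ b /\ e j < B)) /\
      (exists w, w < X /\ (w + 1 = e j /\ (exists o, o < X /\ (o = 0 /\ Nat.land (e j) w = o)))) /\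
      exists u, u < X /\ (u = e j ^ L /\
      exists z, z < X /\ (z = 2 ^ L /\
      exists zm, zm < X /\ (zm + 1 = z /\
      exists s, s < X /\ ((exists t, t < X /\ (zm * s = t /\ t + 1 = u)) /\
      exists q, q < X /\ (zm * q + e i = s /\ e i < zm)))))).
    intros e He. set (v := e j). set (x := e i).
    assert (LX : 2 ^ L < X) by (apply pow2_lt; auto).
    assert (L1 : 1 <= L) by apply pow2_pos.
    split.
    - intros (HB' & (w & _ & W1 & (o & _ & -> & W2)) & (u & _ & -> & z & _ & -> & zm & _ & Ez & s & _ &
         (t & _ & Et & Eu) & q & _ & Es & Lx)).
      destruct HB' as (B & _ & -> & LB). split; auto.
      destruct (land_pred_inv v w W1 W2) as (y & Ev). rewrite Ev. f_equal.
      assert (Hy : y < b). { rewrite Ev in LB. apply (Nat.pow_lt_mono_r_iff 2); auto. }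
      destruct (geo_exists zm y) as (s' & q' & G1 & G2).
      assert (Ey : v ^ L = (zm + 1) ^ y).
      { rewrite Ez, Ev, <- !Nat.pow_mul_r. f_equal; lia. }
      assert (s = s') by nia.
      assert (A1 : x = s mod zm) by (apply (Nat.mod_unique s zm q); lia).
      assert (A2 : y = s mod zm) by (apply (Nat.mod_unique s zm q'); lia).
      congruence.
    - intros (LB & E). assert (Hx : x < b).
      { rewrite <- E in LB. apply (Nat.pow_lt_mono_r_iff 2); auto. }
      assert (VX : v < X) by (apply He).
      assert (bX : 2 ^ b < X). { apply pow2_lt. nia. }
      split; [exists (2 ^ b); auto|]. split.
      + exists (v - 1). pose proof (pow2_pos x). rewrite E in H.
        repeat split; try lia. exists 0. repeat split; auto. rewrite <- E. apply land_pred_pow2.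
      + pose (zm := 2 ^ L - 1).
        destruct (geo_exists zm x) as (s & q & G1 & G2).
        assert (Ez : zm + 1 = 2 ^ L) by (unfold zm; pose proof (pow2_pos L); lia).
        assert (Eu : v ^ L = (zm + 1) ^ x).
        { rewrite Ez, <- E, <- !Nat.pow_mul_r. f_equal; lia. }
        assert (UX : v ^ L < X).
        { rewrite <- E, <- Nat.pow_mul_r. apply pow2_lt. nia. }
        assert (Zp : 0 < zm) by (unfold zm; lia).
        exists (v ^ L). split; auto. split; auto.
        exists (2 ^ L). split; auto. split; auto.
        exists zm. split; [lia|]. split; auto.
        exists s. split; [nia|]. split.
        * exists (zm * s). repeat split; lia.
        * exists q. split; [nia|]. split; auto. unfold zm; lia.
  Qed.
End Pow2.

(** * Definability of bounded computations *)

(** The bound on accessed cells is kept in the definition: it reduces every address to one of [c]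
    values and the memory to [c] words. *)
Fixpoint accepts (n c o T : nat) (s : state) : Prop :=
  match T with
  | 0 => False
  | S T => Forall (fun i => i < c) (accessed s) /\
      ((fetch s = Some Halt /\ out s = [o]) \/
       exists s', step n s = Some s' /\ accepts n c o T s')
  end.

Lemma accepts_run n c o T : forall s,
  (forall t s', run n t s = Some s' -> Forall (fun i => i < c) (accessed s')) ->
  accepts n c o T s <->
  exists t s', t < T /\ run n t s = Some s' /\ fetch s' = Some Halt /\ out s' = [o].
Proof.
  induction T; intros s Hs.
  - simpl. split; [tauto|]. intros (t & s' & L & _); lia.
  - split.
    + intros (_ & [(F & O)|(s1 & E & A)]).
      * exists 0, s. repeat split; auto. lia.
      * apply IHT in A.
        -- destruct A as (t & s' & L & R & F & O). exists (S t), s'.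
           split; [lia|]. split; [simpl; rewrite E; auto|auto].
        -- intros t s' R. apply (Hs (S t)). simpl. rewrite E; auto.
    + intros (t & s' & L & R & F & O). split; [apply (Hs 0); auto|].
      destruct t as [|t]; simpl in R.
      * injection R as <-. auto.
      * destruct (step n s) as [s1|] eqn:E; [|discriminate]. right. exists s1; split; auto.
        apply IHT.
        -- intros u s'' Ru. apply (Hs (S u)). simpl. rewrite E; auto.
        -- exists t, s'. split; [lia|auto].
Qed.

Corollary accepts_outputs n c o T P xs : uses_only n c P xs ->
  accepts n c o T (init P xs) <-> outputs_within n P xs T o.
Proof. intros H. apply accepts_run. exact H. Qed.

Lemma accepts_pc n c o T s : accepts n c o T s -> pc s < c.
Proof. destruct T; [intros []|]. intros (F & _). unfold accessed in F. inversion F; auto. Qed.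

(* A state whose words are functions of a parameter; the program counter is fixed. *)
Record pstate : Type := PState {
  ps_m : nat -> nat -> nat;
  ps_p : nat;
  ps_a : nat -> nat;
  ps_b : nat -> nat;
  ps_d : nat -> nat;
  ps_x : list (nat -> nat);
  ps_y : list (nat -> nat)
}.

Definition evals (l : list (nat -> nat)) (z : nat) : list nat := map (fun v => v z) l.

Definition conc (S : pstate) (z : nat) : state :=
  State (fun i => ps_m S i z) (ps_p S) (ps_a S z) (ps_b S z) (ps_d S z)
    (evals (ps_x S) z) (evals (ps_y S) z).

Section Unfold.
  Variables (n c o : nat).

  Definition next (n p : nat) : nat := (p + 1) mod 2 ^ n.

  (** An address is a function of the parameter. Branching over its possible values [w] makes the
      touched cell and the program counter explicit again, so a symbolic state describes each
      branch. *)
  Definition after (F : pstate -> nat -> Prop) (S : pstate) (z : nat) (i : instr) : Prop :=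
    let 'PState m p a b d xs ys := S in
    match i with
    | Halt => evals ys z = [o]
    | Load => exists w, In w (seq 0 c) /\ (d z = w /\ F (PState m (next n p) (m w) b d xs ys) z)
    | Store => exists w, In w (seq 0 c) /\ (d z = w /\
        F (PState (fun i z => if i =? w then a z else m i z) (next n p) a b d xs ys) z)
    | SwapOpd => F (PState m (next n p) b a d xs ys) z
    | SwapAdr => F (PState m (next n p) d b a xs ys) z
    | Jump => exists w, In w (seq 0 c) /\ (d z = w /\ F (PState m w a b d xs ys) z)
    | JumpZero =>
        (a z = 0 /\ exists w, In w (seq 0 c) /\ (d z = w /\ F (PState m w a b d xs ys) z)) \/
        (a z <> 0 /\ F (PState m (next n p) a b d xs ys) z)
    | Input => match xs with
               | x :: xs => F (PState m (next n p) x b d xs ys) z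
               | [] => False
               end
    | Output => F (PState m (next n p) a b d xs (a :: ys)) z
    | i => F (PState m (next n p) (fun z => val n i (a z) (b z)) b d xs ys) z
    end.

  Lemma in_instruction_set i : In i instruction_set.
  Proof. destruct i; simpl; tauto. Qed.

  Lemma fetch_conc S z i : fetch (conc S z) = Some i <-> ps_m S (ps_p S) z = icode i.
  Proof.
    unfold fetch, conc; simpl. split; [apply decode_some|intros ->; apply decode_icode].
  Qed.

  Lemma accepts_unfold T S z : accepts n c o (Datatypes.S T) (conc S z) <->
    ps_p S < c /\ exists i, In i instruction_set /\ (ps_m S (ps_p S) z = icode i /\
      after (fun S z => accepts n c o T (conc S z)) S z i).
  Proof.
    destruct S as [m p a b d xs ys]. cbn [ps_p ps_m].
    set (s := conc (PState m p a b d xs ys) z).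
    assert (Sw : forall w, In w (seq 0 c) <-> w < c) by (intros; rewrite in_seq; lia).
    cbn [accepts]. split.
    - intros (A & Hs).
      assert (Hp : p < c) by (unfold accessed in A; inversion A; auto).
      split; auto.
      destruct (fetch s) as [i|] eqn:F.
      2:{ destruct Hs as [(? & _)|(s' & St & _)]; [discriminate|].
          unfold step in St. unfold s, conc in St. simpl in St. unfold s in F. simpl in F.
          unfold conc in F; simpl in F. rewrite F in St. discriminate. }
      exists i. split; [apply in_instruction_set|].
      split; [apply (fetch_conc (PState m p a b d xs ys) z); auto|].
      assert (Ad : i = Load \/ i = Store -> d z < c).
      { unfold accessed in A. rewrite F in A. inversion A; subst.
        intros [->| ->]; inversion H2; auto. }
      destruct Hs as [(E & O)|(s' & St & Ac)].
      + injection E as ->. exact O.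
      + unfold step in St. unfold s, conc in St, F. simpl in St, F. unfold conc in F; simpl in F.
        rewrite F in St. 
        destruct i; simpl in St; try discriminate; try (injection St as <-; exact Ac).
        * injection St as <-. exists (d z). split; [apply Sw; auto|]. split; auto.
        * injection St as <-. exists (d z). split; [apply Sw; auto|]. split; auto.
        * injection St as <-. exists (d z). split; [apply Sw; apply accepts_pc in Ac; auto|]. split; auto.
        * injection St as <-. cbn [after]. destruct (Nat.eqb_spec (a z) 0) as [Z|Z].
          -- left. split; auto. exists (d z). split; [apply Sw; apply accepts_pc in Ac; auto|]. split; auto.
          -- right. split; auto.
        * destruct xs as [|x xs]; simpl in St; [discriminate|]. injection St as <-. exact Ac.
    - intros (Hp & i & _ & Hi & Af).
      assert (F : fetch s = Some i) by (apply fetch_conc; auto).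
      assert (Acc : (i = Load \/ i = Store -> d z < c) -> Forall (fun i => i < c) (accessed s)).
      { intros H. unfold accessed. rewrite F. constructor; auto.
        destruct i; try constructor; auto. }
      assert (Go : forall s', step n s = Some s' -> accepts n c o T s' ->
         (fetch s = Some Halt /\ out s = [o] \/ exists s', step n s = Some s' /\ accepts n c o T s'))
        by eauto.
      assert (St : step n s = match i with
        | Halt => None
        | Load => Some (State (fun i => m i z) (next n p) (m (d z) z) (b z) (d z) (evals xs z) (evals ys z))
        | Store => Some (State (update (fun i => m i z) (d z) (a z)) (next n p) (a z) (b z) (d z) (evals xs z) (evals ys z))
        | SwapOpd => Some (State (fun i => m i z) (next n p) (b z) (a z) (d z) (evals xs z) (evals ys z))
        | SwapAdr => Some (State (fun i => m i z) (next n p) (d z) (b z) (a z) (evals xs z) (evals ys z))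
        | Jump => Some (State (fun i => m i z) (d z) (a z) (b z) (d z) (evals xs z) (evals ys z))
        | JumpZero => Some (State (fun i => m i z) (if a z =? 0 then d z else next n p) (a z) (b z) (d z) (evals xs z) (evals ys z))
        | Input => match evals xs z with
                   | x :: r => Some (State (fun i => m i z) (next n p) x (b z) (d z) r (evals ys z))
                   | [] => None end
        | Output => Some (State (fun i => m i z) (next n p) (a z) (b z) (d z) (evals xs z) (a z :: evals ys z))
        | i => match arith n i (a z) (b z) with
               | Some v => Some (State (fun i => m i z) (next n p) v (b z) (d z) (evals xs z) (evals ys z))
               | None => None end
        end).
      { unfold step. unfold s, conc in *. simpl in *. rewrite F. destruct i; reflexivity. }
      destruct i; cbn [after] in Af;
        try (split; [apply Acc; intros [?|?]; discriminate|]; right; rewrite St; eexists; split;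
             [reflexivity|exact Af]).
      + split; [apply Acc; intros [?|?]; discriminate|]. left; auto.
      + destruct Af as (w & Hw & E & Af). apply Sw in Hw.
        split; [apply Acc; lia|]. right. rewrite St. eexists; split; [reflexivity|].
        rewrite E. unfold conc in Af; cbn [ps_m ps_p ps_a ps_b ps_d ps_x ps_y] in Af. rewrite E in Af. exact Af.
      + destruct Af as (w & Hw & E & Af). apply Sw in Hw.
        split; [apply Acc; lia|]. right. rewrite St. eexists; split; [reflexivity|].
        rewrite E. unfold conc in Af; cbn [ps_m ps_p ps_a ps_b ps_d ps_x ps_y] in Af. rewrite E in Af. exact Af.
      + destruct Af as (w & Hw & E & Af).
        split; [apply Acc; intros [?|?]; discriminate|]. right. rewrite St. eexists; split; [reflexivity|].
        rewrite E. unfold conc in Af; cbn [ps_m ps_p ps_a ps_b ps_d ps_x ps_y] in Af. rewrite E in Af. exact Af.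
      + split; [apply Acc; intros [?|?]; discriminate|]. right. rewrite St. eexists; split; [reflexivity|].
        destruct Af as [(Z & w & Hw & E & Af)|(Z & Af)].
        * rewrite Z, Nat.eqb_refl, E. unfold conc in Af; cbn [ps_m ps_p ps_a ps_b ps_d ps_x ps_y] in Af.
          rewrite E, Z in Af. exact Af.
        * apply Nat.eqb_neq in Z. rewrite Z. exact Af.
      + split; [apply Acc; intros [?|?]; discriminate|]. right. rewrite St.
        destruct xs as [|x xs]; [tauto|]. simpl. eexists; split; [reflexivity|exact Af].
  Qed.
End Unfold.

Section DefinableRuns.
  Variables (C : cls) (n c o A : nat) (Kn : nat -> (nat -> nat) -> Prop).
  Hypothesis Kn_mono : forall i j v, Kn i v -> i <= j -> Kn j v.
  Hypothesis Kn_arith : forall k i u v, arith n i 0 0 <> None -> Kn k u -> Kn k v ->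
    Kn (k + A) (fun z => val n i (u z) (v z)).
  Hypothesis Kn_const : forall k v q i, Kn k v -> q < c + 22 -> D C (k + A) (fun e => v (e i) = q).
  Hypothesis Kn_nz : forall k v i, Kn k v -> D C (k + A) (fun e => v (e i) <> 0).
  Hypothesis Ho : o < c + 22.

  Definition known (k : nat) (S : pstate) : Prop :=
    (forall i, i < c -> Kn k (ps_m S i)) /\ Kn k (ps_a S) /\ Kn k (ps_b S) /\ Kn k (ps_d S) /\
    Forall (Kn k) (ps_x S) /\ Forall (Kn k) (ps_y S).

  Lemma D_bigor {U} (l : list U) k (R : U -> (nat -> nat) -> Prop) :
    (forall x, In x l -> D C k (R x)) -> D C (k + length l + 1) (fun e => exists x, In x l /\ R x e).
  Proof.
    induction l as [|a l IH]; intros H.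
    - eapply D_ext; [|eapply D_mono; [apply D_false|simpl; lia]].
      intros e _; simpl. split; [tauto|]. intros (x & [] & _).
    - eapply D_mono.
      + eapply D_ext; [|apply D_or; [apply (H a); simpl; auto|apply IH; intros; apply H; simpl; auto]].
        intros e _; cbv beta. split.
        * intros [Ra|(x & Hx & Rx)]; [exists a|exists x]; simpl; auto.
        * intros (x & [->|Hx] & Rx); eauto.
      + simpl; lia.
  Qed.

  Let step_rank := A + c + 60.

  (** [Kn k v] leaves open how the word [v z] is given: by its graph for short words, by its digits
      for long ones. The words never become quantified variables of this formula; each step replaces
      them by composed functions of rank larger by [A] and branches over instructions and addresses,
      so the rank is linear in [T]. *)
  Theorem D_accepts T : forall k S i, known k S ->
    D C (k + T * step_rank + 1) (fun e => accepts n c o T (conc S (e i))).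
  Proof.
    induction T; intros k S i HK.
    - simpl accepts. eapply D_mono; [apply D_false|lia].
    - eapply D_ext; [intros e _; symmetry; apply accepts_unfold|].
      destruct (Nat.lt_ge_cases (ps_p S) c) as [Hp|Hp].
      2:{ eapply D_ext; [|eapply D_mono; [apply D_false|lia]]. intros; lia. }
      destruct S as [m p a b d xs ys]. destruct HK as (Km & Ka & Kb & Kd & Kx & Ky).
      cbn [ps_m ps_p ps_a ps_b ps_d ps_x ps_y] in *.
      set (r := k + A + T * step_rank + 1).
      assert (Up : forall v, Kn k v -> Kn (k + A) v) by (intros; eapply Kn_mono; eauto; lia).
      assert (IH : forall S, known (k + A) S -> D C r (fun e => accepts n c o T (conc S (e i)))).
      { intros S' H'. apply IHT; auto. }
      assert (Ukx : Forall (Kn (k + A)) xs) by (eapply Forall_impl; [|exact Kx]; auto).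
      assert (Uky : Forall (Kn (k + A)) ys) by (eapply Forall_impl; [|exact Ky]; auto).
      assert (Big : forall (G : nat -> pstate), (forall w, w < c -> known (k + A) (G w)) ->
         D C (r + 1 + c + 1) (fun e => exists w, In w (seq 0 c) /\
            (d (e i) = w /\ accepts n c o T (conc (G w) (e i))))).
      { intros G HG. rewrite <- (length_seq c 0) at 1.
        apply (D_bigor (seq 0 c) (r + 1) (fun w e => d (e i) = w /\ accepts n c o T (conc (G w) (e i)))).
        intros w Hw. rewrite in_seq in Hw. eapply D_mono.
        - apply D_and; [apply Kn_const; [exact Kd|lia]|apply IH, HG; lia].
        - unfold r; lia. }
      (* The outer disjunction ranges over the 22 instructions. *)
      apply D_mono with (r + c + 10 + 22 + 3); [|unfold r, step_rank; lia].
      eapply D_ext.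
      2:{ eapply D_mono; [apply (D_bigor instruction_set (r + c + 10)
            (fun ins e => m p (e i) = icode ins /\
              after n c o (fun S z => accepts n c o T (conc S z)) (PState m p a b d xs ys) (e i) ins))|
            simpl; lia].
          intros ins _.
          assert (HC : D C (k + A) (fun e => m p (e i) = icode ins))
            by (apply Kn_const; [apply Km; auto|destruct ins; simpl; lia]).
          eapply D_mono; [apply D_and; [exact HC|]|].
          2:{ instantiate (1 := r + c + 8). unfold r; lia. }
          destruct ins; cbn [after];
          try (eapply D_mono; [apply IH; repeat split; cbn [ps_m ps_p ps_a ps_b ps_d ps_x ps_y]; auto;
                               apply Kn_arith; auto; discriminate|lia]).
          - destruct ys as [|y [|y' ys]].
            + eapply D_ext; [|eapply D_mono; [apply D_false|lia]]. intros e _. simpl. split; [tauto|discriminate].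
            + inversion_clear Ky.
              eapply D_ext; [|eapply D_mono; [apply (Kn_const k y o i); auto|unfold r; lia]].
              intros e _. simpl. split; [intros ->; auto|intros [= <-]; auto].
            + eapply D_ext; [|eapply D_mono; [apply D_false|lia]]. intros e _. simpl. split; [tauto|discriminate].
          - eapply D_mono; [apply (Big (fun w => PState m (next n p) (m w) b d xs ys))|lia].
            intros w Hw. repeat split; cbn [ps_m ps_p ps_a ps_b ps_d ps_x ps_y]; auto.
          - eapply D_mono; [apply (Big (fun w => PState (fun i z => if i =? w then a z else m i z) (next n p) a b d xs ys))|lia].
            intros w Hw. repeat split; cbn [ps_m ps_p ps_a ps_b ps_d ps_x ps_y]; auto.
            intros q Hq. destruct (q =? w); [apply Up, Ka|apply Up, Km; auto].
          - eapply D_mono; [apply (Big (fun w => PState m w a b d xs ys))|lia].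
            intros w Hw. repeat split; cbn [ps_m ps_p ps_a ps_b ps_d ps_x ps_y]; auto.
          - eapply D_mono.
            + apply D_or; apply D_and.
              * apply (Kn_const k a 0 i); auto; lia.
              * apply (Big (fun w => PState m w a b d xs ys)).
                intros w Hw. repeat split; cbn [ps_m ps_p ps_a ps_b ps_d ps_x ps_y]; auto.
              * apply (Kn_nz k a i); auto.
              * apply (IH (PState m (next n p) a b d xs ys)).
                repeat split; cbn [ps_m ps_p ps_a ps_b ps_d ps_x ps_y]; auto.
            + unfold r; lia.
          - destruct xs as [|x xs].
            + eapply D_mono; [apply D_false|lia].
            + inversion_clear Ukx. eapply D_mono; [apply IH|lia].
              repeat split; cbn [ps_m ps_p ps_a ps_b ps_d ps_x ps_y]; auto. }
      intros e _. tauto.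
  Qed.
End DefinableRuns.

(** * Computations on words short enough to be quantified over *)

Lemma lor_lt_pow2 n a b : a < 2 ^ n -> b < 2 ^ n -> Nat.lor a b < 2 ^ n.
Proof.
  intros Ha Hb.
  destruct (Nat.eq_dec (Nat.lor a b) 0) as [->|Z]; auto.
  apply Nat.log2_lt_pow2; [lia|]. rewrite Nat.log2_lor.
  assert (n <> 0).
  { intros ->. simpl in Ha, Hb. replace a with 0 in Z by lia. replace b with 0 in Z by lia. auto. }
  assert (G : forall x, x < 2 ^ n -> Nat.log2 x < n).
  { intros x Hx. destruct (Nat.eq_dec x 0) as [->|]; [change (Nat.log2 0) with 0; lia|]. apply Nat.log2_lt_pow2; lia. }
  pose proof (G a Ha). pose proof (G b Hb). lia.
Qed.

Lemma lor_join W a A b B : a < 2 ^ W -> b < 2 ^ W ->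
  Nat.lor (a + 2 ^ W * A) (b + 2 ^ W * B) = Nat.lor a b + 2 ^ W * Nat.lor A B.
Proof.
  intros Ha Hb.
  assert (Hl : Nat.lor a b < 2 ^ W) by (apply lor_lt_pow2; auto).
  apply Nat.bits_inj; intro j.
  rewrite Nat.lor_spec, !testbit_join by auto.
  destruct (j <? W); rewrite Nat.lor_spec; reflexivity.
Qed.

(** Disjunction of words is not an atom of formulas; this identity defines it from sum and
    conjunction. *)
Lemma lor_add_land x y : Nat.lor x y + Nat.land x y = x + y.
Proof.
  assert (G : forall W x y, x < 2 ^ W -> y < 2 ^ W -> Nat.lor x y + Nat.land x y = x + y).
  { clear. induction W; intros x y Hx Hy.
    - simpl in *. replace x with 0 by lia. replace y with 0 by lia. reflexivity.
    - assert (Ex : x = x mod 2 + 2 ^ 1 * (x / 2)) by (pose proof (Nat.div_mod_eq x 2); rewrite Nat.pow_1_r; lia).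
      assert (Ey : y = y mod 2 + 2 ^ 1 * (y / 2)) by (pose proof (Nat.div_mod_eq y 2); rewrite Nat.pow_1_r; lia).
      assert (Lx : x mod 2 < 2) by (apply Nat.mod_upper_bound; auto).
      assert (Ly : y mod 2 < 2) by (apply Nat.mod_upper_bound; auto).
      assert (Dx : x / 2 < 2 ^ W) by (apply Nat.Div0.div_lt_upper_bound; rewrite Nat.pow_succ_r' in Hx; auto).
      assert (Dy : y / 2 < 2 ^ W) by (apply Nat.Div0.div_lt_upper_bound; rewrite Nat.pow_succ_r' in Hy; auto).
      specialize (IHW _ _ Dx Dy).
      set (a := x mod 2) in *. set (A := x / 2) in *. set (b := y mod 2) in *. set (B := y / 2) in *.
      rewrite Ex, Ey, lor_join, land_join by (rewrite Nat.pow_1_r; auto).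
      assert (Nat.lor a b + Nat.land a b = a + b).
      { clearbody a b. destruct a as [|[|?]], b as [|[|?]]; try lia; reflexivity. }
      rewrite Nat.pow_1_r. lia. }
  apply (G (x + y)).
  - pose proof (lt_pow2 (x + y)); lia.
  - pose proof (lt_pow2 (x + y)); lia.
Qed.

Lemma lnot_add n x : x < 2 ^ n -> Nat.lnot x n + x = 2 ^ n - 1.
Proof.
  intros. destruct (Nat.eq_dec x 0) as [->|Z].
  - rewrite Nat.lnot_0_l, Nat.ones_equiv. lia.
  - rewrite Nat.lnot_sub_low, Nat.ones_equiv by (apply Nat.log2_lt_pow2; lia). lia.
Qed.

Lemma val_lt n i x y : 0 < n -> x < 2 ^ n -> y < 2 ^ n -> val n i x y < 2 ^ n.
Proof.
  intros Hn Hx Hy. pose proof (pow2_pos n). pose proof (lt_pow2 n).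
  assert (1 < 2 ^ n) by (apply Nat.pow_gt_1; lia).
  unfold val. destruct i; simpl; auto; try lia.
  - apply Nat.mod_upper_bound; auto.
  - apply Nat.mod_upper_bound; auto.
  - eapply Nat.le_lt_trans; [|exact Hx].
    destruct y; [simpl; lia|]. apply Nat.Div0.div_le_upper_bound. nia.
  - eapply Nat.le_lt_trans; [apply Nat.land_le_l|auto].
  - apply lor_lt_pow2; auto.
  - pose proof (lnot_add n x Hx). lia.
Qed.

(** The initial words have rank 12. A step costs [2 * lam + 40] for an operation, of which
    exponentiation is the most expensive, and [c + 60] for the branching. *)
Definition run_rank (c T lam : nat) : nat := 12 + T * (2 * lam + 40 + c + 60) + 1.

Section ShortWords.
  Variables (C : cls) (n nu c lam : nat).
  Notation X := (2 ^ cbe C).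
  (** The constant [n] itself has to be written in formulas; as a power of two it is a single
      run. *)
  Hypothesis Hnu : n = 2 ^ nu.
  Hypothesis Hn0 : 16 < n.
  Hypothesis Hn : 2 * n + 2 <= cbe C.
  Hypothesis HL : 2 ^ lam < cbe C.
  Hypothesis HnL : n * 2 ^ lam < cbe C.
  Hypothesis Hn2 : n + 2 <= 2 ^ 2 ^ lam.
  Hypothesis Hc : c + 22 <= cmf C 0.
  Hypothesis Hcb : c + 22 <= cbe C.

  Let X2 : 2 ^ (2 * n) < X.
  Proof. apply pow2_lt; lia. Qed.
  Let X1 : 2 ^ n < X.
  Proof. apply pow2_lt; lia. Qed.
  Let Xn : n < X.
  Proof. eapply Nat.lt_trans; [apply lt_pow2|auto]. Qed.

  Lemma Ds_word i : D C 0 (fun e => e i = 2 ^ n).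
  Proof. apply D_pow2c; lia. Qed.
  Lemma Ds_n i : D C 0 (fun e => e i = n).
  Proof.
    assert (nu < n) by (rewrite Hnu; apply lt_pow2).
    eapply D_ext; [|apply (D_pow2c C i nu); lia]. intros e _; cbv beta. rewrite Hnu; tauto.
  Qed.
  Lemma Ds_small i q : q < c + 22 -> D C 0 (fun e => e i = q).
  Proof.
    intros. apply D_cst.
    - eapply Nat.lt_le_trans; [apply lt_pow2|]. apply pow2_le. lia.
    - eapply IO_mono; [apply IO_small|lia].
  Qed.
  Hint Resolve Ds_word Ds_n : dd.

  Lemma Ds_isword i : D C 6 (fun e => e i < 2 ^ n).
  Proof.
    dby (fun e => exists w, w < X /\ (w = 2 ^ n /\ e i < w)).
    intros e He. split; [intros (w & _ & -> & L); auto|intros L; exists (2 ^ n); auto].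
  Qed.
  Hint Resolve Ds_isword : dd.

  Lemma Ds_max i : D C 4 (fun e => e i = 2 ^ n - 1).
  Proof.
    dby (fun e => exists w, w < X /\ (w = 2 ^ n /\ e i + 1 = w)).
    intros e He. pose proof (pow2_pos n).
    split; [intros (w & _ & -> & L); lia|intros L; exists (2 ^ n); repeat split; auto; lia].
  Qed.
  Hint Resolve Ds_max : dd.

  Let A := 2 * lam + 40.

  Lemma Ds_pow i j : D C (2 * lam + 20) (fun e => e j < 2 ^ n /\ 2 ^ (e i) = e j).
  Proof. apply D_pow2; auto. Qed.
  Hint Resolve Ds_pow : dd.

  Lemma Ds_arith ins i j l : arith n ins 0 0 <> None ->
    D C (2 * lam + 30) (fun e => (e i < 2 ^ n /\ e j < 2 ^ n) /\ val n ins (e i) (e j) = e l).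
  Proof.
    intros Hins.
    assert (Add_ : D C 20 (fun e => (e i < 2 ^ n /\ e j < 2 ^ n) /\ (e i + e j) mod 2 ^ n = e l)).
    { dby (fun e => (e i < 2 ^ n /\ e j < 2 ^ n) /\
        exists t, t < X /\ (e i + e j = t /\ exists w, w < X /\ (w = 2 ^ n /\ t mod w = e l))).
      intros e He. split.
      - intros (G & t & _ & <- & w & _ & -> & E); auto.
      - intros (G & E). split; auto. exists (e i + e j).
        assert (2 ^ n + 2 ^ n <= 2 ^ (2 * n)).
        { replace (2 ^ n + 2 ^ n) with (2 ^ S n) by (simpl; lia). apply pow2_le. lia. }
        split; [lia|]. split; auto. exists (2 ^ n); auto. }
    assert (Mul_ : D C 20 (fun e => (e i < 2 ^ n /\ e j < 2 ^ n) /\ (e i * e j) mod 2 ^ n = e l)).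
    { dby (fun e => (e i < 2 ^ n /\ e j < 2 ^ n) /\
        exists t, t < X /\ (e i * e j = t /\ exists w, w < X /\ (w = 2 ^ n /\ t mod w = e l))).
      intros e He. split.
      - intros (G & t & _ & <- & w & _ & -> & E); auto.
      - intros (G & E). split; auto. exists (e i * e j).
        assert (e i * e j < 2 ^ (n + n)) by (apply mul_lt_pow2; tauto).
        replace (n + n) with (2 * n) in H by lia.
        split; [lia|]. split; auto. exists (2 ^ n); auto. }
    unfold val.
    destruct ins; try (exfalso; apply Hins; reflexivity); cbn [arith].
    - eapply D_mono; [exact Add_|lia].
    - eapply D_mono; [exact Mul_|lia].
    - dby (fun e => (e i < 2 ^ n /\ e j < 2 ^ n) /\ e l = 0). intros; lia.
    - dby (fun e => (e i < 2 ^ n /\ e j < 2 ^ n) /\ e l = 1). intros; lia.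
    - dby (fun e => (e i < 2 ^ n /\ e j < 2 ^ n) /\ e l = n). intros; lia.
    - dby (fun e => (e i < 2 ^ n /\ e j < 2 ^ n) /\ e l = 2 ^ n - 1). intros; lia.
    - dby (fun e => (e i < 2 ^ n /\ e j < 2 ^ n) /\
        ((e l < 2 ^ n /\ 2 ^ (e i) = e l) \/
         (exists w, w < X /\ (w = n /\ w <= e i)) /\ e l = 2 ^ n - 1)).
      intros e He. split.
      + intros (G & [(L & E)|((w & _ & -> & L) & E)]); split; auto.
        * rewrite E. lia.
        * rewrite E. apply Nat.min_r. pose proof (pow2_le n (e i) L). lia.
      + intros (G & E). split; auto. destruct (Nat.lt_ge_cases (e i) n) as [L|L].
        * left. apply pow2_lt in L. lia.
        * right. split; [exists n; auto|]. apply pow2_le in L. lia.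
    - dby (fun e => (e i < 2 ^ n /\ e j < 2 ^ n) /\ e i / e j = e l). tauto.
    - dby (fun e => (e i < 2 ^ n /\ e j < 2 ^ n) /\
        ((e i <= e j /\ e l = e j) \/ (e j <= e i /\ e l = e i))). intros; lia.
    - dby (fun e => (e i < 2 ^ n /\ e j < 2 ^ n) /\
        ((e i <= e j /\ e l = e i) \/ (e j <= e i /\ e l = e j))). intros; lia.
    - dby (fun e => (e i < 2 ^ n /\ e j < 2 ^ n) /\ Nat.land (e i) (e j) = e l). tauto.
    - dby (fun e => (e i < 2 ^ n /\ e j < 2 ^ n) /\
        exists t, t < X /\ (Nat.land (e i) (e j) = t /\
        exists s, s < X /\ (e l + t = s /\ e i + e j = s))).
      intros e He. split.
      + intros (G & t & _ & <- & s & _ & E1 & E2). split; auto. pose proof (lor_add_land (e i) (e j)). lia.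
      + intros (G & E). split; auto. exists (Nat.land (e i) (e j)).
        split; [eapply Nat.le_lt_trans; [apply Nat.land_le_l|apply He]|]. split; auto.
        exists (e i + e j). pose proof (lor_add_land (e i) (e j)).
        assert (2 ^ n + 2 ^ n <= 2 ^ (2 * n)).
        { replace (2 ^ n + 2 ^ n) with (2 ^ S n) by (simpl; lia). apply pow2_le. lia. }
        repeat split; lia.
    - dby (fun e => (e i < 2 ^ n /\ e j < 2 ^ n) /\
        exists t, t < X /\ (t = 2 ^ n - 1 /\ e l + e i = t)).
      intros e He. split.
      + intros (G & t & _ & -> & E). split; auto. pose proof (lnot_add n (e i)). lia.
      + intros (G & E). split; auto. exists (2 ^ n - 1). pose proof (lnot_add n (e i)).
        repeat split; lia.
  Qed.

  Definition KnS (k : nat) (v : nat -> nat) : Prop :=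
    (forall z, v z < 2 ^ n) /\ forall i j, D C k (fun e => v (e i) = e j).

  Lemma KnS_mono i j v : KnS i v -> i <= j -> KnS j v.
  Proof. intros (B & H) L. split; auto. intros; eapply D_mono; eauto. Qed.

  Lemma KnS_arith k ins u v : arith n ins 0 0 <> None -> KnS k u -> KnS k v ->
    KnS (k + A) (fun z => val n ins (u z) (v z)).
  Proof.
    intros Hi (Bu & Hu) (Bv & Hv). split; [intros; apply val_lt; auto; lia|].
    intros i j.
    assert (Da := fun i j l => Ds_arith ins i j l Hi).
    dby (fun e => exists x, x < X /\ (u (e i) = x /\ exists y, y < X /\ (v (e i) = y /\
           ((x < 2 ^ n /\ y < 2 ^ n) /\ val n ins x y = e j)))).
    intros e He. split.
    - intros (x & _ & <- & y & _ & <- & _ & E). auto.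
    - intros E. exists (u (e i)). split; [specialize (Bu (e i)); lia|]. split; auto.
      exists (v (e i)). split; [specialize (Bv (e i)); lia|]. repeat split; auto.
  Qed.

  Lemma KnS_const k v q i : KnS k v -> q < c + 22 -> D C (k + A) (fun e => v (e i) = q).
  Proof.
    intros (Bv & Hv) Hq. assert (Dq := fun i => Ds_small i q Hq).
    dby (fun e => exists x, x < X /\ (v (e i) = x /\ x = q)).
    intros e He. split.
    - intros (x & _ & <- & E). auto.
    - intros E. exists (v (e i)). split; auto. specialize (Bv (e i)); lia.
  Qed.

  Lemma KnS_nz k v i : KnS k v -> D C (k + A) (fun e => v (e i) <> 0).
  Proof.
    intros (Bv & Hv).
    dby (fun e => exists x, x < X /\ (v (e i) = x /\ x <> 0)).
    intros e He. split.
    - intros (x & _ & <- & E). auto.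
    - intros E. exists (v (e i)). split; auto. specialize (Bv (e i)); lia.
  Qed.

  (** Negation does not occur here, since this formula is what makes negation definable. The
      reduction modulo [2 ^ n] turns an arbitrary value of the variable into a word. *)
  Theorem D_run_short Q o T i : is_program Q -> o < c + 22 ->
    D C (run_rank c T lam)
      (fun e => accepts n c o T (init Q [e i mod 2 ^ n])).
  Proof.
    intros HQ Ho.
    pose (S := PState (fun i _ => nth i Q 0) 0 (fun _ => 0) (fun _ => 0) (fun _ => 0)
                 [fun z => z mod 2 ^ n] []).
    assert (K0 : forall q, q < c + 22 -> q < 2 ^ n -> KnS 12 (fun _ => q)).
    { intros q Hq Hq2. split; auto. intros a b.
      eapply D_ext; [|eapply D_mono; [apply (Ds_small b q Hq)|lia]].
      intros e _; cbv beta. split; auto. }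
    apply (D_accepts C n c o A KnS KnS_mono KnS_arith KnS_const KnS_nz Ho T 12 S i).
    assert (22 < 2 ^ n). { assert (2 ^ 16 < 2 ^ n) by (apply pow2_lt; lia).
      assert (2 ^ 5 <= 2 ^ 16) by (apply pow2_le; lia). simpl (2 ^ 5) in *. lia. }
    assert (Nq : forall q, nth q Q 0 < 22).
    { intros q. destruct (Nat.lt_ge_cases q (length Q)) as [L|L].
      - unfold is_program in HQ. rewrite Forall_forall in HQ. apply (HQ (nth q Q 0)). apply nth_In; auto.
      - rewrite nth_overflow by auto. lia. }
    unfold known; simpl. split; [intros q _; specialize (Nq q); apply K0; lia|].
    do 3 (split; [apply K0; lia|]). split.
    - constructor; [|constructor]. split; [intros; apply Nat.mod_upper_bound; auto|].
      intros a b.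
      dby (fun e => exists w, w < X /\ (w = 2 ^ n /\ e a mod w = e b)).
      intros e He. split; [intros (w & _ & -> & E); auto|intros E; exists (2 ^ n); auto].
    - constructor.
  Qed.
End ShortWords.

(** * Elimination of negation *)

Lemma pow_le_mono3 i j : i <= j -> 3 ^ i <= 3 ^ j.
Proof. intros; apply Nat.pow_le_mono_r; lia. Qed.

(** The class of positive formulas: widths and constants do not grow with the rank, and a connective
    at most triples the bound on the size. *)
Definition flat_cls (b m k : nat) (Hb : 1 <= b) (Hm : 1 <= m) : cls.
Proof.
  refine (Cls b k (fun _ => b) (fun k => 3 ^ (k + 1)) (fun _ => m) _ _ _ _ _ _ _ _); auto.
  - intros; apply pow_le_mono3; lia.
  - intros i. replace (S i + 1) with (S (i + 1)) by lia. rewrite Nat.pow_succ_r'.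
    pose proof (pow_le_mono3 0 (i + 1)). simpl (3 ^ 0) in *. lia.
Defined.

Lemma flat_elim b m k Hb Hm R : D (flat_cls b m k Hb Hm) k R -> PD b b (3 ^ (k + 1)) m R.
Proof. intros H. exact (D_elim _ _ _ H (le_n k)). Qed.

Lemma PD_atom be b m o i j k : PD be b 1 m (fun e => op3_rel o (e i) (e j) (e k)).
Proof. exists (PAtom o i j k). simpl. repeat split; auto. Qed.

Lemma PD_cst be b m i q : q < 2 ^ b -> IO m q -> PD be b 1 m (fun e => e i = q).
Proof. intros. exists (PCst i q). simpl. repeat split; auto. Qed.

(** Horner's scheme, with one product by [2 ^ H] per variable. The shift [d] counts the quantifiers
    under which the variables are read. *)
Lemma PD_lin H b m : H < b -> 1 <= m -> forall vs i d,
  PD b b (20 * length vs + 1) m (fun e => e i = catf H (length vs) (fun q => e (nth q vs 0 + d))).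
Proof.
  intros HH Hm. induction vs as [|v vs IH]; intros i d.
  - simpl. apply PD_cst; auto. apply IO_0.
  - pose (Rt := fun (e : nat -> nat) t => t = catf H (length vs) (fun q => e (nth q vs 0 + d)) /\
       exists p, p < 2 ^ b /\ (p = 2 ^ H /\ exists u, u < 2 ^ b /\ (p * t = u /\ e (v + d) + u = e i))).
    apply (PD_ext b b _ m (fun e => exists t, t < 2 ^ b /\ Rt e t)).
    + intros e He. unfold Rt. simpl catf. split.
      * intros (t & _ & Et & p & _ & -> & u & _ & Eu & E).
        rewrite <- E, <- Eu, Et. reflexivity.
      * intros E. set (t := catf H (length vs) (fun q => e (nth q vs 0 + d))) in *.
        pose proof (pow2_pos H). specialize (He i).
        exists t. split; [nia|]. split; auto.
        exists (2 ^ H). split; [apply pow2_lt; auto|]. split; auto.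
        exists (2 ^ H * t). split; [nia|]. split; auto.
    + eapply PD_mono; [apply PD_ex; auto|auto|auto| |auto].
      * unfold Rt. apply PD_and.
        -- eapply PD_ext; [|apply (IH 0 (S d))]. intros e _. cbv beta.
           rewrite (catf_ext H (length vs) (fun q => e (nth q vs 0 + S d)) (fun q => e (S (nth q vs 0 + d))));
             [reflexivity|]. intros; f_equal; lia.
        -- apply PD_ex; auto. apply PD_and.
           ++ apply PD_cst; [apply pow2_lt; auto|]. eapply IO_mono; [apply IO_pow2|auto].
           ++ apply PD_ex; auto. apply PD_and; [apply (PD_atom _ _ _ OMul)|apply (PD_atom _ _ _ OAdd)].
      * simpl length. lia.
Qed.

Definition decides (c : nat) (Q : list nat) (T N0 NT : nat) : Prop :=
  is_program Q /\ forall n a, N0 <= n -> n <= NT -> 16 < n -> a < 2 ^ n ->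
    uses_only n c Q [a] /\
    (exists y, (y = 0 \/ y = 1) /\ outputs_within n Q [a] T y) /\
    ((exists x, x < 2 ^ n /\ chk n x a) <-> outputs n Q [a] 0).

(** The output of [Q] is 0 or 1, so the failure of an existential statement is the existence of a
    run with output 1, which is expressible positively. *)
Lemma decides_accepts c Q T N0 NT n a : decides c Q T N0 NT ->
  N0 <= n -> n <= NT -> 16 < n -> a < 2 ^ n ->
  ~ (exists x, x < 2 ^ n /\ chk n x a) <-> accepts n c 1 T (init Q [a]).
Proof.
  intros (_ & H) L1 L2 L3 La. destruct (H n a L1 L2 L3 La) as (U & (y & Y & O) & E).
  rewrite accepts_outputs by auto. rewrite E. split.
  - intros NO. destruct Y as [->| ->]; auto. exfalso; apply NO. eexists; eauto.
  - intros O1 O0. assert (1 = 0) by (eapply outputs_unique; [eexists; exact O1|exact O0]). discriminate.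
Qed.

Section Negation.
  Variables (c : nat) (Q : list nat) (T N0 NT : nat).
  Hypothesis HQ : decides c Q T N0 NT.

  (** The new formula computes the parameter [K + u] of the question whether [R e] holds, [u] being
      concatenated from the values of the free variables, and says that [Q] outputs 1 on it. At most
      [3 * s + 1] variables with 20 symbols each account for [60 * s]; the constant [K] accounts for
      the runs. The free variables keep their bound [b0]; only the inner quantifiers widen to
      [b']. *)
  Lemma PD_not b0 b s m R n nu lam b' : PD b0 b s m R -> 1 <= b -> b0 <= b ->
    n = 2 ^ nu -> 16 < n -> N0 <= n -> n <= NT ->
    3000 * (2 * b + 1) * (s * s * s) <= n / 16 ->
    2 * n + 2 <= b' -> 2 ^ lam < b' -> n * 2 ^ lam < b' -> n + 2 <= 2 ^ 2 ^ lam -> c + 22 <= b' ->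
    PD b0 b' (60 * s + 40 + 3 ^ (run_rank c T lam + 1)) (300 * (s * (m + 1)) + c + 22) (fun e => ~ R e).
  Proof.
    intros (f & Sz & Wd & Io & E) Hb Hb0 Hnu H16 L1 L2 Hlen B1 B2 B3 B4 B5.
    destruct (chk_universal f n b s m Sz Hb Wd Io Hlen) as (K & vs & Lv & _ & IK & _ & U).
    assert (Hs : 1 <= s) by (pose proof (psize_pos f); lia).
    assert (Hbn : 2 * b + 1 < n).
    { assert (n / 16 <= n) by (apply Nat.Div0.div_le_upper_bound; lia). nia. }
    set (m' := 300 * (s * (m + 1)) + c + 22).
    assert (KL : K < 2 ^ n).
    { destruct (U (fun _ => 0) (fun _ => pow2_pos b)) as [UL _]. lia. }
    assert (Hb1 : 1 <= b') by lia. assert (Hm1 : 1 <= m') by (unfold m'; lia).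
    pose (C := flat_cls b' m' (run_rank c T lam) Hb1 Hm1).
    pose (Rf := fun (e : nat -> nat) a => accepts n c 1 T (init Q [a mod 2 ^ n])).
    assert (RF : PD b' b' (3 ^ (run_rank c T lam + 1)) m' (fun e => accepts n c 1 T (init Q [e 0 mod 2 ^ n]))).
    { assert (Hm' : c + 22 <= cmf C 0) by (change (cmf C 0) with m'; unfold m'; lia).
      assert (H1 : 1 < c + 22) by lia.
      apply (flat_elim b' m' (run_rank c T lam) Hb1 Hm1). fold C.
      exact (D_run_short C n nu c lam Hnu H16 B1 B2 B3 B4 Hm' B5 Q 1 T 0 (proj1 HQ) H1). }
    pose (R1 := fun (e : nat -> nat) a => (exists u, u < 2 ^ b' /\
        (u = catf (2 * b + 1) (length vs) (fun q => e (nth q vs 0 + 0)) /\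
         exists k, k < 2 ^ b' /\ (k = K /\ k + u = a))) /\ Rf e a).
    apply (PD_ext b0 b' _ m' (fun e => exists a, a < 2 ^ n /\ R1 e a)).
    - intros e He.
      assert (Heb : forall i, e i < 2 ^ b) by (intros; eapply lt_pow2_mono; [apply He|auto]).
      destruct (U e Heb) as [UL US]. rewrite <- E by auto. rewrite <- US.
      set (v := catf (2 * b + 1) (length vs) (fun q => e (nth q vs 0))) in *.
      assert (Ev : catf (2 * b + 1) (length vs) (fun q => e (nth q vs 0 + 0)) = v)
        by (apply catf_ext; intros; f_equal; lia).
      rewrite (decides_accepts c Q T N0 NT n (K + v) HQ) by auto.
      unfold R1, Rf. rewrite Ev. split.
      + intros (a & La & (u & _ & -> & k & _ & -> & <-) & A). rewrite Nat.mod_small in A; auto.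
      + intros A. exists (K + v). split; auto. rewrite Nat.mod_small by auto. split; auto.
        assert (2 ^ n <= 2 ^ b') by (apply pow2_le; lia).
        exists v. split; [lia|]. split; auto. exists K. repeat split; auto. lia.
    - apply (PD_mono b' b' (1 + (1 + (1 + (1 + (20 * length vs + 1) + (1 + (1 + 1 + 1)))) + 3 ^ (run_rank c T lam + 1))) m');
        auto; try lia.
      apply PD_ex; try lia. unfold R1. apply PD_and; [|exact RF].
      apply PD_ex; auto. apply PD_and.
      + eapply PD_ext; [|apply (PD_lin (2 * b + 1) b' m' ltac:(lia) ltac:(unfold m'; lia) vs 0 2)].
        intros e _. cbv beta.
        rewrite (catf_ext (2 * b + 1) (length vs) (fun q => e (nth q vs 0 + 2)) (fun q => e (S (S (nth q vs 0 + 0)))));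
          [reflexivity|]. intros; f_equal; lia.
      + apply PD_ex; auto. apply PD_and.
        * apply PD_cst; [eapply lt_pow2_mono; [exact KL|lia]|]. eapply IO_mono; [exact IK|unfold m'; lia].
        * apply (PD_atom _ _ _ OAdd).
  Qed.
End Negation.

(** * The class of relations definable with negation *)

Section BigClass.
  Variables (c : nat) (Q : list nat) (T N0 NT : nat).
  Hypothesis HQ : decides c Q T N0 NT.
  (* [2 ^ B0] bounds the variables, [2 ^ W0] is the growth of the width per rank,
     [2 ^ Y0] the ratio between word length and width, [S0] the growth of the size. *)
  Variables (B0 W0 Y0 S0 lam kmax : nat).
  Hypothesis HS0 : 100 + 3 ^ (run_rank c T lam + 1) <= S0.
  Hypothesis HS1 : 3 ^ (2 * lam + 21) <= S0.
  Hypothesis HY : 48 * 3000 * (S0 ^ (kmax + 1) * S0 ^ (kmax + 1) * S0 ^ (kmax + 1)) <= 2 ^ Y0.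
  Hypothesis HW : 2 + Y0 + lam + 1 <= W0.
  Hypothesis HW2 : 600 * S0 ^ (kmax + 1) + 1 <= 2 ^ W0.
  Hypothesis HB : N0 <= 2 ^ B0.
  Hypothesis HB2 : c + 22 <= 2 ^ B0.
  Hypothesis HNT : 2 ^ (B0 + W0 * kmax + Y0) <= NT.
  Hypothesis Hlam : NT + 2 <= 2 ^ 2 ^ lam.

  Definition bw (k : nat) : nat := 2 ^ (B0 + W0 * k).

  Let S1 : 100 <= S0.
  Proof. lia. Qed.

  (** The variables of the described relations stay below [2 ^ 2 ^ B0] at every rank. Only the words
      over which eliminated negations quantify get longer. *)
  Definition big_cls : cls.
  Proof.
    refine (Cls (2 ^ B0) kmax bw (fun k => S0 ^ (k + 1)) (fun k => (c + 22) * 2 ^ (W0 * k)) _ _ _ _ _ _ _ _).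
    - intros. apply pow2_le. nia.
    - intros. apply Nat.pow_le_mono_r; lia.
    - intros. apply Nat.mul_le_mono_l, pow2_le. nia.
    - unfold bw. rewrite Nat.mul_0_r, Nat.add_0_r. auto.
    - apply pow2_pos.
    - rewrite Nat.mul_0_r. simpl. lia.
    - simpl. lia.
    - intros i. replace (S i + 1) with (S (i + 1)) by lia. rewrite Nat.pow_succ_r'.
      assert (1 <= S0 ^ (i + 1)) by (apply Nat.neq_0_lt_0, Nat.pow_nonzero; lia). nia.
  Defined.

  (** A formula of width [b] and size [s] is turned into a question on words of length
      [n = b * 2 ^ Y0], where [2 ^ Y0] absorbs the factor [s * s * s] of the packing. Describing [Q]
      on such words takes numbers of about [n * 2 ^ lam] bits, because of exponentiation, and
      [b * 2 ^ W0] exceeds this. The number of runs is multiplied by at most [600 * s + 1], again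
      within [2 ^ W0]. *)
  Theorem D_not k R : D big_cls k R -> D big_cls (S k) (fun e => ~ R e).
  Proof.
    intros H. apply D_intro. intros Hk. simpl ckmax in Hk.
    assert (H' : PD (2 ^ B0) (bw k) (S0 ^ (k + 1)) ((c + 22) * 2 ^ (W0 * k)) R)
      by (apply (D_elim _ _ _ H); simpl; lia).
    clear H.
    set (b := bw k) in *. set (s := S0 ^ (k + 1)) in *. set (m := (c + 22) * 2 ^ (W0 * k)) in *.
    assert (Hs1 : 1 <= s) by (apply Nat.neq_0_lt_0, Nat.pow_nonzero; lia).
    assert (Hs : s <= S0 ^ (kmax + 1)) by (apply Nat.pow_le_mono_r; lia).
    assert (Ebw : bw (S k) = b * 2 ^ W0).
    { unfold b, bw. rewrite <- Nat.pow_add_r. f_equal. lia. }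
    assert (Hb : 1 <= b) by apply pow2_pos.
    assert (EW : 2 ^ (2 + Y0 + lam + 1) <= 2 ^ W0) by (apply pow2_le; auto).
    rewrite !Nat.pow_add_r in EW. change (2 ^ 2) with 4 in EW. change (2 ^ 1) with 2 in EW.
    assert (Hn : b * 2 ^ Y0 = 2 ^ (B0 + W0 * k + Y0)) by (unfold b, bw; rewrite <- Nat.pow_add_r; auto).
    set (n := b * 2 ^ Y0) in *.
    assert (sss : s * s * s <= S0 ^ (kmax + 1) * S0 ^ (kmax + 1) * S0 ^ (kmax + 1))
      by (repeat apply Nat.mul_le_mono; auto).
    set (S3 := S0 ^ (kmax + 1) * S0 ^ (kmax + 1) * S0 ^ (kmax + 1)) in *.
    assert (s3 : 1 <= s * s * s) by nia.
    assert (Hnb : 48 * 3000 * (b * (s * s * s)) <= n).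
    { unfold n. rewrite Nat.mul_assoc, (Nat.mul_comm (48 * 3000)), <- Nat.mul_assoc.
      apply Nat.mul_le_mono_l. lia. }
    assert (n16 : 9 * 1000 * (b * (s * s * s)) <= n / 16).
    { apply Nat.div_le_lower_bound; lia. }
    assert (Hbs : b <= b * (s * s * s)) by (apply Nat.le_mul_r; lia).
    assert (HnT : n <= NT).
    { rewrite Hn. eapply Nat.le_trans; [|exact HNT]. apply pow2_le. nia. }
    assert (B0b : 2 ^ B0 <= b) by (apply pow2_le; lia).
    assert (W4 : n * (4 * 2 ^ lam * 2) <= bw (S k)).
    { rewrite Ebw. unfold n. rewrite <- Nat.mul_assoc. apply Nat.mul_le_mono_l.
      eapply Nat.le_trans; [|exact EW]. lia. }
    pose proof (pow2_pos lam).
    assert (W5 : n * 2 ^ lam * 8 <= bw (S k)) by lia.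
    assert (W6 : n <= n * 2 ^ lam) by (apply Nat.le_mul_r; lia).
    assert (W7 : 2 ^ lam <= n * 2 ^ lam) by (apply Nat.le_mul_l; lia).
    assert (n16' : 3000 * (2 * b + 1) * (s * s * s) <= n / 16).
    { eapply Nat.le_trans; [|exact n16].
      replace (9 * 1000 * (b * (s * s * s))) with (3000 * (3 * b) * (s * s * s)) by lia.
      apply Nat.mul_le_mono_r, Nat.mul_le_mono_l. lia. }
    eapply PD_mono.
    - eapply (PD_not c Q T N0 NT HQ (2 ^ B0) b s m R n (B0 + W0 * k + Y0) lam (bw (S k))); auto; try lia.
    - simpl; auto.
    - simpl; auto.
    - change (csf big_cls (S k)) with (S0 ^ (S k + 1)).
      replace (S k + 1) with (S (k + 1)) by lia. rewrite Nat.pow_succ_r'. fold s.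
      set (P3 := 3 ^ (run_rank c T lam + 1)) in *.
      assert ((100 + P3) * s <= S0 * s) by (apply Nat.mul_le_mono_r; auto).
      assert (P3 <= P3 * s) by (apply Nat.le_mul_r; lia). lia.
    - change (cmf big_cls (S k)) with ((c + 22) * 2 ^ (W0 * S k)). replace (W0 * S k) with (W0 * k + W0) by lia. rewrite Nat.pow_add_r, Nat.mul_assoc.
      fold m. assert (c + 22 <= m) by (apply Nat.le_mul_r; auto).
      assert (m * (600 * s + 1) <= m * 2 ^ W0) by (apply Nat.mul_le_mono_l; lia).
      assert (s <= s * m) by (apply Nat.le_mul_r; lia). lia.
  Qed.

  (** In a flat class this relation has rank [2 * lam + 20]. The resulting formula has size at most
      [S0], so in this class it costs a single rank. *)
  Lemma D_exp2 i j : D big_cls 1 (fun e => 2 ^ e i = e j).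
  Proof.
    apply D_intro. intros Hk. simpl ckmax in Hk.
    pose (b' := 2 ^ (B0 + lam + 1)).
    pose proof (pow2_pos B0). pose proof (pow2_pos lam).
    assert (Eb : b' = 2 ^ B0 * 2 ^ lam * 2) by (unfold b'; rewrite !Nat.pow_add_r; auto).
    pose (C := flat_cls b' 1 (2 * lam + 20) ltac:(apply pow2_pos) (le_n 1)).
    assert (L2 : 2 ^ B0 + 2 <= 2 ^ 2 ^ lam).
    { assert (2 ^ B0 <= NT); [|lia]. eapply Nat.le_trans; [|exact HNT]. apply pow2_le. nia. }
    assert (P : PD b' b' (3 ^ (2 * lam + 20 + 1)) 1 (fun e => e j < 2 ^ 2 ^ B0 /\ 2 ^ e i = e j)).
    { apply (D_elim C (2 * lam + 20)); [|simpl; lia]. apply D_pow2; simpl; nia. }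
    simpl cbe. eapply PD_ext; [|eapply PD_mono; [exact P| | | |]].
    - intros e He. cbv beta. specialize (He j). simpl in He. tauto.
    - simpl. nia.
    - simpl. unfold bw. apply pow2_le. lia.
    - change (csf big_cls 1) with (S0 ^ (1 + 1)). replace (2 * lam + 20 + 1) with (2 * lam + 21) by lia.
      eapply Nat.le_trans; [exact HS1|]. rewrite Nat.pow_add_r, !Nat.pow_1_r. nia.
    - change (cmf big_cls 1) with ((c + 22) * 2 ^ (W0 * 1)). pose proof (pow2_pos (W0 * 1)). nia.
  Qed.
End BigClass.

(** * Iteration of definable functions *)

(** With negation the definable relations are first-order over numbers of [cbe C] bits with
    exponentiation. The arithmetic of long words relies on this interface and not on how negation
    was obtained. *)
Class fo (C : cls) : Prop := {
  fo_not : forall k R, D C k R -> D C (S k) (fun e => ~ R e);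
  fo_exp : forall i j, D C 1 (fun e => 2 ^ e i = e j)
}.

Lemma D_neg C `{fo C} k R : D C k R -> D C (S k) (fun e => ~ R e).
Proof. apply fo_not. Qed.

Lemma D_imp C `{fo C} i j R R' : D C i R -> D C j R' -> D C (S (S (Nat.max i j))) (fun e => R e -> R' e).
Proof.
  intros H1 H2. eapply D_mono; [|apply le_n].
  eapply D_ext; [|eapply D_mono; [apply D_or; [apply fo_not, H1|apply H2]|lia]].
  intros e _; cbv beta. destruct (classic (R e)); tauto.
Qed.

Lemma D_all C `{fo C} k (R : (nat -> nat) -> nat -> Prop) :
  D C k (fun e => R (fun i => e (S i)) (e 0)) ->
  D C (S (S (S k))) (fun e => forall v, v < 2 ^ cbe C -> R e v).
Proof.
  intros H1. eapply D_ext; [|apply fo_not, (D_ex C (S k) (fun e v => ~ R e v)), fo_not, H1].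
  intros e _; cbv beta. split.
  - intros N v Hv. apply NNPP. intros K. apply N. exists v; auto.
  - intros A (v & Hv & K). apply K, A, Hv.
Qed.

#[global] Hint Resolve fo_exp : dd.

Ltac fstep := cbv beta; first
  [ solve [eauto 3 with dd]
  | eapply D_ex | eapply D_exb; [solve [eauto with dd | lia]|]
  | eapply D_and | eapply D_or | eapply D_neg | eapply D_all | eapply D_imp ].
Ltac fbuild := eapply D_mono; [repeat fstep|lia].
Ltac fby P := eapply (D_ext _ _ P); [|fbuild].

Section Iterate.
  Context (C : cls) `{FO : fo C}.
  Notation X := (2 ^ cbe C).

  Lemma D_pconst q i : q < cbe C -> D C 0 (fun e => e i = 2 ^ q).
  Proof. apply D_pow2c. Qed.

  Lemma D_lec q i : q < cbe C -> D C 3 (fun e => e i <= 2 ^ q).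
  Proof.
    intros Hq. assert (Hc := fun i => D_pconst q i Hq).
    fby (fun e => exists t, t < X /\ (t = 2 ^ q /\ e i <= t)).
    intros e He. split; [intros (t & _ & -> & L); auto|].
    intros L. exists (2 ^ q). repeat split; auto. apply pow2_lt; auto.
  Qed.

  Lemma D_ltc q i : q < cbe C -> D C 6 (fun e => e i < 2 ^ q).
  Proof.
    intros Hq. assert (Hc := fun i => D_pconst q i Hq).
    fby (fun e => exists t, t < X /\ (t = 2 ^ q /\ e i < t)).
    intros e He. split; [intros (t & _ & -> & L); auto|].
    intros L. exists (2 ^ q). repeat split; auto. apply pow2_lt; auto.
  Qed.

  Lemma D_mulc q i j : q < cbe C -> D C 2 (fun e => 2 ^ q * e i = e j).
  Proof.
    intros Hq. assert (Hc := fun i => D_pconst q i Hq).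
    fby (fun e => exists t, t < X /\ (t = 2 ^ q /\ t * e i = e j)).
    intros e He. split; [intros (t & _ & -> & L); auto|].
    intros L. exists (2 ^ q). repeat split; auto. apply pow2_lt; auto.
  Qed.

  Lemma D_divc q i j : q < cbe C -> D C 11 (fun e => e i / 2 ^ q = e j).
  Proof.
    intros Hq. assert (Hc := fun i => D_pconst q i Hq).
    fby (fun e => exists t, t < X /\ (t = 2 ^ q /\ e i / t = e j)).
    intros e He. split; [intros (t & _ & -> & L); auto|].
    intros L. exists (2 ^ q). repeat split; auto. apply pow2_lt; auto.
  Qed.

  Lemma D_modc q i j : q < cbe C -> D C 11 (fun e => e i mod 2 ^ q = e j).
  Proof.
    intros Hq. assert (Hc := fun i => D_pconst q i Hq).
    fby (fun e => exists t, t < X /\ (t = 2 ^ q /\ e i mod t = e j)).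
    intros e He. split; [intros (t & _ & -> & L); auto|].
    intros L. exists (2 ^ q). repeat split; auto. apply pow2_lt; auto.
  Qed.

  Definition field (q w j : nat) : nat := (w / 2 ^ (q * j)) mod 2 ^ q.

  (** The guard on the index belongs to the relation: beyond it the power [2 ^ (q * j)] could leave
      the range of the quantifiers. Many relations below carry such a guard. *)
  Lemma D_field a b w j v : 2 ^ a * 2 ^ b < cbe C ->
    D C 20 (fun e => e j <= 2 ^ b /\ field (2 ^ a) (e w) (e j) = e v).
  Proof.
    intros Hab. pose proof (pow2_pos a). pose proof (pow2_pos b).
    assert (A1 : a < cbe C) by (pose proof (lt_pow2 a); nia).
    assert (A2 : b < cbe C) by (pose proof (lt_pow2 b); nia).
    assert (A3 : 2 ^ a < cbe C) by nia.
    assert (L1 := fun i => D_lec b i A2). assert (L2 := fun i j => D_mulc a i j A1).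
    assert (L3 := fun i j => D_modc (2 ^ a) i j A3).
    fby (fun e => e j <= 2 ^ b /\ exists t, t < X /\ (2 ^ a * e j = t /\
      exists u, u < X /\ (2 ^ t = u /\ exists h, h < X /\ (e w / u = h /\ h mod 2 ^ 2 ^ a = e v)))).
    intros e He. unfold field. split.
    - intros (Lj & t & _ & <- & u & _ & <- & h & _ & <- & E). auto.
    - intros (Lj & E). split; auto. exists (2 ^ a * e j).
      assert (Lt : 2 ^ a * e j < cbe C) by nia.
      split; [eapply Nat.lt_trans; [exact Lt|apply lt_pow2]|]. split; auto.
      exists (2 ^ (2 ^ a * e j)). split; [apply pow2_lt; auto|]. split; auto.
      exists (e w / 2 ^ (2 ^ a * e j)). repeat split; auto.
      eapply Nat.le_lt_trans; [|apply (He w)]. apply Nat.Div0.div_le_upper_bound.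
      pose proof (pow2_pos (2 ^ a * e j)). nia.
  Qed.

  Section Rec.
    Variable phi : nat -> nat -> nat -> nat -> nat -> nat.

    Fixpoint rseq (a b c r0 i : nat) : nat :=
      match i with 0 => r0 | S i => phi a b c i (rseq a b c r0 i) end.

    (* [m] steps from index [i] on, stopping at the index [cnt]. *)
    Fixpoint itr (a b c cnt m i r : nat) : nat :=
      match m with
      | 0 => r
      | S m => let s := itr a b c cnt m i r in
               if i + m <? cnt then phi a b c (i + m) s else s
      end.

    Lemma itr_add a b c cnt m1 m2 i r :
      itr a b c cnt (m1 + m2) i r = itr a b c cnt m2 (i + m1) (itr a b c cnt m1 i r).
    Proof.
      induction m2; simpl.
      - rewrite Nat.add_0_r; auto.
      - rewrite Nat.add_succ_r. simpl. rewrite IHm2, Nat.add_assoc. auto.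
    Qed.

    Lemma itr_rseq a b c r0 cnt m : itr a b c cnt m 0 r0 = rseq a b c r0 (Nat.min m cnt).
    Proof.
      induction m; simpl; auto. rewrite IHm.
      destruct (Nat.ltb_spec m cnt).
      - rewrite !Nat.min_l by lia. destruct cnt; [lia|]. rewrite Nat.min_l by lia. auto.
      - rewrite Nat.min_r by lia. destruct cnt; auto. rewrite Nat.min_r by lia. auto.
    Qed.

    Variables (k qa ga : nat).
    Let q := 2 ^ qa.
    Let g0 := 2 ^ ga.
    Hypothesis Hphi : forall a b c i r v, D C k (fun e => phi (e a) (e b) (e c) (e i) (e r) = e v).
    Hypothesis Hbd : forall a b c i r, r < 2 ^ q -> phi a b c i r < 2 ^ q.
    Hypothesis Hw : q * g0 + q < cbe C.
    Hypothesis Hga : 10 * ga + 10 < cbe C.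

    Lemma itr_bd a b c cnt m i r : r < 2 ^ q -> itr a b c cnt m i r < 2 ^ q.
    Proof. intros; induction m; simpl; auto. destruct (_ <? _); auto. Qed.

    Let qpos : 0 < q.
    Proof. apply pow2_pos. Qed.
    Let qC : q < cbe C.
    Proof. nia. Qed.
    Let qX : 2 ^ q < X.
    Proof. apply pow2_lt; auto. Qed.
    Let wX : 2 ^ (q * (g0 + 1)) < X.
    Proof. apply pow2_lt. nia. Qed.

    Lemma D_room l : l <= 10 -> forall i, D C 8 (fun e => e i + g0 ^ l <= 2 ^ (10 * ga)).
    Proof.
      intros Hl i.
      assert (Gc := fun i => D_pconst (ga * l) i ltac:(nia)).
      assert (Lc := fun i => D_lec (10 * ga) i ltac:(lia)).
      assert (El : 2 ^ (ga * l) = g0 ^ l) by (unfold g0; rewrite Nat.pow_mul_r; auto).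
      fby (fun e => exists t, t < X /\ (t = 2 ^ (ga * l) /\ exists s, s < X /\ (e i + t = s /\ s <= 2 ^ (10 * ga)))).
      intros e He. rewrite El. assert (2 ^ (10 * ga) < X) by (apply pow2_lt; lia). split.
      - intros (t & _ & -> & s & _ & <- & L). auto.
      - intros L. exists (g0 ^ l). split; [lia|]. split; auto. exists (e i + g0 ^ l). repeat split; auto; lia.
    Qed.

    (** The [g0 ^ (l + 1)] steps are [g0] blocks of [g0 ^ l] steps. One witness packs the [g0 + 1]
        values between the blocks, [q] bits each, and a universal quantifier checks every block by
        the relation of the previous level. So each level adds a constant rank, and the witnesses
        never exceed [q * (g0 + 1)] bits. *)
    Lemma D_chain l : l <= 10 -> forall a b c cnt i r r',
      D C (k + 15 + 50 * l) (fun e => e r < 2 ^ q /\ (e i + g0 ^ l <= 2 ^ (10 * ga) /\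
        itr (e a) (e b) (e c) (e cnt) (g0 ^ l) (e i) (e r) = e r')).
    Proof.
      assert (Lq := fun i => D_ltc q i qC).
      induction l; intros Hl a b c cnt i r r'.
      - assert (Li := D_room 0 Hl).
        fby (fun e => e r < 2 ^ q /\ (e i + g0 ^ 0 <= 2 ^ (10 * ga) /\
          ((e i < e cnt /\ phi (e a) (e b) (e c) (e i) (e r) = e r') \/ (e cnt <= e i /\ e r' = e r)))).
        intros e He. rewrite Nat.pow_0_r. simpl itr. rewrite Nat.add_0_r.
        destruct (Nat.ltb_spec (e i) (e cnt)); split; intros (? & ? & E); repeat split; auto; lia.
      - assert (IH := IHl ltac:(lia)). clear IHl.
        assert (Li := D_room (S l) Hl).
        assert (F := fun w j v => D_field qa ga w j v ltac:(fold q g0; nia)).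
        assert (Lg := fun i => D_ltc ga i ltac:(lia)).
        assert (Mg := fun i j => D_mulc (ga * l) i j ltac:(nia)).
        assert (Gc := fun i => D_pconst ga i ltac:(lia)).
        fby (fun e => e r < 2 ^ q /\ (e i + g0 ^ S l <= 2 ^ (10 * ga) /\
          exists w, w < X /\
          ((exists z, z < X /\ (z = 0 /\ (z <= 2 ^ ga /\ field (2 ^ qa) w z = e r))) /\
          ((exists z, z < X /\ (z = 2 ^ ga /\ (z <= 2 ^ ga /\ field (2 ^ qa) w z = e r'))) /\
          forall j, j < X -> j < 2 ^ ga ->
            exists x, x < X /\ ((j <= 2 ^ ga /\ field (2 ^ qa) w j = x) /\
            exists y, y < X /\ ((exists j', j' < X /\ (j + 1 = j' /\ (j' <= 2 ^ ga /\ field (2 ^ qa) w j' = y))) /\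
            exists t, t < X /\ (2 ^ (ga * l) * j = t /\
            exists i', i' < X /\ (e i + t = i' /\
              (x < 2 ^ q /\ (i' + g0 ^ l <= 2 ^ (10 * ga) /\
               itr (e a) (e b) (e c) (e cnt) (g0 ^ l) i' x = y)))))))))).
        intros e He. fold q. fold g0.
        set (f := fun m => itr (e a) (e b) (e c) (e cnt) (g0 ^ l * m) (e i) (e r)).
        assert (El : 2 ^ (ga * l) = g0 ^ l) by (unfold g0; rewrite Nat.pow_mul_r; auto).
        rewrite El.
        assert (Ef : f g0 = itr (e a) (e b) (e c) (e cnt) (g0 ^ S l) (e i) (e r)).
        { unfold f. rewrite Nat.pow_succ_r', Nat.mul_comm. auto. }
        assert (fS : forall m, f (S m) = itr (e a) (e b) (e c) (e cnt) (g0 ^ l) (e i + g0 ^ l * m) (f m)).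
        { intros m. unfold f. rewrite Nat.mul_succ_r, itr_add. auto. }
        assert (f0 : f 0 = e r) by (unfold f; rewrite Nat.mul_0_r; auto).
        assert (gX : g0 < X).
        { apply Nat.lt_trans with (cbe C); [nia|apply lt_pow2]. }
        assert (GX : 2 ^ (10 * ga) < X) by (apply pow2_lt; lia).
        rewrite Nat.pow_succ_r' in *.
        split.
        + intros (Lr & Lei & w & _ & (z & _ & -> & _ & W0) & (z' & _ & -> & _ & Wg) & A).
          split; auto. split; auto. rewrite <- Ef, <- Wg.
          assert (G : forall m, m <= g0 -> field q w m = f m).
          { induction m; intros Hm; [rewrite W0, f0; auto|].
            destruct (A m ltac:(lia) Hm) as (x & _ & (_ & Ex) & y & _ & (j' & _ & <- & _ & Ey) & t & _ & <- &
              i' & _ & <- & _ & _ & E).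
            rewrite fS, <- IHm, Ex, E, <- Ey by lia. f_equal; lia. }
          symmetry. apply G; auto.
        + intros (Lr & Lei & E). split; auto. split; auto.
          assert (fq : forall m, f m < 2 ^ q) by (intros; apply itr_bd; auto).
          exists (catf q (g0 + 1) f). split; [eapply Nat.lt_trans; [apply catf_lt; auto|auto]|].
          assert (Fw : forall m, m <= g0 -> field q (catf q (g0 + 1) f) m = f m)
            by (intros; apply catf_nth; auto; lia).
          split; [exists 0; rewrite Fw by lia; repeat split; auto; lia|].
          split; [exists g0; rewrite Fw, Ef by lia; repeat split; auto; lia|].
          intros j _ Hj.
          assert (Lt : g0 ^ l * j + g0 ^ l <= g0 * g0 ^ l).
          { rewrite (Nat.mul_comm g0), <- Nat.mul_succ_r. apply Nat.mul_le_mono_l. lia. }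
          exists (f j). split; [specialize (fq j); lia|]. split; [rewrite Fw by lia; split; auto; lia|].
          exists (f (S j)). split; [specialize (fq (S j)); lia|]. split.
          { exists (j + 1). split; [lia|]. split; auto. split; [lia|]. rewrite Fw by lia. f_equal; lia. }
          exists (g0 ^ l * j). split; [lia|]. split; auto.
          exists (e i + g0 ^ l * j). split; [lia|]. split; auto. split; auto. split; [lia|]. auto.
    Qed.

    (** A full chain of [g0 ^ 10] steps is always described; the stopping index of [itr] cuts it to
        the wanted number of iterations. *)
    Theorem D_rec r0 : r0 < 2 -> forall a b c i v,
      D C (k + 560) (fun e => e i <= g0 ^ 10 /\ rseq (e a) (e b) (e c) r0 (e i) = e v).
    Proof.
      intros Hr a b c i v.
      assert (Ch := D_chain 10 (le_n _)).
      assert (Lc := fun i => D_lec (10 * ga) i ltac:(lia)).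
      assert (Hr0 : forall i, D C 0 (fun e => e i = r0)).
      { intros j. destruct r0 as [|[|?]]; [apply D_zero|apply D_one|lia]. }
      assert (E10 : g0 ^ 10 = 2 ^ (10 * ga)) by (unfold g0; rewrite <- Nat.pow_mul_r; f_equal; lia).
      fby (fun e => e i <= 2 ^ (10 * ga) /\ exists s, s < X /\ (s = r0 /\ exists z, z < X /\ (z = 0 /\
         (s < 2 ^ q /\ (z + g0 ^ 10 <= 2 ^ (10 * ga) /\
          itr (e a) (e b) (e c) (e i) (g0 ^ 10) z s = e v))))).
      intros e He. rewrite <- E10.
      assert (q2 : 2 <= 2 ^ q). { change 2 with (2 ^ 1) at 1. apply pow2_le. auto. }
      split.
      - intros (L & s & _ & -> & z & _ & -> & _ & _ & E). split; auto.
        rewrite itr_rseq, Nat.min_r in E by auto. auto.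
      - intros (L & E). split; auto. exists r0. split; [lia|]. split; auto.
        exists 0. split; [auto|]. split; auto. split; [lia|]. split; [lia|].
        rewrite itr_rseq, Nat.min_r by auto. auto.
    Qed.
  End Rec.
End Iterate.

(** * Polynomials and the discrete Fourier transform modulo [2 ^ M + 1] *)

Fixpoint sumf (n : nat) (f : nat -> nat) : nat :=
  match n with 0 => 0 | S n => sumf n f + f n end.

Lemma sumf_ext n f g : (forall i, i < n -> f i = g i) -> sumf n f = sumf n g.
Proof. induction n; intros H; simpl; auto. rewrite IHn, H by (intros; try apply H; lia); auto. Qed.

Lemma sumf_mul n c f : c * sumf n f = sumf n (fun i => c * f i).
Proof. induction n; simpl; [lia|]. rewrite <- IHn; lia. Qed.

Lemma sumf_plus n f g : sumf n f + sumf n g = sumf n (fun i => f i + g i).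
Proof. induction n; simpl; auto. rewrite <- IHn; lia. Qed.

Lemma sumf_swap n m (f : nat -> nat -> nat) :
  sumf n (fun i => sumf m (fun j => f i j)) = sumf m (fun j => sumf n (fun i => f i j)).
Proof.
  induction n; simpl.
  - induction m; simpl; auto. rewrite <- IHm; auto.
  - rewrite IHn, sumf_plus. auto.
Qed.

Lemma sumf_app a b f : sumf (a + b) f = sumf a f + sumf b (fun i => f (a + i)).
Proof. induction b; simpl; rewrite ?Nat.add_0_r, ?Nat.add_succ_r; auto. simpl. rewrite IHb; lia. Qed.

Lemma sumf_mod F n f g : (forall i, i < n -> f i mod F = g i mod F) -> sumf n f mod F = sumf n g mod F.
Proof.
  induction n; intros H; simpl; auto.
  rewrite (Nat.Div0.add_mod (sumf n f)), (Nat.Div0.add_mod (sumf n g)), IHn, H by (intros; try apply H; lia).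
  auto.
Qed.

Lemma sumf_one n k v : k < n -> sumf n (fun i => if i =? k then v else 0) = v.
Proof.
  intros H. assert (Z : forall m, m <= k -> sumf m (fun i => if i =? k then v else 0) = 0).
  { induction m; intros L; simpl; auto. rewrite IHm by lia. destruct (Nat.eqb_spec m k); lia. }
  induction n; [lia|]. simpl. destruct (Nat.eqb_spec n k) as [->|N].
  - rewrite Z; auto.
  - rewrite IHn by lia. lia.
Qed.

Lemma sumf_const n v : sumf n (fun _ => v) = n * v.
Proof. induction n; simpl; auto. rewrite IHn; lia. Qed.

Fixpoint peval (p : list nat) (x : nat) : nat :=
  match p with [] => 0 | c :: p => c + x * peval p x end.

Lemma peval_sumf p x : forall n, length p <= n -> peval p x = sumf n (fun i => nth i p 0 * x ^ i).
Proof.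
  induction p as [|c p IH]; intros n L.
  - simpl. symmetry. induction n; simpl in *; [reflexivity|]. rewrite IHn by lia.
    destruct n; reflexivity.
  - destruct n; simpl in L; [lia|]. simpl peval. rewrite (IH n) by lia.
    rewrite (sumf_app 1 n).
    replace (sumf 1 (fun i => nth i (c :: p) 0 * x ^ i)) with c by (simpl; lia). f_equal.
    rewrite sumf_mul. apply sumf_ext. intros i _. simpl. lia.
Qed.

Lemma coef_le p : forall i, nth i p 0 <= peval p 1.
Proof.
  induction p as [|c p IH]; intros [|i]; simpl; try lia. specialize (IH i). lia.
Qed.

(* The carry into position [k] when [peval p b] is written in base [b]. *)
Fixpoint carry (p : list nat) (b k : nat) : nat :=
  match k with 0 => 0 | S k => (carry p b k + nth k p 0) / b end.

Lemma carry_spec p b k : b <> 0 -> sumf k (fun i => nth i p 0 * b ^ i) / b ^ k = carry p b k.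
Proof.
  intros Hb. induction k; [reflexivity|]. cbn [sumf carry]. rewrite <- IHk.
  rewrite Nat.pow_succ_r', (Nat.mul_comm b), <- Nat.Div0.div_div.
  rewrite Nat.div_add by (apply Nat.pow_nonzero; auto). auto.
Qed.

Lemma carry_le p b : b <> 0 -> forall k, carry p b k <= peval p 1.
Proof.
  intros Hb k.
  assert (G : carry p b k <= sumf k (fun i => nth i p 0)).
  { induction k; simpl; auto. eapply Nat.le_trans; [apply Nat.Div0.div_le_upper_bound|].
    - instantiate (1 := carry p b k + nth k p 0). nia.
    - lia. }
  assert (S1 : forall k, sumf k (fun i => nth i p 0) <= peval p 1).
  { intros m. rewrite (peval_sumf p 1 (m + length p)) by lia.
    rewrite sumf_app, (sumf_ext m _ (fun i => nth i p 0 * 1 ^ i)); [lia|].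
    intros i _. rewrite Nat.pow_1_l. lia. }
  specialize (S1 k). lia.
Qed.

Lemma peval_digit p b k : b <> 0 ->
  (peval p b / b ^ k) mod b = (carry p b k + nth k p 0) mod b.
Proof.
  intros Hb. rewrite (peval_sumf p b (k + 1 + length p)) by lia.
  rewrite !sumf_app. cbn [sumf]. rewrite Nat.add_0_l, Nat.add_0_r.
  rewrite (sumf_ext (length p) _ (fun i => b ^ k * (b * (nth (k + 1 + i) p 0 * b ^ i)))).
  2:{ intros i _. rewrite !Nat.pow_add_r, Nat.pow_1_r. lia. }
  rewrite <- (sumf_mul _ (b ^ k)), <- (sumf_mul _ b).
  set (s := sumf (length p) _).
  replace (sumf k (fun i => nth i p 0 * b ^ i) + nth k p 0 * b ^ k + b ^ k * (b * s))
    with (sumf k (fun i => nth i p 0 * b ^ i) + (nth k p 0 + b * s) * b ^ k) by lia.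
  rewrite Nat.div_add, carry_spec by (auto; apply Nat.pow_nonzero; auto).
  rewrite Nat.add_assoc, (Nat.mul_comm b), Nat.Div0.mod_add. auto.
Qed.

Section DFT.
  Variables (M w0 kap : nat).
  Let N := 2 ^ kap.
  Let F := 2 ^ M + 1.
  Hypothesis HM : w0 * 2 ^ kap = 2 * M.
  Hypothesis Hk : 0 < kap.

  Lemma geo_factor x k : sumf (2 ^ S k) (fun l => x ^ l) = sumf (2 ^ k) (fun l => x ^ l) * (1 + x ^ 2 ^ k).
  Proof.
    replace (2 ^ S k) with (2 ^ k + 2 ^ k) by (simpl; lia).
    rewrite sumf_app, (sumf_ext (2 ^ k) (fun i => x ^ (2 ^ k + i)) (fun i => x ^ 2 ^ k * x ^ i)).
    - rewrite <- (sumf_mul (2 ^ k) (x ^ 2 ^ k) (fun l => x ^ l)).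
      rewrite Nat.mul_add_distr_l, Nat.mul_1_r, (Nat.mul_comm (x ^ 2 ^ k)). auto.
    - intros; apply Nat.pow_add_r.
  Qed.

  (** A geometric sum of [2 ^ k] terms is the product of the numbers [1 + x ^ 2 ^ j] with [j < k],
      so divisibility of one factor is enough. *)
  Lemma geo_divide x d j k : j < k -> Nat.divide d (1 + x ^ 2 ^ j) ->
    Nat.divide d (sumf (2 ^ k) (fun l => x ^ l)).
  Proof.
    induction k; intros L H; [lia|]. rewrite geo_factor.
    destruct (Nat.eq_dec j k) as [->|N']; [apply Nat.divide_mul_r; auto|].
    apply Nat.divide_mul_l, IHk; auto; lia.
  Qed.

  Lemma F_divides_odd u : Nat.divide F (2 ^ (M * (2 * u + 1)) + 1).
  Proof.
    induction u.
    - rewrite Nat.mul_0_r, Nat.mul_1_r. apply Nat.divide_refl.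
    - destruct IHu as (t & Et).
      set (y := 2 ^ (M * (2 * u + 1))) in *.
      assert (Ey : 2 ^ (M * (2 * S u + 1)) = y * (2 ^ M * 2 ^ M)).
      { unfold y. rewrite <- !Nat.pow_add_r. f_equal. lia. }
      rewrite Ey. set (z := 2 ^ M) in *. assert (1 <= z) by apply pow2_pos.
      exists (z * z * t - (z - 1)). unfold F in *.
      assert (z * z * t * (z + 1) = z * z * (y + 1)) by (rewrite Et; lia).
      rewrite Nat.mul_sub_distr_r. assert (z * z * t * (z + 1) = z * z * y + z * z) by lia.
      assert ((z - 1) * (z + 1) + 1 = z * z) by nia. lia.
  Qed.

  Lemma odd_part d : 0 < d -> exists v u, d = 2 ^ v * (2 * u + 1).
  Proof.
    induction d as [d IH] using lt_wf_ind. intros Hd.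
    destruct (Nat.Even_or_Odd d) as [(e & ->)|(e & ->)].
    - destruct (IH e) as (v & u & E); try lia. exists (S v), u. simpl; lia.
    - exists 0, e. simpl; lia.
  Qed.

  Lemma root_sum_zero d : 0 < d -> d < 2 * N -> d <> N ->
    (sumf N (fun l => 2 ^ (w0 * d * l))) mod F = 0.
  Proof.
    intros H1 H2 H3. destruct (odd_part d H1) as (v & u & E).
    (* Otherwise [d] would be a positive multiple of [N] below [2 * N], that is, [N]. *)
    assert (Hv : v < kap).
    { destruct (Nat.lt_ge_cases v kap) as [|L]; auto. exfalso.
      assert (2 ^ v = 2 ^ (v - kap) * N).
      { unfold N. rewrite <- Nat.pow_add_r. f_equal; lia. }
      rewrite H, <- Nat.mul_assoc in E. pose proof (pow2_pos (v - kap)). unfold N in *.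
      pose proof (pow2_pos kap).
      destruct (Nat.eq_dec (2 ^ (v - kap)) 1) as [E1|E1].
      - destruct u; nia.
      - nia. }
    apply Nat.Lcm0.mod_divide.
    rewrite (sumf_ext _ _ (fun l => (2 ^ (w0 * d)) ^ l)) by (intros; apply Nat.pow_mul_r).
    apply geo_divide with (kap - 1 - v); [lia|].
    rewrite <- Nat.pow_mul_r.
    replace (w0 * d * 2 ^ (kap - 1 - v)) with (M * (2 * u + 1)).
    - rewrite Nat.add_comm. apply F_divides_odd.
    - rewrite E.
      assert (P : 2 ^ v * 2 ^ (kap - 1 - v) * 2 = 2 ^ kap).
      { rewrite <- Nat.pow_add_r. replace (v + (kap - 1 - v)) with (kap - 1) by lia.
        replace kap with (S (kap - 1)) at 2 by lia. simpl. lia. }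
      assert (w0 * (2 ^ v * 2 ^ (kap - 1 - v)) = M) by nia.
      nia.
  Qed.

  Lemma pow_2M_mod l : 2 ^ (2 * M * l) mod F = 1.
  Proof.
    assert (F1 : 1 < F) by (unfold F; pose proof (pow2_pos M); lia).
    assert (E : 2 ^ (2 * M) mod F = 1).
    { assert (1 <= 2 ^ M) by apply pow2_pos.
      replace (2 ^ (2 * M)) with (1 + (2 ^ M - 1) * F).
      - rewrite Nat.Div0.mod_add. apply Nat.mod_small; auto.
      - replace (2 * M) with (M + M) by lia. rewrite Nat.pow_add_r. unfold F. nia. }
    rewrite Nat.pow_mul_r. induction l.
    - simpl. apply Nat.mod_small; auto.
    - rewrite Nat.pow_succ_r', Nat.Div0.mul_mod, E, IHl. apply Nat.mod_small; auto.
  Qed.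

  Lemma pow_mod_2M t : 2 ^ (t mod (2 * M)) mod F = 2 ^ t mod F.
  Proof.
    rewrite (Nat.div_mod_eq t (2 * M)) at 2.
    rewrite Nat.pow_add_r, Nat.Div0.mul_mod, pow_2M_mod, Nat.mul_1_l, Nat.Div0.mod_mod. auto.
  Qed.

  (** Orthogonality of the roots of unity. The exponent [N - k] replaces [- k]; for [i <> k] the
      number [N - k + i] is positive, below [2 * N] and different from [N]. *)
  Theorem dft_inverse (cf : nat -> nat) k : k < N ->
    (sumf N (fun l => 2 ^ (w0 * (N - k) * l) * sumf N (fun i => cf i * 2 ^ (w0 * l * i)))) mod F
    = (N * cf k) mod F.
  Proof.
    intros Hk'.
    rewrite (sumf_ext N _ (fun l => sumf N (fun i => cf i * 2 ^ (w0 * (N - k + i) * l)))).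
    2:{ intros l _. rewrite sumf_mul. apply sumf_ext. intros i _.
        replace (w0 * (N - k + i) * l) with (w0 * (N - k) * l + w0 * l * i) by lia.
        rewrite Nat.pow_add_r. lia. }
    rewrite sumf_swap.
    rewrite (sumf_mod F N _ (fun i => if i =? k then N * cf k else 0)).
    - rewrite sumf_one by auto. auto.
    - intros i Hi. rewrite <- (sumf_mul N (cf i)).
      destruct (Nat.eqb_spec i k) as [->|Ne].
      + replace (N - k + k) with N by lia.
        assert (E : sumf N (fun l => 2 ^ (w0 * N * l)) mod F = N mod F).
        { rewrite (sumf_mod F N _ (fun _ => 1)); [rewrite sumf_const, Nat.mul_1_r; auto|].
          intros l _. unfold N. rewrite HM, pow_2M_mod. symmetry. apply Nat.mod_small.
          unfold F. pose proof (pow2_pos M); lia. }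
        rewrite Nat.Div0.mul_mod, E, <- Nat.Div0.mul_mod. f_equal; lia.
      + rewrite Nat.Div0.mul_mod, root_sum_zero by lia. rewrite Nat.mul_0_r. auto.
  Qed.

  (** As [N] times the sum of the coefficients is below [F], the residue is the integer
      [N * nth k p 0], and an ordinary division recovers the coefficient. Exponents are reduced
      modulo [2 * M], the exponent at which the powers of two repeat. *)
  Corollary dft_coef p k : length p <= N -> N * peval p 1 < F -> k < N ->
    (sumf N (fun l => 2 ^ ((w0 * ((N - k) * l)) mod (2 * M)) * (peval p (2 ^ (w0 * l)) mod F))) mod F / N
    = nth k p 0.
  Proof.
    intros Lp Hp Hk'.
    rewrite (sumf_mod F N _ (fun l => 2 ^ (w0 * (N - k) * l) * sumf N (fun i => nth i p 0 * 2 ^ (w0 * l * i)))).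
    - rewrite dft_inverse by auto.
      assert (nth k p 0 <= peval p 1) by apply coef_le.
      rewrite Nat.mod_small by nia. rewrite Nat.mul_comm, Nat.div_mul; auto. apply pow2_nz.
    - intros l _. rewrite Nat.Div0.mul_mod, pow_mod_2M, Nat.Div0.mod_mod, <- Nat.Div0.mul_mod.
      rewrite (peval_sumf p _ N) by auto. rewrite Nat.mul_assoc. f_equal. f_equal.
      apply sumf_ext. intros i _. rewrite <- Nat.pow_mul_r. auto.
  Qed.
End DFT.

(** * Digits of integers given by polynomials *)

Section Digits.
  Context (C : cls) `{FO : fo C} (bb ga : nat).
  Hypothesis Hcbe : cbe C = 2 ^ (bb + 3 * ga + 7).
  Hypothesis Hga : 3 <= ga.
  Hypothesis Hbb : 8 * ga + 20 <= bb.
  Notation X := (2 ^ cbe C).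

  (* The modulus is [2 ^ M_ + 1], and [2 ^ 2 ^ ew] is a root of unity of order [N_] modulo it. *)
  Definition eM := bb + 2 * ga + 4.
  Definition eN := 8 * ga.
  Definition ew := bb + 5 - 6 * ga.
  Definition M_ := 2 ^ eM.
  Definition N_ := 2 ^ eN.
  Definition F_ := 2 ^ M_ + 1.
  Notation b := (2 ^ 2 ^ bb).

  Lemma w0_N : 2 ^ ew * 2 ^ eN = 2 * M_.
  Proof.
    unfold M_. rewrite <- Nat.pow_succ_r', <- Nat.pow_add_r. f_equal. unfold eM, eN, ew. lia.
  Qed.

  (** The exponent in [Hcbe] gives [cbe C = 8 * 2 ^ ga * M_]: enough for a packed chain of
      [2 ^ ga + 1] residues of [2 * M_] bits. *)
  Lemma cbe_M : 4 * M_ * 2 ^ ga <= cbe C /\ 32 * M_ <= cbe C /\ 2 * M_ * 2 ^ ga + 2 * M_ < cbe C.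
  Proof.
    assert (E : cbe C = 8 * 2 ^ ga * M_ / 1).
    { rewrite Hcbe, Nat.div_1_r. unfold M_, eM. change 8 with (2 ^ 3). rewrite <- !Nat.pow_add_r. f_equal. lia. }
    rewrite Nat.div_1_r in E.
    assert (8 <= 2 ^ ga) by (change 8 with (2 ^ 3); apply pow2_le; auto).
    pose proof (pow2_pos eM). fold M_ in *. nia.
  Qed.

  (** [M_] is the length of [16 * 2 ^ (2 * ga)] digits. The largest coefficients, those in the
      division, have about three times [2 ^ (2 * ga)] digits. *)
  Lemma M_big : 2 ^ bb * 2 ^ (2 * ga) * 16 = M_ /\ bb + 10 * ga + 20 < 2 ^ bb /\ 2 ^ bb < M_ /\ 8 * ga < M_.
  Proof.
    assert (E : 2 ^ bb * 2 ^ (2 * ga) * 16 = M_).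
    { unfold M_, eM. change 16 with (2 ^ 4). rewrite <- !Nat.pow_add_r. auto. }
    assert (bb + 10 * ga + 20 < 2 ^ bb).
    { assert (H4 : 4 * bb < 2 ^ bb).
      { replace bb with (bb - 4 + 4) at 2 by lia. rewrite Nat.pow_add_r. pose proof (lt_pow2 (bb - 4)).
        change (2 ^ 4) with 16. lia. }
      lia. }
    pose proof (pow2_pos (2 * ga)). nia.
  Qed.

  Lemma eM_lt : eM + 2 < cbe C.
  Proof.
    destruct cbe_M as (_ & L & _). assert (eM < M_) by apply lt_pow2. lia.
  Qed.
  Lemma M_lt : 4 * M_ < cbe C.
  Proof. destruct cbe_M as (_ & L & _). pose proof (pow2_pos eM). fold M_ in H. lia. Qed.
  Lemma bb_lt : bb < cbe C /\ 2 ^ bb < cbe C.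
  Proof. pose proof M_lt. destruct M_big as (_ & _ & L & _). pose proof (lt_pow2 bb). lia. Qed.
  Lemma eN_lt : 10 * ga + 10 < cbe C /\ eN < cbe C /\ ew < cbe C.
  Proof. pose proof M_lt. destruct M_big as (_ & L1 & L & _). unfold eN, ew. lia. Qed.

  Lemma X_gt q : q < cbe C -> 2 ^ q < X.
  Proof. apply pow2_lt. Qed.

  Lemma F_lt : F_ <= 2 ^ (M_ + 1) /\ 1 < F_ /\ F_ < 2 ^ (2 * M_).
  Proof.
    unfold F_. pose proof (pow2_pos M_).
    assert (2 ^ (M_ + 1) < 2 ^ (2 * M_)).
    { apply pow2_lt. destruct M_big as (_ & _ & L & _). pose proof (pow2_pos bb). lia. }
    rewrite Nat.pow_add_r in *. change (2 ^ 1) with 2 in *. lia.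
  Qed.

  Lemma D_F i : D C 4 (fun e => e i = F_).
  Proof.
    assert (L := M_lt). assert (P := fun i => D_pconst C M_ i ltac:(lia)).
    fby (fun e => exists t, t < X /\ (t = 2 ^ M_ /\ t + 1 = e i)).
    intros e He. unfold F_. split.
    - intros (t & _ & -> & E); auto.
    - intros E. exists (2 ^ M_). repeat split; auto. apply X_gt. lia.
  Qed.
  Hint Resolve D_F : dd.

  Lemma F_X : F_ < X.
  Proof. pose proof F_lt. pose proof (X_gt (2 * M_)). pose proof M_lt. lia. Qed.

  Lemma D_modF i j : D C 15 (fun e => e i mod F_ = e j).
  Proof.
    fby (fun e => exists f, f < X /\ (f = F_ /\ e i mod f = e j)).
    intros e He. split.
    - intros (f & _ & -> & E); auto.
    - intros E. exists F_. repeat split; auto. apply F_X.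
  Qed.
  Hint Resolve D_modF : dd.

  Lemma D_isF i : D C 10 (fun e => e i < F_).
  Proof.
    fby (fun e => exists f, f < X /\ (f = F_ /\ e i < f)).
    intros e He. split.
    - intros (f & _ & -> & E); auto.
    - intros E. exists F_. repeat split; auto. apply F_X.
  Qed.
  Hint Resolve D_isF : dd.

  Lemma prod_X x y : x < 2 ^ (2 * M_) -> y < 2 ^ (2 * M_) -> x * y < X.
  Proof.
    intros Hx Hy. apply Nat.lt_trans with (2 ^ (2 * M_ + 2 * M_)).
    - apply mul_lt_pow2; auto.
    - apply X_gt. pose proof M_lt. lia.
  Qed.

  (* The guard keeps the product in the range of the quantifiers. *)
  Lemma D_mulF i j l : D C 20 (fun e => (e i < 2 ^ (2 * M_) /\ e j < 2 ^ (2 * M_)) /\ (e i * e j) mod F_ = e l).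
  Proof.
    assert (L := M_lt). assert (P := fun i => D_ltc C (2 * M_) i ltac:(lia)).
    fby (fun e => (e i < 2 ^ (2 * M_) /\ e j < 2 ^ (2 * M_)) /\
       exists t, t < X /\ (e i * e j = t /\ t mod F_ = e l)).
    intros e He. split.
    - intros (G & t & _ & <- & E); auto.
    - intros (G & E). split; auto. exists (e i * e j). repeat split; auto. apply prod_X; tauto.
  Qed.
  Hint Resolve D_mulF : dd.

  Definition root (t : nat) : nat := 2 ^ ((2 ^ ew * t) mod (2 * M_)).

  Lemma root_lt t : root t < 2 ^ (2 * M_).
  Proof. apply pow2_lt, Nat.mod_upper_bound. unfold M_. pose proof (pow2_pos eM). lia. Qed.

  (** The bound [2 ^ (40 * ga)] admits products of three indices up to [N_ = 2 ^ (8 * ga)], which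
      arise in the division. *)
  Lemma D_root i j : D C 20 (fun e => e i < 2 ^ (40 * ga) /\ root (e i) = e j).
  Proof.
    assert (L := M_lt). assert (L2 := eN_lt). assert (L3 := eM_lt).
    assert (B40 : 40 * ga < cbe C).
    { destruct M_big as (_ & L1 & L4 & _). lia. }
    assert (P := fun i => D_ltc C (40 * ga) i B40).
    assert (Q := fun i j => D_mulc C ew i j ltac:(lia)).
    assert (R := fun i j => D_modc C (eM + 1) i j ltac:(lia)).
    fby (fun e => e i < 2 ^ (40 * ga) /\ exists t, t < X /\ (2 ^ ew * e i = t /\
       exists s, s < X /\ (t mod 2 ^ (eM + 1) = s /\ 2 ^ s = e j))).
    assert (EM : 2 ^ (eM + 1) = 2 * M_) by (rewrite Nat.pow_add_r; unfold M_; simpl; lia).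
    intros e He. rewrite EM. unfold root. split.
    - intros (G & t & _ & <- & s & _ & <- & E); auto.
    - intros (G & E). split; auto. exists (2 ^ ew * e i). split.
      + apply Nat.lt_trans with (2 ^ (ew + 40 * ga)).
        * rewrite Nat.pow_add_r. apply Nat.mul_lt_mono_pos_l; auto.
        * apply X_gt. destruct M_big as (_ & L1 & L4 & _). unfold ew. lia.
      + split; auto. exists ((2 ^ ew * e i) mod (2 * M_)). repeat split; auto.
        apply Nat.lt_trans with (2 * M_); [apply Nat.mod_upper_bound; unfold M_; pose proof (pow2_pos eM); lia|].
        rewrite <- EM. apply X_gt. lia.
  Qed.
  Hint Resolve D_root : dd.

  Lemma root_mod t : root t mod F_ = 2 ^ (2 ^ ew * t) mod F_.
  Proof. unfold root, F_. eapply pow_mod_2M; [apply w0_N|unfold eN; lia]. Qed.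

  Definition G2 (k : nat) (h : nat -> nat -> nat) : Prop :=
    forall a i v, D C k (fun e => h (e a) (e i) = e v).

  Section Transform.
    Variables (k em : nat) (h : nat -> nat -> nat).
    Hypothesis Hh : G2 k h.
    Hypothesis HhF : forall z i, h z i < F_.
    Hypothesis Hm : em <= 8 * ga.

    (** One summand of the transform. The iteration demands a total step with definable graph that
        preserves the bound, so [r] is reduced before it is used, and out of range the step is the
        identity. *)
    Definition tphi (z u _c i r : nat) : nat :=
      if (i <? N_) && (u <=? N_) then (r mod F_ + (h z i * root (u * i)) mod F_) mod F_ else r.

    (** It serves in both directions: with the coefficients as [h] it is a value at the [u]-th root
        of unity, and with all [N_] values as [h] and [u = N_ - q] it is [N_] times the coefficient
        [q]. *)
    Definition TS (z u : nat) : nat := sumf (2 ^ em) (fun i => h z i * root (u * i)) mod F_.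

    Lemma h_2M z i : h z i < 2 ^ (2 * M_).
    Proof. pose proof (HhF z i). pose proof F_lt. lia. Qed.

    Lemma D_tphi z u c i r v : D C (k + 45) (fun e => tphi (e z) (e u) (e c) (e i) (e r) = e v).
    Proof.
      assert (L2 := eN_lt). assert (Hh' := Hh). unfold G2 in Hh'.
      assert (P := fun i => D_ltc C eN i ltac:(lia)). assert (Q := fun i => D_lec C eN i ltac:(lia)).
      fby (fun e => ((e i < 2 ^ eN /\ e u <= 2 ^ eN) /\
          exists hv, hv < X /\ (h (e z) (e i) = hv /\
          exists t, t < X /\ (e u * e i = t /\
          exists w, w < X /\ ((t < 2 ^ (40 * ga) /\ root t = w) /\
          exists p, p < X /\ (((hv < 2 ^ (2 * M_) /\ w < 2 ^ (2 * M_)) /\ (hv * w) mod F_ = p) /\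
          exists r', r' < X /\ (e r mod F_ = r' /\
          exists s, s < X /\ (r' + p = s /\ s mod F_ = e v))))))) \/
        (~ (e i < 2 ^ eN /\ e u <= 2 ^ eN) /\ e v = e r)).
      intros e He. unfold tphi. fold N_.
      destruct (Nat.ltb_spec (e i) N_) as [Li|Li]; destruct (Nat.leb_spec (e u) N_) as [Lu|Lu]; simpl andb.
      2,3,4: split; [intros [((? & ?) & _)|(_ & E)]; [lia|auto]|intros E; right; split; [lia|auto]].
      split.
      - intros [(_ & hv & _ & <- & t & _ & <- & w & _ & (_ & <-) & p & _ & (_ & <-) & r' & _ & <- & s & _ & <- & E)|(N & _)].
        + auto.
        + lia.
      - intros E. left. split; auto.
        pose proof F_X. pose proof F_lt as (_ & F1 & F2).
        assert (F0 : F_ <> 0) by lia.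
        exists (h (e z) (e i)). split; [specialize (HhF (e z) (e i)); lia|]. split; auto.
        assert (Lt : e u * e i < 2 ^ (40 * ga)).
        { apply Nat.le_lt_trans with (N_ * N_); [apply Nat.mul_le_mono; lia|].
          unfold N_, eN. rewrite <- Nat.pow_add_r. apply pow2_lt. lia. }
        exists (e u * e i). split.
        { apply Nat.lt_trans with (2 ^ (40 * ga)); auto. apply X_gt.
          destruct M_big as (_ & L1 & L4 & _). pose proof M_lt. lia. }
        split; auto. exists (root (e u * e i)). split.
        { pose proof (root_lt (e u * e i)). pose proof (X_gt (2 * M_)). pose proof M_lt. lia. }
        split; auto. exists ((h (e z) (e i) * root (e u * e i)) mod F_).
        pose proof (Nat.mod_upper_bound (h (e z) (e i) * root (e u * e i)) F_ F0) as B1.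
        pose proof (Nat.mod_upper_bound (e r) F_ F0) as B2.
        split; [lia|]. split; [split; auto; split; [apply h_2M|apply root_lt]|].
        exists (e r mod F_). split; [lia|]. split; auto.
        eexists. split; [|split; [reflexivity|exact E]].
        apply Nat.lt_trans with (2 ^ (2 * M_ + 1)); [rewrite Nat.pow_add_r; simpl (2 ^ 1); lia|].
        apply X_gt. pose proof M_lt. pose proof (pow2_pos eM). unfold M_ in *. lia.
    Qed.

    Lemma tphi_seq z u i : u <= N_ -> i <= N_ ->
      rseq tphi z u 0 0 i = sumf i (fun i => h z i * root (u * i)) mod F_.
    Proof.
      intros Hu. induction i; intros Hi; [simpl; symmetry; apply Nat.Div0.mod_0_l|].
      simpl rseq. rewrite IHi by lia. unfold tphi.
      assert (B1 : i <? N_ = true) by (apply Nat.ltb_lt; lia).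
      assert (B2 : u <=? N_ = true) by (apply Nat.leb_le; lia).
      rewrite B1, B2. simpl andb. cbv iota. rewrite Nat.Div0.mod_mod, <- Nat.Div0.add_mod. auto.
    Qed.

    Lemma D_TS z u v : D C (k + 610) (fun e => e u <= N_ /\ TS (e z) (e u) = e v).
    Proof.
      assert (L2 := eN_lt). destruct cbe_M as (_ & _ & L3).
      assert (Q := fun i => D_lec C eN i ltac:(lia)).
      assert (Cm := fun i => D_pconst C em i ltac:(lia)).
      assert (Eq : 2 ^ (eM + 1) = 2 * M_) by (rewrite Nat.pow_add_r; unfold M_; simpl; lia).
      pose proof F_lt as (_ & F1 & F2).
      assert (Rc := fun a b c i v => D_rec C tphi (k + 45) (eM + 1) ga D_tphi
         ltac:(intros; rewrite Eq in *; unfold tphi; destruct (andb _ _); auto;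
               pose proof (Nat.mod_upper_bound (r mod F_ + (h a0 i0 * root (b0 * i0)) mod F_) F_); lia)
         ltac:(rewrite Eq; lia) ltac:(lia) 0 ltac:(lia) a b c i v).
      fby (fun e => e u <= 2 ^ eN /\ exists o, o < X /\ (o = 0 /\ exists m, m < X /\ (m = 2 ^ em /\
          (m <= (2 ^ ga) ^ 10 /\ rseq tphi (e z) (e u) o 0 m = e v)))).
      intros e He. fold N_. unfold TS.
      assert (Lm : 2 ^ em <= N_) by (apply pow2_le; unfold eN; lia).
      assert (Lm2 : 2 ^ em <= (2 ^ ga) ^ 10) by (rewrite <- Nat.pow_mul_r; apply pow2_le; lia).
      assert (Lm3 : 2 ^ em < X) by (apply X_gt; lia).
      split.
      - intros (Lu & o & _ & -> & m & _ & -> & _ & E). split; auto. rewrite <- E.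
        symmetry. apply tphi_seq; auto.
      - intros (Lu & E). split; auto. exists 0. split; auto. split; auto.
        exists (2 ^ em). split; auto. split; auto. split; auto. rewrite tphi_seq; auto.
    Qed.
  End Transform.

  Section Extract.
    Variables (k : nat) (p : nat -> list nat) (ev : nat -> nat -> nat).
    Hypothesis Hev : G2 k ev.
    Hypothesis HevF : forall z l, ev z l < F_.
    Hypothesis Hp : forall z l, l < N_ -> ev z l = peval (p z) (2 ^ (2 ^ ew * l)) mod F_.
    Hypothesis Hlen : forall z, length (p z) <= N_.
    Hypothesis Hbound : forall z, N_ * peval (p z) 1 < F_.

    Lemma TS_coef z q : q < N_ -> TS (8 * ga) ev z (N_ - q) / N_ = nth q (p z) 0.
    Proof.
      intros Hq. rewrite <- (dft_coef M_ (2 ^ ew) eN w0_N ltac:(unfold eN; lia) (p z) q); auto.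
      f_equal. unfold TS. fold eN. fold N_. fold F_. apply sumf_mod. intros l Hl.
      rewrite Hp by auto. rewrite Nat.mul_comm. unfold root. auto.
    Qed.

    Lemma D_coef z q v : D C (k + 640) (fun e => nth (e q) (p (e z)) 0 = e v).
    Proof.
      assert (L2 := eN_lt).
      assert (Ts := fun z u v => D_TS k (8 * ga) ev Hev HevF (le_n _) z u v).
      assert (P := fun i => D_ltc C eN i ltac:(lia)). assert (Q := fun i => D_lec C eN i ltac:(lia)).
      assert (Cn := fun i => D_pconst C eN i ltac:(lia)). assert (Dv := fun i j => D_divc C eN i j ltac:(lia)).
      fby (fun e => (e q < 2 ^ eN /\ exists m, m < X /\ (m = 2 ^ eN /\ exists u, u < X /\ (u + e q = m /\
          exists t, t < X /\ ((u <= N_ /\ TS (8 * ga) ev (e z) u = t) /\ t / 2 ^ eN = e v)))) \/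
        (~ (e q < 2 ^ eN) /\ e v = 0)).
      intros e He. fold N_. destruct (Nat.lt_ge_cases (e q) N_) as [L|L].
      - rewrite <- (TS_coef (e z) (e q) L). split.
        + intros [(_ & m & _ & -> & u & _ & Eu & t & _ & (_ & <-) & E)|(K & _)]; [|lia].
          rewrite <- E. do 2 f_equal. lia.
        + intros E. left. split; auto. assert (NX : N_ < X) by (apply X_gt; lia).
          exists N_. split; auto. split; auto. exists (N_ - e q). split; [lia|]. split; [lia|].
          eexists. split; [|split; [split; [lia|reflexivity]|exact E]].
          pose proof F_X. pose proof F_lt.
          unfold TS. pose proof (Nat.mod_upper_bound (sumf (2 ^ (8 * ga)) (fun i => ev (e z) i * root ((N_ - e q) * i))) F_). lia.
      - rewrite nth_overflow by (specialize (Hlen (e z)); lia). split.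
        + intros [(? & _)|(_ & E)]; [lia|auto].
        + intros E. right. split; [lia|auto].
    Qed.

    Definition cphi (z _b _c i r : nat) : nat := (r mod 2 ^ (2 * M_) + nth i (p z) 0) / b.

    Lemma coef_lt z i : nth i (p z) 0 < F_.
    Proof.
      pose proof (coef_le (p z) i). specialize (Hbound z). assert (1 <= N_) by apply pow2_pos. nia.
    Qed.

    Lemma D_cphi z u c i r v : D C (k + 660) (fun e => cphi (e z) (e u) (e c) (e i) (e r) = e v).
    Proof.
      assert (Dc := D_coef). destruct bb_lt as [_ Lb]. assert (L := M_lt).
      assert (Dm := fun i j => D_modc C (2 * M_) i j ltac:(lia)).
      assert (Dv := fun i j => D_divc C (2 ^ bb) i j Lb).
      fby (fun e => exists x, x < X /\ (e r mod 2 ^ (2 * M_) = x /\ exists y, y < X /\ (nth (e i) (p (e z)) 0 = y /\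
           exists s, s < X /\ (x + y = s /\ s / b = e v)))).
      intros e He. unfold cphi. split.
      - intros (x & _ & <- & y & _ & <- & s & _ & <- & E). auto.
      - intros E. pose proof (coef_lt (e z) (e i)). pose proof F_lt as (_ & F1 & F2). pose proof F_X.
        assert (2 ^ (2 * M_) < X) by (apply X_gt; lia).
        pose proof (Nat.mod_upper_bound (e r) (2 ^ (2 * M_)) (pow2_nz _)).
        exists (e r mod 2 ^ (2 * M_)). split; [lia|]. split; auto.
        eexists. split; [|split; [reflexivity|]]; [lia|].
        eexists. split; [|split; [reflexivity|exact E]].
        apply Nat.lt_trans with (2 ^ (2 * M_ + 1)); [rewrite Nat.pow_add_r; simpl (2 ^ 1); lia|].
        apply X_gt. pose proof (pow2_pos eM). unfold M_ in *. lia.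
    Qed.

    Lemma cphi_seq z i : rseq cphi z 0 0 0 i = carry (p z) b i.
    Proof.
      induction i; auto. simpl rseq. rewrite IHi. unfold cphi. cbn [carry].
      rewrite Nat.mod_small; auto.
      pose proof (carry_le (p z) b (pow2_nz _) i). specialize (Hbound z). assert (1 <= N_) by apply pow2_pos.
      pose proof F_lt. nia.
    Qed.

    (** The number is given only by the residues of its polynomial at the roots of unity. The
        inverse transform yields the coefficients, an iteration yields the carry into position [q],
        and these two determine the digit. *)
    Theorem D_extract z q v :
      D C (k + 1240) (fun e => e q < N_ /\ field (2 ^ bb) (peval (p (e z)) b) (e q) = e v).
    Proof.
      assert (Dc := D_coef). destruct bb_lt as [_ Lb]. assert (L := M_lt). assert (L2 := eN_lt).
      destruct cbe_M as (_ & _ & L3).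
      assert (P := fun i => D_ltc C eN i ltac:(lia)).
      assert (Dm := fun i j => D_modc C (2 ^ bb) i j Lb).
      assert (Eq : 2 ^ (eM + 1) = 2 * M_) by (rewrite Nat.pow_add_r; unfold M_; simpl; lia).
      pose proof F_lt as (_ & F1 & F2).
      assert (b2 : 2 <= b). { change 2 with (2 ^ 1) at 1. apply pow2_le. apply pow2_pos. }
      assert (Bc : forall a b' c i r, r < 2 ^ 2 ^ (eM + 1) -> cphi a b' c i r < 2 ^ 2 ^ (eM + 1)).
      { intros a b' c i r Hr. rewrite Eq in *. unfold cphi. apply Nat.Div0.div_lt_upper_bound.
        rewrite Nat.mod_small by auto. pose proof (coef_lt a i). nia. }
      assert (Rc := fun a b c i v => D_rec C cphi (k + 660) (eM + 1) ga D_cphi Bc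
         ltac:(rewrite Eq; lia) ltac:(lia) 0 ltac:(lia) a b c i v).
      fby (fun e => e q < 2 ^ eN /\ exists o, o < X /\ (o = 0 /\ exists s, s < X /\
         ((e q <= (2 ^ ga) ^ 10 /\ rseq cphi (e z) o o 0 (e q) = s) /\
          exists y, y < X /\ (nth (e q) (p (e z)) 0 = y /\ exists t, t < X /\ (s + y = t /\ t mod b = e v))))).
      intros e He. fold N_. unfold field.
      rewrite Nat.pow_mul_r, peval_digit, <- cphi_seq by auto.
      assert (Lm2 : N_ <= (2 ^ ga) ^ 10) by (rewrite <- Nat.pow_mul_r; apply pow2_le; unfold eN; lia).
      split.
      - intros (Lq & o & _ & -> & s & _ & (_ & <-) & y & _ & <- & t & _ & <- & E). auto.
      - intros (Lq & E). split; auto. exists 0. split; auto. split; auto.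
        assert (rseq cphi (e z) 0 0 0 (e q) < F_).
        { rewrite cphi_seq. pose proof (carry_le (p (e z)) b (pow2_nz _) (e q)).
          specialize (Hbound (e z)). assert (1 <= N_) by apply pow2_pos. nia. }
        pose proof F_X. pose proof (coef_lt (e z) (e q)).
        eexists. split; [|split; [split; [lia|reflexivity]|]]; [lia|].
        eexists. split; [|split; [reflexivity|]]; [lia|].
        eexists. split; [|split; [reflexivity|exact E]].
        apply Nat.lt_trans with (2 ^ (2 * M_ + 1)); [rewrite Nat.pow_add_r; simpl (2 ^ 1); lia|].
        apply X_gt. pose proof (pow2_pos eM). unfold M_ in *. lia.
    Qed.
  End Extract.
End Digits.

(** * Words given by their digits *)

Lemma field_lt q w j : field q w j < 2 ^ q.
Proof. apply Nat.mod_upper_bound; auto. Qed.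

Lemma testbit_field q w j t : Nat.testbit (field q w j) t = (t <? q) && Nat.testbit w (q * j + t).
Proof.
  unfold field. destruct (Nat.ltb_spec t q); simpl.
  - rewrite Nat.mod_pow2_bits_low, Nat.div_pow2_bits by auto. f_equal; lia.
  - apply Nat.mod_pow2_bits_high; auto.
Qed.

Lemma field_split q m x : x < 2 ^ (q * m) -> x = catf q m (field q x).
Proof. apply catf_split. Qed.

Lemma field_ext q m x y : x < 2 ^ (q * m) -> y < 2 ^ (q * m) ->
  (forall i, i < m -> field q x i = field q y i) -> x = y.
Proof.
  intros Hx Hy E. rewrite (field_split q m x Hx), (field_split q m y Hy). apply catf_ext; auto.
Qed.

Lemma field_catf q m f i : (forall r, r < m -> f r < 2 ^ q) -> i < m -> field q (catf q m f) i = f i.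
Proof. intros. apply catf_nth; auto. Qed.

Lemma field_high q w i : w < 2 ^ (q * i) -> field q w i = 0.
Proof. intros. unfold field. rewrite Nat.div_small by auto. apply Nat.Div0.mod_0_l. Qed.

Lemma field_mod_low q m w i : i < m -> field q (w mod 2 ^ (q * m)) i = field q w i.
Proof. intros. apply mod_div_mod. nia. Qed.

Lemma field_0 q w : field q w 0 = w mod 2 ^ q.
Proof. unfold field. rewrite Nat.mul_0_r, Nat.pow_0_r, Nat.div_1_r. auto. Qed.

Lemma field_land q x y i : field q (Nat.land x y) i = Nat.land (field q x i) (field q y i).
Proof.
  apply Nat.bits_inj; intro t. rewrite Nat.land_spec, !testbit_field, Nat.land_spec.
  destruct (t <? q); auto.
Qed.

Lemma field_lor q x y i : field q (Nat.lor x y) i = Nat.lor (field q x i) (field q y i).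
Proof.
  apply Nat.bits_inj; intro t. rewrite Nat.lor_spec, !testbit_field, Nat.lor_spec.
  destruct (t <? q); auto.
Qed.

Lemma catf_max q m : catf q m (fun _ => 2 ^ q - 1) = 2 ^ (q * m) - 1.
Proof.
  induction m; simpl.
  - rewrite Nat.mul_0_r. auto.
  - rewrite IHm. replace (q * S m) with (q + q * m) by lia. rewrite Nat.pow_add_r.
    pose proof (pow2_pos q). pose proof (pow2_pos (q * m)). nia.
Qed.

Lemma field_compl q m x i : x < 2 ^ (q * m) -> i < m -> field q (2 ^ (q * m) - 1 - x) i = 2 ^ q - 1 - field q x i.
Proof.
  intros Hx Hi.
  assert (E : 2 ^ (q * m) - 1 - x = catf q m (fun i => 2 ^ q - 1 - field q x i)).
  { rewrite <- catf_max. rewrite (field_split q m x) at 1 by auto.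
    assert (S : catf q m (fun i => 2 ^ q - 1 - field q x i) + catf q m (field q x) = catf q m (fun _ => 2 ^ q - 1)).
    { rewrite catf_add. apply catf_ext. intros r _. pose proof (field_lt q x r). lia. }
    lia. }
  rewrite E, field_catf; auto. intros. pose proof (pow2_pos q). lia.
Qed.

Lemma field_pow2 q x i : 0 < q -> field q (2 ^ x) i = if i =? x / q then 2 ^ (x mod q) else 0.
Proof.
  intros Hq. apply Nat.bits_inj; intro t. rewrite testbit_field, Nat.pow2_bits_eqb.
  pose proof (Nat.div_mod_eq x q). pose proof (Nat.mod_upper_bound x q ltac:(lia)).
  destruct (Nat.eqb_spec i (x / q)) as [->|N].
  - rewrite Nat.pow2_bits_eqb.
    destruct (Nat.ltb_spec t q), (Nat.eqb_spec x (q * (x / q) + t)), (Nat.eqb_spec (x mod q) t); simpl; auto; lia.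
  - rewrite Nat.bits_0. destruct (Nat.ltb_spec t q); simpl; auto.
    apply Nat.eqb_neq. intros E. apply N. apply Nat.div_unique with t; auto.
Qed.

Lemma lt_digits q m x y : x < 2 ^ (q * m) -> y < 2 ^ (q * m) ->
  x < y <-> exists i, i < m /\ (field q x i < field q y i /\
              forall j, j < m -> i < j -> field q x j = field q y j).
Proof.
  intros Hx Hy. split.
  - revert x y Hx Hy. induction m; intros x y Hx Hy L.
    + rewrite Nat.mul_0_r in *. simpl in *. lia.
    + destruct (Nat.eq_dec (field q x m) (field q y m)) as [E|E].
      * assert (Sx : x = x mod 2 ^ (q * m) + 2 ^ (q * m) * (x / 2 ^ (q * m)))
          by (pose proof (Nat.div_mod_eq x (2 ^ (q * m))); lia).
        assert (Sy : y = y mod 2 ^ (q * m) + 2 ^ (q * m) * (y / 2 ^ (q * m)))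
          by (pose proof (Nat.div_mod_eq y (2 ^ (q * m))); lia).
        assert (Ex : field q x m = x / 2 ^ (q * m)).
        { apply Nat.mod_small, Nat.Div0.div_lt_upper_bound. rewrite <- Nat.pow_add_r.
          replace (q * m + q) with (q * S m) by lia; auto. }
        assert (Ey : field q y m = y / 2 ^ (q * m)).
        { apply Nat.mod_small, Nat.Div0.div_lt_upper_bound. rewrite <- Nat.pow_add_r.
          replace (q * m + q) with (q * S m) by lia; auto. }
        rewrite <- Ex in Sx. rewrite <- Ey, <- E in Sy.
        destruct (IHm (x mod 2 ^ (q * m)) (y mod 2 ^ (q * m))) as (i & Hi & Li & Ai);
          [apply Nat.mod_upper_bound; auto|apply Nat.mod_upper_bound; auto|lia|].
        rewrite !field_mod_low in Li by auto.
        exists i. split; [lia|]. split; auto. intros j Hj Hij.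
        destruct (Nat.eq_dec j m) as [->|]; auto.
        specialize (Ai j ltac:(lia) Hij). rewrite !field_mod_low in Ai by lia. auto.
      * exists m. split; [lia|]. split; [|intros; lia].
        assert (G : x / 2 ^ (q * m) <= y / 2 ^ (q * m)) by (apply Nat.Div0.div_le_mono; lia).
        assert (Ex : field q x m = x / 2 ^ (q * m)).
        { apply Nat.mod_small, Nat.Div0.div_lt_upper_bound. rewrite <- Nat.pow_add_r.
          replace (q * m + q) with (q * S m) by lia; auto. }
        assert (Ey : field q y m = y / 2 ^ (q * m)).
        { apply Nat.mod_small, Nat.Div0.div_lt_upper_bound. rewrite <- Nat.pow_add_r.
          replace (q * m + q) with (q * S m) by lia; auto. }
        lia.
  - intros (i & Hi & L & A).
    destruct (Nat.lt_ge_cases x y) as [|G]; auto. exfalso.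
    assert (Dv : forall w, w < 2 ^ (q * m) -> w / 2 ^ (q * i) < 2 ^ (q * (m - i))).
    { intros w Hw. apply Nat.Div0.div_lt_upper_bound. rewrite <- Nat.pow_add_r.
      replace (q * i + q * (m - i)) with (q * m) by nia. auto. }
    assert (Sh : forall w j, field q (w / 2 ^ (q * i)) j = field q w (i + j)).
    { intros w j. unfold field. rewrite Nat.Div0.div_div, <- Nat.pow_add_r. do 3 f_equal; lia. }
    assert (G' : y / 2 ^ (q * i) <= x / 2 ^ (q * i)) by (apply Nat.Div0.div_le_mono; auto).
    pose proof (Dv x Hx) as Dx. pose proof (Dv y Hy) as Dy.
    rewrite (field_split q (m - i) _ Dx), (field_split q (m - i) _ Dy) in G'.
    destruct (m - i) as [|r] eqn:Er; [lia|]. simpl catf in G'.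
    rewrite !Sh, Nat.add_0_r in G'.
    rewrite (catf_ext q r (fun r0 => field q (x / 2 ^ (q * i)) (S r0)) (fun r0 => field q (y / 2 ^ (q * i)) (S r0))) in G'.
    + lia.
    + intros j Hj. rewrite !Sh. apply A; lia.
Qed.

Lemma peval_map W m f : peval (map f (seq 0 m)) (2 ^ W) = catf W m f.
Proof.
  assert (G : forall s, peval (map f (seq s m)) (2 ^ W) = catf W m (fun i => f (s + i))).
  { induction m; intros s; simpl; auto. rewrite IHm, Nat.add_0_r. do 2 f_equal.
    apply catf_ext. intros; f_equal; lia. }
  rewrite G. apply catf_ext; auto.
Qed.

Section Words.
  Context (C : cls) {FO : fo C} (bb ga : nat).
  Hypothesis Hcbe : cbe C = 2 ^ (bb + 3 * ga + 7).
  Hypothesis Hga : 3 <= ga.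
  Hypothesis Hbb : 8 * ga + 20 <= bb.
  Notation X := (2 ^ cbe C).
  Notation dg := (field (2 ^ bb)).
  Notation b := (2 ^ 2 ^ bb).
  Notation nd := (2 ^ (4 * ga)).

  (** A word of [2 ^ (4 * ga)] digits of [2 ^ bb] bits. For [ga > 7] it is longer than the
      [2 ^ (bb + 3 * ga + 7)] bits of a variable, by a factor [2 ^ (ga - 7)]. *)
  Definition wl : nat := 2 ^ (bb + 4 * ga).

  Lemma wl_eq : wl = 2 ^ bb * nd.
  Proof. unfold wl. apply Nat.pow_add_r. Qed.

  (** A long word is not a value of a variable; a formula has access to it digit by digit, as a
      function of the parameter and of the index. *)
  Definition KnB (k : nat) (v : nat -> nat) : Prop :=
    (forall z, v z < 2 ^ wl) /\ forall z i j, D C k (fun e => dg (v (e z)) (e i) = e j).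

  Lemma KnB_mono i j v : KnB i v -> i <= j -> KnB j v.
  Proof. intros (B & H) L. split; auto. intros; eapply D_mono; eauto. Qed.

  Lemma dg_high v i : v < 2 ^ wl -> nd <= i -> dg v i = 0.
  Proof.
    intros Hv Hi. apply field_high. eapply lt_pow2_mono; [exact Hv|]. rewrite wl_eq. nia.
  Qed.

  Lemma ltX q : q < 2 ^ bb + 2 -> q < cbe C.
  Proof.
    intros. pose proof (M_lt C bb ga Hcbe Hga Hbb). pose proof (M_big C bb ga Hcbe Hga Hbb). lia.
  Qed.

  Lemma small_ga q : q <= bb + 10 * ga + 20 -> q < cbe C.
  Proof. intros. apply ltX. pose proof (M_big C bb ga Hcbe Hga Hbb). lia. Qed.

  Lemma D_nd i : D C 0 (fun e => e i = nd).
  Proof. apply D_pconst, small_ga. lia. Qed.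
  Lemma D_isnd i : D C 6 (fun e => e i < nd).
  Proof. apply D_ltc, small_ga. lia. Qed.
  Hint Resolve D_nd D_isnd : dd.
  Lemma ndX : nd < X.
  Proof. apply pow2_lt, small_ga. lia. Qed.
  Lemma bX : b < X.
  Proof. apply pow2_lt, ltX. lia. Qed.
  Lemma dgX v i : dg v i < X.
  Proof. pose proof (field_lt (2 ^ bb) v i). pose proof bX. lia. Qed.
  Lemma D_bmax i : D C 4 (fun e => e i = b - 1).
  Proof.
    assert (P := fun i => D_pconst C (2 ^ bb) i ltac:(apply ltX; lia)).
    fby (fun e => exists t, t < X /\ (t = b /\ e i + 1 = t)).
    intros e He. pose proof (pow2_pos (2 ^ bb)). pose proof bX. split.
    - intros (t & _ & -> & E). lia.
    - intros E. exists b. repeat split; auto; lia.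
  Qed.
  Hint Resolve D_bmax : dd.

  Lemma KnB_trunc k (w : nat -> nat) :
    (forall z i j, D C k (fun e => e i < N_ ga /\ dg (w (e z)) (e i) = e j)) ->
    KnB (k + 15) (fun z => w z mod 2 ^ wl).
  Proof.
    intros H. split; [intros; apply Nat.mod_upper_bound; auto|].
    intros z i j.
    fby (fun e => (e i < nd /\ (e i < N_ ga /\ dg (w (e z)) (e i) = e j)) \/ (~ (e i < nd) /\ e j = 0)).
    intros e He. rewrite wl_eq. destruct (Nat.lt_ge_cases (e i) nd) as [L|L].
    - rewrite field_mod_low by auto. assert (e i < N_ ga).
      { eapply Nat.lt_le_trans; [exact L|]. apply pow2_le. unfold eN. lia. }
      split; [intros [(_ & _ & E)|(K & _)]; [auto|lia]|auto].
    - rewrite <- wl_eq, (dg_high (w (e z) mod 2 ^ wl)) by (auto; apply Nat.mod_upper_bound; auto).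
      split; [intros [(K & _)|(_ & E)]; [lia|auto]|intros; right; split; [lia|auto]].
  Qed.

  Lemma KnB_const k (v : nat) : v < 2 ^ wl -> (forall i j, D C k (fun e => dg v (e i) = e j)) ->
    KnB k (fun _ => v).
  Proof. intros. split; auto. Qed.

  Lemma KnB_local k (v : nat -> nat) (o : nat -> nat -> nat) u w :
    KnB k u -> KnB k w -> (forall z, v z < 2 ^ wl) ->
    (forall x y r, D C 20 (fun e => (e x < b /\ e y < b) /\ o (e x) (e y) = e r)) ->
    (forall z i, i < nd -> dg (v z) i = o (dg (u z) i) (dg (w z) i)) ->
    KnB (k + 30) v.
  Proof.
    intros (Bu & Du) (Bw & Dw) Bv Do E. split; auto. intros z i j.
    fby (fun e => (e i < nd /\ exists x, x < X /\ (dg (u (e z)) (e i) = x /\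
         exists y, y < X /\ (dg (w (e z)) (e i) = y /\ ((x < b /\ y < b) /\ o x y = e j)))) \/
         (~ (e i < nd) /\ e j = 0)).
    intros e He. destruct (Nat.lt_ge_cases (e i) nd) as [L|L].
    - rewrite E by auto. split.
      + intros [(_ & x & _ & <- & y & _ & <- & _ & R)|(K & _)]; [auto|lia].
      + intros R. left. split; auto. eexists. split; [|split; [reflexivity|]]; [apply dgX|].
        eexists. split; [|split; [reflexivity|]]; [apply dgX|]. split; auto. split; apply field_lt.
    - rewrite (dg_high (v (e z))) by auto.
      split; [intros [(K & _)|(_ & R)]; [lia|auto]|intros; right; split; [lia|auto]].
  Qed.

  Lemma D_isb i : D C 6 (fun e => e i < b).
  Proof. apply D_ltc, ltX. lia. Qed.
  Hint Resolve D_isb : dd.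

  Lemma KnB_and k u w : KnB k u -> KnB k w -> KnB (k + 30) (fun z => Nat.land (u z) (w z)).
  Proof.
    intros Hu Hw. apply (KnB_local k _ Nat.land u w); auto.
    - intros z. eapply Nat.le_lt_trans; [apply Nat.land_le_l|apply Hu].
    - intros x y r. fbuild.
    - intros. apply field_land.
  Qed.

  Lemma KnB_or k u w : KnB k u -> KnB k w -> KnB (k + 30) (fun z => Nat.lor (u z) (w z)).
  Proof.
    intros Hu Hw. apply (KnB_local k _ Nat.lor u w); auto.
    - intros z. apply lor_lt_pow2; [apply Hu|apply Hw].
    - intros x y r.
      fby (fun e => (e x < b /\ e y < b) /\
        exists t, t < X /\ (Nat.land (e x) (e y) = t /\
        exists s, s < X /\ (e r + t = s /\ e x + e y = s))).
      intros e He. split.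
      + intros (G & t & _ & <- & s & _ & E1 & E2). split; auto. pose proof (lor_add_land (e x) (e y)). lia.
      + intros (G & E). split; auto. exists (Nat.land (e x) (e y)).
        split; [eapply Nat.le_lt_trans; [apply Nat.land_le_l|apply He]|]. split; auto.
        exists (e x + e y). pose proof (lor_add_land (e x) (e y)).
        assert (2 ^ (2 ^ bb + 1) < X) by (apply pow2_lt, ltX; lia).
        rewrite Nat.pow_add_r in H0. simpl (2 ^ 1) in H0.
        repeat split; lia.
    - intros. apply field_lor.
  Qed.

  Lemma KnB_not k u : KnB k u -> KnB (k + 30) (fun z => Nat.lnot (u z) wl).
  Proof.
    intros Hu.
    assert (E : forall z, Nat.lnot (u z) wl = 2 ^ wl - 1 - u z).
    { intros z. pose proof (lnot_add wl (u z) (proj1 Hu z)). lia. }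
    apply (KnB_local k _ (fun x _ => b - 1 - x) u u); auto.
    - intros z. rewrite E. pose proof (pow2_pos wl). lia.
    - intros x y r.
      fby (fun e => (e x < b /\ e y < b) /\ exists t, t < X /\ (t = b - 1 /\ e r + e x = t)).
      intros e He. pose proof bX. split.
      + intros (G & t & _ & -> & R). split; auto. lia.
      + intros (G & R). split; auto. exists (b - 1). repeat split; lia.
    - intros z i Hi. rewrite E, wl_eq. apply field_compl; auto. rewrite <- wl_eq. apply Hu.
  Qed.

  Lemma KnB_zero : KnB 0 (fun _ => 0).
  Proof.
    apply KnB_const; auto. intros i j.
    fby (fun e : nat -> nat => e j = 0). intros e He. rewrite field_high by auto. split; auto.
  Qed.

  Lemma KnB_small v : v < b -> (forall i, D C 0 (fun e => e i = v)) -> KnB 10 (fun _ => v).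
  Proof.
    intros Hv Dv. apply KnB_const.
    - eapply lt_pow2_mono; [exact Hv|]. rewrite wl_eq. pose proof (pow2_pos (4 * ga)). nia.
    - intros i j.
      fby (fun e => (e i = 0 /\ e j = v) \/ (~ (e i = 0) /\ e j = 0)).
      intros e He. destruct (Nat.eq_dec (e i) 0) as [->|N].
      + rewrite field_0, Nat.mod_small by auto. lia.
      + rewrite field_high; [lia|]. eapply lt_pow2_mono; [exact Hv|]. nia.
  Qed.

  Lemma KnB_word : KnB 10 (fun _ => wl).
  Proof.
    assert (L : wl < b).
    { apply pow2_lt. pose proof (M_big C bb ga Hcbe Hga Hbb). lia. }
    apply KnB_small; auto. intros i. apply D_pconst, small_ga. lia.
  Qed.

  Lemma KnB_max : KnB 30 (fun _ => 2 ^ wl - 1).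
  Proof.
    apply KnB_const; [pose proof (pow2_pos wl); lia|]. intros i j.
    fby (fun e => (e i < nd /\ e j = b - 1) \/ (~ (e i < nd) /\ e j = 0)).
    intros e He. destruct (Nat.lt_ge_cases (e i) nd) as [L|L].
    - rewrite <- (Nat.sub_0_r (2 ^ wl - 1)), wl_eq, field_compl by auto.
      rewrite (field_high _ 0) by auto. lia.
    - rewrite dg_high by (auto; pose proof (pow2_pos wl); lia). lia.
  Qed.

  Lemma eq_small v q : v < 2 ^ wl -> q < b ->
    v = q <-> dg v 0 = q /\ forall i, i < nd -> i <> 0 -> dg v i = 0.
  Proof.
    intros Hv Hq. split.
    - intros ->. split; [rewrite field_0; apply Nat.mod_small; auto|].
      intros i _ Hi. apply field_high. eapply lt_pow2_mono; [exact Hq|]. nia.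
    - intros (E0 & E). apply (field_ext (2 ^ bb) nd).
      + rewrite <- wl_eq; auto.
      + eapply lt_pow2_mono; [exact Hq|]. pose proof (pow2_pos (4 * ga)). nia.
      + intros i Hi. destruct (Nat.eq_dec i 0) as [->|N].
        * rewrite E0, field_0, Nat.mod_small; auto.
        * rewrite E by auto. symmetry. apply field_high. eapply lt_pow2_mono; [exact Hq|]. nia.
  Qed.

  Lemma D_eq_small k v z x : KnB k v -> D C (k + 25) (fun e => e x < b /\ v (e z) = e x).
  Proof.
    intros (Bv & Dv).
    fby (fun e => e x < b /\ ((exists o, o < X /\ (o = 0 /\ dg (v (e z)) o = e x)) /\
       forall i, i < X -> i < nd -> i <> 0 -> exists o, o < X /\ (o = 0 /\ dg (v (e z)) i = o))).
    intros e He. split.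
    - intros (L & (o & _ & -> & E0) & A). split; auto. apply eq_small; auto. split; auto.
      intros i Hi Ni. destruct (A i) as (o & _ & -> & E); auto. pose proof ndX. lia.
    - intros (L & E). apply eq_small in E; auto. destruct E as [E0 E]. split; auto. split.
      + exists 0; auto.
      + intros i _ Hi Ni. exists 0. auto.
  Qed.

  Lemma KnB_test k v q i : KnB k v -> q < b -> (forall i, D C 0 (fun e => e i = q)) ->
    D C (k + 30) (fun e => v (e i) = q).
  Proof.
    intros Hv Hq Dq. assert (De := fun z x => D_eq_small k v z x Hv).
    fby (fun e => exists x, x < X /\ (x = q /\ (x < b /\ v (e i) = x))).
    intros e He. pose proof bX. split.
    - intros (x & _ & -> & _ & E). auto.
    - intros E. exists q. repeat split; auto. lia.
  Qed.

  Lemma KnB_nz k v i : KnB k v -> D C (k + 31) (fun e => v (e i) <> 0).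
  Proof.
    intros Hv. assert (De := KnB_test k v 0 i Hv (pow2_pos _) (D_zero C)).
    fbuild.
  Qed.

  Lemma D_less k u v z : KnB k u -> KnB k v -> D C (k + 25) (fun e => u (e z) < v (e z)).
  Proof.
    intros (Bu & Du) (Bv & Dv).
    fby (fun e => exists i, i < X /\ (i < nd /\ ((exists x, x < X /\ (dg (u (e z)) i = x /\
          exists y, y < X /\ (dg (v (e z)) i = y /\ x < y))) /\
          forall j, j < X -> j < nd -> i < j -> exists x, x < X /\ (dg (u (e z)) j = x /\ dg (v (e z)) j = x)))).
    intros e He. rewrite (lt_digits (2 ^ bb) nd) by (rewrite <- wl_eq; auto). pose proof ndX. split.
    - intros (i & _ & Hi & (x & _ & <- & y & _ & <- & L) & A). exists i. split; auto. split; auto.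
      intros j Hj Hij. destruct (A j) as (w & _ & <- & E); auto. lia.
    - intros (i & Hi & L & A). exists i. split; [lia|]. split; auto. split.
      + eexists. split; [|split; [reflexivity|]]; [apply dgX|].
        eexists. split; [|split; [reflexivity|auto]]. apply dgX.
      + intros j _ Hj Hij. eexists. split; [|split; [reflexivity|]]; [apply dgX|]. symmetry; apply A; auto.
  Qed.

  Lemma KnB_cases k (R : nat -> Prop) u v w : KnB k u -> KnB k v ->
    (forall z, D C (k + 25) (fun e => R (e z))) ->
    (forall z, R z -> w z = u z) -> (forall z, ~ R z -> w z = v z) -> KnB (k + 30) w.
  Proof.
    intros (Bu & Du) (Bv & Dv) DR E1 E2. split.
    - intros z. destruct (classic (R z)) as [H|H]; [rewrite E1|rewrite E2]; auto.
    - intros z i j.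
      fby (fun e => (R (e z) /\ dg (u (e z)) (e i) = e j) \/ (~ R (e z) /\ dg (v (e z)) (e i) = e j)).
      intros e He. destruct (classic (R (e z))) as [H|H]; [rewrite (E1 _ H)|rewrite (E2 _ H)]; tauto.
  Qed.

  Lemma KnB_Max k u v : KnB k u -> KnB k v -> KnB (k + 30) (fun z => Nat.max (u z) (v z)).
  Proof.
    intros Hu Hv. apply (KnB_cases k (fun z => u z < v z) v u); auto; try (intros; lia).
    intros; apply D_less; auto.
  Qed.

  Lemma KnB_Min k u v : KnB k u -> KnB k v -> KnB (k + 30) (fun z => Nat.min (u z) (v z)).
  Proof.
    intros Hu Hv. apply (KnB_cases k (fun z => u z < v z) u v); auto; try (intros; lia).
    intros; apply D_less; auto.
  Qed.

  (** An exponent below [wl] is smaller than [b] and fits into a variable. The power then has one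
      nonzero digit, at the quotient of the exponent by [2 ^ bb], and the remainder determines
      it. *)
  Lemma KnB_Exp2 k v : KnB k v -> KnB (k + 80) (fun z => Nat.min (2 ^ v z) (2 ^ wl - 1)).
  Proof.
    intros Hv.
    assert (Lw : wl < b) by (apply pow2_lt; pose proof (M_big C bb ga Hcbe Hga Hbb); lia).
    assert (Pw := fun i => D_pconst C (bb + 4 * ga) i ltac:(apply small_ga; lia)).
    assert (Pl := fun i => D_ltc C (bb + 4 * ga) i ltac:(apply small_ga; lia)).
    assert (Pd := fun i j => D_divc C bb i j ltac:(apply small_ga; lia)).
    assert (Pm := fun i j => D_modc C bb i j ltac:(apply small_ga; lia)).
    assert (De := fun z x => D_eq_small k v z x Hv).
    pose proof KnB_max as (_ & Dm).
    assert (Dl : forall z, D C (k + 40) (fun e => v (e z) < wl)).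
    { intros z. fby (fun e => exists x, x < X /\ ((x < b /\ v (e z) = x) /\ x < 2 ^ (bb + 4 * ga))).
      intros e He. fold wl. pose proof bX. split.
      - intros (x & _ & (_ & <-) & L); auto.
      - intros L. exists (v (e z)). repeat split; lia. }
    split; [intros; pose proof (pow2_pos wl); lia|].
    intros z i j.
    fby (fun e => (v (e z) < wl /\ exists x, x < X /\ ((x < b /\ v (e z) = x) /\
         exists q, q < X /\ (x / 2 ^ bb = q /\ exists r, r < X /\ (x mod 2 ^ bb = r /\
         ((e i = q /\ 2 ^ r = e j) \/ (e i <> q /\ e j = 0)))))) \/
         (~ (v (e z) < wl) /\ dg (2 ^ wl - 1) (e i) = e j)).
    intros e He. destruct (Nat.lt_ge_cases (v (e z)) wl) as [L|L].
    - rewrite Nat.min_l by (apply pow2_lt in L; lia). rewrite field_pow2 by auto.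
      destruct (Nat.eqb_spec (e i) (v (e z) / 2 ^ bb)) as [Ei|Ni].
      + split.
        * intros [(_ & x & _ & (_ & <-) & q & _ & <- & r & _ & <- & [(_ & E)|(K & _)])|(K & _)]; [auto|tauto|lia].
        * intros E. left. split; auto. pose proof bX. exists (v (e z)). split; [lia|]. split; [lia|].
          assert (v (e z) / 2 ^ bb <= v (e z)).
          { apply Nat.Div0.div_le_upper_bound. pose proof (pow2_pos bb). nia. }
          eexists. split; [|split; [reflexivity|]]; [lia|].
          eexists. split; [|split; [reflexivity|]]; [|left; auto].
          pose proof (Nat.Div0.mod_le (v (e z)) (2 ^ bb)). lia.
      + split.
        * intros [(_ & x & _ & (_ & <-) & q & _ & <- & r & _ & <- & [(K & _)|(_ & E)])|(K & _)]; [tauto|auto|lia].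
        * intros E. left. split; auto. pose proof bX. exists (v (e z)). split; [lia|]. split; [lia|].
          assert (v (e z) / 2 ^ bb <= v (e z)).
          { apply Nat.Div0.div_le_upper_bound. pose proof (pow2_pos bb). nia. }
          eexists. split; [|split; [reflexivity|]]; [lia|].
          eexists. split; [|split; [reflexivity|]]; [|right; auto].
          pose proof (Nat.Div0.mod_le (v (e z)) (2 ^ bb)). lia.
    - rewrite Nat.min_r by (apply pow2_le in L; lia).
      split; [intros [(K & _)|(_ & E)]; [lia|auto]|intros; right; split; [lia|auto]].
  Qed.
End Words.

(** * Division by a power series *)

Fixpoint padd (p q : list nat) : list nat :=
  match p, q with
  | [], q => q
  | p, [] => p
  | a :: p, b :: q => (a + b) :: padd p q
  end.
Definition pscale (c : nat) (p : list nat) : list nat := map (Nat.mul c) p.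
Fixpoint pmul (p q : list nat) : list nat :=
  match p with
  | [] => []
  | a :: p => padd (pscale a q) (0 :: pmul p q)
  end.

Lemma padd_length p : forall q, length (padd p q) = Nat.max (length p) (length q).
Proof. induction p as [|a p IH]; intros [|c q]; simpl; auto. Qed.
Lemma pscale_length c p : length (pscale c p) = length p.
Proof. apply length_map. Qed.
Lemma pmul_length p q : length (pmul p q) <= length p + length q.
Proof. induction p; simpl; [lia|]. rewrite padd_length, pscale_length. simpl. lia. Qed.

Lemma peval_padd p x : forall q, peval (padd p q) x = peval p x + peval q x.
Proof. induction p as [|a p IH]; intros [|c q]; simpl; auto. rewrite IH. lia. Qed.
Lemma peval_pscale c p x : peval (pscale c p) x = c * peval p x.
Proof. induction p; simpl; [lia|]. fold (pscale c p). rewrite IHp. lia. Qed.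
Lemma peval_pmul p q x : peval (pmul p q) x = peval p x * peval q x.
Proof. induction p; simpl; auto. rewrite peval_padd, peval_pscale. simpl. rewrite IHp. lia. Qed.
Lemma peval_monomial k x : peval (repeat 0 k ++ [1]) x = x ^ k.
Proof. induction k; simpl; [lia|]. rewrite IHk. auto. Qed.

(* [sum_(i < j) E ^ i * Y ^ (j - 1 - i)] *)
Fixpoint geo2 (Y E j : nat) : nat :=
  match j with 0 => 0 | S j => geo2 Y E j * E + Y ^ j end.

Lemma geo2_spec A E j : A * geo2 (A + E) E j + E ^ j = (A + E) ^ j.
Proof.
  induction j; simpl; [lia|].
  set (Y := A + E) in *. set (R := geo2 Y E j) in *.
  assert (A * (R * E + Y ^ j) + E * E ^ j = E * (A * R + E ^ j) + A * Y ^ j) by lia.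
  rewrite H, IHj. unfold Y. lia.
Qed.

Lemma geo2_1 E j : geo2 1 E j <= (E + 1) ^ j.
Proof.
  induction j; simpl; [lia|]. rewrite Nat.pow_1_l.
  assert (1 <= (E + 1) ^ j) by (apply Nat.neq_0_lt_0, Nat.pow_nonzero; lia). nia.
Qed.

(* [W / YJ] approximates [1 / y] from below, with a relative error below [1 / (b x + 1)];
   the quotient is that of [b x + 1] by [b y], which is bounded away from the integers. *)
Lemma quotient_approx b x y W EJ YJ : 2 <= b -> 0 < y -> 0 < YJ ->
  y * W + EJ = YJ -> (b * x + 1) * EJ <= YJ ->
  ((b * x + 1) * W) / (b * YJ) = x / y.
Proof.
  intros Hb Hy HY E S.
  pose proof (Nat.div_mod_eq x y) as Dx. pose proof (Nat.mod_upper_bound x y ltac:(lia)) as Mx.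
  set (q := x / y) in *. set (r := x mod y) in *.
  set (P := b * x + 1) in *.
  assert (EP : P * (y * W) + P * EJ = P * YJ) by (rewrite <- E; lia).
  symmetry. apply Nat.div_unique with (P * W - b * YJ * q).
  - assert (U : P * W < b * YJ * (q + 1)).
    { apply (Nat.mul_lt_mono_pos_l y); auto.
      assert (y * (P * W) <= P * YJ) by lia.
      assert (P * YJ < y * (b * YJ * (q + 1))); [|lia].
      replace (y * (b * YJ * (q + 1))) with (b * (y * (q + 1)) * YJ) by lia.
      apply Nat.mul_lt_mono_pos_r; auto. unfold P.
      assert (x + 1 <= y * (q + 1)) by lia. nia. }
    lia.
  - assert (L : b * YJ * q <= P * W).
    { apply (Nat.mul_le_mono_pos_l _ _ y); auto.
      replace (y * (b * YJ * q)) with (b * (y * q) * YJ) by lia.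
      replace (y * (P * W)) with (P * (y * W)) by lia.
      assert (b * (y * q) * YJ + YJ <= P * YJ); [|lia].
      replace (b * (y * q) * YJ + YJ) with ((b * (y * q) + 1) * YJ) by lia.
      apply Nat.mul_le_mono_r. unfold P. nia. }
    lia.
Qed.

Section DivMath.
  Variables (be g : nat).
  Hypothesis Hbe : 0 < be.
  Hypothesis Hg : 2 <= g.
  Let b := 2 ^ be.

  (** [dtop] is the index of the leading digit of [y], [dlead] is [y] scaled to [2 * g + 1] digits,
      and [drec] is its scaled reciprocal, rounded down with [dlead + 1] so that [drec y * y] stays
      below [b ^ dlam y]. The defect [derr] is smaller than that power by a factor of at least
      [b ^ g]. Thus [1 / y] is [drec] divided by [b ^ dlam - derr], a geometric series in [derr]. *)
  Definition dtop (y : nat) : nat := Nat.log2 y / be.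
  Definition dlead (y : nat) : nat := (y * b ^ (2 * g)) / b ^ dtop y.
  Definition drec (y : nat) : nat := b ^ (4 * g) / (dlead y + 1).
  Definition dlam (y : nat) : nat := 2 * g + dtop y.
  Definition derr (y : nat) : nat := b ^ dlam y - drec y * y.

  Let b2 : 2 <= b.
  Proof. change 2 with (2 ^ 1). apply pow2_le; auto. Qed.

  Let bp k : 1 <= b ^ k.
  Proof. apply Nat.neq_0_lt_0, Nat.pow_nonzero. lia. Qed.

  Lemma dtop_spec y : 0 < y -> b ^ dtop y <= y < b ^ (dtop y + 1).
  Proof.
    intros Hy. destruct (Nat.log2_spec y Hy) as [L U]. unfold b, dtop.
    rewrite <- !Nat.pow_mul_r. pose proof (Nat.div_mod_eq (Nat.log2 y) be).
    pose proof (Nat.mod_upper_bound (Nat.log2 y) be ltac:(lia)).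
    set (t := Nat.log2 y / be) in *. split.
    - eapply Nat.le_trans; [|exact L]. apply pow2_le. lia.
    - eapply Nat.lt_le_trans; [exact U|]. apply pow2_le. nia.
  Qed.

  Lemma dlead_spec y : 0 < y ->
    b ^ (2 * g) <= dlead y /\ dlead y < b ^ (2 * g + 1) /\
    dlead y * b ^ dtop y <= y * b ^ (2 * g) /\ y * b ^ (2 * g) < (dlead y + 1) * b ^ dtop y.
  Proof.
    intros Hy. destruct (dtop_spec y Hy) as [L U]. unfold dlead. set (t := dtop y) in *.
    pose proof (bp t). pose proof (bp (2 * g)).
    pose proof (Nat.div_mod_eq (y * b ^ (2 * g)) (b ^ t)) as Dv.
    pose proof (Nat.mod_upper_bound (y * b ^ (2 * g)) (b ^ t) ltac:(lia)) as Md.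
    set (Yt := y * b ^ (2 * g) / b ^ t) in *. split; [|split; [|split]].
    - apply Nat.div_le_lower_bound; [lia|]. apply Nat.mul_le_mono_r; auto.
    - apply Nat.Div0.div_lt_upper_bound. rewrite <- Nat.pow_add_r.
      replace (t + (2 * g + 1)) with ((t + 1) + 2 * g) by lia. rewrite Nat.pow_add_r.
      apply Nat.mul_lt_mono_pos_r; auto.
    - lia.
    - lia.
  Qed.

  Lemma drec_spec y : 0 < y ->
    drec y <= b ^ (2 * g) /\ drec y * y < b ^ dlam y /\ b ^ dlam y <= drec y * y + b ^ (dtop y + 2).
  Proof.
    intros Hy. destruct (dlead_spec y Hy) as (A1 & A2 & A3 & A4).
    unfold drec, dlam. set (Yt := dlead y) in *. set (t := dtop y) in *.
    pose proof (Nat.div_mod_eq (b ^ (4 * g)) (Yt + 1)) as Dv.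
    pose proof (Nat.mod_upper_bound (b ^ (4 * g)) (Yt + 1) ltac:(lia)) as Md.
    set (u := b ^ (4 * g) / (Yt + 1)) in *. set (r := b ^ (4 * g) mod (Yt + 1)) in *.
    assert (E4 : b ^ (4 * g) = b ^ (2 * g) * b ^ (2 * g)).
    { rewrite <- Nat.pow_add_r. f_equal. lia. }
    pose proof (bp (2 * g)) as G1. pose proof (bp t) as T1.
    assert (Elam : b ^ (2 * g + t) = b ^ (2 * g) * b ^ t) by apply Nat.pow_add_r.
    assert (Et2 : b ^ (t + 2) = b * b * b ^ t).
    { rewrite Nat.pow_add_r. simpl. lia. }
    assert (E21 : b ^ (2 * g + 1) = b * b ^ (2 * g)).
    { rewrite Nat.pow_add_r, Nat.pow_1_r. lia. }
    rewrite Elam, Et2. rewrite E21 in A2.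
    set (B := b ^ (2 * g)) in *. set (Tt := b ^ t) in *.
    assert (U1 : u <= B).
    { apply Nat.lt_succ_r. apply (Nat.mul_lt_mono_pos_l B); [lia|].
      apply Nat.le_lt_trans with (u * (Yt + 1)); [nia|]. apply Nat.le_lt_trans with (B * B); lia. }
    split; auto. split.
    - apply (Nat.mul_lt_mono_pos_l B); [lia|].
      destruct (Nat.eq_dec u 0) as [->|Nu]; [simpl; nia|].
      apply Nat.lt_le_trans with (u * ((Yt + 1) * Tt)).
      + replace (B * (u * y)) with (u * (y * B)) by lia. apply Nat.mul_lt_mono_pos_l; lia.
      + replace (u * ((Yt + 1) * Tt)) with (((Yt + 1) * u) * Tt) by lia.
        replace (B * (B * Tt)) with (B * B * Tt) by lia. apply Nat.mul_le_mono_r. lia.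
    - apply (Nat.mul_le_mono_pos_l _ _ B); [lia|].
      rewrite Nat.mul_add_distr_l.
      replace (B * (u * y)) with (u * (y * B)) by lia.
      assert (u * (Yt * Tt) <= u * (y * B)) by (apply Nat.mul_le_mono_l; auto).
      assert (B * (B * Tt) <= u * (Yt * Tt) + B * (b * b * Tt)); [|lia].
      replace (B * (B * Tt)) with ((B * B) * Tt) by lia.
      replace (u * (Yt * Tt) + B * (b * b * Tt)) with ((u * Yt + B * (b * b)) * Tt) by lia.
      apply Nat.mul_le_mono_r.
      assert (B * B = u * Yt + u + r) by lia.
      assert (u + r <= B + b * B) by lia.
      assert (B + b * B <= B * (b * b)) by nia. lia.
  Qed.

  (** The first [g + 1] terms of the series leave the relative error [(derr / b ^ dlam) ^ (g + 1)],
      at most [b ^ - (g * (g + 1))]. For [x < b ^ (g * g)] this is small enough for the quotient of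
      [b * x + 1] to be rounded correctly. *)
  Theorem division_formula x y : 0 < y -> x < b ^ (g * g) ->
    x / y = ((b * x + 1) * (drec y * geo2 (b ^ dlam y) (derr y) (g + 1))) / b ^ (dlam y * (g + 1) + 1).
  Proof.
    intros Hy Hx. destruct (drec_spec y Hy) as (R1 & R2 & R3).
    assert (EY : b ^ dlam y = drec y * y + derr y) by (unfold derr; lia).
    assert (Le : derr y * b ^ g <= b ^ dlam y).
    { assert (derr y <= b ^ (dtop y + 2)) by (unfold derr; lia).
      apply Nat.le_trans with (b ^ (dtop y + 2) * b ^ g); [apply Nat.mul_le_mono_r; auto|].
      rewrite <- Nat.pow_add_r. unfold dlam. apply Nat.pow_le_mono_r; lia. }
    pose proof (geo2_spec (drec y * y) (derr y) (g + 1)) as Sp. rewrite <- EY in Sp.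
    replace (b ^ (dlam y * (g + 1) + 1)) with (b * (b ^ dlam y) ^ (g + 1)).
    2:{ rewrite (Nat.pow_add_r b (dlam y * (g + 1))), Nat.pow_1_r, (Nat.pow_mul_r b). apply Nat.mul_comm. }
    symmetry. apply quotient_approx with (derr y ^ (g + 1)); auto.
    - apply Nat.neq_0_lt_0, Nat.pow_nonzero. specialize (bp (dlam y)). lia.
    - rewrite <- Sp. lia.
    - apply Nat.le_trans with ((b ^ g) ^ (g + 1) * derr y ^ (g + 1)).
      + apply Nat.mul_le_mono_r. rewrite <- Nat.pow_mul_r.
        apply Nat.le_trans with (b * b ^ (g * g)).
        * nia.
        * rewrite <- Nat.pow_succ_r'. apply Nat.pow_le_mono_r; [lia|]. nia.
      + rewrite <- Nat.pow_mul_l. apply Nat.pow_le_mono_l. lia.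
  Qed.
End DivMath.

(** * Sums, products and quotients of words *)

Lemma nth_map_seq (f : nat -> nat) m i : nth i (map f (seq 0 m)) 0 = if i <? m then f i else 0.
Proof.
  destruct (Nat.ltb_spec i m).
  - rewrite nth_indep with (d' := f 0) by (rewrite length_map, length_seq; auto).
    rewrite map_nth, seq_nth by auto. auto.
  - apply nth_overflow. rewrite length_map, length_seq. auto.
Qed.

Lemma peval_map_le m f B : (forall i, f i <= B) -> peval (map f (seq 0 m)) 1 <= m * B.
Proof.
  intros H. assert (G : forall s, peval (map f (seq s m)) 1 <= m * B); [|apply G].
  induction m; intros s; simpl; [lia|]. specialize (IHm (S s)). specialize (H s). lia.
Qed.

Lemma catf_cut W l : forall m f, l <= m -> catf W m (fun i => if i <? l then f i else 0) = catf W l f.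
Proof.
  induction l; intros m f L; simpl.
  - apply catf_zero.
  - destruct m; [lia|]. simpl. f_equal. f_equal. rewrite <- (IHl m (fun i => f (S i))) by lia.
    apply catf_ext. intros. auto.
Qed.

Section Evaluate.
  Context (C : cls) {FO : fo C} (bb ga : nat).
  Hypothesis Hcbe : cbe C = 2 ^ (bb + 3 * ga + 7).
  Hypothesis Hga : 3 <= ga.
  Hypothesis Hbb : 8 * ga + 20 <= bb.
  Notation X := (2 ^ cbe C).
  Notation dg := (field (2 ^ bb)).
  Notation b := (2 ^ 2 ^ bb).
  Notation nd := (2 ^ (4 * ga)).
  Notation mm := (2 ^ (4 * ga + 1)).
  Notation F := (F_ bb ga).
  Notation N := (N_ ga).
  Notation M := (M_ bb ga).
  Notation WL := (2 ^ wl bb ga).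
  Notation Kn := (KnB C bb ga).
  Notation pt l := (2 ^ (2 ^ ew bb ga * l)).

  Let big := M_big C bb ga Hcbe Hga Hbb.
  Let Flt := F_lt C bb ga Hcbe Hga Hbb.
  Let FX := F_X C bb ga Hcbe Hga Hbb.
  Let Mlt := M_lt C bb ga Hcbe Hga Hbb.

  Lemma F_gt a x : x <= 2 ^ a -> 8 * ga + a <= M -> N * x < F.
  Proof.
    intros Hx L. unfold F_. rewrite Nat.add_1_r. apply Nat.lt_succ_r, Nat.le_trans with (2 ^ (8 * ga) * 2 ^ a).
    - apply Nat.mul_le_mono_l; auto.
    - rewrite <- Nat.pow_add_r. apply pow2_le; auto.
  Qed.

  Lemma bF : 2 * b < F.
  Proof.
    unfold F_. rewrite Nat.add_1_r. apply Nat.lt_succ_r. rewrite <- Nat.pow_succ_r'. apply pow2_le. lia.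
  Qed.

  Lemma modF x : x mod F < F.
  Proof. apply Nat.mod_upper_bound. lia. Qed.

  (** There are twice as many coefficients as digits in a word, because the number [b ^ lam - U] in
      the division may have that many digits. *)
  Definition digit_poly (h : nat -> nat -> nat) (z : nat) : list nat := map (h z) (seq 0 mm).
  Definition poly_eval (h : nat -> nat -> nat) (z l : nat) : nat :=
    if l <=? N then TS bb ga (4 * ga + 1) h z l else 0.

  Lemma pl_length h z : length (digit_poly h z) = mm.
  Proof. unfold digit_poly. rewrite length_map, length_seq. auto. Qed.

  Lemma evt_lt h z l : poly_eval h z l < F.
  Proof. unfold poly_eval. destruct (_ <=? _); [apply modF|lia]. Qed.

  Lemma evt_eval h z l : l < N -> poly_eval h z l = peval (digit_poly h z) (pt l) mod F.
  Proof.
    intros L. unfold poly_eval. rewrite (proj2 (Nat.leb_le l N)) by lia. unfold TS.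
    rewrite (peval_sumf (digit_poly h z) _ mm) by (rewrite pl_length; auto).
    apply sumf_mod. intros i Hi. unfold digit_poly. rewrite nth_map_seq, (proj2 (Nat.ltb_lt i mm)) by auto.
    rewrite Nat.Div0.mul_mod, (root_mod C bb ga Hcbe Hga Hbb), <- Nat.Div0.mul_mod.
    do 2 f_equal. rewrite <- Nat.pow_mul_r. f_equal. lia.
  Qed.

  Lemma G2_evt k h : G2 C k h -> (forall z i, h z i < F) -> G2 C (k + 620) (poly_eval h).
  Proof.
    intros Hh HF z l v.
    assert (T := fun z u v => D_TS C bb ga Hcbe Hga Hbb k (4 * ga + 1) h Hh HF ltac:(lia) z u v).
    assert (Q := fun i => D_lec C (eN ga) i (proj1 (proj2 (eN_lt C bb ga Hcbe Hga Hbb)))).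
    fby (fun e => (e l <= N /\ TS bb ga (4 * ga + 1) h (e z) (e l) = e v) \/ (~ (e l <= 2 ^ eN ga) /\ e v = 0)).
    intros e He. unfold poly_eval. fold (N_ ga). destruct (Nat.leb_spec (e l) N); lia.
  Qed.

  Lemma G2_mulF k f g : G2 C k f -> G2 C k g -> (forall z i, f z i < F) -> (forall z i, g z i < F) ->
    G2 C (k + 30) (fun z l => (f z l * g z l) mod F).
  Proof.
    intros Df Dg Bf Bg z l v. unfold G2 in *.
    assert (Dm := D_mulF C bb ga Hcbe Hga Hbb).
    fby (fun e => exists x, x < X /\ (f (e z) (e l) = x /\ exists y, y < X /\ (g (e z) (e l) = y /\
          ((x < 2 ^ (2 * M) /\ y < 2 ^ (2 * M)) /\ (x * y) mod F = e v)))).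
    intros e He. specialize (Bf (e z) (e l)). specialize (Bg (e z) (e l)). split.
    - intros (x & _ & <- & y & _ & <- & _ & E). auto.
    - intros E. eexists. split; [|split; [reflexivity|]]; [lia|].
      eexists. split; [|split; [reflexivity|]]; [lia|]. split; auto. lia.
  Qed.

  Lemma KnB_poly k p ev : G2 C k ev -> (forall z l, ev z l < F) ->
    (forall z l, l < N -> ev z l = peval (p z) (pt l) mod F) ->
    (forall z, length (p z) <= N) -> (forall z, N * peval (p z) 1 < F) ->
    Kn (k + 1260) (fun z => peval (p z) b mod WL).
  Proof.
    intros H1 H2 H3 H4 H5. eapply KnB_mono; [apply (KnB_trunc C bb ga Hcbe Hga Hbb (k + 1240))|lia].
    intros z i j. apply (D_extract C bb ga Hcbe Hga Hbb k p ev); auto.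
  Qed.

  Lemma mmN : mm + mm <= N.
  Proof.
    replace (mm + mm) with (2 ^ (4 * ga + 2)) by (rewrite !Nat.pow_add_r; simpl (2 ^ 1); simpl (2 ^ 2); lia).
    apply pow2_le. unfold eN. lia.
  Qed.

  Lemma word_split x : x < WL -> catf (2 ^ bb) mm (dg x) = x.
  Proof.
    intros H. symmetry. apply field_split. eapply lt_pow2_mono; [exact H|].
    rewrite wl_eq. apply Nat.mul_le_mono_l, pow2_le. lia.
  Qed.

  Lemma peval_word (v : nat -> nat) z : v z < WL -> peval (digit_poly (fun z => dg (v z)) z) b = v z.
  Proof. intros H. unfold digit_poly. rewrite peval_map. apply word_split; auto. Qed.

  Lemma KnB_ext k u v : (forall z, u z = v z) -> Kn k u -> Kn k v.
  Proof.
    intros E (B & H). split; [intros; rewrite <- E; auto|].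
    intros z i j. eapply D_ext; [|apply (H z i j)]. intros e _; cbv beta. rewrite E. tauto.
  Qed.

  Lemma KnB_Add k u v : Kn k u -> Kn k v -> Kn (k + 1900) (fun z => (u z + v z) mod WL).
  Proof.
    intros (Bu & Du) (Bv & Dv).
    set (h := fun z i => dg (u z) i + dg (v z) i).
    assert (Hh : G2 C (k + 6) h).
    { intros z i j. fby (fun e => exists x, x < X /\ (dg (u (e z)) (e i) = x /\
        exists y, y < X /\ (dg (v (e z)) (e i) = y /\ x + y = e j))).
      intros e He. unfold h. split.
      - intros (x & _ & <- & y & _ & <- & E). auto.
      - intros E. eexists. split; [|split; [reflexivity|]]; [apply (dgX C bb ga Hcbe Hga Hbb)|].
        eexists. split; [|split; [reflexivity|]]; [apply (dgX C bb ga Hcbe Hga Hbb)|]. auto. }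
    assert (Bh : forall z i, h z i <= 2 * b).
    { intros. unfold h. pose proof (field_lt (2 ^ bb) (u z) i). pose proof (field_lt (2 ^ bb) (v z) i). lia. }
    assert (Fh : forall z i, h z i < F) by (intros z i; specialize (Bh z i); pose proof bF; lia).
    apply (KnB_ext _ (fun z => peval (digit_poly h z) b mod WL)).
    { intros z. unfold digit_poly, h. rewrite peval_map, <- catf_add, !word_split; auto. }
    eapply KnB_mono; [apply (KnB_poly (k + 6 + 620) (digit_poly h) (poly_eval h))|lia].
    - apply G2_evt; auto.
    - apply evt_lt.
    - apply evt_eval.
    - intros z. rewrite pl_length. pose proof mmN. lia.
    - intros z. apply F_gt with (4 * ga + 1 + (2 ^ bb + 1)).
      + rewrite Nat.pow_add_r. rewrite (Nat.pow_add_r 2 (2 ^ bb)). rewrite Nat.pow_1_r.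
        eapply Nat.le_trans; [apply peval_map_le, Bh|]. lia.
      + pose proof (pow2_pos (2 * ga)). nia.
  Qed.

  Lemma G2_digits k u : Kn k u -> G2 C k (fun z => dg (u z)).
  Proof. intros (_ & H). exact H. Qed.

  Lemma dgF x i : dg x i < F.
  Proof. pose proof (field_lt (2 ^ bb) x i). pose proof bF. lia. Qed.

  (** The convolution of digits becomes a product of residues at each root of unity; [N_] exceeds
      the degree of the product and [F] its scaled coefficients. *)
  Lemma KnB_Mul k u v : Kn k u -> Kn k v -> Kn (k + 1930) (fun z => (u z * v z) mod WL).
  Proof.
    intros Hu Hv. set (hu := fun z => dg (u z)). set (hv := fun z => dg (v z)).
    apply (KnB_ext _ (fun z => peval (pmul (digit_poly hu z) (digit_poly hv z)) b mod WL)).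
    { intros z. rewrite peval_pmul. unfold hu, hv. rewrite !peval_word; [auto|apply Hv|apply Hu]. }
    eapply KnB_mono; [apply (KnB_poly (k + 620 + 30) _ (fun z l => (poly_eval hu z l * poly_eval hv z l) mod F))|lia].
    - apply G2_mulF; try apply evt_lt; apply G2_evt; try (intros; apply dgF); apply G2_digits; auto.
    - intros; apply modF.
    - intros z l Hl. rewrite !evt_eval, peval_pmul, <- Nat.Div0.mul_mod by auto. auto.
    - intros z. eapply Nat.le_trans; [apply pmul_length|]. rewrite !pl_length. apply mmN.
    - intros z. rewrite peval_pmul. apply F_gt with ((4 * ga + 1 + 2 ^ bb) + (4 * ga + 1 + 2 ^ bb)).
      + assert (L : forall w, peval (digit_poly (fun z => dg (w z)) z) 1 <= 2 ^ (4 * ga + 1 + 2 ^ bb)).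
        { intros w. rewrite (Nat.pow_add_r 2 (4 * ga + 1)). apply peval_map_le. intros.
          apply Nat.lt_le_incl, field_lt. }
        rewrite (Nat.pow_add_r 2 (4 * ga + 1 + 2 ^ bb)). apply Nat.mul_le_mono; apply L.
      + pose proof (pow2_pos (2 * ga)). nia.
  Qed.
End Evaluate.

Section Quotient.
  Context (C : cls) {FO : fo C} (bb ga : nat).
  Hypothesis Hcbe : cbe C = 2 ^ (bb + 3 * ga + 7).
  Hypothesis Hga : 3 <= ga.
  Hypothesis Hbb : 8 * ga + 20 <= bb.
  Notation X := (2 ^ cbe C).
  Notation dg := (field (2 ^ bb)).
  Notation b := (2 ^ 2 ^ bb).
  Notation nd := (2 ^ (4 * ga)).
  Notation mm := (2 ^ (4 * ga + 1)).
  Notation F := (F_ bb ga).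
  Notation N := (N_ ga).
  Notation M := (M_ bb ga).
  Notation WL := (2 ^ wl bb ga).
  Notation Kn := (KnB C bb ga).
  Notation pt l := (2 ^ (2 ^ ew bb ga * l)).
  Notation g := (2 ^ (2 * ga)).
  Notation be := (2 ^ bb).
  Notation pl := (digit_poly ga).
  Notation evt := (poly_eval bb ga).
  Notation evt_eval := (evt_eval C bb ga Hcbe Hga Hbb).
  Notation evt_lt := (evt_lt C bb ga Hcbe Hga Hbb).
  Notation modF := (modF C bb ga Hcbe Hga Hbb).

  Let big := M_big C bb ga Hcbe Hga Hbb.
  Let Flt := F_lt C bb ga Hcbe Hga Hbb.
  Let FX := F_X C bb ga Hcbe Hga Hbb.
  Let Mlt := M_lt C bb ga Hcbe Hga Hbb.

  Lemma g_facts : 64 <= g /\ g * g = nd /\ mm = 2 * nd /\ N = nd * nd.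
  Proof.
    repeat split.
    - change 64 with (2 ^ 6). apply pow2_le. lia.
    - rewrite <- Nat.pow_add_r. f_equal. lia.
    - rewrite Nat.add_1_r. apply Nat.pow_succ_r'.
    - unfold N_, eN. rewrite <- Nat.pow_add_r. f_equal. lia.
  Qed.

  Lemma bpow i : b ^ i = 2 ^ (be * i).
  Proof. symmetry. apply Nat.pow_mul_r. Qed.

  Lemma dtop_graph y t : 0 < y -> y < WL ->
    dtop be y = t <-> dg y t <> 0 /\ forall j, j < nd -> t < j -> dg y j = 0.
  Proof.
    intros Hy Hw. assert (G := g_facts).
    destruct (dtop_spec be g ltac:(auto) ltac:(lia) y Hy) as [L U]. rewrite !bpow in *.
    set (t0 := dtop be y) in *.
    assert (A : forall j, t0 < j -> dg y j = 0).
    { intros j Hj. apply field_high. eapply lt_pow2_mono; [exact U|]. apply Nat.mul_le_mono_l. lia. }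
    assert (B : dg y t0 <> 0).
    { unfold field. rewrite Nat.mod_small.
      - assert (1 <= y / 2 ^ (be * t0)); [|lia]. apply Nat.div_le_lower_bound; auto. lia.
      - apply Nat.Div0.div_lt_upper_bound. rewrite <- Nat.pow_add_r. replace (be * t0 + be) with (be * (t0 + 1)) by lia. auto. }
    split; [intros <-; auto|]. intros (B' & A').
    destruct (Nat.lt_trichotomy t0 t) as [K|[K|K]]; auto.
    - exfalso; auto.
    - exfalso. apply B, A'; auto. destruct (Nat.lt_ge_cases t0 nd); auto. exfalso; apply B.
      apply (dg_high C bb ga Hcbe Hga Hbb); auto.
  Qed.

  Lemma dtop_lt y : 0 < y -> y < WL -> dtop be y < nd.
  Proof.
    intros Hy Hw. destruct (proj1 (dtop_graph y _ Hy Hw) eq_refl) as (B & _).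
    destruct (Nat.lt_ge_cases (dtop be y) nd); auto. exfalso; apply B. apply (dg_high C bb ga Hcbe Hga Hbb); auto.
  Qed.

  Lemma dlead_digit y i :
    dg (dlead be g y) i = if 2 * g <=? i + dtop be y then dg y (i + dtop be y - 2 * g) else 0.
  Proof.
    unfold dlead. set (t := dtop be y). rewrite !bpow. unfold field.
    rewrite Nat.Div0.div_div, <- Nat.pow_add_r.
    destruct (Nat.leb_spec (2 * g) (i + t)).
    - replace (be * t + be * i) with (be * (i + t - 2 * g) + be * (2 * g)) by nia.
      rewrite Nat.pow_add_r, Nat.Div0.div_mul_cancel_r by auto. auto.
    - replace (be * (2 * g)) with (be * (2 * g - (i + t) - 1) + be + (be * t + be * i)) by nia.
      rewrite Nat.pow_add_r, Nat.mul_assoc, Nat.div_mul by auto.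
      rewrite Nat.pow_add_r, Nat.mul_assoc. apply Nat.Div0.mod_mul.
  Qed.

  Section Fixed.
    Variables (k : nat) (u v : nat -> nat).
    Hypothesis Hu : Kn k u.
    Hypothesis Hv : Kn k v.
    Hypothesis Hpos : forall z, 0 < v z.

    Let Bv z : v z < WL := proj1 Hv z.
    Let Bu z : u z < WL := proj1 Hu z.

    Let top z := dtop be (v z).
    Let lam z := dlam be g (v z).
    Let rc z := drec be g (v z).

    Lemma D_top z t : D C (k + 20) (fun e => top (e z) = e t).
    Proof.
      assert (Dv := proj2 Hv). assert (Dn := D_isnd C bb ga Hcbe Hga Hbb).
      fby (fun e => (exists x, x < X /\ (dg (v (e z)) (e t) = x /\ x <> 0)) /\
          forall j, j < X -> (j < nd /\ e t < j) -> exists x, x < X /\ (x = 0 /\ dg (v (e z)) j = x)).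
      intros e He. unfold top. rewrite dtop_graph by auto. split.
      - intros ((x & _ & <- & Nx) & A). split; auto. intros j H1 H2.
        destruct (A j) as (x & _ & -> & E); auto. pose proof (ndX C bb ga Hcbe Hga Hbb). lia.
      - intros (Nx & A). split.
        + eexists. split; [|split; [reflexivity|auto]]. apply (dgX C bb ga Hcbe Hga Hbb).
        + intros j _ (H1 & H2). exists 0. auto.
    Qed.
    Hint Resolve D_top : dd.

    Lemma gq : 2 ^ (bb + 2 * ga + 2) = be * (4 * g) /\ be * (4 * g) + be * (4 * g) < cbe C.
    Proof.
      assert (E : 2 ^ (bb + 2 * ga + 2) = be * (4 * g)).
      { rewrite !Nat.pow_add_r. simpl (2 ^ 2). lia. }
      split; auto. pose proof (pow2_pos bb). nia.
    Qed.

    (** The leading part of the divisor has at most [2 * g + 1] digits. Unlike the divisor it is the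
        value of a variable, so its reciprocal is obtained by a division of short numbers. *)
    Lemma D_lead z y : D C (k + 60) (fun e => dlead be g (v (e z)) = e y).
    Proof.
      assert (Dv := proj2 Hv). destruct gq as [E1 E2]. assert (G := g_facts).
      assert (Ly := fun i => D_ltc C (2 ^ (bb + 2 * ga + 2)) i ltac:(lia)).
      assert (Li := fun i => D_ltc C (2 * ga + 2) i ltac:(apply (small_ga C bb ga Hcbe Hga Hbb); auto; lia)).
      assert (Dg := fun i => D_pconst C (2 * ga + 1) i ltac:(apply (small_ga C bb ga Hcbe Hga Hbb); auto; lia)).
      assert (Df := fun w j v => D_field C bb (2 * ga + 2) w j v ltac:(rewrite <- Nat.pow_add_r, Nat.add_assoc; lia)).
      fby (fun e => e y < 2 ^ 2 ^ (bb + 2 * ga + 2) /\ exists t, t < X /\ (top (e z) = t /\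
         exists g2, g2 < X /\ (g2 = 2 ^ (2 * ga + 1) /\
         forall i, i < X -> i < 2 ^ (2 * ga + 2) -> exists it, it < X /\ (i + t = it /\
           exists x, x < X /\ ((i <= 2 ^ (2 * ga + 2) /\ dg (e y) i = x) /\
            ((exists s, s < X /\ (g2 + s = it /\ dg (v (e z)) s = x)) \/ (it < g2 /\ x = 0))))))).
      intros e He. unfold top. rewrite E1.
      assert (Eg1 : 2 ^ (2 * ga + 1) = 2 * g) by (rewrite Nat.add_1_r, Nat.pow_succ_r'; lia).
      assert (Eg2 : 2 ^ (2 * ga + 2) = 4 * g) by (rewrite Nat.pow_add_r; simpl (2 ^ 2); lia).
      rewrite Eg1, Eg2.
      destruct (dlead_spec be g ltac:(auto) ltac:(lia) (v (e z)) ltac:(auto)) as (_ & U & _).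
      rewrite bpow in U.
      assert (U' : dlead be g (v (e z)) < 2 ^ (be * (4 * g))).
      { eapply lt_pow2_mono; [exact U|]. apply Nat.mul_le_mono_l. lia. }
      assert (gX : 4 * g < X). { rewrite <- Eg2. apply pow2_lt, (small_ga C bb ga Hcbe Hga Hbb); auto; lia. }
      pose proof (dtop_lt (v (e z)) (Hpos _) (Bv _)) as Lt.
      assert (nX : nd + 4 * g < X).
      { apply Nat.lt_trans with (2 ^ (4 * ga + 3)); [rewrite Nat.pow_add_r; simpl (2 ^ 3); nia|].
        apply pow2_lt, (small_ga C bb ga Hcbe Hga Hbb); auto; lia. }
      split.
      - intros (Ly' & t & _ & <- & g2 & _ & -> & A). apply (field_ext be (4 * g)); auto.
        intros i Hi. rewrite dlead_digit.
        destruct (A i ltac:(lia) Hi) as (it & _ & <- & x & _ & (_ & ->) & [(s & _ & Es & <-)|(L & ->)]).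
        + destruct (Nat.leb_spec (2 * g) (i + dtop be (v (e z)))); [|lia]. f_equal. lia.
        + destruct (Nat.leb_spec (2 * g) (i + dtop be (v (e z)))); [lia|]. auto.
      - intros <-. split; auto. eexists. split; [|split; [reflexivity|]]; [lia|].
        eexists. split; [|split; [reflexivity|]]; [lia|]. intros i _ Hi.
        eexists. split; [|split; [reflexivity|]]; [lia|].
        eexists. split; [|split; [split; [lia|reflexivity]|]]; [apply (dgX C bb ga Hcbe Hga Hbb)|].
        rewrite dlead_digit. destruct (Nat.leb_spec (2 * g) (i + dtop be (v (e z)))).
        + left. exists (i + dtop be (v (e z)) - 2 * g). repeat split; lia.
        + right. auto.
    Qed.
    Hint Resolve D_lead : dd.

    Lemma rc_le z : rc z <= 2 ^ (be * (2 * g)).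
    Proof.
      assert (G := g_facts). destruct (drec_spec be g ltac:(auto) ltac:(lia) (v z) (Hpos z)) as (A & _).
      rewrite bpow in A. auto.
    Qed.

    Lemma rcF z : rc z < F.
    Proof.
      assert (G := g_facts). pose proof (rc_le z).
      assert (N * rc z < F).
      { apply (F_gt bb ga) with (be * (2 * g)); auto. pose proof (pow2_pos bb). nia. }
      assert (1 <= N) by apply pow2_pos. nia.
    Qed.

    Lemma D_rc z y : D C (k + 70) (fun e => rc (e z) = e y).
    Proof.
      destruct gq as [E1 E2]. assert (G := g_facts).
      assert (Dc := fun i => D_pconst C (2 ^ (bb + 2 * ga + 2)) i ltac:(lia)).
      fby (fun e => exists l, l < X /\ (dlead be g (v (e z)) = l /\ exists s, s < X /\ (l + 1 = s /\
         exists c, c < X /\ (c = 2 ^ 2 ^ (bb + 2 * ga + 2) /\ c / s = e y)))).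
      intros e He. unfold rc, drec. rewrite bpow, E1.
      destruct (dlead_spec be g ltac:(auto) ltac:(lia) (v (e z)) ltac:(auto)) as (_ & U & _).
      rewrite bpow in U.
      assert (U' : dlead be g (v (e z)) < 2 ^ (be * (4 * g))).
      { eapply lt_pow2_mono; [exact U|]. apply Nat.mul_le_mono_l. lia. }
      assert (2 ^ (be * (4 * g)) < X) by (apply pow2_lt; lia).
      split.
      - intros (l & _ & <- & s & _ & <- & c & _ & -> & E). auto.
      - intros E. eexists. split; [|split; [reflexivity|]]; [lia|].
        eexists. split; [|split; [reflexivity|]]; [lia|].
        eexists. split; [|split; [reflexivity|]]; [lia|]. auto.
    Qed.
    Hint Resolve D_rc : dd.

    Lemma lam_bd z : 2 * g <= lam z /\ lam z < mm.
    Proof.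
      assert (G := g_facts). pose proof (dtop_lt (v z) (Hpos z) (Bv z)). unfold lam, dlam. nia.
    Qed.

    Lemma smallX q : q <= bb + 10 * ga + 20 -> 2 ^ q < X.
    Proof. intros. apply pow2_lt, (small_ga C bb ga Hcbe Hga Hbb); auto. Qed.

    Lemma D_lam z y : D C (k + 30) (fun e => lam (e z) = e y).
    Proof.
      assert (G := g_facts).
      assert (Dg := fun i => D_pconst C (2 * ga + 1) i ltac:(apply (small_ga C bb ga Hcbe Hga Hbb); auto; lia)).
      fby (fun e => exists t, t < X /\ (top (e z) = t /\ exists c, c < X /\ (c = 2 ^ (2 * ga + 1) /\ c + t = e y))).
      intros e He. unfold lam, dlam.
      assert (Eg1 : 2 ^ (2 * ga + 1) = 2 * g) by (rewrite Nat.add_1_r, Nat.pow_succ_r'; lia).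
      rewrite Eg1. split.
      - intros (t & _ & <- & c & _ & -> & E). auto.
      - intros E. pose proof (dtop_lt (v (e z)) (Hpos _) (Bv _)).
        pose proof (ndX C bb ga Hcbe Hga Hbb).
        exists (top (e z)). unfold top. split; [lia|]. split; auto.
        exists (2 * g). rewrite <- Eg1. split; [apply smallX; lia|]. rewrite Eg1. auto.
    Qed.
    Hint Resolve D_lam : dd.

    Let hv z := dg (v z).
    Let pU z := pscale (rc z) (pl (fun z => hv z) z).
    Let U z := rc z * v z.

    Lemma pU_eval z : peval (pU z) b = U z.
    Proof.
      unfold pU, U, hv. rewrite peval_pscale, (peval_word C bb ga Hcbe Hga Hbb); auto.
    Qed.

    Lemma pl_one (h : nat -> nat -> nat) z : (forall i, h z i <= b) -> peval (pl h z) 1 <= 2 ^ (4 * ga + 1 + be).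
    Proof. intros. rewrite (Nat.pow_add_r 2 (4 * ga + 1)). apply peval_map_le. auto. Qed.

    Lemma D_U z q y : D C (k + 1920) (fun e => e q < N /\ dg (U (e z)) (e q) = e y).
    Proof.
      assert (G := g_facts).
      apply (D_ext _ _ (fun e => e q < N /\ dg (peval (pU (e z)) b) (e q) = e y)).
      { intros e _; cbv beta. rewrite pU_eval. tauto. }
      eapply D_mono; [apply (D_extract C bb ga Hcbe Hga Hbb (k + 620 + 30) pU
         (fun z l => (rc z * evt (fun z => hv z) z l) mod F))|lia].
      - apply (G2_mulF C bb ga Hcbe Hga Hbb (k + 620) (fun z _ => rc z) (evt (fun z => hv z))).
        + intros z' l y'. eapply D_mono; [apply D_rc|lia].
        + apply (G2_evt C bb ga Hcbe Hga Hbb); [apply (G2_digits C bb ga k v Hv)|].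
          intros; apply (dgF C bb ga Hcbe Hga Hbb).
        + intros; apply rcF.
        + intros; apply evt_lt.
      - intros; apply modF.
      - intros z' l Hl. rewrite evt_eval by auto. unfold pU. rewrite peval_pscale.
        apply Nat.Div0.mul_mod_idemp_r.
      - intros z'. unfold pU. rewrite pscale_length, pl_length. nia.
      - intros z'. unfold pU. rewrite peval_pscale.
        apply (F_gt bb ga) with (be * (2 * g) + (4 * ga + 1 + be)).
        + rewrite Nat.pow_add_r. apply Nat.mul_le_mono; [apply rc_le|].
          apply pl_one. intros. apply Nat.lt_le_incl, field_lt.
        + nia.
    Qed.
    Hint Resolve D_U : dd.

    (* The digits of [b ^ lam - U], up to a carry from the lowest one. *)
    Let hE z i := if i <? lam z then (b - 1 - dg (U z) i) + (if i =? 0 then 1 else 0) else 0.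

    Lemma U_lt z : U z < 2 ^ (be * lam z).
    Proof.
      assert (G := g_facts). destruct (drec_spec be g ltac:(auto) ltac:(lia) (v z) (Hpos z)) as (_ & A & _).
      rewrite bpow in A. auto.
    Qed.

    Lemma hE_le z i : hE z i <= b.
    Proof.
      unfold hE. destruct (i <? lam z); [|lia]. pose proof (pow2_pos be). destruct (i =? 0); lia.
    Qed.

    Lemma hE_F z i : hE z i < F.
    Proof. pose proof (hE_le z i). pose proof (bF C bb ga Hcbe Hga Hbb). lia. Qed.

    Lemma hE_eval z : peval (pl hE z) b = derr be g (v z).
    Proof.
      unfold derr. rewrite bpow. fold (lam z). change (drec be g (v z) * v z) with (U z).
      pose proof (lam_bd z) as Lm. assert (G := g_facts). pose proof (U_lt z) as UL.
      unfold digit_poly. rewrite peval_map.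
      unfold hE. rewrite (catf_cut be (lam z) mm (fun i => (b - 1 - dg (U z) i) + (if i =? 0 then 1 else 0))) by lia.
      assert (E : catf be (lam z) (fun i => (b - 1 - dg (U z) i) + (if i =? 0 then 1 else 0)) + U z = 2 ^ (be * lam z)).
      { set (f := fun i => _). transitivity (catf be (lam z) f + catf be (lam z) (dg (U z))).
        { f_equal. exact (field_split be (lam z) (U z) UL). }
        rewrite catf_add. unfold f.
        rewrite (catf_ext be (lam z) _ (fun i => (if i =? 0 then 1 else 0) + (b - 1))).
        - rewrite <- (catf_add be (lam z) (fun i => if i =? 0 then 1 else 0) (fun _ => b - 1)), catf_max.
          assert (E1 : catf be (lam z) (fun i => if i =? 0 then 1 else 0) = 1).
          { destruct (lam z); [lia|]. simpl. rewrite catf_zero. lia. }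
          rewrite E1. pose proof (pow2_pos (be * lam z)). lia.
        - intros r _. pose proof (field_lt be (U z) r). destruct (r =? 0); lia. }
      lia.
    Qed.

    Lemma mmX : mm < X /\ N < X.
    Proof.
      split; [apply smallX; lia|]. unfold N_. apply pow2_lt. apply (eN_lt C bb ga Hcbe Hga Hbb).
    Qed.

    Lemma D_hE : G2 C (k + 1950) hE.
    Proof.
      intros z i y. assert (Db := D_bmax C bb ga Hcbe Hga Hbb). assert (G := g_facts).
      fby (fun e => exists l, l < X /\ (lam (e z) = l /\
         ((e i < l /\ exists x, x < X /\ ((e i < N /\ dg (U (e z)) (e i) = x) /\
            exists m, m < X /\ (m = b - 1 /\
            exists w, w < X /\ (x + w = m /\ ((e i = 0 /\ w + 1 = e y) \/ (e i <> 0 /\ w = e y)))))) \/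
          (~ (e i < l) /\ e y = 0)))).
      intros e He. unfold hE. destruct (lam_bd (e z)) as [L1 L2]. destruct mmX as [X1 X2].
      pose proof (bX C bb ga Hcbe Hga Hbb).
      pose proof (field_lt be (U (e z)) (e i)) as Ld.
      split.
      - intros (l & _ & <- & [(Li & x & _ & (_ & <-) & m & _ & -> & w & _ & Ew & Ey)|(Li & Ey)]).
        + rewrite (proj2 (Nat.ltb_lt _ _) Li). destruct (Nat.eqb_spec (e i) 0); lia.
        + rewrite (proj2 (Nat.ltb_ge _ _)) by lia. auto.
      - intros E. exists (lam (e z)). split; [lia|]. split; auto.
        destruct (Nat.ltb_spec (e i) (lam (e z))) as [Li|Li].
        + left. split; auto. eexists. split; [|split; [split; [|reflexivity]|]]; [lia|nia|].
          exists (b - 1). split; [lia|]. split; auto.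
          exists (b - 1 - dg (U (e z)) (e i)). split; [lia|]. split; [lia|].
          destruct (Nat.eqb_spec (e i) 0); lia.
        + right. lia.
    Qed.

    (** One step [R * E + Y ^ j] of [geo2], modulo [F] and at the [l]-th root of unity. As [Y] is a
        power of the base, [Y ^ j] is a monomial and its value is again a root of unity. Thus powers
        of a long polynomial cost only an iteration on residues. *)
    Definition zphi (z l _c j r : nat) : nat :=
      if (j <=? N) && (l <=? N) then
        ((r mod F * evt hE z l) mod F + root bb ga (l * (lam z * j)) mod F) mod F
      else r.

    Lemma D_zphi z l c j r y : D C (k + 2650) (fun e => zphi (e z) (e l) (e c) (e j) (e r) = e y).
    Proof.
      assert (De := G2_evt C bb ga Hcbe Hga Hbb (k + 1950) hE D_hE hE_F).
      assert (Q := fun i => D_lec C (eN ga) i (proj1 (proj2 (eN_lt C bb ga Hcbe Hga Hbb)))).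
      assert (Dr := D_root C bb ga Hcbe Hga Hbb). assert (Dm := D_mulF C bb ga Hcbe Hga Hbb).
      assert (Df := D_modF C bb ga Hcbe Hga Hbb). unfold G2 in De.
      fby (fun e => ((e j <= 2 ^ eN ga /\ e l <= 2 ^ eN ga) /\
         exists m, m < X /\ (lam (e z) = m /\ exists s, s < X /\ (m * e j = s /\ exists t, t < X /\ (e l * s = t /\
         exists w, w < X /\ ((t < 2 ^ (40 * ga) /\ root bb ga t = w) /\ exists w', w' < X /\ (w mod F = w' /\
         exists ev, ev < X /\ (evt hE (e z) (e l) = ev /\ exists r', r' < X /\ (e r mod F = r' /\
         exists p, p < X /\ (((r' < 2 ^ (2 * M) /\ ev < 2 ^ (2 * M)) /\ (r' * ev) mod F = p) /\
         exists q, q < X /\ (p + w' = q /\ q mod F = e y)))))))))) \/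
         (~ (e j <= 2 ^ eN ga /\ e l <= 2 ^ eN ga) /\ e y = e r)).
      intros e He. unfold zphi. fold (N_ ga).
      destruct (Nat.leb_spec (e j) N) as [Lj|Lj]; destruct (Nat.leb_spec (e l) N) as [Ll|Ll]; simpl andb.
      2,3,4: split; [intros [((? & ?) & _)|(_ & E)]; [lia|auto]|intros E; right; split; [lia|auto]].
      split.
      - intros [(_ & m & _ & <- & s & _ & <- & t & _ & <- & w & _ & (_ & <-) & w' & _ & <- & ev & _ & <- &
          r' & _ & <- & p & _ & (_ & <-) & q & _ & <- & E)|(K & _)]; [auto|lia].
      - intros E. left. split; auto. assert (G := g_facts). destruct (lam_bd (e z)) as [L1 L2]. destruct mmX as [X1 X2].
        assert (Ls : lam (e z) * e j <= N * N) by (apply Nat.mul_le_mono; nia).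
        assert (Lt : e l * (lam (e z) * e j) <= N * (N * N)) by (apply Nat.mul_le_mono; auto).
        assert (N3 : N * (N * N) < 2 ^ (40 * ga)).
        { unfold N_, eN. rewrite <- !Nat.pow_add_r. apply pow2_lt. lia. }
        assert (X40 : 2 ^ (40 * ga) < X) by (apply pow2_lt; lia).
        pose proof (pow2_pos (eN ga)) as NP. fold (N_ ga) in NP.
        assert (2 ^ (2 * M) < X) by (apply pow2_lt; lia).
        pose proof (root_lt C bb ga Hcbe Hga Hbb (e l * (lam (e z) * e j))).
        exists (lam (e z)). split; [lia|]. split; auto.
        exists (lam (e z) * e j). split; [nia|]. split; auto.
        exists (e l * (lam (e z) * e j)). split; [lia|]. split; auto.
        eexists. split; [|split; [split; [lia|reflexivity]|]]; [lia|].
        set (w := root bb ga (e l * (lam (e z) * e j))) in *. pose proof (modF w).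
        exists (w mod F). split; [lia|]. split; auto.
        pose proof (evt_lt hE (e z) (e l)).
        eexists. split; [|split; [reflexivity|]]; [lia|].
        pose proof (modF (e r)). exists (e r mod F). split; [lia|]. split; auto.
        pose proof (modF (e r mod F * evt hE (e z) (e l))).
        eexists. split; [|split; [split; [lia|reflexivity]|]]; [lia|].
        eexists. split; [|split; [reflexivity|exact E]].
        apply Nat.lt_trans with (2 ^ (2 * M + 1)); [rewrite Nat.pow_add_r; simpl (2 ^ 1); lia|].
        apply pow2_lt. lia.
    Qed.

    Fixpoint Zp (z j : nat) : list nat :=
      match j with
      | 0 => []
      | S j => padd (pmul (Zp z j) (pl hE z)) (repeat 0 (lam z * j) ++ [1])
      end.

    Lemma Zp_eval z j x : peval (Zp z j) x = geo2 (x ^ lam z) (peval (pl hE z) x) j.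
    Proof.
      induction j; simpl; auto. rewrite peval_padd, peval_pmul, IHj, peval_monomial, <- Nat.pow_mul_r. auto.
    Qed.

    Lemma Zp_length z j : length (Zp z j) <= mm * j.
    Proof.
      induction j; [simpl; lia|]. cbn [Zp]. rewrite padd_length, length_app, repeat_length. cbn [length].
      pose proof (pmul_length (Zp z j) (pl hE z)) as L. rewrite pl_length in L.
      destruct (lam_bd z) as [_ Lm]. assert (lam z * j <= mm * j) by (apply Nat.mul_le_mono_r; lia). lia.
    Qed.

    Lemma zphi_seq z l j : l < N -> j <= N -> rseq zphi z l 0 0 j = peval (Zp z j) (pt l) mod F.
    Proof.
      intros Hl. induction j; intros Hj; [simpl; symmetry; apply Nat.Div0.mod_0_l|].
      simpl rseq. rewrite IHj by lia. unfold zphi.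
      rewrite (proj2 (Nat.leb_le j N)), (proj2 (Nat.leb_le l N)) by lia. simpl andb. cbv iota.
      rewrite Nat.Div0.mod_mod, evt_eval, <- Nat.Div0.mul_mod by auto.
      rewrite (root_mod C bb ga Hcbe Hga Hbb), <- Nat.Div0.add_mod.
      simpl Zp. rewrite peval_padd, peval_pmul, peval_monomial, <- Nat.pow_mul_r. do 3 f_equal. lia.
    Qed.

    Let evZ z l := if l <? N then rseq zphi z l 0 0 (g + 1) else 0.

    Lemma gN : g + 1 <= N /\ (g + 1) * mm + mm + 2 <= N.
    Proof. assert (G := g_facts). nia. Qed.

    Lemma evZ_lt z l : evZ z l < F.
    Proof.
      unfold evZ. destruct (Nat.ltb_spec l N); [|lia]. rewrite zphi_seq by (auto; apply gN). apply modF.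
    Qed.

    Lemma D_evZ : G2 C (k + 3230) evZ.
    Proof.
      intros z l y. destruct (cbe_M C bb ga Hcbe Hga Hbb) as (_ & _ & L3).
      assert (Eq : 2 ^ (eM bb ga + 1) = 2 * M) by (rewrite Nat.pow_add_r; unfold M_; simpl (2 ^ 1); lia).
      assert (Rc := fun a b c i v => D_rec C zphi (k + 2650) (eM bb ga + 1) ga D_zphi
         ltac:(intros; rewrite Eq in *; unfold zphi; destruct (andb _ _); auto;
               match goal with |- ?x mod F < _ => pose proof (modF x) end; lia)
         ltac:(rewrite Eq; lia) ltac:(apply (eN_lt C bb ga Hcbe Hga Hbb)) 0 ltac:(lia) a b c i v).
      assert (Ql := fun i => D_ltc C (eN ga) i (proj1 (proj2 (eN_lt C bb ga Hcbe Hga Hbb)))).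
      assert (Dg := fun i => D_pconst C (2 * ga) i ltac:(apply (small_ga C bb ga Hcbe Hga Hbb); auto; lia)).
      fby (fun e => (e l < 2 ^ eN ga /\ exists o, o < X /\ (o = 0 /\ exists g1, g1 < X /\ (g1 = 2 ^ (2 * ga) /\
         exists m, m < X /\ (g1 + 1 = m /\ (m <= (2 ^ ga) ^ 10 /\ rseq zphi (e z) (e l) o 0 m = e y))))) \/
         (~ (e l < 2 ^ eN ga) /\ e y = 0)).
      intros e He. fold (N_ ga). unfold evZ. destruct (Nat.ltb_spec (e l) N) as [L|L].
      - split.
        + intros [(_ & o & _ & -> & g1 & _ & -> & m & _ & <- & _ & E)|(K & _)]; [auto|lia].
        + intros E. left. split; auto. exists 0. split; auto. split; auto.
          destruct gN as [G1 _]. destruct mmX as [_ X2].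
          exists g. split; [lia|]. split; auto. exists (g + 1). split; [lia|]. split; auto. split; auto.
          eapply Nat.le_trans; [exact G1|]. unfold N_, eN. rewrite <- Nat.pow_mul_r. apply pow2_le. lia.
      - split; [intros [(K & _)|(_ & E)]; [lia|auto]|intros; right; split; [lia|auto]].
    Qed.

    Let hu z := dg (u z).
    (** The numerator of the division formula as a polynomial in the base; the leading coefficient
        list entry 1 accounts for [b * u + 1]. *)
    Let pG z := pmul (1 :: pl (fun z => hu z) z) (pscale (rc z) (Zp z (g + 1))).
    Let evx z l := if l <? N then (1 + (root bb ga l mod F * evt (fun z => hu z) z l) mod F) mod F else 0.

    Lemma D_evx : G2 C (k + 660) evx.
    Proof.
      intros z l y.
      assert (De := G2_evt C bb ga Hcbe Hga Hbb k _ (G2_digits C bb ga k u Hu)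
                    ltac:(intros; apply (dgF C bb ga Hcbe Hga Hbb))).
      assert (Dr := D_root C bb ga Hcbe Hga Hbb). assert (Dm := D_mulF C bb ga Hcbe Hga Hbb).
      assert (Df := D_modF C bb ga Hcbe Hga Hbb). unfold G2 in De.
      assert (Ql := fun i => D_ltc C (eN ga) i (proj1 (proj2 (eN_lt C bb ga Hcbe Hga Hbb)))).
      fby (fun e => (e l < 2 ^ eN ga /\ exists w, w < X /\ ((e l < 2 ^ (40 * ga) /\ root bb ga (e l) = w) /\
         exists w', w' < X /\ (w mod F = w' /\ exists ev, ev < X /\ (evt (fun z => dg (u z)) (e z) (e l) = ev /\
         exists p, p < X /\ (((w' < 2 ^ (2 * M) /\ ev < 2 ^ (2 * M)) /\ (w' * ev) mod F = p) /\
         exists q, q < X /\ (p + 1 = q /\ q mod F = e y)))))) \/ (~ (e l < 2 ^ eN ga) /\ e y = 0)).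
      intros e He. fold (N_ ga). unfold evx. destruct (Nat.ltb_spec (e l) N) as [L|L].
      - split.
        + intros [(_ & w & _ & (_ & <-) & w' & _ & <- & ev & _ & <- & p & _ & (_ & <-) & q & _ & <- & E)|(K & _)]; [|lia].
          rewrite Nat.add_comm. auto.
        + intros E. rewrite Nat.add_comm in E. left. split; auto.
          assert (2 ^ (2 * M) < X) by (apply pow2_lt; lia).
          pose proof (root_lt C bb ga Hcbe Hga Hbb (e l)).
          eexists. split; [|split; [split; [|reflexivity]|]]; [lia| |].
          { eapply lt_pow2_mono; [exact L|]. unfold eN. lia. }
          pose proof (modF (root bb ga (e l))).
          eexists. split; [|split; [reflexivity|]]; [lia|].
          pose proof (evt_lt (fun z => hu z) (e z) (e l)).
          eexists. split; [|split; [reflexivity|]]; [unfold hu in *; lia|].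
          pose proof (modF (root bb ga (e l) mod F * evt (fun z => hu z) (e z) (e l))).
          eexists. split; [|split; [split; [unfold hu in *; lia|reflexivity]|]]; [unfold hu in *; lia|].
          eexists. split; [|split; [reflexivity|exact E]]. unfold hu in *. lia.
      - split; [intros [(K & _)|(_ & E)]; [lia|auto]|intros; right; split; [lia|auto]].
    Qed.

    Lemma evx_lt z l : evx z l < F.
    Proof. unfold evx. destruct (_ <? _); [apply modF|lia]. Qed.

    Let evG z l := (evx z l * ((rc z * evZ z l) mod F)) mod F.

    Lemma pG_one z : N * peval (pG z) 1 < F.
    Proof.
      assert (G := g_facts).
      assert (Lx : 1 + 1 * peval (pl (fun z => hu z) z) 1 <= 2 ^ (4 * ga + 2 + be)).
      { assert (peval (pl (fun z => hu z) z) 1 <= 2 ^ (4 * ga + 1 + be)).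
        { apply pl_one. intros. apply Nat.lt_le_incl, field_lt. }
        replace (4 * ga + 2 + be) with (S (4 * ga + 1 + be)) by lia. rewrite Nat.pow_succ_r'.
        pose proof (pow2_pos (4 * ga + 1 + be)). lia. }
      assert (Lz : peval (Zp z (g + 1)) 1 <= 2 ^ ((4 * ga + 2 + be) * (g + 1))).
      { rewrite Zp_eval, Nat.pow_1_l. eapply Nat.le_trans; [apply geo2_1|].
        rewrite (Nat.pow_mul_r 2 (4 * ga + 2 + be)). apply Nat.pow_le_mono_l.
        pose proof (pl_one hE z (hE_le z)).
        replace (4 * ga + 2 + be) with (S (4 * ga + 1 + be)) by lia. rewrite Nat.pow_succ_r'.
        pose proof (pow2_pos (4 * ga + 1 + be)). lia. }
      unfold pG. rewrite peval_pmul, peval_pscale.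
      apply (F_gt bb ga) with ((4 * ga + 2 + be) + (be * (2 * g) + (4 * ga + 2 + be) * (g + 1))).
      - rewrite (Nat.pow_add_r 2 (4 * ga + 2 + be)), (Nat.pow_add_r 2 (be * (2 * g))).
        apply Nat.mul_le_mono; [exact Lx|]. apply Nat.mul_le_mono; [apply rc_le|exact Lz].
      - nia.
    Qed.

    Lemma D_G z q y : D C (k + 4540) (fun e => e q < N /\ dg (peval (pG (e z)) b) (e q) = e y).
    Proof.
      eapply D_mono; [apply (D_extract C bb ga Hcbe Hga Hbb (k + 3230 + 30 + 30) pG evG)|lia].
      - apply (G2_mulF C bb ga Hcbe Hga Hbb).
        + intros z' l y'. eapply D_mono; [apply D_evx|lia].
        + apply (G2_mulF C bb ga Hcbe Hga Hbb (k + 3230) (fun z _ => rc z) evZ).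
          * intros z' l y'. eapply D_mono; [apply D_rc|lia].
          * apply D_evZ.
          * intros; apply rcF.
          * apply evZ_lt.
        + apply evx_lt.
        + intros; apply modF.
      - intros; apply modF.
      - intros z' l Hl. unfold evG, evx, evZ, pG. rewrite (proj2 (Nat.ltb_lt l N) Hl).
        rewrite evt_eval by auto. rewrite (root_mod C bb ga Hcbe Hga Hbb), zphi_seq by (auto; apply gN).
        rewrite peval_pmul, peval_pscale. cbn [peval].
        rewrite <- (Nat.Div0.mul_mod (pt l)), Nat.Div0.add_mod_idemp_r, (Nat.Div0.mul_mod_idemp_r (rc z')).
        symmetry. apply Nat.Div0.mul_mod.
      - intros z'. unfold pG. eapply Nat.le_trans; [apply pmul_length|].
        rewrite pscale_length. cbn [length]. rewrite pl_length. pose proof (Zp_length z' (g + 1)).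
        destruct gN. lia.
      - apply pG_one.
    Qed.
    Hint Resolve D_G : dd.

    (** The denominator of the division formula is a power of the base, so dividing by it shifts the
        digits. *)
    Lemma quotient_digit z i : dg (u z / v z) i = dg (peval (pG z) b) (i + lam z * (g + 1) + 1).
    Proof.
      assert (G := g_facts).
      rewrite (division_formula be g ltac:(auto) ltac:(lia) (u z) (v z) (Hpos z)).
      2:{ rewrite bpow. pose proof (Bu z) as B. rewrite wl_eq in B. destruct G as (_ & -> & _). auto. }
      unfold pG. rewrite peval_pmul, peval_pscale, Zp_eval, hE_eval. cbn [peval].
      unfold hu. rewrite (peval_word C bb ga Hcbe Hga Hbb u z (Bu z)). fold (lam z). fold (rc z).
      rewrite (Nat.add_comm 1 (b * u z)). unfold field. rewrite !bpow, Nat.Div0.div_div, <- Nat.pow_add_r.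
      replace (be * (lam z * (g + 1) + 1) + be * i) with (be * (i + lam z * (g + 1) + 1)) by lia. reflexivity.
    Qed.

    Lemma KnB_quotient : Kn (k + 4600) (fun z => u z / v z).
    Proof.
      assert (B : forall z, u z / v z < WL).
      { intros z. eapply Nat.le_lt_trans; [|apply (Bu z)]. apply Nat.Div0.div_le_upper_bound. specialize (Hpos z). nia. }
      split; auto.
      intros z i y. assert (G := g_facts). assert (Dn := D_isnd C bb ga Hcbe Hga Hbb).
      assert (Dg := fun i => D_pconst C (2 * ga) i ltac:(apply (small_ga C bb ga Hcbe Hga Hbb); auto; lia)).
      fby (fun e => (e i < nd /\ exists c, c < X /\ (c = 2 ^ (2 * ga) /\ exists c1, c1 < X /\ (c + 1 = c1 /\
         exists m, m < X /\ (lam (e z) = m /\ exists t, t < X /\ (m * c1 = t /\ exists s, s < X /\ (e i + t = s /\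
         exists q, q < X /\ (s + 1 = q /\ (q < N /\ dg (peval (pG (e z)) b) q = e y)))))))) \/
         (~ (e i < nd) /\ e y = 0)).
      intros e He. destruct (Nat.lt_ge_cases (e i) nd) as [L|L].
      - rewrite quotient_digit. split.
        + intros [(_ & c & _ & -> & c1 & _ & <- & m & _ & <- & t & _ & <- & s & _ & <- & q & _ & <- & _ & E)|(K & _)]; [auto|lia].
        + intros E. left. split; auto. destruct gN as [G1 G2]. destruct mmX as [X1 X2]. destruct (lam_bd (e z)) as [L1 L2].
          assert (lam (e z) * (g + 1) <= mm * (g + 1)) by (apply Nat.mul_le_mono_r; lia).
          exists g. split; [lia|]. split; auto. exists (g + 1). split; [lia|]. split; auto.
          exists (lam (e z)). split; [lia|]. split; auto.
          exists (lam (e z) * (g + 1)). split; [lia|]. split; auto.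
          eexists. split; [|split; [reflexivity|]]; [lia|].
          eexists. split; [|split; [reflexivity|]]; [lia|]. split; [lia|auto].
      - rewrite (dg_high C bb ga Hcbe Hga Hbb) by auto.
        split; [intros [(K & _)|(_ & E)]; [lia|auto]|intros; right; split; [lia|auto]].
    Qed.
  End Fixed.

  (** The preceding construction needs a divisor that is positive for every parameter. Zero is
      replaced by 1 there, and the quotient by zero is treated as a separate case. *)
  Lemma KnB_Div k u v : Kn k u -> Kn k v -> Kn (k + 4700) (fun z => u z / v z).
  Proof.
    intros Hu Hv.
    assert (H1 : Kn (k + 10) (fun _ => 1)).
    { eapply KnB_mono; [apply (KnB_small C bb ga Hcbe Hga Hbb)|lia].
      - apply Nat.pow_gt_1; [lia|]. pose proof (pow2_pos bb). lia.
      - apply D_one. }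
    assert (Z : forall z, D C (k + 10 + 25) (fun e => v (e z) = 0)).
    { intros z. eapply D_mono; [apply (KnB_test C bb ga Hcbe Hga Hbb k v 0 z Hv); auto; apply D_zero|lia]. }
    assert (Hv' : Kn (k + 10 + 30) (fun z => if v z =? 0 then 1 else v z)).
    { apply (KnB_cases C bb ga Hcbe Hga Hbb (k + 10) (fun z => v z = 0) (fun _ => 1) v); auto.
      - eapply KnB_mono; eauto. lia.
      - intros z E. rewrite E. auto.
      - intros z E. apply Nat.eqb_neq in E. rewrite E. auto. }
    assert (Hq := KnB_quotient (k + 10 + 30) u _ (KnB_mono C bb ga k (k + 10 + 30) u Hu ltac:(lia)) Hv'
      ltac:(intros z; cbv beta; destruct (Nat.eqb_spec (v z) 0); lia)).
    eapply KnB_mono; [apply (KnB_cases C bb ga Hcbe Hga Hbb (k + 10 + 30 + 4600) (fun z => v z = 0) (fun _ => 0)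
      (fun z => u z / (if v z =? 0 then 1 else v z)))|].
    - eapply KnB_mono; [apply (KnB_zero C bb ga Hcbe Hga Hbb)|lia].
    - exact Hq.
    - intros z. eapply D_mono; [apply Z|lia].
    - intros z E. rewrite E. reflexivity.
    - intros z E. apply Nat.eqb_neq in E. rewrite E. auto.
    - lia.
  Qed.
End Quotient.

(** * Computations on long words *)

Section LongWords.
  Context (C : cls) {FO : fo C} (bb ga c : nat).
  Hypothesis Hcbe : cbe C = 2 ^ (bb + 3 * ga + 7).
  Hypothesis Hga : 3 <= ga.
  Hypothesis Hbb : 8 * ga + 20 <= bb.
  Hypothesis Hc : c + 22 <= 2 ^ bb.
  Hypothesis Hcm : c + 22 <= cmf C 0.
  Notation X := (2 ^ cbe C).
  Notation dg := (field (2 ^ bb)).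
  Notation b := (2 ^ 2 ^ bb).
  Notation nd := (2 ^ (4 * ga)).
  Notation Kn := (KnB C bb ga).
  Notation n := (wl bb ga).

  Lemma small_b q : q < c + 22 -> q < b.
  Proof. intros. pose proof (lt_pow2 (2 ^ bb)). lia. Qed.

  Lemma D_small_const q i : q < c + 22 -> D C 0 (fun e => e i = q).
  Proof.
    intros Hq. apply D_cst.
    - pose proof (small_b q Hq). pose proof (bX C bb ga Hcbe Hga Hbb). lia.
    - eapply IO_mono; [apply IO_small|lia].
  Qed.

  Lemma KnB_arith k i u v : arith n i 0 0 <> None -> Kn k u -> Kn k v ->
    Kn (k + 4800) (fun z => val n i (u z) (v z)).
  Proof.
    intros Hi Hu Hv. unfold val.
    destruct i; try (exfalso; apply Hi; reflexivity); cbn [arith];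
      (eapply KnB_mono; [first
        [ apply (KnB_Add C bb ga Hcbe Hga Hbb k u v); assumption
        | apply (KnB_Mul C bb ga Hcbe Hga Hbb k u v); assumption
        | apply (KnB_zero C bb ga Hcbe Hga Hbb)
        | apply (KnB_word C bb ga Hcbe Hga Hbb)
        | apply (KnB_max C bb ga Hcbe Hga Hbb)
        | apply (KnB_Exp2 C bb ga Hcbe Hga Hbb k u); assumption
        | apply (KnB_Div C bb ga Hcbe Hga Hbb k u v); assumption
        | apply (KnB_Max C bb ga Hcbe Hga Hbb k u v); assumption
        | apply (KnB_Min C bb ga Hcbe Hga Hbb k u v); assumption
        | apply (KnB_and C bb ga Hcbe Hga Hbb k u v); assumption
        | apply (KnB_or C bb ga Hcbe Hga Hbb k u v); assumption
        | apply (KnB_not C bb ga Hcbe Hga Hbb k u); assumption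
        | apply (KnB_small C bb ga Hcbe Hga Hbb 1); [apply small_b; lia|intros; apply D_one] ]|lia]).
  Qed.

  (** In contrast to the runs on short words, the rank does not involve [lam]: exponentiation has
      rank 1 in a class with negation. The rank per step is a constant plus [c]. *)
  Theorem D_run_long Q o T v k i : is_program Q -> o < c + 22 -> 10 <= k -> Kn k v ->
    D C (k + T * (4800 + c + 60) + 1) (fun e => accepts n c o T (init Q [v (e i)])).
  Proof.
    intros HQ Ho Hk Hv.
    pose (S := PState (fun i _ => nth i Q 0) 0 (fun _ => 0) (fun _ => 0) (fun _ => 0) [v] []).
    apply (D_accepts C n c o 4800 Kn (KnB_mono C bb ga) KnB_arith) with (S := S); auto.
    - intros k' w q j Hw Hq.
      eapply D_mono; [apply (KnB_test C bb ga Hcbe Hga Hbb k' w q j Hw)|lia].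
      + apply small_b; auto.
      + intros; apply D_small_const; auto.
    - intros k' w j Hw. eapply D_mono; [apply (KnB_nz C bb ga Hcbe Hga Hbb k' w j Hw)|lia].
    - assert (K0 : forall q, q < 22 -> Kn k (fun _ => q)).
      { intros q Hq. eapply KnB_mono; [apply (KnB_small C bb ga Hcbe Hga Hbb)|lia].
        - apply small_b. lia.
        - intros; apply D_small_const. lia. }
      assert (Nq : forall q, nth q Q 0 < 22).
      { intros q. destruct (Nat.lt_ge_cases q (length Q)) as [L|L].
        - unfold is_program in HQ. rewrite Forall_forall in HQ. apply (HQ (nth q Q 0)). apply nth_In; auto.
        - rewrite nth_overflow by auto. lia. }
      unfold known; simpl. split; [intros; apply K0; auto|]. do 3 (split; [apply K0; lia|]).
      split; constructor; auto.
  Qed.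
End LongWords.

(** * Self-reference *)

Lemma testbit_catf1 n (g : nat -> bool) j :
  Nat.testbit (catf 1 n (fun j => Nat.b2n (g j))) j = (j <? n) && g j.
Proof.
  revert g j. induction n; intros g j; cbn [catf]; [apply Nat.bits_0|].
  rewrite testbit_join by (destruct (g 0); simpl; lia).
  destruct j as [|j].
  - simpl. destruct (g 0); auto.
  - change (S j <? 1) with false. cbv iota. replace (S j - 1) with j by lia.
    rewrite (IHn (fun j => g (S j))). reflexivity.
Qed.

(* Field [2 r] of [z] is the lower end, field [2 r + 1] the upper end of an interval. *)
Definition items (q I z : nat) : list (nat * nat) :=
  map (fun r => (field q z (2 * r), field q z (2 * r + 1))) (seq 0 I).

Lemma in_items q I z j : in_ivs (items q I z) j = true <->
  exists r, r < I /\ (field q z (2 * r) <= j /\ j < field q z (2 * r + 1)).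
Proof.
  unfold in_ivs, items. rewrite existsb_exists. split.
  - intros (p & Hp & E). apply in_map_iff in Hp. destruct Hp as (r & <- & Hr).
    apply in_seq in Hr. apply andb_prop in E. destruct E as [E1 E2].
    apply Nat.leb_le in E1. apply Nat.ltb_lt in E2. exists r. split; [lia|auto].
  - intros (r & Hr & L & U). exists (field q z (2 * r), field q z (2 * r + 1)). split.
    + apply in_map_iff. exists r. split; auto. apply in_seq. lia.
    + apply andb_true_intro. split; [apply Nat.leb_le|apply Nat.ltb_lt]; auto.
Qed.

(** Bits of [z] itself are included so that the decoded word can contain its own code. *)
Definition abit (q I z j : nat) : bool := Nat.testbit z j || in_ivs (items q I z) j.
Definition expand (q I n z : nat) : nat := catf 1 n (fun j => Nat.b2n (abit q I z j)).

Lemma expand_lt q I n z : expand q I n z < 2 ^ n.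
Proof.
  rewrite <- (Nat.mul_1_l n) at 2. apply catf_lt. intros. destruct (abit q I z r); simpl; lia.
Qed.

Lemma encode_items q I n l : length l <= I -> n < 2 ^ q ->
  exists z, z < 2 ^ (q * (2 * I)) /\ forall j, j < n -> in_ivs (items q I z) j = in_ivs l j.
Proof.
  intros Hl Hn.
  (* Endpoints are cut at [n] to fit into [q] bits; beyond the end of the list the default is the
     empty interval. *)
  set (f := fun j => let p := nth (j / 2) l (0, 0) in
                     Nat.min n (if j mod 2 =? 0 then fst p else snd p)).
  assert (Hf : forall j, f j < 2 ^ q) by (intros; unfold f; lia).
  exists (catf q (2 * I) f). split; [apply catf_lt; auto|].
  intros j Hj. apply eq_true_iff_eq. rewrite in_items. unfold in_ivs. rewrite existsb_exists.
  assert (F : forall r, r < I -> field q (catf q (2 * I) f) (2 * r) = Nat.min n (fst (nth r l (0, 0))) /\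
                       field q (catf q (2 * I) f) (2 * r + 1) = Nat.min n (snd (nth r l (0, 0)))).
  { intros r Hr. rewrite !field_catf by (auto; lia). unfold f.
    replace (2 * r) with (r * 2) by lia.
    rewrite Nat.div_mul, Nat.div_add_l, Nat.Div0.mod_mul by lia.
    rewrite (Nat.add_comm (r * 2) 1), Nat.Div0.mod_add. simpl (1 / 2). rewrite Nat.add_0_r. auto. }
  split.
  - intros (r & Hr & L & U). destruct (F r Hr) as [F1 F2]. rewrite F1 in L. rewrite F2 in U.
    destruct (Nat.lt_ge_cases r (length l)) as [Lr|Lr].
    + exists (nth r l (0, 0)). split; [apply nth_In; auto|].
      apply andb_true_intro. split; [apply Nat.leb_le|apply Nat.ltb_lt]; lia.
    + rewrite nth_overflow in U by auto. simpl in U. lia.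
  - intros (p & Hp & E). apply (In_nth _ _ (0, 0)) in Hp. destruct Hp as (r & Hr & <-).
    apply andb_prop in E. destruct E as [E1 E2]. apply Nat.leb_le in E1. apply Nat.ltb_lt in E2.
    exists r. split; [lia|]. destruct (F r ltac:(lia)) as [-> ->]. lia.
Qed.

(* The low part [z] of [K + z] lists the intervals of bits that make up its high part [K]. *)
Lemma expand_fixpoint q I n H K : IO I K -> K mod 2 ^ H = 0 -> n < 2 ^ q -> q * (2 * I) <= H ->
  exists z, z < 2 ^ (q * (2 * I)) /\ (K + z < 2 ^ n -> expand q I n z = K + z).
Proof.
  intros (l & Ll & El) HK Hn HH. destruct (encode_items q I n l Ll Hn) as (z & Hz & Ez).
  exists z. split; auto. intros Hkz.
  assert (Hz' : z < 2 ^ H) by (eapply lt_pow2_mono; eauto).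
  apply Nat.bits_inj. intros j. unfold expand. rewrite testbit_catf1. unfold abit.
  destruct (Nat.ltb_spec j n) as [L|L]; simpl.
  - rewrite Ez, <- El by auto.
    assert (EK : K = 2 ^ H * (K / 2 ^ H)) by (pose proof (Nat.div_mod_eq K (2 ^ H)); lia).
    assert (E1 : Nat.testbit K j = if j <? H then false else Nat.testbit (K / 2 ^ H) (j - H)).
    { rewrite EK at 1. rewrite <- (Nat.add_0_l (2 ^ H * _)), testbit_join, Nat.bits_0 by auto. auto. }
    rewrite Nat.add_comm. rewrite EK at 2. rewrite testbit_join, E1 by auto.
    destruct (Nat.ltb_spec j H) as [L'|L']; [apply orb_false_r|].
    rewrite <- (Nat.mod_small z (2 ^ H)) by auto. rewrite Nat.mod_pow2_bits_high; auto.
  - symmetry. rewrite <- (Nat.mod_small (K + z) (2 ^ n)) by auto. apply Nat.mod_pow2_bits_high; auto.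
Qed.

Lemma land_pow2_testbit x t : Nat.land x (2 ^ t) = 2 ^ t <-> Nat.testbit x t = true.
Proof.
  split.
  - intros E. apply (f_equal (fun y => Nat.testbit y t)) in E.
    rewrite Nat.land_spec, Nat.pow2_bits_true, andb_true_r in E. auto.
  - intros E. apply Nat.bits_inj. intros j. rewrite Nat.land_spec, Nat.pow2_bits_eqb.
    destruct (Nat.eqb_spec t j) as [<-|]; [rewrite E; auto|apply andb_false_r].
Qed.

(** * Definability of decoding a word from its intervals *)

Section Expand.
  Context (C : cls) {FO : fo C} (bb ga lam ib : nat).
  Hypothesis Hcbe : cbe C = 2 ^ (bb + 3 * ga + 7).
  Hypothesis Hga : 3 <= ga.
  Hypothesis Hbb : 8 * ga + 20 <= bb.
  Hypothesis Hib : 2 ^ lam * 2 ^ (ib + 1) < cbe C.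
  Notation X := (2 ^ cbe C).
  Notation dg := (field (2 ^ bb)).
  Notation b := (2 ^ 2 ^ bb).
  Notation nd := (2 ^ (4 * ga)).
  Notation n := (wl bb ga).
  Notation q := (2 ^ lam).
  Notation I := (2 ^ ib).

  Lemma D_bit x t : D C 3 (fun e => Nat.testbit (e x) (e t) = true).
  Proof.
    fby (fun e => exists p, p < X /\ (2 ^ e t = p /\ Nat.land (e x) p = p)).
    intros e He. rewrite <- land_pow2_testbit. split.
    - intros (p & _ & <- & E). auto.
    - intros E. exists (2 ^ e t). repeat split; auto. rewrite <- E.
      eapply Nat.le_lt_trans; [apply Nat.land_le_l|apply He].
  Qed.
  Hint Resolve D_bit : dd.

  Lemma D_abit z j : D C 45 (fun e => abit q I (e z) (e j) = true).
  Proof.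
    assert (Df := fun w j v => D_field C lam (ib + 1) w j v Hib).
    assert (Li : ib + 1 < cbe C).
    { pose proof (lt_pow2 (ib + 1)). pose proof (pow2_pos lam). nia. }
    assert (Dl := fun i => D_ltc C ib i ltac:(lia)). assert (D2 := fun i j => D_mulc C 1 i j ltac:(lia)).
    fby (fun e => Nat.testbit (e z) (e j) = true \/
       exists r, r < X /\ (r < I /\ exists r2, r2 < X /\ (2 ^ 1 * r = r2 /\ exists r3, r3 < X /\ (r2 + 1 = r3 /\
       exists l, l < X /\ ((r2 <= 2 ^ (ib + 1) /\ field q (e z) r2 = l) /\
       exists h, h < X /\ ((r3 <= 2 ^ (ib + 1) /\ field q (e z) r3 = h) /\ (l <= e j /\ e j < h))))))).
    intros e He. unfold abit. rewrite orb_true_iff, in_items. apply or_iff_compat_l.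
    assert (XI : 2 ^ (ib + 1) < X) by (apply pow2_lt; auto).
    assert (EI : 2 ^ (ib + 1) = 2 * I) by (rewrite Nat.add_1_r; apply Nat.pow_succ_r').
    assert (Fl : forall j, field q (e z) j < X).
    { intros k. eapply Nat.lt_trans; [apply field_lt|]. apply pow2_lt.
      pose proof (pow2_pos (ib + 1)). nia. }
    rewrite Nat.pow_1_r. split.
    - intros (r & _ & Hr & r2 & _ & <- & r3 & _ & <- & l & _ & (_ & <-) & h & _ & (_ & <-) & L). eauto.
    - intros (r & Hr & L). exists r. split; [lia|]. split; auto.
      exists (2 * r). split; [lia|]. split; auto. exists (2 * r + 1). split; [lia|]. split; auto.
      eexists. split; [|split; [split; [lia|reflexivity]|]]; auto.
      eexists. split; [|split; [split; [lia|reflexivity]|]]; auto.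
  Qed.
  Hint Resolve D_abit : dd.

  Lemma KnB_expand : KnB C bb ga 80 (fun z => expand q I n z).
  Proof.
    split; [intros; apply expand_lt|]. intros z i v.
    assert (Dn := D_isnd C bb ga Hcbe Hga Hbb). assert (Db := D_isb C bb ga Hcbe Hga Hbb).
    assert (Sm := small_ga C bb ga Hcbe Hga Hbb).
    assert (Dt := fun i => D_ltc C bb i ltac:(apply Sm; lia)).
    assert (Dm := fun i j => D_mulc C bb i j ltac:(apply Sm; lia)).
    fby (fun e => (e i < nd /\ (e v < b /\ forall t, t < X -> t < 2 ^ bb ->
        exists s, s < X /\ (2 ^ bb * e i = s /\ exists j, j < X /\ (s + t = j /\
         ((Nat.testbit (e v) t = true -> abit q I (e z) j = true) /\
          (abit q I (e z) j = true -> Nat.testbit (e v) t = true)))))) \/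
       (~ (e i < nd) /\ e v = 0)).
    intros e He. destruct (Nat.lt_ge_cases (e i) nd) as [L|L].
    - assert (Ei : 2 ^ bb * e i + 2 ^ bb <= n).
      { rewrite wl_eq. nia. }
      assert (nX : n < X) by (apply pow2_lt, Sm; lia).
      split.
      + intros [(_ & Lv & A)|(K & _)]; [|lia]. apply Nat.bits_inj. intros t. rewrite testbit_field.
        destruct (Nat.ltb_spec t (2 ^ bb)) as [Lt|Lt]; simpl.
        * destruct (A t ltac:(lia) Lt) as (s & _ & <- & j & _ & <- & A1 & A2).
          unfold expand. rewrite testbit_catf1. rewrite (proj2 (Nat.ltb_lt _ _)) by lia. simpl.
          apply eq_true_iff_eq. split; auto.
        * rewrite <- (Nat.mod_small (e v) b) by auto. symmetry. apply Nat.mod_pow2_bits_high; auto.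
      + intros <-. left. split; auto. split; [apply field_lt|]. intros t _ Lt.
        exists (2 ^ bb * e i). split; [lia|]. split; auto. eexists. split; [|split; [reflexivity|]]; [lia|].
        rewrite testbit_field. unfold expand. rewrite testbit_catf1.
        rewrite (proj2 (Nat.ltb_lt t _)), (proj2 (Nat.ltb_lt (_ + _) _)) by lia. auto.
    - rewrite (dg_high C bb ga Hcbe Hga Hbb) by (auto; apply expand_lt).
      split; [intros [(K & _)|(_ & E)]; [lia|auto]|intros; right; split; [lia|auto]].
  Qed.
End Expand.

Lemma catf_first W v ws (e : nat -> nat) : ~ In 0 ws -> e 0 = v -> (forall i, i <> 0 -> e i = 0) ->
  catf W (length (0 :: ws)) (fun q => e (nth q (0 :: ws) 0)) = v.
Proof.
  intros H0 Ev E. cbn [length catf nth]. rewrite Ev.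
  rewrite (catf_ext W (length ws) _ (fun _ => 0)); [rewrite catf_zero; lia|].
  intros r Hr. apply E. intros K. apply H0. rewrite <- K. apply nth_In; auto.
Qed.

Section Diagonal.
  Variables (c : nat) (Q : list nat) (T N0 bb ga : nat).
  Let NT := wl bb ga.
  Let B0 := bb + 3 * ga + 7.
  Variables (W0 Y0 S0 lam kmax ib : nat).
  Hypothesis HQ : decides c Q T N0 NT.
  Hypothesis HS0 : 100 + 3 ^ (run_rank c T lam + 1) <= S0.
  Hypothesis HS1 : 3 ^ (2 * lam + 21) <= S0.
  Hypothesis HY : 48 * 3000 * (S0 ^ (kmax + 1) * S0 ^ (kmax + 1) * S0 ^ (kmax + 1)) <= 2 ^ Y0.
  Hypothesis HW : 2 + Y0 + lam + 1 <= W0.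
  Hypothesis HW2 : 600 * S0 ^ (kmax + 1) + 1 <= 2 ^ W0.
  Hypothesis HB : N0 <= 2 ^ bb.
  Hypothesis HB2 : c + 22 <= 2 ^ bb.
  Hypothesis HNT : B0 + W0 * kmax + Y0 <= bb + 4 * ga.
  Hypothesis Hlam : NT + 2 <= 2 ^ 2 ^ lam.
  Hypothesis Hga : 3 <= ga.
  Hypothesis Hbb : 8 * ga + 20 <= bb.
  Hypothesis Hk : 80 + T * (4800 + c + 60) + 1 <= kmax.
  Hypothesis Hib : 300 * (S0 ^ (kmax + 1) * ((c + 22) * 2 ^ (W0 * kmax) + 1)) <= 2 ^ ib.
  Hypothesis Hib2 : lam + ib + 1 < B0.

  (* The formula "[Q] rejects the word coded by [z]" is a question to the binary test,
     and [z] is chosen as the code of the parameter of this very question. *)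
  Theorem diagonal : False.
  Proof.
    assert (HB' : N0 <= 2 ^ B0) by (eapply Nat.le_trans; [exact HB|apply pow2_le; unfold B0; lia]).
    assert (HB2' : c + 22 <= 2 ^ B0) by (eapply Nat.le_trans; [exact HB2|apply pow2_le; unfold B0; lia]).
    assert (HNT' : 2 ^ (B0 + W0 * kmax + Y0) <= NT) by (apply pow2_le; exact HNT).
    pose (C := big_cls c T N0 NT B0 W0 Y0 S0 lam kmax HS0 HS1 HY HW HW2 HB' HB2' HNT' Hlam).
    assert (FO : fo C).
    { split.
      - intros k R. apply (D_not c Q T N0 NT HQ).
      - apply D_exp2. }
    assert (Ecbe : cbe C = 2 ^ (bb + 3 * ga + 7)) by reflexivity.
    set (q := 2 ^ lam). set (I := 2 ^ ib).
    assert (EqI : q * (2 * I) = 2 ^ (lam + ib + 1)).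
    { unfold q, I. rewrite Nat.add_1_r, Nat.pow_succ_r', Nat.pow_add_r. lia. }
    assert (LqI : q * (2 * I) < cbe C).
    { rewrite EqI, Ecbe. apply pow2_lt. exact Hib2. }
    assert (Kx : KnB C bb ga 80 (fun z => expand q I NT z)).
    { apply (KnB_expand C bb ga lam ib Ecbe Hga Hbb). rewrite (Nat.add_1_r ib), Nat.pow_succ_r'. exact LqI. }
    assert (Dq : D C kmax (fun e => accepts NT c 1 T (init Q [expand q I NT (e 0)]))).
    { eapply D_mono; [apply (D_run_long C bb ga c Ecbe Hga Hbb HB2)|exact Hk]; auto; try lia.
      - change (cmf C 0) with ((c + 22) * 2 ^ (W0 * 0)). pose proof (pow2_pos (W0 * 0)). nia.
      - apply HQ. }
    apply D_elim in Dq; [|apply le_n].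
    change (cbe C) with (2 ^ B0) in Dq. change (cbf C kmax) with (2 ^ (B0 + W0 * kmax)) in Dq.
    change (csf C kmax) with (S0 ^ (kmax + 1)) in Dq.
    change (cmf C kmax) with ((c + 22) * 2 ^ (W0 * kmax)) in Dq.
    destruct Dq as (f & Sz & Wd & Io & E).
    set (s := S0 ^ (kmax + 1)) in *. set (B := 2 ^ (B0 + W0 * kmax)) in *.
    set (m := (c + 22) * 2 ^ (W0 * kmax)) in *.
    assert (B1 : 1 <= B) by apply pow2_pos.
    assert (Hlen : 3000 * (2 * B + 1) * (s * s * s) <= NT / 16).
    { apply Nat.div_le_lower_bound; [lia|].
      eapply Nat.le_trans; [|exact HNT']. rewrite (Nat.pow_add_r 2 (B0 + W0 * kmax)). fold B.
      apply Nat.le_trans with (B * (48 * 3000 * (s * s * s))); [|apply Nat.mul_le_mono_l; exact HY].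
      replace (16 * (3000 * (2 * B + 1) * (s * s * s))) with ((2 * B + 1) * ((48 * 1000) * (s * s * s))) by lia.
      replace (B * (48 * 3000 * (s * s * s))) with (3 * B * ((48 * 1000) * (s * s * s))) by lia.
      apply Nat.mul_le_mono_r. lia. }
    destruct (chk_universal f NT B s m Sz B1 Wd Io Hlen) as (K & vs & _ & (ws & -> & H0) & IK & MK & U).
    assert (BB0 : 2 ^ B0 <= B) by (apply pow2_le; lia).
    destruct (expand_fixpoint q I NT (2 * B + 1) K) as (z & Hz & Ez); auto.
    { eapply IO_mono; [exact IK|exact Hib]. }
    { unfold q. lia. }
    { unfold B0 in *. lia. }
    (* With [z] for variable 0 and zero for all other variables the parameter is [K + z], the word
       that [z] decodes to. *)
    pose (e := fun i => if i =? 0 then z else 0).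
    assert (He : ebd (2 ^ B0) e).
    { intros i. unfold e. destruct (i =? 0); auto. eapply lt_pow2_mono; [exact Hz|]. unfold B0 in *. lia. }
    assert (HeB : forall i, e i < 2 ^ B) by (intros; eapply lt_pow2_mono; [apply He|exact BB0]).
    destruct (U e HeB) as [UL US].
    rewrite (catf_first _ z) in UL, US; auto.
    2,3: intros i Hi; unfold e; apply Nat.eqb_neq in Hi; rewrite Hi; auto.
    rewrite (E e He) in US. unfold e in US. simpl (0 =? 0) in US. cbv iota in US. rewrite Ez in US by auto.
    assert (N0T : N0 <= NT).
    { eapply Nat.le_trans; [exact HB|]. unfold NT, wl. apply pow2_le. lia. }
    assert (N16 : 16 < NT).
    { unfold NT, wl. change 16 with (2 ^ 4). apply pow2_lt. lia. }
    (* By [US] the question with parameter [K + z] holds iff [Q] outputs 1 on it; by [DA] it fails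
       iff [Q] outputs 1 on it. *)
    pose proof (decides_accepts c Q T N0 NT NT (K + z) HQ N0T (le_n _) N16 UL) as DA. tauto.
  Qed.
End Diagonal.

(** * Choice of the parameters *)

Lemma pow3_le x : 3 ^ x <= 2 ^ (2 * x).
Proof. rewrite Nat.pow_mul_r. apply Nat.pow_le_mono_l. simpl. lia. Qed.

(** The parameters in turn: [lam = T ^ 2 + 1] bounds the iterated logarithm of the longest word. A
    run on short words then has rank of order [T ^ 3], so [S0 = 2 ^ (T ^ 4)]. A run on long words
    has rank at most [kmax = T ^ 2], so formulas have size up to [2 ^ (T ^ 6 + T ^ 4)]; this leads
    to [Y0 = T ^ 7] and [W0 = T ^ 8]. The total growth is [W0 * kmax = T ^ 10] in the exponent,
    which [ga = T ^ 11] and [ib = T ^ 11] cover, and [bb] is what remains of [2 ^ (T ^ 2)]. Since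
    [T >= 5000], each power of [T] outweighs the constant multiples of lower powers that occur. *)
Theorem no_fast_decision c Q T N0 : c + N0 + 5000 <= T ->
  ~ decides c Q T N0 (2 ^ 2 ^ (T * T)).
Proof.
  intros HT HQ.
  set (T2 := T * T). set (T3 := T * T2). set (T4 := T * T3). set (T5 := T * T4). set (T6 := T * T5).
  set (T7 := T * T6). set (T8 := T * T7). set (T9 := T * T8). set (T10 := T * T9). set (T11 := T * T10).
  assert (G : forall x, 5000 * x <= T * x) by (intros; apply Nat.mul_le_mono_r; lia).
  pose proof (G T) as G2. pose proof (G T2) as G3. pose proof (G T3) as G4. pose proof (G T4) as G5.
  pose proof (G T5) as G6. pose proof (G T6) as G7. pose proof (G T7) as G8. pose proof (G T8) as G9.
  pose proof (G T9) as G10. pose proof (G T10) as G11.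
  fold T2 in G2. fold T3 in G3. fold T4 in G4. fold T5 in G5. fold T6 in G6. fold T7 in G7.
  fold T8 in G8. fold T9 in G9. fold T10 in G10. fold T11 in G11.
  assert (Hc : c * T <= T2) by (apply Nat.mul_le_mono_r; lia).
  assert (Big : 12 * T11 + 20 <= 2 ^ T2).
  { assert (E : T ^ 12 = T * T11).
    { unfold T11, T10, T9, T8, T7, T6, T5, T4, T3, T2. cbn [Nat.pow]. rewrite Nat.mul_1_r. reflexivity. }
    assert (T ^ 12 <= 2 ^ T2).
    { unfold T2. rewrite Nat.pow_mul_r. apply Nat.le_trans with ((2 ^ T) ^ 12).
      - apply Nat.pow_le_mono_l. pose proof (lt_pow2 T). lia.
      - apply Nat.pow_le_mono_r; [auto|lia]. }
    pose proof (G T11). lia. }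
  set (bb := 2 ^ T2 - 4 * T11).
  assert (Ebb : bb + 4 * T11 = 2 ^ T2) by (unfold bb; lia).
  assert (M46 : T4 * T2 = T6).
  { unfold T6, T5, T4, T3. lia. }
  assert (M810 : T8 * T2 = T10).
  { unfold T10, T9. lia. }
  assert (ES : (2 ^ T4) ^ (T2 + 1) = 2 ^ (T6 + T4)).
  { rewrite <- Nat.pow_mul_r. f_equal. lia. }
  assert (Lbb : forall x, x <= 5000 + T -> x <= 2 ^ bb).
  { intros x Hx. apply Nat.le_trans with bb; [lia|]. pose proof (lt_pow2 bb). lia. }
  assert (E2 : T * T = T2) by reflexivity. assert (E3 : T * T2 = T3) by reflexivity.
  (* The powers of [T] become atoms, and the inequalities between them are linear. *)
  clearbody bb T11 T10 T9 T8 T7 T6 T5 T4 T3 T2.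
  apply (diagonal c Q T N0 bb T11 T8 T7 (2 ^ T4) (T2 + 1) T2 T11).
  - replace (wl bb T11) with (2 ^ 2 ^ (T * T)); auto. unfold wl. rewrite Ebb, E2. auto.
  - unfold run_rank. eapply Nat.le_trans; [apply Nat.add_le_mono_l, pow3_le|].
    assert (Ex : T * (2 * (T2 + 1) + 40 + c + 60) = 2 * T3 + 102 * T + c * T) by (rewrite <- E3; ring).
    rewrite Ex. set (x := 2 * _). assert (Hx : x + 8 <= T4) by (unfold x; lia).
    apply Nat.le_trans with (2 ^ (x + 8)); [|apply pow2_le; auto].
    rewrite Nat.pow_add_r. change (2 ^ 8) with 256. pose proof (pow2_pos x). lia.
  - eapply Nat.le_trans; [apply pow3_le|]. apply pow2_le. lia.
  - rewrite ES, <- !Nat.pow_add_r. apply Nat.le_trans with (2 ^ (18 + (T6 + T4 + (T6 + T4) + (T6 + T4)))).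
    + rewrite (Nat.pow_add_r 2 18). apply Nat.mul_le_mono_r. change 18 with (6 + 12).
      rewrite (Nat.pow_add_r 2 6). apply Nat.mul_le_mono; apply Nat.leb_le; reflexivity.
    + apply pow2_le. lia.
  - lia.
  - rewrite ES. apply Nat.le_trans with (2 ^ (10 + (T6 + T4))); [|apply pow2_le; lia].
    rewrite (Nat.pow_add_r 2 10). change (2 ^ 10) with 1024. pose proof (pow2_pos (T6 + T4)). lia.
  - apply Lbb. lia.
  - apply Lbb. lia.
  - rewrite M810. lia.
  - unfold wl. rewrite Ebb, Nat.add_1_r, Nat.pow_succ_r'.
    assert (1 < 2 ^ T2) by (apply Nat.pow_gt_1; lia).
    set (y := 2 ^ T2) in *. replace (2 * y) with (y + y) by lia. rewrite Nat.pow_add_r.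
    assert (P4 : 4 <= 2 ^ y) by (change 4 with (2 ^ 2); apply pow2_le; lia).
    pose proof (Nat.mul_le_mono_r 4 (2 ^ y) (2 ^ y) P4). lia.
  - lia.
  - lia.
  - assert (T * (4800 + c + 60 + 140) <= T * T) by (apply Nat.mul_le_mono_l; lia). lia.
  - rewrite ES, M810. apply Nat.le_trans with (2 ^ (10 + (T6 + T4) + (T + T10))); [|apply pow2_le; lia].
    rewrite (Nat.pow_add_r 2 (10 + (T6 + T4))), (Nat.pow_add_r 2 10), (Nat.pow_add_r 2 T).
    change (2 ^ 10) with 1024. pose proof (lt_pow2 T). pose proof (pow2_pos T10).
    set (x := 2 ^ T10) in *. set (y := 2 ^ T) in *. set (w := 2 ^ (T6 + T4)).
    assert ((c + 22) * x + 1 <= y * x).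
    { apply Nat.le_trans with ((c + 23) * x); [lia|]. apply Nat.mul_le_mono_r. lia. }
    replace (1024 * w * (y * x)) with (1024 * (w * (y * x))) by lia.
    apply Nat.mul_le_mono; [lia|]. apply Nat.mul_le_mono_l. auto.
  - lia.
Qed.

(** * Real logarithms *)

Lemma ln2_pos : (0 < ln 2)%R.
Proof. rewrite <- ln_1. apply ln_increasing; lra. Qed.

Lemma log2_le x y : (0 < x -> x <= y -> log2 x <= log2 y)%R.
Proof.
  intros Hx Hxy. unfold log2, Rdiv. apply Rmult_le_compat_r.
  - left. apply Rinv_0_lt_compat, ln2_pos.
  - destruct Hxy as [L| ->]; [|lra]. left. apply ln_increasing; auto.
Qed.

Lemma log2_pow k : log2 (INR (2 ^ k)) = INR k.
Proof.
  unfold log2. rewrite pow_INR. replace (INR 2) with 2%R by (simpl; lra). rewrite ln_pow by lra.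
  field. pose proof ln2_pos. lra.
Qed.

(** The upper bound on [n] gives the iterated logarithm at most [T * T]; from 16 on the triple
    logarithm is at least 1, so dividing by it does not increase the square root. *)
Lemma log_bound n T : 16 <= n -> n <= 2 ^ 2 ^ (T * T) ->
  (1 * sqrt (log2 (log2 (INR n))) * / log2 (log2 (log2 (INR n))) <= INR T)%R.
Proof.
  intros L U.
  assert (A1 : (INR 4 <= log2 (INR n))%R).
  { rewrite <- (log2_pow 4). apply log2_le; [apply lt_0_INR, pow2_pos|]. apply le_INR. exact L. }
  assert (A2 : (log2 (INR n) <= INR (2 ^ (T * T)))%R).
  { rewrite <- (log2_pow (2 ^ (T * T))). apply log2_le; [apply lt_0_INR; lia|]. apply le_INR. exact U. }
  assert (B1 : (INR 2 <= log2 (log2 (INR n)))%R).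
  { rewrite <- (log2_pow 2). apply log2_le; [apply lt_0_INR, pow2_pos|]. exact A1. }
  assert (B2 : (log2 (log2 (INR n)) <= INR (T * T))%R).
  { rewrite <- (log2_pow (T * T)). apply log2_le; [|exact A2]. simpl (INR 4) in A1. lra. }
  assert (C1 : (INR 1 <= log2 (log2 (log2 (INR n))))%R).
  { rewrite <- (log2_pow 1). apply log2_le; [apply lt_0_INR, pow2_pos|]. exact B1. }
  assert (S : (sqrt (log2 (log2 (INR n))) <= INR T)%R).
  { rewrite <- (sqrt_square (INR T)) by apply pos_INR. apply sqrt_le_1_alt. rewrite <- mult_INR. exact B2. }
  pose proof (sqrt_pos (log2 (log2 (INR n)))). simpl (INR 1) in C1.
  assert (I : (/ log2 (log2 (log2 (INR n))) <= 1)%R).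
  { rewrite <- Rinv_1. apply Rinv_le_contravar; lra. }
  assert (0 < / log2 (log2 (log2 (INR n))))%R by (apply Rinv_0_lt_compat; lra).
  nra.
Qed.

(** * Infinitely many slow word lengths *)

Lemma outputs_within_mono n P xs t t' y : outputs_within n P xs t y -> t <= t' -> outputs_within n P xs t' y.
Proof. intros (u & s & L & H) Ht. exists u, s. split; [lia|auto]. Qed.

(** A machine has finitely many inputs, and the maximum of the halting times serves for all of
    them. *)
Lemma has_time n c Q : 10 < n -> is_test c 1 Q -> exists t, time_requirement n 1 Q t.
Proof.
  intros Hn (_ & _ & _ & _ & _ & H).
  assert (G : forall m, m <= 2 ^ n -> exists t, forall a, a < m -> exists y, outputs_within n Q [a] t y).
  { induction m; intros Hm; [exists 0; intros; lia|].
    destruct (IHm ltac:(lia)) as (t & Ht).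
    destruct (H n [m] Hn) as (_ & y & _ & (u & Hu)).
    { split; auto. }
    exists (Nat.max t u). intros a Ha. destruct (Nat.eq_dec a m) as [->|Na].
    - exists y. eapply outputs_within_mono; [exact Hu|lia].
    - destruct (Ht a ltac:(lia)) as (y' & Hy'). exists y'. eapply outputs_within_mono; [exact Hy'|lia]. }
  destruct (G _ (le_n _)) as (t & Ht).
  destruct (least_time n 1 Q t) as (t' & T' & _); eauto.
  intros xs (L & F). destruct xs as [|a [|? ?]]; try discriminate. inversion F; subst. auto.
Qed.

Theorem theorem1 :
  exists (eps : R) (c : nat) (P : list nat),
    (0 < eps)%R /\ 0 < c /\ is_test c 2 P /\
    (forall n, 10 < n -> exists t, time_requirement n 2 P t /\ t <= c) /\
    forall (c' : nat) (Q : list nat),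
      0 < c' -> is_test c' 1 Q ->
      (exists n0, forall n, n0 <= n -> 10 < n -> forall a, a < 2 ^ n ->
         ((exists x, x < 2 ^ n /\ outputs n P [x; a] 0) <-> outputs n Q [a] 0)) ->
      forall N, exists n t,
        N <= n /\ 10 < n /\ time_requirement n 1 Q t /\
        (eps * sqrt (log2 (log2 (INR n))) * / log2 (log2 (log2 (INR n)))
           <= INR t)%R.
Proof.
  exists 1%R, test_size, test_prog. split; [lra|].
  split; [apply test_prog_is_test|]. split; [apply test_prog_is_test|].
  split; [apply test_prog_time|].
  intros c Q _ Test (n0 & Dec) N. apply NNPP. intros Fast.
  (* If the bound failed for every [n >= N], then by [log_bound] the time would be at most [T] on
     all lengths from [n0 + N + 17] to [2 ^ 2 ^ (T * T)]. The summand 17 keeps to lengths on which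
     the binary test computes [chk]. *)
  set (T := c + (n0 + N + 17) + 5000).
  apply (no_fast_decision c Q T (n0 + N + 17)); [lia|].
  assert (Test' := Test). destruct Test' as (_ & _ & Prog & _ & _ & Out).
  split; auto. intros n a L1 L2 _ La.
  destruct (Out n [a] ltac:(lia)) as (U & y & Y & Oy).
  { split; auto. }
  split; auto. split.
  - exists y. split; auto.
    destruct (has_time n c Q ltac:(lia) Test) as (t & Ht).
    assert (Lt : t <= T).
    { destruct (Nat.le_gt_cases t T) as [|G]; auto. exfalso. apply Fast. exists n, t.
      split; [lia|]. split; [lia|]. split; auto.
      apply Rle_trans with (INR T); [apply log_bound; auto; lia|]. apply le_INR. lia. }
    destruct Ht as (Ht & _). destruct (Ht [a]) as (y' & Oy').
    { split; auto. }
    assert (y' = y) by (eapply outputs_unique; [eexists; exact Oy'|exact Oy]). subst y'.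
    eapply outputs_within_mono; eauto.
  - rewrite <- (Dec n ltac:(lia) ltac:(lia) a La). split; intros (x & Hx & E); exists x; split; auto.
    + apply test_prog_spec; auto; lia.
    + apply test_prog_spec in E; auto; lia.
Qed.
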